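(* Let $G$ be a Lie group with Lie algebra $\mathfrak g$. Then via right trivialization $(\kappa^r,\pi_G):TG\to\mathfrak g\times G$ the tangent group $TG$ is isomorphic to the semidirect product $\mathfrak g\rtimes G$, where $G$ acts on $\mathfrak g$ by $\operatorname{Ad}:G\to\operatorname{Aut}(\mathfrak g)$. For $g,h\in G$ and $X,Y,Z,X_i,Y_i\in\mathfrak g$ its multiplication $\mu_{\mathfrak g\rtimes G}$, inversion $\nu_{\mathfrak g\rtimes G}$, Lie bracket and adjoint representation are $$\mu_{\mathfrak g\rtimes G}((X,g),(Y,h))=(X+\operatorname{Ad}(g)Y,\,gh),\qquad \nu_{\mathfrak g\rtimes G}(X,g)=(-\operatorname{Ad}(g^{-1})X,\,g^{-1}),$$ $$[(X_1,Y_1),(X_2,Y_2)]_{\mathfrak g\rtimes\mathfrak g}=([Y_1,X_2]-[Y_2,X_1],\,[Y_1,Y_2]),$$ $$\operatorname{Ad}^{\mathfrak g\rtimes G}_{(X,g)}(Y,Z)=(\operatorname{Ad}(g)Y-[\operatorname{Ad}(g)Z,X],\,\operatorname{Ad}(g)Z).$$ If $G$ is a regular Lie group, then so is $TG\cong\mathfrak g\rtimes G$, and $T\operatorname{evol}^{\mathbb R}_G$ corresponds to $\operatorname{evol}^{\mathbb R}_{TG}$: under the identification $TC^\infty(\mathbb R,\mathfrak g)\cong C^\infty(\mathbb R,\mathfrak g\rtimes\mathfrak g)$, the map $T\operatorname{evol}^{\mathbb R}_G:TC^\infty(\mathbb R,\mathfrak g)\to TG$ equals $\operatorname{evol}^{\mathbb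 R}_{TG}:C^\infty(\mathbb R,\mathfrak g\rtimes\mathfrak g)\to TG$, and composing the latter with $TG\cong\mathfrak g\rtimes G$ gives $\operatorname{evol}^{\mathbb R}_{\mathfrak g\rtimes G}$. In particular, for $(Y,X)\in C^\infty(\mathbb R,\mathfrak g\times\mathfrak g)=TC^\infty(\mathbb R,\mathfrak g)$, where $X$ is the footpoint, $$\operatorname{evol}^{\mathbb R}_{\mathfrak g\rtimes G}(Y,X)=\Bigl(\operatorname{Ad}(\operatorname{evol}^{\mathbb R}_G(X))\int_0^1\operatorname{Ad}(\operatorname{Evol}^{\mathbb R}_G(X)(s)^{-1}).Y(s)\,ds,\ \operatorname{evol}^{\mathbb R}_G(X)\Bigr),$$ $$T_X\operatorname{evol}^{\mathbb R}_G.Y=T(\mu_{\operatorname{evol}^{\mathbb R}_G(X)}).\int_0^1\operatorname{Ad}(\operatorname{Evol}^{\mathbb R}_G(X)(s)^{-1}).Y(s)\,ds,$$ $$T_X(\operatorname{Evol}^{\mathbb R}_G(\;\cdot\;)(t)).Y=T(\mu_{\operatorname{Evol}^{\mathbb R}_G(X)(t)}).\int_0^t\operatorname{Ad}(\operatorname{Evol}^{\mathbb R}_G(X)(s)^{-1}).Y(s)\,ds.$$ Moreover, for $G$ regular and a pointed simply connected manifold $(M,x_0)$ (possibly infinite dimensional) we have $$\begin{aligned}T\Omega^1_{\mathrm{flat}}(M,\mathfrak g)&=\{(\xi,\eta)\in\Omega^1(M,\mathfrak g)^2: d\xi-\tfrac12[\xi,\xi]^{\mathfrak g}_\wedge=0\text{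 and }d\eta-[\xi,\eta]^{\mathfrak g}_\wedge=0\}\\&\cong\{(\eta,\xi)\in\Omega^1(M,\mathfrak g\rtimes\mathfrak g):(d\eta-[\xi,\eta]^{\mathfrak g}_\wedge,\ d\xi-\tfrac12[\xi,\xi]^{\mathfrak g}_\wedge)=(0,0)\}\\&=\Omega^1_{\mathrm{flat}}(M,\mathfrak g\rtimes\mathfrak g),\end{aligned}$$ and the following diagram commutes: $$\begin{array}{ccc} T\Omega^1_{\mathrm{flat}}(M,\mathfrak g)&\xrightarrow{\ T\operatorname{Evol}^M_G\ }&TC^\infty((M,x_0),(G,e))\\ {\scriptstyle\cong}\downarrow&&\downarrow{\scriptstyle\cong}\\ \Omega^1_{\mathrm{flat}}(M,T\mathfrak g)&\xrightarrow{\ \operatorname{Evol}^M_{TG}\ }&C^\infty((M,x_0),(TG,0_e))\\ {\scriptstyle\cong}\downarrow&&\downarrow{\scriptstyle\cong}\\ \Omega^1_{\mathrm{flat}}(M,\mathfrak g\rtimes\mathfrak g)&\xrightarrow{\ \operatorname{Evol}^M_{\mathfrak g\rtimes G}\ }&C^\infty((M,x_0),(\mathfrak g\rtimes G,(0,e))). \end{array}$$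
   Context: Manifolds and Lie groups may be infinite dimensional and are modeled on convenient vector spaces (locally convex spaces in which every Mackey-Cauchy sequence converges), in the sense of convenient calculus (Kriegl–Michor): a mapping is smooth if it maps smooth curves to smooth curves. For a Lie group $G$ with Lie algebra $\mathfrak g$ and unit $e$, write $\mu(x,y)=xy=\mu_x(y)=\mu^y(x)$ for multiplication and left/right translations, $\nu$ for inversion, and $\pi_G:TG\to G$ for the projection. The Lie bracket on $\mathfrak g$ comes from left invariant vector fields. The right Maurer-Cartan form is $\kappa^r_x(\zeta)=T_x(\mu^{x^{-1}}).\zeta\in\mathfrak g$ for $\zeta\in T_xG$. The tangent group $TG$ is the Lie group with multiplication $T\mu$, inversion $T\nu$ and unit $0_e$; its Lie algebra is $T\mathfrak g$, identified with the semidirect product $\mathfrak g\rtimes\mathfrak g$, where the second component is the footpoint. For smooth $f:M\to G$ the right logarithmic derivative is $\delta^rf=f^*\kappa^r\in\Omega^1(M,\mathfrak g)$. Regular Lie group: $G$ is regular if for each $X\in C^\infty(\mathbb R,\mathfrak g)$ there is a (necessarily unique) $g=:\operatorname{Evol}^{\mathbb R}_G(X)\in C^\infty(\mathbb R,G)$ with $g(0)=e$ and $\partial_tg(t)=T_e(\mu^{g(t)}).X(t)$, and the map $\operatorname{evol}^{\mathbb R}_G:C^\infty(\mathbb R,\mathfrak g)\to G$, $X\mapsto\operatorname{Evol}^{\mathbb R}_G(X)(1)$, is smooth. For $\mathfrak g$-valued 1-forms, $[\varphi,\psi]^{\mathfrak g}_\wedge(\zeta_1,\zeta_2)=[\varphi(\zeta_1),\psi(\zeta_2)]-[\varphi(\zeta_2),\psi(\zeta_1)]$.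 For a Lie algebra $\mathfrak g$, $\Omega^1_{\mathrm{flat}}(M,\mathfrak g)=\{\xi\in\Omega^1(M,\mathfrak g):d\xi-\tfrac12[\xi,\xi]^{\mathfrak g}_\wedge=0\}$, a Frölicher space whose smooth curves are those that are smooth into the convenient vector space $\Omega^1(M,\mathfrak g)$ (equivalently, whose associated map $\mathbb R\times TM\to\mathfrak g$ is smooth). $T\Omega^1_{\mathrm{flat}}(M,\mathfrak g)$ is its kinematic tangent bundle, consisting of the pairs $(\xi,\eta)=(c(0),c'(0))$ for smooth curves $c$ in $\Omega^1_{\mathrm{flat}}(M,\mathfrak g)$. For $G$ regular and $(M,x_0)$ simply connected pointed, $\operatorname{Evol}^M_G:\Omega^1_{\mathrm{flat}}(M,\mathfrak g)\to C^\infty((M,x_0),(G,e))=\{f\in C^\infty(M,G):f(x_0)=e\}$ is the unique smooth mapping of Frölicher spaces with $\delta^r\circ\operatorname{Evol}^M_G=\operatorname{Id}$; it exists, and it is the Cartan development. The space $C^\infty(M,G)$ carries its canonical Frölicher structure (generated by the functions $k\mapsto\lambda(f\circ k\circ c)$ for $c\in C^\infty(\mathbb R,M)$, $f\in C^\infty(G,\mathbb R)$, $\lambda$ a bounded linear functional on $C^\infty(\mathbb R,\mathbb R)$), with tangent bundle $TC^\infty(M,G)=C^\infty(M,TG)$; accordingly $TC^\infty((M,x_0),(G,e))$ is identified with $C^\infty((M,x_0),(TG,0_e))$. In the diagram, the left vertical isomorphisms send $(\xi,\eta)$, with footpoint $\xi$, to the form written $(\eta,\xi)$ in $\Omega^1_{\mathrm{flat}}(M,\mathfrak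 g\rtimes\mathfrak g)$; the lower right vertical isomorphism is composition with the right trivialization $(\kappa^r,\pi_G):TG\to\mathfrak g\rtimes G$; $T\operatorname{Evol}^M_G$ maps velocity vectors of smooth curves to the velocity vectors of their images. *)

(* Defs.v *)
From HB Require Import structures.
From mathcomp Require Import all_boot all_order all_algebra.
From mathcomp Require Import boolp classical_sets functions reals topology.
From mathcomp Require Import tvs normedtype.

Set Implicit Arguments.
Unset Strict Implicit.
Unset Printing Implicit Defensive.

Import Order.TTheory GRing.Theory Num.Theory.
Import numFieldTopology.Exports numFieldNormedType.Exports.

Local Open Scope classical_set_scope.
Local Open Scope ring_scope.

(* [tvsType R] is the library's type of locally convex spaces (not assumed   *)
(* Hausdorff).  [derive1] needs a norm on the codomain, hence [cderiv].      *)

Section Calculus.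
Variable R : realType.
Implicit Types E F : tvsType R.

Definition diffquot E (c : R -> E) (t h : R) : E := h^-1 *: (c (t + h) - c t).

Definition cderivable E (c : R -> E) (t : R) : Prop :=
  exists l : E, diffquot c t @ 0^' --> l.

Definition cderiv E (c : R -> E) (t : R) : E :=
  xget 0 [set l : E | diffquot c t @ 0^' --> l].

Definition cderivn E (n : nat) (c : R -> E) : R -> E := iter n (@cderiv E) c.

Definition smooth_curve E (c : R -> E) : Prop :=
  forall n t, cderivable (cderivn n c) t.

Definition smooth_near E (c : R -> E) (t : R) : Prop :=
  \forall s \near t, forall n, cderivable (cderivn n c) s.

Definition lc_bounded E (B : set E) : Prop :=
  forall U : set E, nbhs (0 : E) U ->
    exists2 r : R, 0 < r & B `<=` [set r *: u | u in U].

Definition mackey_cauchy E (x : nat -> E) : Prop :=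
  exists (B : set E) (s : nat -> nat -> R),
    [/\ lc_bounded B,
        forall e : R, 0 < e -> exists N : nat, forall m n : nat,
          (N <= m)%N -> (N <= n)%N -> `|s m n| < e
      & forall m n, exists2 b, B b & x m - x n = s m n *: b].

Definition convenient E : Prop :=
  hausdorff_space E /\
  forall x : nat -> E, mackey_cauchy x -> exists l : E, x @ \oo --> l.

(* Open for the final topology with respect to all smooth curves. *)
Definition cinf_open E (U : set E) : Prop :=
  forall c : R -> E, smooth_curve c -> open (c @^-1` U).

Definition smooth_on E F (U : set E) (f : E -> F) : Prop :=
  forall c : R -> E, smooth_curve c -> (forall t, U (c t)) ->
    smooth_curve (f \o c).

Definition dirder E F (f : E -> F) (x v : E) : F :=
  cderiv (fun t : R => f (x + t *: v)) 0.

(* Riemann integral: limit of the sums over tagged partitions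
   p 0 <= q 0 <= p 1 <= ... <= p n  as the mesh tends to 0. *)
Definition is_rint E (c : R -> E) (a b : R) (v : E) : Prop :=
  forall U : set E, nbhs v U -> exists2 d : R, 0 < d &
    forall (n : nat) (p q : nat -> R), p 0%N = a -> p n = b ->
      (forall i, (i < n)%N ->
         [/\ p i <= q i, q i <= p i.+1 & p i.+1 - p i < d]) ->
      U (\sum_(i < n) (p i.+1 - p i) *: c (q i)).

Definition rint E (a b : R) (c : R -> E) : E :=
  if a <= b then xget 0 (is_rint c a b) else - xget 0 (is_rint c b a).

End Calculus.

(* [premanifold E] is the bare data of an atlas, [is_manifold] states its    *)
(* axioms; the tangent bundle of an atlas can thus be written down before it *)
(* is known to be a manifold.  Charts are onto c^infty-open subsets of one   *)
(* model space E: on a connected manifold, and on a Lie group, the tangent   *)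
(* spaces, hence the model spaces, are all isomorphic.                       *)
(* [cochart i] is the inverse of [chart i], meaningful only on its image.    *)
(* [chart_at x] is a chosen chart around x; nothing is required of its       *)
(* dependence on x.                                                          *)

Record premanifold (R : realType) (E : tvsType R) := Premanifold {
  pt :> Type;
  idx : Type;
  dom : idx -> set pt;
  chart : idx -> pt -> E;
  cochart : idx -> E -> pt;
  chart_at : pt -> idx }.

Section Manifolds.
Variable R : realType.

Definition is_manifold (E : tvsType R) (M : premanifold E) : Prop :=
  [/\ convenient E,
      forall x : M, dom (chart_at x) x,
      forall (i : idx M) (x : M), dom i x -> cochart i (chart i x) = x,
      forall i j : idx M, cinf_open (chart i @` (dom i `&` dom j))
    & forall i j : idx M,
        smooth_on (chart i @` (dom i `&` dom j)) (chart j \o cochart i)].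

Definition msmooth (E : tvsType R) (M : premanifold E) (c : R -> M) : Prop :=
  forall (t : R) (i : idx M), dom i (c t) ->
    (\forall s \near t, dom i (c s)) /\ smooth_near (chart i \o c) t.

Definition smooth_map (E F : tvsType R) (M : premanifold E) (N : premanifold F)
    (f : M -> N) : Prop :=
  forall c : R -> M, msmooth c -> msmooth (f \o c).

Definition mvec (E : tvsType R) : premanifold E :=
  @Premanifold R E E unit (fun _ => setT) (fun _ => id) (fun _ => id)
    (fun _ => tt).

Definition mprod (E F : tvsType R) (M : premanifold E) (N : premanifold F) :
    premanifold (E * F)%type :=
  @Premanifold R (E * F)%type (M * N)%type (idx M * idx N)%type
    (fun ij p => dom ij.1 p.1 /\ dom ij.2 p.2)
    (fun ij p => (chart ij.1 p.1, chart ij.2 p.2))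
    (fun ij y => (cochart ij.1 y.1, cochart ij.2 y.2))
    (fun p => (chart_at p.1, chart_at p.2)).

(* The tangent bundle as the quotient of the triples (v, x, i), i a chart at *)
(* x, by (v, x, i) ~ (d(u_j u_i^-1)(u_i x).v, x, j).  Each class has exactly *)
(* one representative with i = chart_at x, so a tangent vector is a pair     *)
(* (v, x): the footpoint x comes second, and T_xM is E, read in the          *)
(* preferred chart at x.                                                     *)
Definition mtan (E : tvsType R) (M : premanifold E) :
    premanifold (E * E)%type :=
  @Premanifold R (E * E)%type (E * M)%type (idx M)
    (fun i p => dom i p.2)
    (fun i p =>
       (dirder (chart i \o cochart (chart_at p.2))
               (chart (chart_at p.2) p.2) p.1,
        chart i p.2))
    (fun i y =>
       (dirder (chart (chart_at (cochart i y.2)) \o cochart i) y.2 y.1,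
        cochart i y.2))
    (fun p => chart_at p.2).

Definition velocity (E : tvsType R) (M : premanifold E) (c : R -> M) (t : R) :
    mtan M :=
  (cderiv (chart (chart_at (c t)) \o c) t, c t).

Definition tmap (E F : tvsType R) (M : premanifold E) (N : premanifold F)
    (f : M -> N) (p : mtan M) : mtan N :=
  (dirder (chart (chart_at (f p.2)) \o f \o cochart (chart_at p.2))
          (chart (chart_at p.2) p.2) p.1,
   f p.2).

Definition mopen (E : tvsType R) (M : premanifold E) (W : set M) : Prop :=
  forall i : idx M, cinf_open (chart i @` (W `&` dom i)).

Definition mcontinuous (E : tvsType R) (M : premanifold E)
    (T : topologicalType) (f : T -> M) : Prop :=
  forall W : set M, mopen W -> open (f @^-1` W).

(* Paths and homotopies on [0, 1] are extended to R, resp. R^2. *)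
Definition simply_connected (E : tvsType R) (M : premanifold E) (x0 : M) :
    Prop :=
  (forall x : M, exists c : R -> M, [/\ mcontinuous c, c 0 = x0 & c 1 = x]) /\
  (forall c : R -> M, mcontinuous c -> c 0 = x0 -> c 1 = x0 ->
     exists H : (R * R)%type -> M,
       [/\ mcontinuous H,
           forall t : R, 0 <= t -> t <= 1 -> H (0, t) = c t /\ H (1, t) = x0
         & forall s : R, 0 <= s -> s <= 1 -> H (s, 0) = x0 /\ H (s, 1) = x0]).

(* Lie bracket of vector fields at x:  d eta.xi - d xi.eta  in the preferred
   chart at x. *)
Definition vfield_loc (E : tvsType R) (M : premanifold E) (xi : M -> mtan M)
    (i : idx M) (y : E) : E :=
  (@chart R (E * E)%type (mtan M) i (xi (cochart i y))).1.

Definition vfield_bracket (E : tvsType R) (M : premanifold E)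
    (xi eta : M -> mtan M) (x : M) : E :=
  let i := chart_at x in
  dirder (vfield_loc eta i) (chart i x) (vfield_loc xi i (chart i x))
  - dirder (vfield_loc xi i) (chart i x) (vfield_loc eta i (chart i x)).

(* Smooth curves in the function space C^infty(M, F), F a convenient vector
   space: those whose associated map R x M -> F is smooth. *)
Definition fun_curve (E F : tvsType R) (M : premanifold E)
    (c : R -> M -> F) : Prop :=
  @smooth_map (R^o * E)%type F (mprod (mvec R^o) M) (mvec F)
    (fun p => c p.1 p.2).

(* Velocity at 0 of a curve in a space of vector valued functions. *)
Definition fun_velocity (F : tvsType R) (A : Type) (c : R -> A -> F) : A -> F :=
  fun a => cderiv (fun t => c t a) 0.

(* Kinematic tangent bundle of a space of F-valued functions on A with set C
   of smooth curves: the pairs (c(0), c'(0)), here with the footpoint first. *)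
Definition kin_tangent (F : tvsType R) (A : Type) (C : set (R -> A -> F)) :
    set ((A -> F) * (A -> F)) :=
  [set p | exists2 c, C c & p = (c 0, fun_velocity c)].

(* (xi, eta), footpoint xi, is sent to  (eta, xi). *)
Definition twist (F : tvsType R) (A : Type) (p : (A -> F) * (A -> F)) :
    A -> (F * F)%type :=
  fun a => (p.2 a, p.1 a).

(* Isomorphism of spaces A, B given with their sets of smooth curves. *)
Definition smooth_iso (X Y : Type) (A : set X) (CA : set (R -> X))
    (B : set Y) (CB : set (R -> Y)) (f : X -> Y) : Prop :=
  set_bij A B f /\
  forall c : R -> X, (forall t, A (c t)) -> (CA c <-> CB (f \o c)).

Definition is_form (E F : tvsType R) (M : premanifold E) (w : mtan M -> F) :
    Prop :=
  (forall (x : M) (a : R) (u v : E),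
     w (a *: u + v, x) = a *: w (u, x) + w (v, x)) /\
  @smooth_map (E * E)%type F (mtan M) (mvec F) w.

Definition form_curve (E F : tvsType R) (M : premanifold E)
    (c : R -> mtan M -> F) : Prop :=
  (forall t, is_form (c t)) /\ @fun_curve (E * E)%type F (mtan M) c.

(* (dw)_x(u, v)  in the preferred chart at x. *)
Definition form_loc (E F : tvsType R) (M : premanifold E) (w : mtan M -> F)
    (i : idx M) (y v : E) : F :=
  w (@cochart R (E * E)%type (mtan M) i (v, y)).

Definition extd (E F : tvsType R) (M : premanifold E) (w : mtan M -> F)
    (x : M) (u v : E) : F :=
  let i := chart_at x in
  dirder (fun y => form_loc w i y v) (chart i x) u
  - dirder (fun y => form_loc w i y u) (chart i x) v.

Definition bracket_wedge (E F : tvsType R) (M : premanifold E)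
    (br : F -> F -> F) (phi psi : mtan M -> F) (x : M) (u v : E) : F :=
  br (phi (u, x)) (psi (v, x)) - br (phi (v, x)) (psi (u, x)).

Definition mc_eq (E F : tvsType R) (M : premanifold E) (br : F -> F -> F)
    (xi : mtan M -> F) : Prop :=
  forall (x : M) (u v : E),
    extd xi x u v - 2%:R^-1 *: bracket_wedge br xi xi x u v = 0.

Definition mc_lin_eq (E F : tvsType R) (M : premanifold E) (br : F -> F -> F)
    (xi eta : mtan M -> F) : Prop :=
  forall (x : M) (u v : E),
    extd eta x u v - bracket_wedge br xi eta x u v = 0.

Definition flat (E F : tvsType R) (M : premanifold E) (br : F -> F -> F) :
    set (mtan M -> F) :=
  [set xi | is_form xi /\ mc_eq br xi].

Definition flat_curve (E F : tvsType R) (M : premanifold E) (br : F -> F -> F) :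
    set (R -> mtan M -> F) :=
  [set c | form_curve c /\ forall t, flat br (c t)].

(* Bounded linear functionals on the convenient vector space C^infty(R, R). *)
Definition bounded_functional (l : (R -> R^o) -> R^o) : Prop :=
  (forall (a : R) (f g : R -> R^o), smooth_curve f -> smooth_curve g ->
     l (fun t => a * f t + g t) = a * l f + l g) /\
  (forall B : set (R -> R^o), (forall f, B f -> smooth_curve f) ->
     (forall (n : nat) (K : R), exists C : R, forall f, B f ->
        forall t : R, `|t| <= K -> `|cderivn n f t| <= C) ->
     exists C : R, forall f, B f -> `|l f| <= C).

(* C^infty((M, x0), (N, y0)) and its smooth curves. *)
Definition pointed_map (E F : tvsType R) (M : premanifold E) (x0 : M)
    (N : premanifold F) (y0 : N) : set (M -> N) :=
  [set f | smooth_map f /\ f x0 = y0].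

Definition pointed_curve (E F : tvsType R) (M : premanifold E) (x0 : M)
    (N : premanifold F) (y0 : N) : set (R -> M -> N) :=
  [set k | (forall s, pointed_map x0 y0 (k s)) /\
     forall (c : R -> M) (f : N -> mvec R^o) (l : (R -> R^o) -> R^o),
       msmooth c -> smooth_map f -> bounded_functional l ->
       @smooth_curve R R^o (fun s => l (f \o k s \o c))].

End Manifolds.

(* The Lie algebra T_eG is E, read in the chart [chart_at e].  For the       *)
(* tangent group below this makes the Lie algebra E * E, where (Y, X) is the *)
(* vector of the tangent bundle Tg of g = E with value Y at the footpoint X: *)
(* this is the canonical identification of T_{0_e}(TG) with T(T_eG).         *)

Record prelie (R : realType) (E : tvsType R) := Prelie {
  grp :> premanifold E;
  gmul : grp -> grp -> grp;
  ginv : grp -> grp;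
  gone : grp }.

Arguments gone {R E} p.

Section LieGroups.
Variable R : realType.

Definition is_lie_group (E : tvsType R) (G : prelie E) : Prop :=
  is_manifold G /\
  [/\ forall x y z : G, gmul x (gmul y z) = gmul (gmul x y) z,
      forall x : G, gmul (gone G) x = x /\ gmul x (gone G) = x,
      forall x : G, gmul (ginv x) x = gone G /\ gmul x (ginv x) = gone G,
      @smooth_map R (E * E)%type E (mprod G G) G (fun p => gmul p.1 p.2)
    & @smooth_map R E E G G (@ginv R E G)].

Section Ops.
Variables (E : tvsType R) (G : prelie E).

Definition left_field (X : E) (g : G) : mtan G :=
  tmap (gmul g) ((X, gone G) : mtan G).

Definition lie_bracket (X Y : E) : E :=
  vfield_bracket (left_field X) (left_field Y) (gone G).

Definition Ad (g : G) (X : E) : E :=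
  (tmap (fun h : G => gmul (gmul g h) (ginv g)) ((X, gone G) : mtan G)).1.

(* The right Maurer-Cartan form  kappa^r. *)
Definition kappa (p : mtan G) : E :=
  (tmap (fun y : G => gmul y (ginv p.2)) p).1.

Definition rtriv (p : mtan G) : (E * G)%type := (kappa p, p.2).

(* The right logarithmic derivative  delta^r f. *)
Definition rlogder (F : tvsType R) (M : premanifold F) (f : M -> G) :
    mtan M -> E :=
  fun p => kappa (tmap f p).

Definition is_Evol (X : R -> E) (g : R -> G) : Prop :=
  [/\ msmooth g, g 0 = gone G
    & forall t : R,
        velocity g t = tmap (fun h : G => gmul h (g t)) ((X t, gone G) : mtan G)].

Definition Evol (X : R -> E) : R -> G :=
  match pselect (exists g, is_Evol X g) with
  | left ex => projT1 (cid ex)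
  | right _ => fun _ => gone G
  end.

Definition evol (X : R -> E) : G := Evol X 1.

Definition regular : Prop :=
  [/\ is_lie_group G,
      forall X : R -> E, smooth_curve X -> exists g, is_Evol X g
    & forall c : R -> R -> E, @fun_curve R R^o E (mvec R^o) c ->
        msmooth (fun s => evol (c s))].

(* Lambda is the Cartan development  Evol^M_G. *)
Definition is_development (F : tvsType R) (M : premanifold F) (x0 : M)
    (Lambda : (mtan M -> E) -> M -> G) : Prop :=
  (forall xi, flat lie_bracket xi ->
     pointed_map x0 (gone G) (Lambda xi) /\ rlogder (Lambda xi) = xi) /\
  (forall c, flat_curve lie_bracket c ->
     pointed_curve x0 (gone G) (fun s => Lambda (c s))).

(* T mu : TG x TG = T(G x G) -> TG,  T nu  and  0_e. *)
Definition tangent_group : prelie (E * E)%type :=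
  @Prelie R (E * E)%type (mtan G)
    (fun p q => @tmap R (E * E)%type E (mprod G G) G
                  (fun z => gmul z.1 z.2) ((p.1, q.1), (p.2, q.2)))
    (tmap (@ginv R E G))
    (0, gone G).

Definition semidirect : prelie (E * E)%type :=
  @Prelie R (E * E)%type (mprod (mvec E) G)
    (fun p q => (p.1 + Ad p.2 q.1, gmul p.2 q.2))
    (fun p => (- Ad (ginv p.2) p.1, ginv p.2))
    (0, gone G).

End Ops.

Definition lie_iso (E F : tvsType R) (G : prelie E) (H : prelie F)
    (f : G -> H) : Prop :=
  [/\ smooth_map f,
      forall x y : G, f (gmul x y) = gmul (f x) (f y)
    & exists h : H -> G, [/\ smooth_map h, cancel f h & cancel h f]].

End LieGroups.

(* Main.v *)
Require Import Defs.
From HB Require Import structures.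
From mathcomp Require Import all_boot all_order all_algebra.
From mathcomp Require Import boolp classical_sets functions reals topology.
From mathcomp Require Import tvs normedtype.
From mathcomp Require Import interval_inference convex.
From mathcomp Require Import sequences exp.
From mathcomp Require Import ring lra.

Import Order.TTheory GRing.Theory Num.Theory.
Import numFieldTopology.Exports numFieldNormedType.Exports.

Local Open Scope classical_set_scope.
Local Open Scope ring_scope.

(** The analytic base is Boman's theorem for plane maps: a map from the plane that is smooth along
    smooth plane curves ([scw]) has smooth partial derivatives ([scw_partial]), symmetric second
    derivatives ([scw_sym]), and its derivative along the diagonal is the sum of the partials
    ([scw_diag]). Together with Hadamard's lemma this gives the chain rule [cc_chain] and
    differential calculus on manifolds. There every smooth curve in TM is locally made of the
    velocities of a plot, that is of a smooth two parameter family ([tangent_plot]), so identities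
    are proved by differentiating plots.

    On a Lie group the main object is the right logarithmic derivative [rv] of a curve. Its product
    rule [rvM] says that right trivialization is a homomorphism from TG to the semidirect product.
    The Maurer-Cartan equation for plots, d_s rv_t - d_t rv_s = [rv_s, rv_t] ([maurer_cartan]),
    gives the derivative of Ad ([Ad_deriv]), and this gives the logarithmic derivative (h' -
    [rv g, h], rv g) of a curve (h, g) in the semidirect product ([rv_semidirect]); the formulas for
    bracket and adjoint representation follow.

    Regularity: for a family X_s with velocity Y at s = 0, the Maurer-Cartan equation of P(s, t) =
    Evol(X_s)(t) states precisely that t |-> (rv_s P, P)(0, t) is the evolution of (Y, X) in the
    semidirect product ([Evol_variation]). So evolutions there are derivatives of evolutions in G;
    variation of constants yields the integral formulas ([Evol_semidirect]). The results pass to TG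
    because [rtriv] is the identity on the Lie algebra E * E ([tmap_rtriv_one], section [Transfer]).

    Flat forms: the form (eta, xi) is flat over the semidirect product if and only if xi is flat and
    eta solves the linearized equation ([flat_semidirect]). Velocities of curves of flat forms
    satisfy that equation ([flat_velocity]). Conversely a flat form over a regular group has a
    development on a simply connected manifold ([development_exists]): radial evolutions are local
    primitives, and monodromy glues them. If Phi = (A, f) develops (eta, xi), then the logarithmic
    derivatives of exp(r A) f form a curve of flat forms through xi with velocity eta
    ([flat_curve_exists]). The diagram commutes because maps with the same logarithmic derivative
    and the same value at x0 are equal ([development_unique]). *)

Set Implicit Arguments.
Unset Strict Implicit.
Unset Printing Implicit Defensive.

(* A reflexive decision procedure for linear identities in a module: both    *)
(* sides are compared coefficientwise, the coefficients being left to [field]. *)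
Inductive lm_expr (R : Type) : Type :=
  | LmVar of nat | LmZero | LmAdd of lm_expr R & lm_expr R
  | LmOpp of lm_expr R | LmScale of R & lm_expr R.
Arguments LmVar {R}. Arguments LmZero {R}.

Section LinearIdentities.
Variables (R : comNzRingType) (V : lmodType R).

Fixpoint lm_eval (env : seq V) (e : lm_expr R) : V :=
  match e with
  | LmVar k => nth 0 env k
  | LmZero => 0
  | LmAdd a b => lm_eval env a + lm_eval env b
  | LmOpp a => - lm_eval env a
  | LmScale x a => x *: lm_eval env a
  end.

Fixpoint lm_coef (e : lm_expr R) (n : nat) : R :=
  match e with
  | LmVar k => if Nat.eqb k n then 1 else 0
  | LmZero => 0
  | LmAdd a b => lm_coef a n + lm_coef b n
  | LmOpp a => - lm_coef a n
  | LmScale x a => x * lm_coef a n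
  end.

Fixpoint lm_same (N : nat) (a b : lm_expr R) : Prop :=
  match N with
  | 0%N => True
  | S k => lm_coef a k = lm_coef b k /\ lm_same k a b
  end.

Lemma lm_evalE env e : lm_eval env e = \sum_(i < size env) lm_coef e i *: nth 0 env i.
Proof.
elim: e => [k||a IHa b IHb|a IHa|x a IHa] /=.
- have eqbE i j : Nat.eqb i j = (i == j) by elim: i j => [|i IH] [|j] //=; rewrite IH.
  case: (ltnP k (size env)) => kn; last first.
    rewrite nth_default // big1 // => i _; rewrite eqbE gtn_eqF ?scale0r //.
    exact: leq_trans (ltn_ord i) kn.
  rewrite (bigD1 (Ordinal kn)) //= eqbE eqxx scale1r big1 ?addr0 // => i /eqP ik.
  rewrite eqbE; case: eqP => [ki|_]; last by rewrite scale0r.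
  by case: ik; apply: val_inj.
- by rewrite big1 // => i _; rewrite scale0r.
- by rewrite IHa IHb -big_split; apply: eq_bigr => i _; rewrite scalerDl.
- by rewrite IHa -sumrN; apply: eq_bigr => i _; rewrite scaleNr.
- by rewrite IHa scaler_sumr; apply: eq_bigr => i _; rewrite scalerA.
Qed.

Fixpoint lm_size (env : seq V) : nat := if env is _ :: l then S (lm_size l) else 0%N.

Lemma lm_correct env a b : lm_same (lm_size env) a b -> lm_eval env a = lm_eval env b.
Proof.
have -> : lm_size env = size env by elim: env => //= _ l ->.
rewrite !lm_evalE => h; apply: eq_bigr => i _; congr (_ *: _).
suff H N : lm_same N a b -> forall k, (k < N)%N -> lm_coef a k = lm_coef b k by exact: H h _ _.
elim: N {h} => [//|N IH] /= [h1 h2] k; rewrite ltnS leq_eqVlt => /orP[/eqP->//|].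
exact: IH.
Qed.

End LinearIdentities.

Ltac lm_ins env x :=
  lazymatch env with
  | nil => constr:(x :: nil)
  | x :: _ => env
  | ?y :: ?l => let l' := lm_ins l x in constr:(y :: l')
  end.
Ltac lm_idx env x :=
  lazymatch env with
  | x :: _ => constr:(0%N)
  | _ :: ?l => let n := lm_idx l x in constr:(S n)
  end.
Ltac lm_vars env t :=
  lazymatch t with
  | @GRing.add _ ?a ?b => let env := lm_vars env a in lm_vars env b
  | @GRing.opp _ ?a => lm_vars env a
  | @GRing.scale _ _ _ ?a => lm_vars env a
  | @GRing.zero _ => env
  | _ => lm_ins env t
  end.
Ltac lm_reify R env t :=
  lazymatch t with
  | @GRing.add _ ?a ?b => let a := lm_reify R env a in let b := lm_reify R env b in
                          constr:(@LmAdd R a b)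
  | @GRing.opp _ ?a => let a := lm_reify R env a in constr:(@LmOpp R a)
  | @GRing.scale _ _ ?x ?a => let a := lm_reify R env a in constr:(@LmScale R x a)
  | @GRing.zero _ => constr:(@LmZero R)
  | _ => let n := lm_idx env t in constr:(@LmVar R n)
  end.
Ltac lm_main R V :=
  lazymatch goal with
  | |- @eq _ ?x ?y =>
    let env := lm_vars (@nil V) x in
    let env := lm_vars env y in
    let a := lm_reify R env x in
    let b := lm_reify R env y in
    apply: (@lm_correct R V env a b);
    cbv [lm_same lm_coef lm_size Nat.eqb]; repeat (split; [try (by []); try ring|]); try exact I
  end.
Ltac lmod E := lazymatch type of E with Tvs.type ?R => lm_main R E end.

(** * Induction along a real interval *)

Section RealInduction.
Variable R : realType.

(** At the supremum of the good points the hypothesis carries a good point just below it to a point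
    beyond it, unless [b] is reached. This replaces compactness of intervals in the mean value
    inequality, in uniform continuity and in the lifting of paths and homotopies. *)
Lemma real_induction (P : R -> Prop) (a b : R) : a <= b -> P a ->
  (forall t, a <= t -> t <= b -> exists2 d, 0 < d & forall s u,
     a <= s -> s <= t -> t <= u -> u <= b -> t - d < s -> u < t + d ->
     P s -> P u) ->
  P b.
Proof.
move=> ab Pa H.
pose S := [set t | a <= t /\ t <= b /\ P t].
have Sa : S a by [].
have hS : has_sup S by split; [exists a | exists b => t [_ []]].
have aS : a <= sup S by apply: sup_upper_bound.
have Sb : sup S <= b by apply: ge_sup; [exists a | move=> t [_ []]].
have [d d0 Hd] := H _ aS Sb.
have [s [as' [sb Ps]] ls] := sup_adherent d0 hS.
have sS : s <= sup S by apply: sup_upper_bound.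
pose u := Order.min b (sup S + d / 2).
have d2 : 0 < d / 2 by rewrite divr_gt0.
have Su : sup S <= u by rewrite le_min Sb lerDl ltW.
have Pu : P u.
  apply: (Hd s u) => //; first by rewrite ge_min lexx.
  by rewrite gt_min ltrD2l ltr_pdivrMr // mulr_natr mulr2n ltrDl d0 orbT.
have uS : u <= sup S.
  by apply: sup_upper_bound => //; split; [exact: le_trans Su | rewrite ge_min lexx].
suff <- : u = b by [].
move: uS; rewrite /u; case: (leP b (sup S + d / 2)) => // lt.
by rewrite gerDl leNgt d2.
Qed.

End RealInduction.

(** * Continuous seminorms on a locally convex space *)

Section Seminorms.
Variables (R : realType).
Implicit Types E F : tvsType R.

Definition csemi E (p : E -> R) : Prop :=
  [/\ forall x y, p (x + y) <= p x + p y,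
      forall a x, p (a *: x) = `|a| * p x
    & forall e, 0 < e -> nbhs (0 : E) [set x | p x < e]].

Lemma csemi0 E (p : E -> R) : csemi p -> p 0 = 0.
Proof. by case=> _ h _; rewrite -(scale0r (0 : E)) h normr0 mul0r. Qed.

Lemma csemiN E (p : E -> R) x : csemi p -> p (- x) = p x.
Proof. by case=> _ h _; rewrite -scaleN1r h normrN1 mul1r. Qed.

Lemma csemi_ge0 E (p : E -> R) x : csemi p -> 0 <= p x.
Proof.
move=> hp; have [h1 _ _] := hp.
have := h1 x (- x); rewrite subrr csemi0 // csemiN //; lra.
Qed.

Lemma csemi_sub E (p : E -> R) x y : csemi p -> p (x - y) <= p x + p y.
Proof. by move=> hp; have [h1 _ _] := hp; rewrite -(csemiN y hp). Qed.

Lemma csemi_dist E (p : E -> R) x y : csemi p -> p (x - y) = p (y - x).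
Proof. by move=> hp; rewrite -opprB csemiN. Qed.

Lemma csemi_tri E (p : E -> R) z x y : csemi p -> p (x - y) <= p (x - z) + p (z - y).
Proof.
move=> hp; have [h1 _ _] := hp; apply: le_trans (h1 _ _).
by rewrite addrA subrK.
Qed.

Lemma nbhs_of_csemi E (p : E -> R) (x : E) (e : R) : csemi p -> 0 < e ->
  nbhs x [set y | p (y - x) < e].
Proof.
move=> [_ _ h] e0; have := nbhsT x (h e e0); apply: filterS => y [z /= pz <-].
by rewrite [x + z]addrC addrK.
Qed.

(** The seminorm is the Minkowski functional of the symmetric convex neighbourhood formed by [C] and
    its negative. It lets all limits be treated as estimates in continuous seminorms. *)
Lemma nbhs_csemi E (x : E) (U : set E) : nbhs x U ->
  exists2 p : E -> R, csemi p & forall y, p (y - x) < 1 -> U y.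
Proof.
move=> Ux.
have U0 : nbhs (0 : E) (+%R (- x) @` U) by rewrite -(addNr x); apply: nbhsB.
have [B convB [opB basB]] := @locally_convex R E.
have [C [BC C0] CU] := basB _ _ U0.
have nC : nbhs (0 : E) C by apply: open_nbhs_nbhs; split=> //; exact: opB.
have cC := convB C (mem_set BC).
pose V := C `&` (-%R @` C).
have nV : nbhs (0 : E) V by apply: filterI => //; exact: nbhs0N.
have V0 : V 0 by exact: nbhs_singleton nV.
have cvxC y z (l : R) : C y -> C z -> 0 <= l -> l <= 1 -> C (l *: y + (1 - l) *: z).
  move=> Cy Cz l0 l1.
  by have /set_mem := cC y z (Itv01 l0 l1) (mem_set Cy) (mem_set Cz).
have cvxV y z (l : R) : V y -> V z -> 0 <= l -> l <= 1 -> V (l *: y + (1 - l) *: z).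
  move=> [Cy [y' Cy' yy]] [Cz [z' Cz' zz]] l0 l1; split; first exact: cvxC.
  exists (l *: y' + (1 - l) *: z'); first exact: cvxC.
  by rewrite -yy -zz !scalerN opprD.
have symV y : V y -> V (- y).
  move=> [Cy [y' Cy' yy]]; split; first by rewrite -yy opprK.
  by exists y.
have shrV y (l : R) : V y -> 0 <= l -> l <= 1 -> V (l *: y).
  by move=> Vy l0 l1; have := cvxV y 0 l Vy V0 l0 l1; rewrite scaler0 addr0.
pose G y := [set r : R | 0 < r /\ V (r^-1 *: y)].
have absV y : exists r, G y r.
  have := @scale_continuous R E (0, y) V; rewrite /= scale0r => /(_ nV).
  case=> -[A A'] [/= nA nA'] AV.
  have /nbhs_ballP [d d0 dA] := nA.
  exists (d / 2)^-1; split; first by rewrite invr_gt0 divr_gt0.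
  rewrite invrK; apply: (AV (d / 2, y)); split=> /=; last exact: nbhs_singleton.
  apply: dA; rewrite /ball /= sub0r normrN gtr0_norm ?divr_gt0 //.
  by rewrite ltr_pdivrMr // mulr_natr mulr2n ltrDl.
have hinf y : has_inf (G y).
  by split; [exact: absV | exists 0 => r [/ltW]].
pose p y := inf (G y).
have Gup y r r' : G y r -> r <= r' -> G y r'.
  move=> [r0 Vr] rr'; have r'0 := lt_le_trans r0 rr'; split=> //.
  have -> : r'^-1 *: y = (r / r') *: (r^-1 *: y).
    by rewrite scalerA mulrAC divff ?mul1r // gt_eqF.
  apply: shrV => //; first by rewrite divr_ge0 // ltW.
  by rewrite ler_pdivrMr // mul1r.
have p0 y : 0 <= p y by apply: lb_le_inf; [exact: absV | move=> r [/ltW]].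
have plt y r : p y < r -> G y r.
  move=> pr; have [s Gs /ltW ls] := inf_lt (absV y) pr.
  exact: Gup ls.
have ple y r : G y r -> p y <= r.
  by move=> Gr; apply: ge_inf => //; exact: (hinf y).2.
have pD y z : p (y + z) <= p y + p z.
  apply/ler_addgt0Pr => e e0.
  have e2 : 0 < e / 2 by rewrite divr_gt0.
  have [a0 Va] := plt y (p y + e / 2) (ltr_pwDr e2 (lexx _)).
  have [b0 Vb] := plt z (p z + e / 2) (ltr_pwDr e2 (lexx _)).
  set a := p y + e / 2 in a0 Va; set b := p z + e / 2 in b0 Vb.
  have -> : p y + p z + e = a + b by rewrite /a /b; lra.
  apply: ple; split; first exact: addr_gt0.
  have ab0 : a + b != 0 by rewrite gt_eqF // addr_gt0.
  have -> : (a + b)^-1 *: (y + z) =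
     (a / (a + b)) *: (a^-1 *: y) + (1 - a / (a + b)) *: (b^-1 *: z).
    rewrite !scalerA scalerDr; congr (_ *: _ + _ *: _).
      by field; rewrite ab0 gt_eqF.
    by field; rewrite ab0 gt_eqF.
  have abp : 0 < a + b by exact: addr_gt0.
  apply: cvxV => //; first by rewrite divr_ge0 // ltW.
  by rewrite ler_pdivrMr // mul1r lerDl ltW.
have pZpos (a : R) y : 0 < a -> p (a *: y) <= a * p y.
  move=> a0; apply/ler_addgt0Pr => e e0.
  have ea : 0 < e / a by rewrite divr_gt0.
  have [b0 Vb] := plt y (p y + e / a) (ltr_pwDr ea (lexx _)).
  have -> : a * p y + e = a * (p y + e / a) by field; rewrite gt_eqF.
  apply: ple; split; first by rewrite mulr_gt0.
  by rewrite scalerA invfM mulrAC mulVf ?mul1r // gt_eqF.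
have pN y : p (- y) <= p y.
  apply/ler_addgt0Pr => e e0.
  have [b0 Vb] := plt y (p y + e) (ltr_pwDr e0 (lexx _)).
  by apply: ple; split=> //; rewrite scalerN; exact: symV.
have pNE y : p (- y) = p y.
  by apply/eqP; rewrite eq_le pN -{1}[y in p y <= _]opprK pN.
have pp0 : p 0 = 0.
  apply/eqP; rewrite eq_le p0 andbT; apply/ler_addgt0Pr => e e0.
  by rewrite add0r; apply: ple; split=> //; rewrite scaler0.
have pZ (a : R) y : p (a *: y) = `|a| * p y.
  have pos b : 0 < b -> p (b *: y) = b * p y.
    move=> b0; apply/eqP; rewrite eq_le pZpos //=.
    have b1 : 0 < b^-1 by rewrite invr_gt0.
    have := pZpos b^-1 (b *: y) b1; rewrite scalerA mulVf ?gt_eqF // scale1r.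
    by rewrite mulrC ler_pdivlMr // mulrC.
  case: (ltgtP a 0) => [a0|a0|->].
  - by rewrite -{1}(opprK a) scaleNr pNE pos ?oppr_gt0 // ltr0_norm.
  - by rewrite pos // gtr0_norm.
  - by rewrite scale0r normr0 mul0r.
exists p.
  split=> // e e0.
  have e2 : e / 2 != 0 by rewrite gt_eqF // divr_gt0.
  have := nbhs0Z e2 nV; apply: filterS => y [z Vz <-] /=.
  apply: (@le_lt_trans _ _ (e / 2)).
    apply: ple; split; first by rewrite divr_gt0.
    by rewrite scalerA mulVf // scale1r.
  by rewrite ltr_pdivrMr // mulr_natr mulr2n ltrDl.
move=> y py; have [_] := plt _ _ py; rewrite invr1 scale1r => -[Cy _].
have [z Uz] := CU _ Cy; rewrite [- x + z]addrC => /(congr1 (fun w => w + x)).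
by rewrite !subrK => <-.
Qed.

End Seminorms.

(** * Derivatives of curves as first order expansions *)

Class hs (R : realType) (E : tvsType R) : Prop := hs_hausdorff : hausdorff_space E.

Section Derivative.
Variables (R : realType).
Implicit Types E F : tvsType R.

Lemma csemi_eq0 E {hE : hs E} (x : E) :
  (forall p : E -> R, csemi p -> p x = 0) -> x = 0.
Proof.
move=> h; apply/esym; apply: hE => A B nA nB; exists 0; split.
  exact: nbhs_singleton nA.
have [p hp pB] := nbhs_csemi nB.
by apply: pB; rewrite sub0r csemiN // h.
Qed.

Lemma nbhs_real (x : R) (A : set R) :
  nbhs x A <-> exists2 d, 0 < d & forall s, `|s - x| < d -> A s.
Proof.
split.
  move=> /nbhs_ballP[d d0 dA]; exists d => // s sd; apply: dA.
  by rewrite /ball /= distrC.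
case=> d d0 dA; apply/nbhs_ballP; exists d => // s.
by rewrite /ball /= distrC; apply: dA.
Qed.

Lemma open_real (A : set R) t : open A -> A t ->
  exists2 d, 0 < d & forall s, `|s - t| < d -> A s.
Proof. by move=> oA At; apply/nbhs_real; apply: open_nbhs_nbhs. Qed.

Lemma real_open (A : set R) :
  (forall t, A t -> exists2 d, 0 < d & forall s, `|s - t| < d -> A s) -> open A.
Proof. by move=> h; rewrite openE => t /h /nbhs_real. Qed.

Lemma open_ballR (t d : R) : open [set s | `|s - t| < d].
Proof.
apply: real_open => s /= st; exists (d - `|s - t|); first by rewrite subr_gt0.
move=> u us; rewrite -(subrKA s); apply: le_lt_trans (ler_normD _ _) _; lra.
Qed.

Definition isd E (c : R -> E) (t : R) (l : E) : Prop :=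
  forall p : E -> R, csemi p -> forall e, 0 < e -> exists2 d, 0 < d &
    forall h, `|h| < d -> p (c (t + h) - c t - h *: l) <= e * `|h|.

Lemma diffquotP E (c : R -> E) t l : (diffquot c t @ 0^' --> l) <-> isd c t l.
Proof.
split=> [cv p hp e e0|H U nU].
  have := cv _ (nbhs_of_csemi l hp e0); rewrite /= /fmap /= /within /=.
  move=> /nbhs_real[d d0 dH]; exists d => // h hd.
  have [->|h0] := eqVneq h 0.
    by rewrite addr0 scale0r !subrr csemi0 // normr0 mulr0.
  have := dH h; rewrite subr0 => /(_ hd h0) /= => /ltW.
  have [_ pZ _] := hp; rewrite /diffquot => pe.
  have -> : c (t + h) - c t - h *: l = h *: (h^-1 *: (c (t + h) - c t) - l).
    by rewrite scalerBr scalerA mulfV // scale1r.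
  by rewrite pZ mulrC ler_wpM2r.
have [p hp pU] := nbhs_csemi nU.
have [d d0 dH] := H p hp (2^-1) ltac:(by rewrite invr_gt0).
rewrite /= /fmap /= /within /=; apply/nbhs_real; exists d => // h hd h0.
rewrite subr0 in hd; apply: pU; have := dH _ hd.
have [_ pZ _] := hp; rewrite /diffquot.
have -> : c (t + h) - c t - h *: l = h *: (h^-1 *: (c (t + h) - c t) - l).
  by rewrite scalerBr scalerA mulfV // scale1r.
rewrite pZ mulrC ler_pM2r ?normr_gt0 // => /le_lt_trans; apply.
by rewrite invf_lt1 // ltr1n.
Qed.

Lemma isd_unique E {hE : hs E} (c : R -> E) t l l' : isd c t l -> isd c t l' -> l = l'.
Proof.
move=> H H'; apply/eqP; rewrite -subr_eq0; apply/eqP; apply: csemi_eq0 => p hp.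
apply/eqP; rewrite eq_le csemi_ge0 // andbT; apply/ler_addgt0Pr => e e0.
have e2 : 0 < e / 2 by rewrite divr_gt0.
have [d d0 dH] := H p hp _ e2; have [d' d'0 dH'] := H' p hp _ e2.
pose h := Order.min d d' / 2.
have m0 : 0 < Order.min d d' by rewrite lt_min d0.
have h0 : 0 < h by rewrite divr_gt0.
have hm : h < Order.min d d' by rewrite ltr_pdivrMr // mulr_natr mulr2n ltrDl.
move: (hm); rewrite lt_min => /andP[hd hd'].
have := dH h; rewrite gtr0_norm // => /(_ hd) h1.
have := dH' h; rewrite gtr0_norm // => /(_ hd') h2.
have [_ pZ _] := hp.
rewrite add0r -(ler_pM2l h0) -{1}(gtr0_norm h0) -pZ.
have -> : h *: (l - l') = (c (t + h) - c t - h *: l') - (c (t + h) - c t - h *: l).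
  by lmod E.
apply: le_trans (csemi_sub _ _ hp) _; lra.
Qed.

Lemma isd_cderiv E {hE : hs E} (c : R -> E) t l : isd c t l -> cderiv c t = l.
Proof.
move=> H; rewrite /cderiv; case: xgetP => [y _ /= /diffquotP Hy|/(_ l)].
  exact: isd_unique Hy H.
by move=> /(_ (iffRL (diffquotP _ _ _) H)).
Qed.

Lemma cderivable_isd E (c : R -> E) t : cderivable c t -> isd c t (cderiv c t).
Proof.
case=> l Hl; rewrite /cderiv; case: xgetP => [y _ /= /diffquotP //|/(_ l)].
by move=> /(_ Hl).
Qed.

Lemma isd_cderivable E (c : R -> E) t l : isd c t l -> cderivable c t.
Proof. by move=> H; exists l; apply/diffquotP. Qed.

Lemma isd_near E (c c' : R -> E) t l d : 0 < d ->
  (forall s, `|s - t| < d -> c s = c' s) -> isd c t l -> isd c' t l.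
Proof.
move=> d0 cc H p hp e e0; have [d' d'0 dH] := H p hp e e0.
exists (Order.min d d'); first by rewrite lt_min d0.
move=> h; rewrite lt_min => /andP[hd hd'].
rewrite -!cc ?subrr ?normr0 //; last by rewrite addrAC subrr add0r.
exact: dH.
Qed.

Lemma isd_eq E (c : R -> E) t l l' : isd c t l -> l = l' -> isd c t l'.
Proof. by move=> H <-. Qed.

Lemma isd_cont E (c : R -> E) t l : isd c t l -> forall p, csemi p ->
  forall e, 0 < e -> exists2 d, 0 < d & forall s, `|s - t| < d -> p (c s - c t) < e.
Proof.
move=> H p hp e e0; have [d d0 dH] := H p hp 1 ltr01.
have pl0 := csemi_ge0 l hp.
have k0 : 0 < 1 + p l by rewrite ltr_pwDl.
exists (Order.min d (e / (1 + p l))); first by rewrite lt_min d0 divr_gt0.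
move=> s; rewrite lt_min ltr_pdivlMr // => /andP[sd se].
have := dH _ sd; rewrite [t + _]addrC subrK mul1r => h1.
have [pD pZ _] := hp.
apply: le_lt_trans se.
rewrite -(subrK ((s - t) *: l) (c s - c t)).
apply: le_trans (pD _ _) _; rewrite pZ mulrDr mulr1 lerD2r.
exact: h1.
Qed.

Lemma isd_cst E (x : E) t : isd (fun=> x) t 0.
Proof.
move=> p hp e e0; exists 1 => // h _.
by rewrite subrr scaler0 subr0 csemi0 // mulr_ge0 // ltW.
Qed.

Lemma isd_id t : isd (fun s : R => s : R^o) t (1 : R^o).
Proof.
move=> p hp e e0; exists 1 => // h _.
by rewrite [t + h]addrC addrK [h *: _]mulr1 subrr csemi0 // mulr_ge0 // ltW.
Qed.

Lemma isdD E (c d : R -> E) t l m : isd c t l -> isd d t m ->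
  isd (fun s => c s + d s) t (l + m).
Proof.
move=> H H' p hp e e0; have e2 : 0 < e / 2 by rewrite divr_gt0.
have [a a0 aH] := H p hp _ e2; have [b b0 bH] := H' p hp _ e2.
exists (Order.min a b); first by rewrite lt_min a0.
move=> h; rewrite lt_min => /andP[ha hb].
have [pD _ _] := hp.
have -> : c (t + h) + d (t + h) - (c t + d t) - h *: (l + m) =
    (c (t + h) - c t - h *: l) + (d (t + h) - d t - h *: m).
  by lmod E.
apply: le_trans (pD _ _) _; have := aH _ ha; have := bH _ hb; lra.
Qed.

Lemma isd_linear E F (L : E -> F) (c : R -> E) t l :
  (forall a x y, L (a *: x + y) = a *: L x + L y) ->
  (forall q : F -> R, csemi q -> exists2 p, csemi p & forall x, q (L x) <= p x) ->
  isd c t l -> isd (L \o c) t (L l).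
Proof.
move=> Ll Lc H q hq e e0; have [p hp pq] := Lc q hq.
have L0 : L 0 = 0 by have /(congr1 (fun z => z - L 0)) := Ll 1 0 0; rewrite scaler0 addr0 scale1r addrK subrr.
have LZ a x : L (a *: x) = a *: L x by rewrite -[a *: x]addr0 Ll L0 addr0.
have LD x y : L (x + y) = L x + L y by rewrite -[x in L (x + _)]scale1r Ll scale1r.
have LN x : L (- x) = - L x by rewrite -scaleN1r LZ scaleN1r.
have [d d0 dH] := H p hp e e0; exists d => // h hd.
rewrite /= -LZ -!LN -!LD; exact: le_trans (pq _) (dH _ hd).
Qed.

Lemma isdZ E (c : R -> E) a t l : isd c t l -> isd (fun s => a *: c s) t (a *: l).
Proof.
apply: (@isd_linear E E (fun x => a *: x)).
  by move=> b x y; rewrite scalerDr !scalerA mulrC.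
move=> q hq; exists (fun x => `|a| * q x); last by move=> x; case: hq => _ ->.
case: (hq) => qD qZ qn; split.
- by move=> x y; rewrite -mulrDr ler_wpM2l.
- by move=> b x; rewrite qZ mulrCA.
move=> e e0; have k0 : 0 < 1 + `|a| by rewrite ltr_pwDl.
apply: filterS (qn (e / (1 + `|a|)) _); last by rewrite divr_gt0.
move=> x /=; rewrite ltr_pdivlMr // => h; apply: le_lt_trans h.
by rewrite mulrC ler_wpM2l ?csemi_ge0 // lerDr.
Qed.

Lemma isdN E (c : R -> E) t l : isd c t l -> isd (fun s => - c s) t (- l).
Proof.
by move=> /(isdZ (-1)); rewrite scaleN1r; under eq_fun do rewrite scaleN1r.
Qed.

Lemma isdB E (c d : R -> E) t l m : isd c t l -> isd d t m ->
  isd (fun s => c s - d s) t (l - m).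
Proof. by move=> h /isdN; apply: isdD. Qed.

Lemma isd_scal E (f : R -> R^o) (c : R -> E) t (a : R^o) l : isd f t a -> isd c t l ->
  isd (fun s => (f s : R) *: c s) t ((a : R) *: c t + (f t : R) *: l).
Proof.
move=> Hf Hc p hp e e0; have [pD pZ _] := hp.
have hn : csemi (fun x : R^o => `|x|).
  split; [exact: ler_normD | exact: normrM | move=> r r0].
  by apply/nbhs_real; exists r => // s; rewrite subr0.
set K := 1 + p (c t) + `|f t|.
have K0 : 0 < K by rewrite /K -addrA ltr_pwDl // addr_ge0 ?csemi_ge0.
have e3 : 0 < e / (3 * K) by rewrite divr_gt0 // mulr_gt0.
have [d1 d10 H1] := Hf _ hn _ e3.
have [d2 d20 H2] := Hc _ hp _ e3.
have pl0 := csemi_ge0 l hp.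
have [d3 d30 H3] := isd_cont Hc hp ltr01.
have e4 : 0 < e / (3 * (1 + `|a : R|)).
  by rewrite divr_gt0 // mulr_gt0 // ltr_pwDl.
have [d4 d40 H4] := isd_cont Hc hp e4.
exists (Order.min d1 (Order.min d2 (Order.min d3 d4))); first by rewrite !lt_min d10 d20 d30.
move=> h; rewrite !lt_min => /and4P[h1 h2 h3 h4].
have -> : f (t + h) *: c (t + h) - f t *: c t - h *: (a *: c t + f t *: l) =
  (f (t + h) - f t - h * a) *: c (t + h) + (h * a) *: (c (t + h) - c t)
  + f t *: (c (t + h) - c t - h *: l) by lmod E.
have b1 := H1 _ h1; have b2 := H2 _ h2.
have b3 := H3 (t + h); rewrite addrAC subrr add0r in b3; have {}b3 := b3 h3.
have b4 := H4 (t + h); rewrite addrAC subrr add0r in b4; have {}b4 := b4 h4.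
have pc : p (c (t + h)) <= K.
  rewrite -(subrK (c t) (c (t + h))); apply: le_trans (pD _ _) _.
  have := normr_ge0 (f t); rewrite /K; lra.
apply: le_trans (pD _ _) _; apply: le_trans (lerD (pD _ _) (lexx _)) _.
rewrite !pZ normrM.
have i1 : `|f (t + h) - f t - h * a| * p (c (t + h)) <= e / (3 * K) * `|h| * K.
  by rewrite ler_pM // csemi_ge0.
have i2 : `|h| * `|a : R| * p (c (t + h) - c t) <= `|h| * ((1 + `|a : R|) * (e / (3 * (1 + `|a : R|)))).
  rewrite -mulrA ler_wpM2l // ler_pM ?csemi_ge0 //; last exact: ltW.
  by rewrite ler_wpDl.
have i3 : `|f t| * p (c (t + h) - c t - h *: l) <= K * (e / (3 * K) * `|h|).
  by rewrite ler_pM ?csemi_ge0 // /K ler_wpDl // addr_ge0 ?csemi_ge0.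
have j1 : e / (3 * K) * `|h| * K = e * `|h| / 3 by field; rewrite gt_eqF.
have j2 : (1 + `|a : R|) * (e / (3 * (1 + `|a : R|))) = e / 3.
  by field; rewrite gt_eqF // ltr_pwDl.
have j3 : K * (e / (3 * K) * `|h|) = e * `|h| / 3 by field; rewrite gt_eqF.
rewrite j1 in i1; rewrite j2 in i2; rewrite j3 in i3; lra.
Qed.

End Derivative.

(** * Composition, products of spaces and the mean value inequality *)

Section DerivativeRules.
Variables (R : realType).
Implicit Types E F : tvsType R.

Lemma csemi_norm : csemi (fun x : R^o => `|x|).
Proof.
split; [exact: ler_normD | exact: normrM | move=> r r0].
by apply/nbhs_real; exists r => // s; rewrite subr0.
Qed.

Lemma isd_comp E (f : R -> R^o) (c : R -> E) t (a : R) l :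
  isd f t (a : R^o) -> isd c (f t) l -> isd (fun s => c (f s)) t (a *: l).
Proof.
move=> Hf Hc p hp e e0; have [pD pZ _] := hp.
have pl0 := csemi_ge0 l hp.
have a1 : 0 < 1 + `|a| by rewrite ltr_pwDl.
have p1 : 0 < 1 + p l by rewrite ltr_pwDl.
have e1 : 0 < e / (2 * (1 + `|a|)) by rewrite divr_gt0 // mulr_gt0.
have e2 : 0 < e / (2 * (1 + p l)) by rewrite divr_gt0 // mulr_gt0.
have [d1 d10 H1] := Hc _ hp _ e1.
have [d2 d20 H2] := Hf _ csemi_norm _ e2.
have [d3 d30 H3] := Hf _ csemi_norm _ ltr01.
exists (Order.min d2 (Order.min d3 (d1 / (1 + `|a|)))).
  by rewrite !lt_min d20 d30 divr_gt0.
move=> h; rewrite !lt_min ltr_pdivlMr // => /and3P[h2 h3 h1].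
set k := f (t + h) - f t.
have kE : f (t + h) = f t + k by rewrite /k subrKC.
have b2 := H2 _ h2; have b3 := H3 _ h3; rewrite mul1r in b3.
have kb : `|k| <= (1 + `|a|) * `|h|.
  rewrite -(subrK (h * a) k) mulrDl mul1r; apply: le_trans (ler_normD _ _) _.
  by rewrite normrM [`|a| * _]mulrC lerD2r.
have kd : `|k| < d1 by apply: le_lt_trans kb _; rewrite mulrC.
have b1 := H1 _ kd; rewrite -kE in b1.
have -> : c (f (t + h)) - c (f t) - h *: (a *: l) =
   (c (f (t + h)) - c (f t) - k *: l) + (k - h * a) *: l by lmod E.
apply: le_trans (pD _ _) _; rewrite pZ.
have i1 : e / (2 * (1 + `|a|)) * `|k| <= e / (2 * (1 + `|a|)) * ((1 + `|a|) * `|h|).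
  by rewrite ler_wpM2l // ltW.
have j1 : e / (2 * (1 + `|a|)) * ((1 + `|a|) * `|h|) = e * `|h| / 2.
  by field; rewrite gt_eqF.
have i2 : `|k - h * a| * p l <= e / (2 * (1 + p l)) * `|h| * (1 + p l).
  by rewrite ler_pM // ler_wpDl.
have j2 : e / (2 * (1 + p l)) * `|h| * (1 + p l) = e * `|h| / 2.
  by field; rewrite gt_eqF.
rewrite j1 in i1; rewrite j2 in i2; lra.
Qed.

Lemma csemi_fst E F (p : E -> R) : csemi p -> csemi (fun z : E * F => p z.1).
Proof.
case=> pD pZ pn; split=> [x y|a x|e e0] //=.
have := pn e e0 => h; exists ([set x | p x < e], setT) => /=.
  by split=> //; exact: filterT.
by move=> [x y] /= [].
Qed.

Lemma csemi_snd E F (p : F -> R) : csemi p -> csemi (fun z : E * F => p z.2).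
Proof.
case=> pD pZ pn; split=> [x y|a x|e e0] //=.
have := pn e e0 => h; exists (setT, [set x | p x < e]) => /=.
  by split=> //; exact: filterT.
by move=> [x y] /= [].
Qed.

Lemma csemi_inl E F (p : E * F -> R) : csemi p -> csemi (fun x : E => p (x, 0)).
Proof.
case=> pD pZ pn; split=> [x y|a x|e e0] /=.
- by apply: le_trans (pD _ _); rewrite -[_ + _ in leRHS]/(x + y, 0 + 0) addr0.
- by rewrite -pZ; congr (p _); rewrite -[RHS]/(a *: x, a *: 0) scaler0.
have [[A B] /= [nA nB] AB] := pn e e0.
by apply: filterS nA => x Ax; apply: (AB (x, 0)); split=> //=; exact: nbhs_singleton nB.
Qed.

Lemma csemi_inr E F (p : E * F -> R) : csemi p -> csemi (fun x : F => p (0, x)).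
Proof.
case=> pD pZ pn; split=> [x y|a x|e e0] /=.
- by apply: le_trans (pD _ _); rewrite -[_ + _ in leRHS]/(0 + 0, x + y) addr0.
- by rewrite -pZ; congr (p _); rewrite -[RHS]/(a *: 0, a *: x) scaler0.
have [[A B] /= [nA nB] AB] := pn e e0.
by apply: filterS nB => x Bx; apply: (AB (0, x)); split=> //=; exact: nbhs_singleton nA.
Qed.

Lemma isd_fst E F (c : R -> E * F) t l : isd c t l -> isd (fun s => (c s).1) t l.1.
Proof.
apply: (@isd_linear R (E * F)%type E fst) => // q hq.
by exists (fun z => q z.1) => //; exact: csemi_fst.
Qed.

Lemma isd_snd E F (c : R -> E * F) t l : isd c t l -> isd (fun s => (c s).2) t l.2.
Proof.
apply: (@isd_linear R (E * F)%type F snd) => // q hq.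
by exists (fun z => q z.2) => //; exact: csemi_snd.
Qed.

Lemma isd_pair E F (c : R -> E) (d : R -> F) t l m : isd c t l -> isd d t m ->
  isd (fun s => (c s, d s)) t (l, m).
Proof.
move=> Hc Hd.
have H1 : isd (fun s => (c s, 0 : F)) t (l, 0).
  apply: (@isd_linear R E (E * F)%type (fun x => (x, 0))) Hc.
    by move=> a x y; rewrite -[RHS]/(a *: x + y, a *: 0 + 0) scaler0 addr0.
  by move=> q hq; exists (fun x => q (x, 0)) => //; exact: csemi_inl.
have H2 : isd (fun s => (0 : E, d s)) t (0, m).
  apply: (@isd_linear R F (E * F)%type (fun x => (0, x))) Hd.
    by move=> a x y; rewrite -[RHS]/(a *: 0 + 0, a *: x + y) scaler0 addr0.
  by move=> q hq; exists (fun x => q (0, x)) => //; exact: csemi_inr.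
have := isdD H1 H2; rewrite -[(l, 0) + _]/(l + 0, 0 + m) addr0 add0r.
under eq_fun do rewrite -[_ + _]/(_ + 0, 0 + _) addr0 add0r.
by [].
Qed.

Lemma isd_inv (x : R) : x != 0 ->
  isd (fun s : R => s^-1 : R^o) x (- (x^-1 * x^-1) : R^o).
Proof.
move=> x0 p hp e e0; have [_ pZ _] := hp.
have n0 : 0 < `|x| by rewrite normr_gt0.
have p1 := csemi_ge0 (1 : R^o) hp.
(* The remainder of the inverse is h^2 / (x^2 (x + h)), and |x + h| >= |x| / 2 bounds its
   coefficient by 2 / |x|^3. *)
pose K := 2 * p (1 : R^o) / `|x| ^+ 3 + 1.
have K0 : 0 < K by rewrite /K ltr_wpDl // divr_ge0 // ?mulr_ge0 // exprn_ge0.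
exists (Order.min (`|x| / 2) (e / K)); first by rewrite lt_min !divr_gt0.
move=> h; rewrite lt_min !ltr_pdivlMr // => /andP[h1 h2].
have xh : `|x| / 2 <= `|x + h|.
  have := ler_normB (x + h) h; rewrite addrK; lra.
have xh0 : x + h != 0 by rewrite -normr_gt0; apply: lt_le_trans xh; rewrite divr_gt0.
have -> : (x + h)^-1 - x^-1 - h *: (- (x^-1 * x^-1) : R^o) =
   (h * h / (x ^+ 2 * (x + h))) *: (1 : R^o).
  rewrite -[h *: _]/(h * - (x^-1 * x^-1)) -[_ *: (1 : R^o)]/(_ * 1).
  by field; rewrite x0 xh0.
rewrite pZ normrM normrM normfV normrM normrX.
have : (`|x| ^+ 2 * `|x + h|)^-1 <= 2 / `|x| ^+ 3.
  rewrite -[leRHS]invrK lef_pV2 ?posrE ?invr_gt0 ?divr_gt0 ?exprn_gt0 ?mulr_gt0 ?exprn_gt0 ?normr_gt0 //.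
  rewrite invf_div exprSr -mulrA ler_wpM2l // exprn_ge0 //.
move=> i1.
apply: (@le_trans _ _ (`|h| * `|h| * (2 / `|x| ^+ 3) * p (1 : R^o))).
  by rewrite ler_wpM2r // ler_wpM2l // mulr_ge0.
have -> : `|h| * `|h| * (2 / `|x| ^+ 3) * p (1 : R^o) = `|h| * (`|h| * (K - 1)).
  by rewrite /K addrK; ring.
rewrite mulrC ler_wpM2r //; have := normr_ge0 h; have := h2; lra.
Qed.

(** Real induction with the larger slope [M + e]: the expansion at t controls increments on both
    sides of t, so the bound passes from a point below t to a point above it. Then e tends to 0. *)
Lemma mvt E (p : E -> R) (c l : R -> E) a b M : csemi p -> a <= b ->
  (forall t, a <= t -> t <= b -> isd c t (l t)) ->
  (forall t, a <= t -> t <= b -> p (l t) <= M) ->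
  p (c b - c a) <= M * (b - a).
Proof.
move=> hp ab Hc Hl; have [pD pZ _] := hp.
have step e : 0 < e -> p (c b - c a) <= (M + e) * (b - a).
  move=> e0; pose P t := p (c t - c a) <= (M + e) * (t - a).
  apply: (@real_induction R P a b) => //.
    by rewrite /P !subrr csemi0 // mulr0.
  move=> t at' tb; have [d d0 dH] := Hc t at' tb p hp e e0.
  exists d => // s u as' st tu ub ds ud Ps; rewrite /P.
  have est v : `|v - t| < d -> p (c v - c t) <= (M + e) * `|v - t|.
    move=> vd; have := dH _ vd; rewrite [t + _]addrC subrK => h1.
    rewrite -(subrK ((v - t) *: l t) (c v - c t)).
    apply: le_trans (pD _ _) _; rewrite pZ.
    have : `|v - t| * p (l t) <= `|v - t| * M by rewrite ler_wpM2l // Hl.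
    lra.
  have e1 := est u; rewrite ger0_norm ?subr_ge0 // in e1.
  have e2 := est s; rewrite distrC ger0_norm ?subr_ge0 // in e2.
  have {}e1 := e1 ltac:(lra); have {}e2 := e2 ltac:(lra).
  have := csemi_tri (c t) (c u) (c a) hp; have := csemi_tri (c s) (c t) (c a) hp.
  rewrite (csemi_dist (c t) (c s) hp); rewrite /P in Ps; lra.
apply/ler_addgt0Pr => e e0.
have k0 : 0 < 1 + (b - a) by rewrite ltr_pwDl // subr_ge0.
apply: le_trans (step (e / (1 + (b - a))) _) _; first by rewrite divr_gt0.
rewrite mulrDl lerD2l mulrAC ler_pdivrMr // ler_pM2l // lerDr //.
Qed.

Lemma isd0_const E {hE : hs E} (c : R -> E) a b : a <= b ->
  (forall t, a <= t -> t <= b -> isd c t 0) -> c b = c a.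
Proof.
move=> ab H; apply/eqP; rewrite -subr_eq0; apply/eqP; apply: csemi_eq0 => p hp.
apply/eqP; rewrite eq_le csemi_ge0 // andbT.
have := @mvt E p c (fun=> 0) a b 0 hp ab H; rewrite mul0r; apply.
by move=> t _ _; rewrite csemi0.
Qed.

End DerivativeRules.

#[export] Instance hs_real (R : realType) : hs (R^o : tvsType R).
Proof. exact: norm_hausdorff. Qed.

#[export] Instance hs_prod (R : realType) (E F : tvsType R) {hE : hs E} {hF : hs F} :
  hs (E * F : tvsType R)%type.
Proof.
move=> [x y] [x' y'] cl.
have cx : x = x'.
  apply: hE => A B nA nB; case: (cl (A `*` setT) (B `*` setT)).
  - by exists (A, setT) => //=; split=> //; exact: filterT.
  - by exists (B, setT) => //=; split=> //; exact: filterT.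
  by move=> [u v] /= [[Au _] [Bu _]]; exists u.
have cy : y = y'.
  apply: hF => A B nA nB; case: (cl (setT `*` A) (setT `*` B)).
  - by exists (setT, A) => //=; split=> //; exact: filterT.
  - by exists (setT, B) => //=; split=> //; exact: filterT.
  by move=> [u v] /= [[_ Au] [_ Bu]]; exists v.
by rewrite cx cy.
Qed.

(** * Curves of class C^n and smooth curves on subsets of the line *)

Section Cn.
Variables (R : realType).
Implicit Types (E F : tvsType R) (A B : set R).

(** The derivative is an existential witness and not [cderiv], so closure under operations is an
    induction on [n] from the rules for [isd]; [smP] recovers the iterated derivatives on open
    sets. *)
Fixpoint Cn E (n : nat) (A : set R) (c : R -> E) : Prop :=
  match n with
  | 0%N => True
  | S k => exists2 c' : R -> E, forall t, A t -> isd c t (c' t) & Cn k A c'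
  end.

Definition sm E (A : set R) (c : R -> E) : Prop := forall n, Cn n A c.

Lemma CnS E n A (c : R -> E) : Cn n.+1 A c -> Cn n A c.
Proof. by elim: n c => [//|n IH] c [c' Hc Hn]; exists c' => //; exact: IH. Qed.

Lemma Cn_sub E n A B (c : R -> E) : B `<=` A -> Cn n A c -> Cn n B c.
Proof.
move=> BA; elim: n c => [//|n IH] c [c' Hc Hn]; exists c'; last exact: IH.
by move=> t /BA; exact: Hc.
Qed.

Lemma sm_sub E A B (c : R -> E) : B `<=` A -> sm A c -> sm B c.
Proof. by move=> BA H n; exact: Cn_sub (H n). Qed.

Lemma Cn_ext E n A (c d : R -> E) : open A -> (forall t, A t -> c t = d t) ->
  Cn n A c -> Cn n A d.
Proof.
move=> oA cd; case: n => [//|n] [c' Hc Hn]; exists c' => // t At.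
have [e e0 He] := open_real oA At.
by apply: isd_near e0 _ (Hc t At) => s /He; exact: cd.
Qed.

Lemma sm_ext E A (c d : R -> E) : open A -> (forall t, A t -> c t = d t) ->
  sm A c -> sm A d.
Proof. by move=> oA cd H n; exact: Cn_ext (H n). Qed.

Lemma Cn_cst E n A (x : E) : Cn n A (fun=> x).
Proof.
elim: n x => [//|n IH] x; exists (fun=> 0); last exact: IH.
by move=> t _; exact: isd_cst.
Qed.

Lemma CnD E n A (c d : R -> E) : Cn n A c -> Cn n A d -> Cn n A (fun t => c t + d t).
Proof.
elim: n c d => [//|n IH] c d [c' Hc Hn] [d' Hd Hm].
exists (fun t => c' t + d' t); last exact: IH.
by move=> t At; apply: isdD; [exact: Hc | exact: Hd].
Qed.

Lemma Cn_linear E F n A (L : E -> F) (c : R -> E) :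
  (forall a x y, L (a *: x + y) = a *: L x + L y) ->
  (forall q : F -> R, csemi q -> exists2 p, csemi p & forall x, q (L x) <= p x) ->
  Cn n A c -> Cn n A (fun t => L (c t)).
Proof.
move=> h1 h2; elim: n c => [//|n IH] c [c' Hc Hn].
exists (fun t => L (c' t)); last exact: IH.
by move=> t At; apply: (isd_linear h1 h2); exact: Hc.
Qed.

Lemma Cn_fst E F n A (c : R -> E * F) : Cn n A c -> Cn n A (fun t => (c t).1).
Proof.
apply: (@Cn_linear (E * F)%type E) => // q hq.
by exists (fun z => q z.1) => //; exact: csemi_fst.
Qed.

Lemma Cn_snd E F n A (c : R -> E * F) : Cn n A c -> Cn n A (fun t => (c t).2).
Proof.
apply: (@Cn_linear (E * F)%type F) => // q hq.
by exists (fun z => q z.2) => //; exact: csemi_snd.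
Qed.

Lemma Cn_pair E F n A (c : R -> E) (d : R -> F) :
  Cn n A c -> Cn n A d -> Cn n A (fun t => (c t, d t)).
Proof.
elim: n c d => [//|n IH] c d [c' Hc Hn] [d' Hd Hm].
exists (fun t => (c' t, d' t)); last exact: IH.
by move=> t At; apply: isd_pair; [exact: Hc | exact: Hd].
Qed.

Lemma Cn_scal E n A (f : R -> R^o) (c : R -> E) : Cn n A f -> Cn n A c ->
  Cn n A (fun t => (f t : R) *: c t).
Proof.
elim: n f c => [//|n IH] f c hf hc; move: (hf) (hc) => [f' Hf Hn] [c' Hc Hm].
exists (fun t => (f' t : R) *: c t + (f t : R) *: c' t).
  by move=> t At; apply: isd_scal; [exact: Hf | exact: Hc].
by apply: CnD; apply: IH => //; exact: CnS.
Qed.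

Lemma CnZ E n A (a : R) (c : R -> E) : Cn n A c -> Cn n A (fun t => a *: c t).
Proof. exact: Cn_scal (Cn_cst n A (a : R^o)). Qed.

Lemma CnN E n A (c : R -> E) : Cn n A c -> Cn n A (fun t => - c t).
Proof. by move=> /(CnZ (-1)); under eq_fun do rewrite scaleN1r. Qed.

Lemma CnB E n A (c d : R -> E) : Cn n A c -> Cn n A d -> Cn n A (fun t => c t - d t).
Proof. by move=> hc /CnN; exact: CnD. Qed.

Lemma CnM n A (f g : R -> R^o) : Cn n A f -> Cn n A g ->
  Cn n A (fun t => (f t : R) * (g t : R) : R^o).
Proof. exact: Cn_scal. Qed.

Lemma Cn_id n A : Cn n A (fun t => t : R^o).
Proof.
case: n => [//|n]; exists (fun=> 1); last exact: Cn_cst.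
by move=> t _; exact: isd_id.
Qed.

Lemma Cn_comp E n A B (f : R -> R^o) (c : R -> E) : (forall t, A t -> B (f t)) ->
  Cn n A f -> Cn n B c -> Cn n A (fun t => c (f t)).
Proof.
move=> AB; elim: n f c AB => [//|n IH] f c AB hf hc.
move: (hf) (hc) => [f' Hf Hn] [c' Hc Hm].
exists (fun t => (f' t : R) *: c' (f t)).
  by move=> t At; apply: isd_comp; [exact: Hf | apply: Hc; exact: AB].
by apply: Cn_scal => //; apply: IH => //; exact: CnS.
Qed.

Lemma Cn_inv n A (f : R -> R^o) : (forall t, A t -> (f t : R) != 0) ->
  Cn n A f -> Cn n A (fun t => (f t : R)^-1 : R^o).
Proof.
move=> f0; elim: n => [//|n IH] hf; move: (hf) => [f' Hf Hn].
exists (fun t => (f' t : R) *: (- ((f t : R)^-1 * (f t : R)^-1) : R^o)).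
  move=> t At; apply: (@isd_comp R R^o f (fun s => s^-1 : R^o)); first exact: Hf.
  by apply: isd_inv; exact: f0.
apply: Cn_scal => //; apply: CnN; apply: CnM; apply: IH; exact: CnS.
Qed.

Lemma Cn_derivP E {hE : hs E} n A (c : R -> E) : open A ->
  Cn n.+1 A c <-> (forall t, A t -> cderivable c t) /\ Cn n A (cderiv c).
Proof.
move=> oA; split=> [[c' Hc Hn]|[Hc Hn]].
  split; first by move=> t /Hc; exact: isd_cderivable.
  by apply: (Cn_ext oA) Hn => t /Hc /isd_cderiv ->.
by exists (cderiv c) => // t /Hc; exact: cderivable_isd.
Qed.

Lemma sm_derivP E {hE : hs E} A (c : R -> E) : open A ->
  sm A c <-> (forall t, A t -> cderivable c t) /\ sm A (cderiv c).
Proof.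
move=> oA; split=> [H|[h1 h2] [//|n]]; last by apply/Cn_derivP.
split; first by have /Cn_derivP [] := H 1%N.
by move=> n; have /Cn_derivP [] := H n.+1.
Qed.

Lemma sm_isd E {hE : hs E} A (c : R -> E) : open A -> sm A c ->
  forall t, A t -> isd c t (cderiv c t).
Proof. by move=> oA /sm_derivP[//|h _ t At]; apply: cderivable_isd; exact: h. Qed.

Lemma sm_cderiv E {hE : hs E} A (c : R -> E) : open A -> sm A c -> sm A (cderiv c).
Proof. by move=> oA /sm_derivP[]. Qed.

Lemma sm_cderivn E {hE : hs E} A (c : R -> E) n : open A -> sm A c -> sm A (cderivn n c).
Proof. by move=> oA H; elim: n => [//|n IH]; apply: sm_cderiv. Qed.

Lemma smP E {hE : hs E} A (c : R -> E) : open A ->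
  sm A c <-> (forall n t, A t -> cderivable (cderivn n c) t).
Proof.
move=> oA; split=> [H n t At|H n].
  by have [h _] := iffLR (sm_derivP _ oA) (sm_cderivn n oA H); exact: h.
elim: n c H => [//|n IH] c H; apply/Cn_derivP => //; split; first exact: (H 0%N).
by apply: IH => m t At; have := H m.+1 t At; rewrite /cderivn iterSr.
Qed.

Lemma smooth_curveP E {hE : hs E} (c : R -> E) : smooth_curve c <-> sm setT c.
Proof. by rewrite smP; [split=> H n t|exact: openT]; [move=> _; exact: H | exact: H]. Qed.

Lemma smooth_nearP E {hE : hs E} (c : R -> E) t :
  smooth_near c t <-> exists2 d, 0 < d & sm [set s | `|s - t| < d] c.
Proof.
split.
  move=> /nbhs_real[d d0 dH]; exists d => //; apply/smP; first exact: open_ballR.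
  by move=> n s; move=> /dH.
case=> d d0 /(iffLR (smP _ (@open_ballR R _ _))) H; apply/nbhs_real; exists d => // s sd n.
exact: H.
Qed.

Lemma sm_loc E {hE : hs E} A (c : R -> E) : open A ->
  (forall t, A t -> exists2 d, 0 < d & sm [set s | `|s - t| < d] c) -> sm A c.
Proof.
move=> oA H; apply/smP => // n t At; have [d d0 /(iffLR (smP _ (@open_ballR R _ _))) Hd] := H t At.
by apply: Hd; rewrite /= subrr normr0.
Qed.

Lemma sm_cst E A (x : E) : sm A (fun=> x). Proof. by move=> n; exact: Cn_cst. Qed.
Lemma sm_id A : sm A (fun t => t : R^o). Proof. by move=> n; exact: Cn_id. Qed.
Lemma smD E A (c d : R -> E) : sm A c -> sm A d -> sm A (fun t => c t + d t).
Proof. by move=> hc hd n; exact: CnD. Qed.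
Lemma smN E A (c : R -> E) : sm A c -> sm A (fun t => - c t).
Proof. by move=> hc n; exact: CnN. Qed.
Lemma smB E A (c d : R -> E) : sm A c -> sm A d -> sm A (fun t => c t - d t).
Proof. by move=> hc hd n; exact: CnB. Qed.
Lemma sm_scal E A (f : R -> R^o) (c : R -> E) : sm A f -> sm A c ->
  sm A (fun t => (f t : R) *: c t).
Proof. by move=> hc hd n; exact: Cn_scal. Qed.
Lemma smM A (f g : R -> R^o) : sm A f -> sm A g ->
  sm A (fun t => (f t : R) * (g t : R) : R^o).
Proof. exact: sm_scal. Qed.
Lemma sm_pair E F A (c : R -> E) (d : R -> F) :
  sm A c -> sm A d -> sm A (fun t => (c t, d t)).
Proof. by move=> hc hd n; exact: Cn_pair. Qed.
Lemma sm_fst E F A (c : R -> E * F) : sm A c -> sm A (fun t => (c t).1).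
Proof. by move=> hc n; exact: Cn_fst. Qed.
Lemma sm_snd E F A (c : R -> E * F) : sm A c -> sm A (fun t => (c t).2).
Proof. by move=> hc n; exact: Cn_snd. Qed.
Lemma sm_comp E A B (f : R -> R^o) (c : R -> E) : (forall t, A t -> B (f t)) ->
  sm A f -> sm B c -> sm A (fun t => c (f t)).
Proof. by move=> AB hf hc n; exact: Cn_comp (hc n). Qed.
Lemma sm_inv A (f : R -> R^o) : (forall t, A t -> (f t : R) != 0) ->
  sm A f -> sm A (fun t => (f t : R)^-1 : R^o).
Proof. by move=> f0 hf n; exact: Cn_inv. Qed.

Lemma cderivn_ext E (c d : R -> E) t e n : 0 < e ->
  (forall s, `|s - t| < e -> c s = d s) ->
  forall s, `|s - t| < e -> cderivn n c s = cderivn n d s.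
Proof.
move=> e0 cd; elim: n => [//|n IH] s se /=.
have [a a0 Ha] := open_real (@open_ballR R t e) se.
congr (xget _ _); apply/seteqP; split=> l /= /diffquotP H; apply/diffquotP.
  by apply: isd_near a0 _ H => r /Ha; exact: IH.
by apply: isd_near a0 _ H => r /Ha /IH ->.
Qed.

Lemma cderiv_ext E (c d : R -> E) t e : 0 < e ->
  (forall s, `|s - t| < e -> c s = d s) -> cderiv c t = cderiv d t.
Proof. by move=> e0 cd; apply: (cderivn_ext 1 e0 cd); rewrite subrr normr0. Qed.

Lemma cderivn_affine E {hE : hs E} (c : R -> E) (a b : R) A n t : open A -> sm A c ->
  A (a + t * b) ->
  cderivn n (fun s => c (a + s * b)) t = b ^+ n *: cderivn n c (a + t * b).
Proof.
move=> oA hc; elim: n t => [|n IH] t At; first by rewrite expr0 scale1r.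
have hf s : isd (fun s => a + s * b : R^o) s (b : R^o).
  apply: isd_eq (isdD (isd_cst (a : R^o) s) (isd_scal (isd_id s) (isd_cst (b : R^o) s))) _.
  by rewrite add0r scaler0 addr0 /= -[_ *: _]/(1 * b) mul1r.
have [d d0 Hd] := isd_cont (hf t) (csemi_norm R) ltac:(exact: ltr01).
have oA' : open [set s | A (a + s * b)].
  apply: real_open => s As; have [e e0 He] := open_real oA As.
  have [d' d'0 Hd'] := isd_cont (hf s) (csemi_norm R) e0.
  by exists d' => // u us; apply: He; exact: Hd'.
have [e e0 He] := open_real oA' At.
rewrite /= (@cderiv_ext _ _ (fun s => b ^+ n *: cderivn n c (a + s * b)) t e) //; last first.
  by move=> s /He /IH.
have hn : sm A (cderivn n c) by exact: sm_cderivn.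
have h1 : isd (cderivn n c) (a + t * b) (cderiv (cderivn n c) (a + t * b)).
  exact: (sm_isd oA hn).
have h2 := isdZ (b ^+ n) (isd_comp (hf t) h1).
by rewrite (isd_cderiv h2) scalerA exprSr.
Qed.

Lemma sm_cont E {hE : hs E} A (c : R -> E) t : open A -> sm A c -> A t ->
  forall p, csemi p -> forall e, 0 < e ->
  exists2 d, 0 < d & forall s, `|s - t| < d -> p (c s - c t) < e.
Proof. by move=> oA hc At; exact: isd_cont (sm_isd oA hc At). Qed.

End Cn.

(** * Smooth steps, bumps and cutoffs *)

Section Bumps.
Variables (R : realType).

(** The factor x^-k makes the family stable under differentiation ([isd_flat_exp]), so that
    smoothness is one induction over all k at once. *)
Definition flat_exp (k : nat) (x : R) : R^o :=
  if 0 < x then x ^- k * expR (- x^-1) else 0.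

Lemma isd_expR (x : R) : isd (fun s : R => expR s : R^o) x (expR x : R^o).
Proof.
move=> p hp e e0; have [_ pZ _] := hp.
have p1 := csemi_ge0 (1 : R^o) hp.
have K0 : 0 < 2 * expR x * p (1 : R^o) + 1.
  by rewrite ltr_wpDl // mulr_ge0 // mulr_ge0 // expR_ge0.
exists (Order.min (1 / 2) (e / (2 * expR x * p (1 : R^o) + 1))).
  by rewrite lt_min !divr_gt0.
move=> h; rewrite lt_min !ltr_pdivlMr // => /andP[h1 h2].
have -> : expR (x + h) - expR x - h *: (expR x : R^o) =
    (expR x * (expR h - 1 - h)) *: (1 : R^o).
  by rewrite expRD -[h *: _]/(h * _) -[_ *: (1 : R^o)]/(_ * 1); ring.
have b1 := expR_ge1Dx h; have b2 := expR_ge1Dx (- h).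
have hh : `|h| ^+ 2 = h ^+ 2 by rewrite real_normK // num_real.
have := ler_norm h; have := ler_norm (- h); rewrite normrN => n1 n2.
have b3 : expR h * (1 - h) <= 1.
  by rewrite -[leRHS](expRxMexpNx_1 h); apply: ler_wpM2l b2; exact: expR_ge0.
have b4 : expR h - 1 - h <= 2 * `|h| ^+ 2.
  rewrite hh; have : 0 < 1 - h by lra.
  move=> k0; rewrite -(ler_pM2r k0).
  have := sqr_ge0 h; rewrite expr2 => q; have : 0 <= h * h * (1 - 2 * h).
    by apply: mulr_ge0 => //; lra.
  move=> r; nra.
have b5 : 0 <= expR h - 1 - h by lra.
rewrite pZ normrM (ger0_norm (expR_ge0 _)) (ger0_norm b5).
have : expR x * (expR h - 1 - h) * p (1 : R^o) <= expR x * (2 * `|h| ^+ 2) * p (1 : R^o).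
  by apply: ler_wpM2r => //; apply: ler_wpM2l b4; exact: expR_ge0.
move=> b6; apply: le_trans b6 _.
have := normr_ge0 h; set a := `|h| in h2 *; move=> a0; rewrite expr2.
have : 0 <= a * (e - a * (2 * expR x * p (1 : R^o) + 1)).
  by apply: mulr_ge0 => //; rewrite subr_ge0; exact: ltW h2.
have := mulr_ge0 a0 a0; lra.
Qed.

(** From exp y >= (1 + y/n)^n >= (y/n)^n at y = 1/x with n = k + 1. With [flat_expS] every member of
    the family is O(x^2) at 0, hence has derivative 0 there. *)
Lemma flat_exp_bound k (x : R) : 0 < x -> flat_exp k x <= (k.+1%:R ^+ k.+1) * x.
Proof.
move=> x0; rewrite /flat_exp x0; set n := k.+1.
have n0 : 0 < n%:R :> R by rewrite ltr0n.
have y0 : 0 < x^-1 by rewrite invr_gt0.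
have b : (x^-1 / n%:R) ^+ n <= expR x^-1.
  have -> : expR x^-1 = expR (x^-1 / n%:R) ^+ n.
    by rewrite -expRM_natr mulfVK ?gt_eqF.
  apply: lerXn2r; first by rewrite nnegrE divr_ge0 // ltW.
    by rewrite nnegrE expR_ge0.
  by apply: le_trans (expR_ge1Dx _); rewrite ler_wpDl.
rewrite expRN ler_pdivrMr ?expR_gt0 //.
have b' : x^-1 ^+ n <= n%:R ^+ n * expR x^-1.
  by rewrite -ler_pdivrMl ?exprn_gt0 // mulrC -expr_div_n.
have -> : x ^- k = x^-1 ^+ n * x.
  by rewrite exprVn exprSr invfM -mulrA mulVf ?mulr1 // gt_eqF.
by rewrite [leRHS]mulrAC ler_wpM2r // ltW.
Qed.

Lemma flat_exp_ge0 k x : 0 <= flat_exp k x :> R.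
Proof.
rewrite /flat_exp; case: ifP => // x0.
by rewrite mulr_ge0 ?expR_ge0 // invr_ge0 exprn_ge0 // ltW.
Qed.

Lemma flat_expS k x : flat_exp k x = x * flat_exp k.+1 x :> R.
Proof.
rewrite /flat_exp; case: ifP => x0; last by rewrite mulr0.
by rewrite mulrA exprS invfM mulrA mulfV ?mul1r // gt_eqF.
Qed.

Lemma flat_exp_le0 k x : x <= 0 -> flat_exp k x = 0 :> R.
Proof. by move=> x0; rewrite /flat_exp ltNge x0. Qed.

Lemma isd_flat_exp k x :
  isd (flat_exp k) x (- k%:R * flat_exp k.+1 x + flat_exp k.+2 x : R^o).
Proof.
case: (ltgtP x 0) => x0.
- have -> : - k%:R * flat_exp k.+1 x + flat_exp k.+2 x = 0 :> R^o.
    by rewrite /flat_exp ltNge ltW //= mulr0 addr0.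
  apply: (@isd_near R R^o (fun=> 0) _ _ _ (- x)); [lra| |exact: isd_cst].
  move=> s; rewrite ltr_norml => /andP[_ h]; rewrite /flat_exp ifF //.
  by apply/negbTE; rewrite -leNgt; lra.
- have xn : x != 0 by rewrite gt_eqF.
  have h1 := isd_inv xn.
  have h2 : isd (fun s : R => s ^- k : R^o) x (- k%:R * x ^- k.+1 : R^o).
    elim: k => [|k IH].
      apply: (@isd_eq R R^o _ _ 0); last by rewrite oppr0 mul0r.
      apply: (@isd_near R R^o (fun=> 1) _ _ _ 1) => //; last exact: isd_cst.
      by move=> s _; rewrite expr0 invr1.
    apply: (@isd_near R R^o (fun s => s^-1 * s ^- k) _ _ _ 1) => //.
      by move=> s _; rewrite exprS invfM.
    apply: isd_eq (isd_scal h1 IH) _.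
    rewrite -![_ *: _]/(_ * _) !exprS -[k.+1]addn1 natrD !invfM; ring.
  have h3 : isd (fun s : R => expR (- s^-1) : R^o) x (x^-1 * x^-1 * expR (- x^-1) : R^o).
    apply: isd_eq (isd_comp (isdN h1) (isd_expR _)) _.
    by rewrite opprK.
  apply: (@isd_near R R^o (fun s => s ^- k * expR (- s^-1)) _ _ _ x) => //.
    move=> s; rewrite ltr_norml => /andP[h _]; rewrite /flat_exp ifT //; lra.
  apply: isd_eq (isd_scal h2 h3) _.
  by rewrite /flat_exp x0 -![_ *: _]/(_ * _) !exprS !invfM; ring.
rewrite x0; apply: (@isd_eq R R^o _ _ 0); last by rewrite /flat_exp ltxx mulr0 addr0.
move=> p hp e e0.
have [_ pZ _] := hp.
have p1 := csemi_ge0 (1 : R^o) hp.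
set C : R := k.+2%:R ^+ k.+2; have C0 : 0 <= C by rewrite exprn_ge0.
have bnd h : 0 < h -> flat_exp k.+1 h <= C * h by exact: flat_exp_bound.
clearbody C.
exists (e / (C * p (1 : R^o) + 1)); first by rewrite divr_gt0 // ltr_wpDl // mulr_ge0.
move=> h; rewrite ltr_pdivlMr ?ltr_wpDl ?mulr_ge0 // => hh.
rewrite add0r scaler0 subr0 [flat_exp k 0]flat_exp_le0 // subr0.
have [h0|h0] := ltP 0 h; last first.
  by rewrite /flat_exp ltNge h0 /= csemi0 // mulr_ge0 // ltW.
rewrite flat_expS -[h * _]/(h *: (flat_exp k.+1 h : R^o)) pZ mulrC ler_wpM2r //.
have -> : flat_exp k.+1 h = flat_exp k.+1 h *: (1 : R^o) by rewrite -[_ *: _]/(_ * 1) mulr1.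
rewrite pZ ger0_norm ?flat_exp_ge0 //.
apply: le_trans (ltW hh); rewrite gtr0_norm //.
apply: le_trans (ler_wpM2r p1 (bnd _ h0)) _; lra.
Qed.

Lemma sm_flat_exp k : sm setT (flat_exp k).
Proof.
move=> n; elim: n k => [//|n IH] k.
exists (fun x => - k%:R * flat_exp k.+1 x + flat_exp k.+2 x).
  by move=> t _; exact: isd_flat_exp.
by apply: CnD => //; exact: (CnM (Cn_cst n setT (- k%:R : R^o)) (IH _)).
Qed.

Lemma flat_exp_gt0 k x : 0 < x -> 0 < flat_exp k x :> R.
Proof. by move=> x0; rewrite /flat_exp x0 mulr_gt0 ?expR_gt0 // invr_gt0 exprn_gt0. Qed.

Lemma sm_quot (f g : R -> R^o) : sm setT f -> sm setT g ->
  (forall t, 0 <= f t :> R) -> (forall t, 0 <= g t :> R) ->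
  (forall t, 0 < f t + g t :> R) ->
  sm setT (fun t => f t / (f t + g t) : R^o).
Proof.
move=> hf hg f0 g0 fg; apply: smM => //; apply: (@sm_inv _ _ (fun t => f t + g t)).
  by move=> t _; rewrite gt_eqF.
exact: smD.
Qed.

Lemma smooth_step : exists rho : R -> R^o, [/\ sm setT rho,
  forall t, t <= 0 -> rho t = 0, forall t, 1 <= t -> rho t = 1
  & forall t, 0 <= (rho t : R) <= 1].
Proof.
pose f t : R^o := flat_exp 0 t; pose g t : R^o := flat_exp 0 (1 - t).
have fg t : 0 < f t + g t :> R.
  have f0 := flat_exp_ge0 0 t; have g0 := flat_exp_ge0 0 (1 - t).
  have [t0|t0] := ltP 0 t; first by rewrite ltr_pwDl // flat_exp_gt0.
  by rewrite ltr_wpDl // flat_exp_gt0 //; lra.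
exists (fun t => f t / (f t + g t)); split.
- apply: sm_quot => //; [exact: sm_flat_exp| |by move=> t; exact: flat_exp_ge0..].
  apply: (@sm_comp _ _ setT setT (fun t => 1 - t : R^o)) => //; last exact: sm_flat_exp.
  exact: smB (sm_cst _ (1 : R^o)) (@sm_id _ _).
- by move=> t t0; rewrite /f flat_exp_le0 // mul0r.
- move=> t t1; rewrite /g flat_exp_le0 ?addr0; last by lra.
  by rewrite divff // gt_eqF // flat_exp_gt0 //; lra.
move=> t; have ft : 0 <= f t :> R by exact: flat_exp_ge0.
have gt : 0 <= g t :> R by exact: flat_exp_ge0.
have fgt := fg t; apply/andP; split; first by apply: divr_ge0 => //; exact: ltW.
by rewrite ler_pdivrMr // mul1r lerDl.
Qed.

Lemma smooth_bump : exists chi : R -> R^o, [/\ sm setT chi,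
  forall s, `|s| < 1 / 4 -> chi s = 1, forall s, 1 / 2 < `|s| -> chi s = 0
  & forall s, `|chi s : R| <= 1].
Proof.
have [rho [h1 h2 h3 h4]] := smooth_step.
(* The argument of [rho] is at least 1 for |s| <= 1/4 and at most 0 for |s| >= 1/2. *)
exists (fun s => rho (4 / 3 - 16 / 3 * (s * s))); split.
- apply: (@sm_comp _ _ setT setT (fun s => 4 / 3 - 16 / 3 * (s * s) : R^o)) => //.
  apply: smB; first exact: sm_cst.
  by apply: smM; [exact: sm_cst | apply: smM; exact: sm_id].
- move=> s; rewrite ltr_norml => /andP[a b]; apply: h3; nra.
- move=> s sh; apply: h2.
  have : s * s = `|s| * `|s| by rewrite -normrM ger0_norm // -expr2 sqr_ge0.
  nra.
by move=> s; rewrite ger0_norm; case/andP: (h4 (4 / 3 - 16 / 3 * (s * s))).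
Qed.

(** Composition with [psi] turns a curve or plane map that behaves well only near a point into a
    global one with the same germ; all later globalizations rest on it. *)
Lemma smooth_cutoff (t e : R) : 0 < e -> exists psi : R -> R^o, [/\ sm setT psi,
  forall s, `|s - t| < e / 4 -> psi s = s & forall s, `|psi s - t| < e].
Proof.
move=> e0; have [chi [h1 h2 h3 h4]] := smooth_bump.
exists (fun s => t + (s - t) * chi ((s - t) / e)); split.
- apply: smD; first exact: sm_cst.
  have hs : sm setT (fun s => s - t : R^o) by apply: smB; [exact: sm_id|exact: sm_cst].
  apply: smM => //; apply: (@sm_comp _ _ setT setT (fun s => (s - t) / e : R^o)) => //.
  by apply: smM => //; exact: sm_cst.
- move=> s st; rewrite h2 ?mulr1 ?subrKC //.
  by rewrite normrM normfV (gtr0_norm e0) ltr_pdivrMr // mul1r mulrC -[e * _]/(e * _) mulrC; lra.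
move=> s; rewrite addrAC subrr add0r normrM.
have [se|se] := ltP `|s - t| e; last first.
  rewrite h3 ?normr0 ?mulr0 // normrM normfV (gtr0_norm e0) ltr_pdivlMr //; lra.
by apply: le_lt_trans se; rewrite -[leRHS]mulr1 ler_wpM2l.
Qed.

End Bumps.

(** * The special curve lemma: fast sequences lie on smooth curves *)

Section SpecialCurve.
Variables (R : realType).
Implicit Types (y : nat -> R) (th : R -> R^o).

Definition tn (n : nat) : R := 2^-1 ^+ n.

Lemma tn_gt0 n : 0 < tn n. Proof. by rewrite exprn_gt0 // invr_gt0. Qed.

Lemma tnS n : tn n.+1 = tn n / 2. Proof. by rewrite /tn exprSr. Qed.

Lemma tn_le m n : (m <= n)%N -> tn n <= tn m.
Proof.
move=> /subnK <-; elim: (n - m)%N => [//|k IH].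
rewrite addSn tnS; apply: le_trans IH; have := tn_gt0 (k + m); lra.
Qed.

Lemma tn_lt m n : (m < n)%N -> tn n <= tn m / 2.
Proof. by move=> mn; rewrite -tnS; exact: tn_le. Qed.

Lemma tn_small (e : R) : 0 < e -> exists n, tn n < e.
Proof.
move=> e0; have [n hn] : exists n : nat, e^-1 < n%:R.
  by exists (Num.Def.truncn e^-1).+1; exact: truncnS_gt.
exists n; rewrite /tn exprVn invf_plt ?posrE ?exprn_gt0 //.
apply: lt_trans hn _; rewrite -natrX ltr_nat; exact: ltn_expl.
Qed.

Definition near_tn (n : nat) : set R := [set t | `|t - tn n| < tn n / 4].

Lemma near_tn_inj n m t : near_tn n t -> near_tn m t -> n = m.
Proof.
wlog nm : n m / (n <= m)%N => [W|] hn hm.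
  by case: (leqP n m) => [/W->//|/ltnW /W W']; rewrite W'.
move: nm; rewrite leq_eqVlt => /orP[/eqP //|/tn_lt].
move: hn hm; rewrite /near_tn /= !ltr_norml => /andP[a b] /andP[c d] e.
have := tn_gt0 m; have := tn_gt0 n; exfalso; lra.
Qed.

(** The sum over n of y_n th((t - t_n) / (t_n / 4)), each term cut to its window [near_tn n]. The
    windows are disjoint, so the sum is the choice of at most one term. *)
Definition bumps th y (t : R) : R^o :=
  match pselect (exists n, near_tn n t) with
  | left ex => y (projT1 (cid ex)) * th ((t - tn (projT1 (cid ex))) / (tn (projT1 (cid ex)) / 4))
  | right _ => 0
  end.

Lemma bumpsE th y n t : near_tn n t -> bumps th y t = y n * th ((t - tn n) / (tn n / 4)).
Proof.
move=> hn; rewrite /bumps; case: pselect => [ex|[]]; last by exists n.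
by case: (cid ex) => m hm /=; rewrite (near_tn_inj hm hn).
Qed.

Lemma bumps0 th y t : (forall n, ~ near_tn n t) -> bumps th y t = 0.
Proof. by move=> h; rewrite /bumps; case: pselect => // ex; have [n hn] := ex; case: (h n hn). Qed.

Definition fast y : Prop := forall j, exists C, forall n, `|y n| <= C * tn n ^+ j.

Lemma fast_div y : fast y -> fast (fun n => y n / (tn n / 4)).
Proof.
move=> fy j; have [C HC] := fy j.+1; exists (4 * C) => n.
have t0 := tn_gt0 n.
rewrite normrM (gtr0_norm (x := _^-1)) ?invr_gt0 ?divr_gt0 // ler_pdivrMr ?divr_gt0 //.
by apply: le_trans (HC n) _; rewrite exprSr; lra.
Qed.

Lemma fast_mul y : fast y -> fast (fun n => y n * (tn n / 4)).
Proof.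
move=> fy j; have [C HC] := fy j; exists C => n; have t0 := tn_gt0 n.
have t1 : tn n <= 1 by have := tn_le (leq0n n); rewrite /tn expr0.
rewrite normrM (gtr0_norm (x := tn n / 4)) ?divr_gt0 //.
by apply: le_trans (HC n); rewrite ler_piMr //; lra.
Qed.

Lemma fast_self y : (forall n, `|y n| <= tn n ^+ n) -> fast y.
Proof.
move=> H j; exists (1 + (tn j ^+ j)^-1) => n; apply: le_trans (H n) _.
have a0 m k : 0 < tn m ^+ k by rewrite exprn_gt0 // tn_gt0.
have t1 m : tn m <= 1 by have := tn_le (leq0n m); rewrite /tn expr0.
case: (leqP j n) => jn.
  apply: (@le_trans _ _ (tn n ^+ j)).
    by apply: ler_wiXn2l; rewrite ?t1 // ltW // tn_gt0.
  by rewrite ler_peMl ?(ltW (a0 _ _)) // lerDl invr_ge0 ltW.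
apply: (@le_trans _ _ 1); first by rewrite exprn_ile1 ?t1 // ltW // tn_gt0.
rewrite mulrDl; apply: ler_wpDl; first by rewrite mul1r ltW.
rewrite mulrC ler_pdivlMr // mul1r; apply: lerXn2r; rewrite ?nnegrE ?(ltW (tn_gt0 _)) //.
exact: tn_le (ltnW jn).
Qed.

Lemma sm_bounded th (a b : R) : sm setT th -> a <= b ->
  exists C, forall t, a <= t -> t <= b -> `|th t : R| <= C.
Proof.
move=> hth ab.
apply: (@real_induction R (fun u => exists C, forall t, a <= t -> t <= u -> `|th t : R| <= C) a b) => //.
  by exists `|th a : R| => t at' ta; rewrite (le_anti (introT andP (conj at' ta))).
move=> t at' tb.
have [d d0 Hd] := sm_cont (openT) hth (I : setT t) (csemi_norm R) ltr01.
exists d => // s u as' st tu ub ds ud [C HC].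
exists (Order.max C (1 + `|th t : R|)) => v av vu; rewrite le_max.
have [vs|sv] := leP v s; first by rewrite HC.
apply/orP; right; have : `|v - t| < d by rewrite ltr_norml; apply/andP; split; lra.
move=> /Hd /= /ltW h; rewrite -(subrK (th t) (th v)).
by apply: le_trans (ler_normD _ _) _; rewrite lerD2r.
Qed.

Definition short th : Prop := forall s, 1 / 2 < `|s| -> th s = 0.

Lemma bumps_far th y (t : R) : short th -> t != 0 -> (forall n, ~ near_tn n t) ->
  exists2 d, 0 < d & forall s, `|s - t| < d -> bumps th y s = 0.
Proof.
(* Off the windows |t - t_n| >= t_n / 4; a point within |t| / 20 of t is then still farther than t_n
   / 8 from t_n, where a [short] profile vanishes. *)
move=> hth t0 ht; exists (`|t| / 20); first by rewrite divr_gt0 // normr_gt0.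
move=> s st; have [[n hn]|h] := pselect (exists n, near_tn n s); last first.
  by apply: bumps0 => n hn; apply: h; exists n.
rewrite (bumpsE _ _ hn) hth ?mulr0 //; have n0 := tn_gt0 n.
have r0 : 0 < tn n / 4 by rewrite divr_gt0.
rewrite normrM normfV (gtr0_norm r0) ltr_pdivlMr //.
have {ht} := ht n; rewrite /near_tn /= => /negP; rewrite -leNgt => h1.
move: hn; rewrite /near_tn /= => hn.
have := ler_distD s t (tn n); rewrite (distrC t s).
have := ler_normD (t - tn n) (tn n); rewrite subrK (gtr0_norm n0).
have := ler_distD s t (tn n); rewrite (distrC t s); lra.
Qed.

Lemma isd_bumps th y t : short th -> sm setT th -> t != 0 ->
  isd (bumps th y) t (bumps (cderiv th) (fun n => y n / (tn n / 4)) t).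
Proof.
move=> sh hth t0; have [[n hn]|h] := pselect (exists n, near_tn n t).
  have [d d0 Hd] : exists2 d, 0 < d & forall s, `|s - t| < d -> near_tn n s.
    by apply: open_real hn; exact: open_ballR.
  have r0 : tn n / 4 != 0 by rewrite gt_eqF // divr_gt0 // tn_gt0.
  apply: (@isd_near R R^o (fun s => y n * th ((s - tn n) / (tn n / 4))) _ _ _ d) => //.
    by move=> s /Hd hs; rewrite (bumpsE _ _ hs).
  rewrite (bumpsE _ _ hn).
  have h1 : isd (fun s => (s - tn n) / (tn n / 4) : R^o) t ((tn n / 4)^-1 : R^o).
    apply: isd_eq (isd_scal (isdB (isd_id t) (isd_cst (tn n : R^o) t)) (isd_cst ((tn n / 4)^-1 : R^o) t)) _.
    by rewrite subr0 scaler0 addr0 -[_ *: _]/(_ * _) mul1r.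
  have h2 : isd th ((t - tn n) / (tn n / 4)) (cderiv th ((t - tn n) / (tn n / 4))).
    by apply: (sm_isd (openT) hth).
  apply: isd_eq (isdZ (y n) (isd_comp h1 h2)) _.
  by rewrite -![_ *: _]/(_ * _) mulrA.
have h' n : ~ near_tn n t by move=> hn; apply: h; exists n.
have [d d0 Hd] := bumps_far y sh t0 h'; rewrite (bumps0 _ _ h').
by apply: (@isd_near R R^o (fun=> 0) _ _ _ d) => //; [move=> s /Hd-> | exact: isd_cst].
Qed.

(** In the n-th window |h| >= (3/4) t_n, so the decay of y_n with exponent 2 makes the sum
    O(h^2). *)
Lemma isd_bumps0 th y : short th -> sm setT th -> fast y -> isd (bumps th y) 0 0.
Proof.
move=> sh hth fy p hp e e0; have [_ pZ _] := hp; have p1 := csemi_ge0 (1 : R^o) hp.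
have [C HC] := @sm_bounded th (-1) 1 hth ltac:(lra).
have C0 : 0 <= C by apply: le_trans (HC 0 _ _) => //; lra.
have [D HD] := fy 2%N.
have D0 : 0 <= D.
  by have := le_trans (normr_ge0 _) (HD 0%N); rewrite /tn expr0 expr1n mulr1.
pose K := 2 * (D * C) * p (1 : R^o) + 1.
have DC : 0 <= D * C by exact: mulr_ge0.
have K0 : 0 < K by rewrite /K ltr_wpDl // mulr_ge0 // mulr_ge0.
have b00 : bumps th y 0 = 0.
  apply: bumps0 => n; rewrite /near_tn /= sub0r normrN gtr0_norm ?tn_gt0 //.
  by have := tn_gt0 n; lra.
exists (e / K); first by rewrite divr_gt0.
move=> h; rewrite ltr_pdivlMr // => hh.
rewrite add0r scaler0 subr0 b00 subr0.
have -> : bumps th y h = bumps th y h *: (1 : R^o) by rewrite -[_ *: _]/(_ * 1) mulr1.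
rewrite pZ; suff b : `|bumps th y h| <= 2 * (D * C) * `|h| ^+ 2.
  apply: (@le_trans _ _ (2 * (D * C) * `|h| ^+ 2 * p (1 : R^o))); first exact: ler_wpM2r.
  have -> : 2 * (D * C) * `|h| ^+ 2 * p (1 : R^o) = `|h| * (`|h| * (K - 1)).
    by rewrite /K addrK; ring.
  rewrite [leRHS]mulrC ler_wpM2l //; have := normr_ge0 h; lra.
have [[n hn]|hf] := pselect (exists n, near_tn n h); last first.
  rewrite bumps0 ?normr0; first by rewrite mulr_ge0 ?mulr_ge0 // exprn_ge0.
  by move=> n hn; apply: hf; exists n.
rewrite (bumpsE _ _ hn) normrM; have t0 := tn_gt0 n.
move: hn; rewrite /near_tn /= ltr_norml => /andP[l1 l2].
have h34 : 3 / 4 * tn n <= `|h| by have := ler_norm h; lra.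
have b1 := HD n.
have r0 : 0 < tn n / 4 by rewrite divr_gt0.
have b2 : `|th ((h - tn n) / (tn n / 4)) : R| <= C.
  apply: HC; first by rewrite ler_pdivlMr //; lra.
  by rewrite ler_pdivrMr //; lra.
apply: (@le_trans _ _ (D * tn n ^+ 2 * C)); first exact: ler_pM.
have -> : D * tn n ^+ 2 * C = D * C * tn n ^+ 2 by ring.
have -> : 2 * (D * C) * `|h| ^+ 2 = D * C * (2 * `|h| ^+ 2) by ring.
apply: ler_wpM2l => //.
have := mulr_ge0 (ltW t0) (ltW t0).
have : (3 / 4 * tn n) * (3 / 4 * tn n) <= `|h| * `|h| by apply: ler_pM => //; lra.
rewrite !expr2; lra.
Qed.

Lemma short_cderiv th : short th -> short (cderiv th).
Proof.
move=> sh s hs; have d0 : 0 < `|s| - 1 / 2 by rewrite subr_gt0.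
rewrite (@cderiv_ext R R^o _ (fun=> 0) s _ d0); last first.
  move=> u us; apply: sh; have := ler_distD u s 0; rewrite !subr0 (distrC s); lra.
exact: (isd_cderiv (isd_cst (0 : R^o) s)).
Qed.

(** The derivative is of the same form, with profile [cderiv th] and the still fast coefficients y_n
    / (t_n / 4), so induction on the order applies. *)
Lemma sm_bumps th y : short th -> sm setT th -> fast y -> sm setT (bumps th y).
Proof.
move=> sh hth fy n; elim: n th y sh hth fy => [//|n IH] th y sh hth fy.
exists (bumps (cderiv th) (fun n => y n / (tn n / 4))); last first.
  by apply: IH; [exact: short_cderiv | exact: (sm_cderiv openT) | exact: fast_div].
move=> t _; have [->|t0] := eqVneq t 0; last exact: isd_bumps.
apply: isd_eq (isd_bumps0 sh hth fy) _; apply/esym; apply: bumps0 => m.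
by rewrite /near_tn /= sub0r normrN gtr0_norm ?tn_gt0 //; have := tn_gt0 m; lra.
Qed.

(** The profile chi carries the values and s chi(s) the velocities, the latter rescaled by the
    window radius t_n / 4; for |s| < t_n / 16 the rescaled argument lies where chi = 1. *)
Lemma special_curve (x v : nat -> R) :
  (forall n, `|x n| <= tn n ^+ n) -> (forall n, `|v n| <= tn n ^+ n) ->
  exists a : R -> R^o, [/\ sm setT a, a 0 = 0
    & forall n s, `|s| < tn n / 16 -> a (tn n + s) = x n + s * v n].
Proof.
move=> /fast_self fx /fast_self fv.
have [chi [h1 h2 h3 _]] := smooth_bump R.
pose th s : R^o := s * chi s.
have hth : sm setT th by apply: smM => //; exact: sm_id.
have sth : short th by move=> s /h3 h; rewrite /th h mulr0.
exists (fun t => bumps chi x t + bumps th (fun n => v n * (tn n / 4)) t); split.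
- by apply: smD; apply: sm_bumps => //; exact: fast_mul.
- have h n : ~ near_tn n 0.
    by rewrite /near_tn /= sub0r normrN gtr0_norm ?tn_gt0 //; have := tn_gt0 n; lra.
  by rewrite !bumps0 // addr0.
move=> n s sn; have t0 := tn_gt0 n.
have hn : near_tn n (tn n + s) by rewrite /near_tn /= addrAC subrr add0r; lra.
rewrite !(bumpsE _ _ hn) addrAC subrr add0r /th h2; last first.
  by rewrite normrM normfV (gtr0_norm (x := tn n / 4)) ?divr_gt0 // ltr_pdivrMr ?divr_gt0 //; lra.
by rewrite mulr1 mulr1; field; rewrite gt_eqF.
Qed.

End SpecialCurve.

(** * Finite differences and polarization *)

Section FiniteDifferences.
Variables (R : realType).
Implicit Types F : tvsType R.

Lemma smT_cderivn F {hF : hs F} (c : R -> F) n : sm setT c -> sm setT (cderivn n c).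
Proof. by move=> h; apply: sm_cderivn => //; exact: openT. Qed.

Lemma smT_isd F {hF : hs F} (c : R -> F) t n : sm setT c ->
  isd (cderivn n c) t (cderiv (cderivn n c) t).
Proof. by move=> /(@smT_cderivn _ _ _ n) h; apply: (@sm_isd _ _ hF setT _ openT h). Qed.

Definition dif F (g : R -> F) (s : R) : F := g (s + 1) - g s.

(** A polynomial in the unit shift operator; the operator [dif] is then X - 1. *)
Definition act F (q : {poly R}) (g : R -> F) (s : R) : F :=
  \sum_(k < size q) q`_k *: g (s + k%:R).

Lemma act_wide F (q : {poly R}) (g : R -> F) s n : (size q <= n)%N ->
  act q g s = \sum_(k < n) q`_k *: g (s + k%:R).
Proof.
move=> qn; rewrite /act (big_ord_widen n (fun k => q`_k *: g (s + k%:R))) // big_mkcond.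
apply: eq_bigr => i _; case: ltnP => // h; by rewrite nth_default // scale0r.
Qed.

Lemma iter_difE F (g : R -> F) n s : iter n (@dif F) g s = act (('X - 1) ^+ n) g s.
Proof.
elim: n s => [|n IH] s; first by rewrite expr0 /act size_poly1 big_ord1 coef1 scale1r addr0.
rewrite iterS /dif !IH exprS; set q := ('X - 1) ^+ n.
have sz : (size (('X - 1) * q)%R <= (size q).+1)%N.
  by apply: leq_trans (size_polyMleq _ _) _; rewrite -[1]/(1%:P) size_XsubC.
rewrite (act_wide _ _ sz) (act_wide g s (leqnSn (size q))).
under [RHS]eq_bigr => k _ do rewrite mulrBl mul1r coefB coefXM scalerBl.
rewrite sumrB; congr (_ - _); rewrite big_ord_recl /= scale0r add0r.
apply: eq_bigr => k _; by rewrite -natr1 [k%:R + 1]addrC addrA.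
Qed.

(** Induction on n: by the mean value inequality the hypothesis for g at order n + 1 passes to the
    first difference of g at order n. *)
Lemma diffN_bound F {hF : hs F} (p : F -> R) (g : R -> F) (l : F) (e : R) n s :
  csemi p -> sm setT g ->
  (forall r, s <= r -> r <= s + n%:R -> p (cderivn n g r - l) <= e) ->
  p (iter n (@dif F) g s - l) <= e.
Proof.
move=> hp; elim: n g l => [|n IH] g l hg H; first by apply: H => //; rewrite addr0.
rewrite iterSr; have sh : sm setT (fun u => g (1 + u * 1)).
  apply: (@sm_comp _ _ setT setT (fun u => 1 + u * 1 : R^o)) => //.
  by apply: smD; [exact: sm_cst | apply: smM; [exact: sm_id | exact: sm_cst]].
have dE : dif g = (fun u => g (1 + u * 1) - g u).
  by apply/funext => u; rewrite /dif mulr1 [1 + u]addrC.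
have hd : sm setT (dif g) by rewrite dE; apply: smB.
apply: IH => // r sr rn.
have -> : cderivn n (dif g) r = cderivn n g (r + 1) - cderivn n g r.
  have : forall k u, cderivn k (dif g) u = cderivn k g (u + 1) - cderivn k g u.
    elim=> [//|k IHk] u; rewrite /= (@cderiv_ext _ _ _ (fun u => cderivn k g (1 + u * 1) - cderivn k g u) u 1) //.
      have h1 : isd (cderivn k g) u (cderiv (cderivn k g) u).
        exact: smT_isd.
      have h2 : isd (cderivn k g) (1 + u * 1) (cderiv (cderivn k g) (1 + u * 1)).
        exact: smT_isd.
      have h3 : isd (fun v => 1 + v * 1 : R^o) u (1 : R^o).
        apply: isd_eq (isdD (isd_cst (1 : R^o) u) (isd_scal (isd_id u) (isd_cst (1 : R^o) u))) _.
        by rewrite add0r scaler0 addr0 -[_ *: _]/(1 * 1) mul1r.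
      rewrite (isd_cderiv (isdB (isd_comp h3 h2) h1)) scale1r mulr1.
      by rewrite [1 + u]addrC.
    by move=> v _; rewrite IHk mulr1 [1 + v]addrC.
  exact.
have := @mvt _ F p (fun u => cderivn n g u - u *: l) (fun u => cderivn n.+1 g u - l) r (r + 1) e hp.
rewrite lerDl => /(_ ler01).
have -> : cderivn n g (r + 1) - (r + 1) *: l - (cderivn n g r - r *: l) =
   cderivn n g (r + 1) - cderivn n g r - l by lmod F.
have -> : r + 1 - r = 1 by rewrite addrAC subrr add0r.
rewrite mulr1; apply.
  move=> t _ _; apply: isdB; first exact: smT_isd.
  apply: isd_eq (isd_scal (isd_id t) (isd_cst l t)) _.
  by rewrite scaler0 addr0 scale1r.
move=> t rt tr; apply: H; first exact: le_trans rt.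
by rewrite -natr1 addrA; apply: le_trans tr _; rewrite lerD2r.
Qed.

(* Polarization: a product of first differences along v_1, ..., v_N is a      *)
(* combination of N-th differences, each along one direction                  *)
(* - sum_(i in S) v_i / i.  [polS] lists the sign, the base point and the     *)
(* direction for each subset S.                                               *)
Fixpoint polA F (l : seq ((R * R) * R)) (k : R) (G : R * R -> F) (x : R * R) : F :=
  match l with
  | [::] => G x
  | vi :: l => polA l k G x - polA l k G (x + (1 - k / vi.2) *: vi.1)
  end.

Fixpoint polS (l : seq ((R * R) * R)) : seq (R * (R * R) * (R * R)) :=
  match l with
  | [::] => [:: (1, 0, 0)]
  | vi :: l => polS l ++
      [seq (- z.1.1, z.1.2 + vi.1, z.2 + vi.2^-1 *: vi.1) | z <- polS l]
  end.

Lemma polAE F l k (G : R * R -> F) x :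
  polA l k G x = \sum_(z <- polS l) z.1.1 *: G (x + z.1.2 - k *: z.2).
Proof.
elim: l x => [|vi l IH] x /=.
  by rewrite big_seq1 /= scale1r scaler0 subr0 addr0.
rewrite big_cat big_map /= !IH; congr (_ + _); rewrite -sumrN.
apply: eq_bigr => z _ /=; rewrite scaleNr; congr (- (_ *: G _)).
by lm_main R (R * R)%type.
Qed.

Lemma polA0 F l k (G : R * R -> F) x : k != 0 -> k \in map snd l -> polA l k G x = 0.
Proof.
move=> k0; elim: l x => [//|vi l IH] x; rewrite inE => /orP[/eqP kv|h] /=.
  by rewrite -kv divff // subrr scale0r addr0 subrr.
by rewrite !IH // subrr.
Qed.

(** Expand the N-th difference by (X - 1)^N. The k-th coefficient multiplies [polA l k], which is 0
    for 1 <= k <= N, since the direction labelled k enters with factor 1 - k/k; only k = 0 with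
    coefficient (-1)^N survives. *)
Lemma polarization F l N (G : R * R -> F) :
  (forall k, (0 < k <= N)%N -> k%:R \in map snd l) ->
  \sum_(z <- polS l) z.1.1 *: iter N (@dif F) (fun r => G (z.1.2 - r *: z.2)) 0
  = (-1) ^+ N *: polA l 0 G 0.
Proof.
move=> hl; under eq_bigr => z _ do rewrite iter_difE.
set q : {poly R} := ('X - 1) ^+ N.
have sz : size q = N.+1.
  by rewrite /q -[1]/(1%:P) size_exp_XsubC.
under eq_bigr => z _ do rewrite /act sz scaler_sumr.
rewrite exchange_big /=.
have H k : \sum_(z <- polS l) z.1.1 *: (q`_k *: G (z.1.2 - (0 + k%:R) *: z.2)) =
    q`_k *: polA l k%:R G 0.
  rewrite polAE scaler_sumr; apply: eq_bigr => z _.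
  by rewrite scalerA mulrC -scalerA !add0r.
under eq_bigr => k _ do rewrite H.
rewrite big_ord_recl big1 ?addr0 => [|k _]; last first.
  by rewrite polA0 ?scaler0 ?pnatr_eq0 //; apply: hl; rewrite /= ltn_ord.
by rewrite -horner_coef0 /q horner_exp !hornerE.
Qed.

End FiniteDifferences.

(** * Boman's theorem: continuity of directional derivatives *)

Section Boman.
Variables (R : realType).

(** Points satisfying [P n] are chosen within t_n^n of (x, y), and the special curve lemma is
    applied to both coordinates. It refutes the negations of local statements in [plane_open] and
    [dirn_bounded]. *)
Lemma fast_curve (P : nat -> R -> R -> Prop) (x y : R) (v w : nat -> R) :
  (forall n, `|v n| <= tn R n ^+ n) -> (forall n, `|w n| <= tn R n ^+ n) ->
  (forall n d, 0 < d -> exists x' y', [/\ `|x' - x| < d, `|y' - y| < d & P n x' y']) ->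
  exists a b : R -> R^o, [/\ sm setT a, sm setT b, a 0 = x, b 0 = y &
    forall n, exists x' y', P n x' y' /\ forall s, `|s| < tn R n / 16 ->
      a (tn R n + s) = x' + s * v n /\ b (tn R n + s) = y' + s * w n].
Proof.
move=> hv hw H.
have t0 n : 0 < tn R n ^+ n by rewrite exprn_gt0 // tn_gt0.
have /choice [z Hz] : forall n, exists z : R * R,
    [/\ `|z.1 - x| < tn R n ^+ n, `|z.2 - y| < tn R n ^+ n & P n z.1 z.2].
  by move=> n; have [x' [y' h]] := H n _ (t0 n); exists (x', y').
have [a [ha a0 Ha]] := @special_curve R (fun n => (z n).1 - x) v
   ltac:(by move=> n; case: (Hz n) => /ltW) hv.
have [b [hb b0 Hb]] := @special_curve R (fun n => (z n).2 - y) w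
   ltac:(by move=> n; case: (Hz n) => _ /ltW) hw.
exists (fun t => x + a t), (fun t => y + b t); split.
- by apply: smD => //; exact: sm_cst.
- by apply: smD => //; exact: sm_cst.
- by rewrite a0 addr0.
- by rewrite b0 addr0.
move=> n; exists (z n).1, (z n).2; split; first by case: (Hz n).
by move=> s hs; rewrite Ha // Hb //; split; ring.
Qed.

Lemma tn_near0 (d : R) : 0 < d -> exists N, forall n, (N <= n)%N -> `|tn R n| < d.
Proof.
move=> d0; have [N HN] := tn_small d0; exists N => n Nn.
by rewrite gtr0_norm ?tn_gt0 //; apply: le_lt_trans HN; exact: tn_le.
Qed.

(** Otherwise points outside [W] would converge fast to (x, y) and lie on a smooth curve that is in
    [W] at time 0, against openness of its preimage. *)
Lemma plane_open (W : R -> R -> Prop) :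
  (forall a b : R -> R^o, sm setT a -> sm setT b -> open [set t | W (a t) (b t)]) ->
  forall x y, W x y -> exists2 d, 0 < d &
    forall x' y', `|x' - x| < d -> `|y' - y| < d -> W x' y'.
Proof.
move=> H x y Wxy; apply: contrapT => C.
have z0 n : `|0 : R| <= tn R n ^+ n by rewrite normr0 exprn_ge0 // ltW // tn_gt0.
have [|a [b [ha hb a0 b0 Hab]]] :=
   @fast_curve (fun _ x' y' => ~ W x' y') x y (fun=> 0) (fun=> 0) z0 z0.
  move=> n d d0; apply: contrapT => C2; apply: C; exists d => // x' y' h1 h2.
  by apply: contrapT => C3; apply: C2; exists x', y'.
have W0 : W (a 0) (b 0) by rewrite a0 b0.
have [d d0 Hd] := open_real (H a b ha hb) W0.
have [N HN] := tn_near0 d0.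
have [x' [y' [nW]]] := Hab N.
move=> /(_ 0); rewrite normr0 divr_gt0 ?tn_gt0 // => /(_ isT).
rewrite !mul0r !addr0 => -[ax by'].
by apply: nW; rewrite -ax -by'; apply: Hd; rewrite subr0; exact: HN.
Qed.

Variables (F : tvsType R).
Context {hF : hs F}.
Implicit Types (f : R -> R -> F).

Definition scw f : Prop := forall a b : R -> R^o, sm setT a -> sm setT b ->
  sm setT (fun t => f (a t) (b t)).

Definition dirn N u w f x y : F := cderivn N (fun s => f (x + s * u) (y + s * w)) 0.

Lemma sm_affine (x u : R) : sm setT (fun s => x + s * u : R^o).
Proof. by apply: smD; [exact: sm_cst | apply: smM; [exact: sm_id | exact: sm_cst]]. Qed.

Lemma scw_line f x y u w : scw f -> sm setT (fun s => f (x + s * u) (y + s * w)).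
Proof. by move=> hf; apply: hf; exact: sm_affine. Qed.

Lemma dirn_line f N u w x y r : scw f ->
  cderivn N (fun s => f (x + s * u) (y + s * w)) r = dirn N u w f (x + r * u) (y + r * w).
Proof.
move=> hf; rewrite /dirn.
have := cderivn_affine (a := r) (b := 1) N (t := 0) openT (scw_line x y u w hf) I.
rewrite expr1n scale1r mul0r addr0 => <-; congr cderivn; apply/funext => s.
by congr (f _ _); rewrite mulr1; ring.
Qed.

Lemma isd_dirn f N u w x y r : scw f ->
  isd (fun s => dirn N u w f (x + s * u) (y + s * w)) r
      (dirn N.+1 u w f (x + r * u) (y + r * w)).
Proof.
move=> hf; have := @smT_isd _ _ hF (fun s => f (x + s * u) (y + s * w)) r N (scw_line _ _ _ _ hf).
rewrite -[cderiv _ _]/(cderivn N.+1 _ _) dirn_line //.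
by move=> H; apply: (@isd_near _ _ _ _ _ _ 1 _ _ H) => // s _; rewrite dirn_line.
Qed.

(** Otherwise a smooth curve crosses at t_n, with velocity r_n (u, w), a point where the derivative
    exceeds n / r_n^N. The N-th derivative of f along the curve at t_n then exceeds n, although it
    is continuous at 0. *)
Lemma dirn_bounded f N u w x y (p : F -> R) : scw f -> csemi p ->
  exists C, exists2 d, 0 < d & forall x' y', `|x' - x| < d -> `|y' - y| < d ->
    p (dirn N u w f x' y') <= C.
Proof.
move=> hf hp; apply: contrapT => C.
pose K := 1 + `|u| + `|w|.
have K0 : 0 < K by rewrite /K -addrA ltr_pwDl // addr_ge0.
(* [K] bounds |u| and |w|, so the velocities r_n u and r_n w are at most t_n^n, as [fast_curve]
   requires. *)
pose r n := tn R n ^+ n / K.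
have t0 n : 0 < tn R n ^+ n by rewrite exprn_gt0 // tn_gt0.
have r0 n : 0 < r n by rewrite divr_gt0.
have hb u' : `|u'| <= K -> forall n, `|r n * u'| <= tn R n ^+ n.
  move=> uK n; rewrite normrM (gtr0_norm (r0 n)) /r mulrAC ler_pdivrMr //.
  by rewrite ler_wpM2l // ltW.
have [|||a [b [ha hb' a0 b0 Hab]]] :=
   @fast_curve (fun n x' y' => n%:R / r n ^+ N < p (dirn N u w f x' y')) x y
     (fun n => r n * u) (fun n => r n * w).
- by apply: hb; rewrite /K; have := normr_ge0 w; lra.
- by apply: hb; rewrite /K; have := normr_ge0 u; lra.
- move=> n d d0; apply: contrapT => C2; apply: C; exists (n%:R / r n ^+ N), d => //.
  move=> x' y' h1 h2; rewrite leNgt; apply/negP => C3.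
  by apply: C2; exists x', y'.
pose g t := f (a t) (b t).
have hg : sm setT g by exact: hf.
have [d d0 Hd] := isd_cont (smT_isd 0 N hg) hp ltr01.
have [N1 HN1] := tn_near0 d0.
pose M := p (cderivn N g 0) + 1.
have [N2 HN2] : exists n : nat, M < n%:R.
  by exists (Num.Def.truncn M).+1; exact: truncnS_gt.
pose n := maxn N1 N2.
have [x' [y' [big]]] := Hab n => Hn.
have tn16 : 0 < tn R n / 16 by rewrite divr_gt0 // tn_gt0.
have gE : cderivn N g (tn R n) = r n ^+ N *: dirn N u w f x' y'.
  have := cderivn_affine (a := tn R n) (b := 1) N (t := 0) openT hg I.
  rewrite expr1n scale1r mul0r addr0 => <-.
  have := cderivn_affine (a := 0) (b := r n) N (t := 0) openT (scw_line x' y' u w hf) I.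
  rewrite mul0r addr0 => <-.
  apply: (@cderivn_ext R F _ _ 0 _ N tn16); last by rewrite subrr normr0.
  move=> s; rewrite subr0 => /Hn[h1 h2]; rewrite /g mulr1 h1 h2.
  by congr (f _ _); ring.
have := Hd (tn R n); rewrite subr0 => /(_ (HN1 n (leq_maxl _ _))).
have [pD pZ _] := hp => h.
have : p (cderivn N g (tn R n)) <= M.
  rewrite -(subrK (cderivn N g 0) (cderivn N g _)); apply: le_trans (pD _ _) _.
  by rewrite /M addrC lerD2l ltW.
rewrite gE pZ ger0_norm ?exprn_ge0 ?(ltW (r0 n)) // leNgt => /negP; apply.
apply: lt_le_trans HN2 _; apply: (@le_trans _ _ n%:R).
  by rewrite ler_nat leq_maxr.
by rewrite mulrC -ler_pdivrMr ?exprn_gt0 // ltW.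
Qed.

Lemma mvt_abs (p : F -> R) (c l : R -> F) a b M : csemi p ->
  (forall t, `|t - a| <= `|b - a| -> isd c t (l t)) ->
  (forall t, `|t - a| <= `|b - a| -> p (l t) <= M) ->
  p (c b - c a) <= M * `|b - a|.
Proof.
move=> hp Hc Hl; case: (leP a b) => ab.
  rewrite ger0_norm ?subr_ge0 //; apply: (mvt hp ab (l := l)) => t at' tb.
    by apply: Hc; rewrite !ger0_norm ?subr_ge0 // lerD2r.
  by apply: Hl; rewrite !ger0_norm ?subr_ge0 // lerD2r.
rewrite csemi_dist // distrC gtr0_norm ?subr_gt0 //.
apply: (mvt hp (ltW ab) (l := l)) => t bt ta.
  by apply: Hc; rewrite distrC (distrC b) !ger0_norm ?subr_ge0 // ?lerB // ltW.
by apply: Hl; rewrite distrC (distrC b) !ger0_norm ?subr_ge0 // ?lerB // ltW.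
Qed.

Definition cont2 f : Prop := forall (p : F -> R) x y e, csemi p -> 0 < e ->
  exists2 d, 0 < d & forall x' y', `|x' - x| < d -> `|y' - y| < d ->
    p (f x' y' - f x y) < e.

Lemma scw_cont f : scw f -> cont2 f.
Proof.
move=> hf p x y e hp e0.
have [C1 [d1 d10 H1]] := dirn_bounded 1 1 0 x y hf hp.
have [C2 [d2 d20 H2]] := dirn_bounded 1 0 1 x y hf hp.
pose K := `|C1| + `|C2| + 1.
have K0 : 0 < K by rewrite /K ltr_wpDl // addr_ge0.
exists (Order.min d1 (Order.min d2 (e / (2 * K)))).
  by rewrite !lt_min d10 d20 divr_gt0 // mulr_gt0.
move=> x' y'; rewrite !lt_min => /and3P[a1 a2 a3] /and3P[b1 b2 b3].
have i1 : p (f x' y' - f x y') <= K * `|x' - x|.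
  apply: (@mvt_abs p (fun s => f s y') (fun s => dirn 1 1 0 f s y')) => //.
    move=> t _; have := @isd_dirn f 0 1 0 0 y' t hf.
    rewrite !mulr1 !add0r !mulr0 !addr0 => H; apply: (@isd_near _ _ _ _ _ _ 1 _ _ H) => // s _.
    by rewrite /dirn /= !mul0r !mulr0 !addr0 mulr1 add0r.
  move=> t tx; apply: (@le_trans _ _ C1).
    by apply: H1 => //; exact: le_lt_trans tx a1.
  by rewrite /K; have := ler_norm C1; have := normr_ge0 C2; lra.
have i2 : p (f x y' - f x y) <= K * `|y' - y|.
  apply: (@mvt_abs p (fun s => f x s) (fun s => dirn 1 0 1 f x s)) => //.
    move=> t _; have := @isd_dirn f 0 0 1 x 0 t hf.
    rewrite !mulr1 !add0r !mulr0 !addr0 => H; apply: (@isd_near _ _ _ _ _ _ 1 _ _ H) => // s _.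
    by rewrite /dirn /= !mul0r !mulr0 !addr0 mulr1 add0r.
  move=> t tx; apply: (@le_trans _ _ C2).
    by apply: H2; rewrite ?subrr ?normr0 //; exact: le_lt_trans tx b2.
  by rewrite /K; have := ler_norm C2; have := normr_ge0 C1; lra.
apply: le_lt_trans (csemi_tri (f x y') _ _ hp) _.
have j1 : K * `|x' - x| < e / 2.
  have -> : e / 2 = K * (e / (2 * K)) by field; rewrite gt_eqF.
  by rewrite ltr_pM2l.
have j2 : K * `|y' - y| < e / 2.
  have -> : e / 2 = K * (e / (2 * K)) by field; rewrite gt_eqF.
  by rewrite ltr_pM2l.
lra.
Qed.

(** For fixed small h the difference quotient of [dirn N] along (u, w) is continuous by induction
    and approximates [dirn N.+1] up to C h, where C is a local bound of [dirn N.+2]. *)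
Lemma dirn_cont f N u w : scw f -> cont2 (dirn N u w f).
Proof.
move=> hf; elim: N => [|N IH].
  have -> : dirn 0 u w f = f; last exact: scw_cont.
  by apply/funext => x; apply/funext => y; rewrite /dirn /= !mul0r !addr0.
move=> p x y e hp e0; have [pD pZ _] := hp.
have [C [d d0 HC]] := dirn_bounded N.+2 u w x y hf hp.
have C0 : 0 <= C.
  by apply: le_trans (HC x y _ _); rewrite ?csemi_ge0 // subrr normr0.
pose K := 1 + `|u| + `|w|.
have K0 : 0 < K by rewrite /K -addrA ltr_pwDl // addr_ge0.
pose h := Order.min (d / (2 * K)) (e / (8 * (C + 1))).
have h0 : 0 < h by rewrite lt_min !divr_gt0 // ?mulr_gt0 // ltr_wpDl.
have hd : h * K <= d / 2.
  have : h <= d / (2 * K) by rewrite ge_min lexx.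
  by rewrite -(ler_pM2r K0) => /le_trans; apply; rewrite le_eqVlt; apply/orP; left;
     apply/eqP; field; rewrite gt_eqF.
have he : C * h <= e / 8.
  have : h <= e / (8 * (C + 1)) by rewrite ge_min lexx orbT.
  have C1 : 0 < C + 1 by rewrite ltr_wpDl.
  rewrite -(ler_pM2r C1) => hh.
  have : e / (8 * (C + 1)) * (C + 1) = e / 8 by field; rewrite gt_eqF.
  have := h0; lra.
have taylor x' y' : `|x' - x| < d / 2 -> `|y' - y| < d / 2 ->
   p (dirn N u w f (x' + h * u) (y' + h * w) - dirn N u w f x' y' - h *: dirn N.+1 u w f x' y')
     <= C * h * h.
  move=> hx hy.
  have B t : `|t - 0| <= `|h - 0| -> p (dirn N.+2 u w f (x' + t * u) (y' + t * w)) <= C.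
    rewrite !subr0 (gtr0_norm h0) => th.
    have tK q : `|q| <= K -> `|t * q| <= d / 2.
      by move=> qK; rewrite normrM; apply: le_trans hd; exact: ler_pM.
    have uK : `|u| <= K by rewrite /K; have := normr_ge0 w; lra.
    have wK : `|w| <= K by rewrite /K; have := normr_ge0 u; lra.
    apply: HC; rewrite addrAC; apply: le_lt_trans (ler_normD _ _) _.
      by have := tK u uK; lra.
    by have := tK w wK; lra.
  have B1 t : `|t - 0| <= `|h - 0| ->
      p (dirn N.+1 u w f (x' + t * u) (y' + t * w) - dirn N.+1 u w f x' y') <= C * h.
    move=> th; have := @mvt_abs p (fun s => dirn N.+1 u w f (x' + s * u) (y' + s * w))
       (fun s => dirn N.+2 u w f (x' + s * u) (y' + s * w)) 0 t C hp.
    rewrite !mul0r !addr0 => H; apply: le_trans (H _ _) _.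
    - by move=> s _; exact: isd_dirn.
    - by move=> s st; apply: B; exact: le_trans st th.
    rewrite ler_wpM2l //; apply: le_trans th _; by rewrite subr0 gtr0_norm.
  have := @mvt_abs p (fun s => dirn N u w f (x' + s * u) (y' + s * w) - s *: dirn N.+1 u w f x' y')
       (fun s => dirn N.+1 u w f (x' + s * u) (y' + s * w) - dirn N.+1 u w f x' y') 0 h (C * h) hp.
  rewrite subr0 (gtr0_norm h0) !mul0r !addr0 scale0r subr0.
  rewrite addrAC; apply; last by move=> s st; apply: B1; rewrite !subr0 (gtr0_norm h0) -[s]subr0.
  move=> t _; apply: isdB; first exact: isd_dirn.
  apply: isd_eq (isd_scal (isd_id t) (isd_cst _ t)) _.
  by rewrite scaler0 addr0 scale1r.
have eh : 0 < e * h / 4 by rewrite divr_gt0 // mulr_gt0.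
have [d1 d10 H1] := IH p x y _ hp eh.
have [d2 d20 H2] := IH p (x + h * u) (y + h * w) _ hp eh.
exists (Order.min (d / 2) (Order.min d1 d2)); first by rewrite !lt_min d10 d20 divr_gt0.
move=> x' y'; rewrite !lt_min => /and3P[a1 a2 a3] /and3P[b1 b2 b3].
have e1 := H1 x' y' a2 b2.
have e2 := H2 (x' + h * u) (y' + h * w).
have aux a b c : a + c - (b + c) = a - b :> R by ring.
rewrite !aux in e2; have {}e2 := e2 a3 b3.
have t1 := taylor x' y' a1 b1.
have t2 := taylor x y; rewrite !subrr !normr0 in t2.
have {}t2 := t2 ltac:(by rewrite divr_gt0) ltac:(by rewrite divr_gt0).
rewrite -(ltr_pM2l h0) -{1}(gtr0_norm h0) -pZ.
set A := dirn N u w f (x' + h * u) (y' + h * w) in e2 t1.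
set A0 := dirn N u w f (x + h * u) (y + h * w) in e2 t2.
set B := dirn N u w f x' y' in e1 t1; set B0 := dirn N u w f x y in e1 t2.
set D := dirn N.+1 u w f x' y' in t1 *; set D0 := dirn N.+1 u w f x y in t2 *.
have -> : h *: (D - D0) = (A - A0) - (B - B0) - ((A - B - h *: D) - (A0 - B0 - h *: D0)).
  by lmod F.
apply: le_lt_trans (csemi_sub _ _ hp) _.
apply: le_lt_trans (lerD (csemi_sub _ _ hp) (csemi_sub _ _ hp)) _.
have : C * h * h <= e / 8 * h by rewrite ler_wpM2r // ltW.
have := mulr_gt0 e0 h0; lra.
Qed.

End Boman.

(** * Mixed partial derivatives as combinations of directional ones *)

Section MixedDerivatives.
Variables (R : realType) (F : tvsType R).
Context {hF : hs F}.
Implicit Types (f : R -> R -> F).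

Lemma difE (g : R -> F) s : dif g s = g (s + 1) - g s. Proof. by []. Qed.

Lemma iter_difD (g k : R -> F) n s :
  iter n (@dif R F) (fun u => g u + k u) s = iter n (@dif R F) g s + iter n (@dif R F) k s.
Proof.
elim: n s => [//|n IH] s; rewrite !iterS !difE !IH; lmod F.
Qed.

Lemma iter_difN (g : R -> F) n s :
  iter n (@dif R F) (fun u => - g u) s = - iter n (@dif R F) g s.
Proof.
elim: n s => [//|n IH] s; rewrite !iterS !difE !IH; lmod F.
Qed.

Lemma iter_dif_shift (g : R -> F) n s r :
  iter n (@dif R F) (fun u => g (u + r)) s = iter n (@dif R F) g (s + r).
Proof.
by elim: n s => [//|n IH] s; rewrite !iterS !difE !IH addrAC.
Qed.

(** One horizontal and m vertical unit vectors carrying the labels 1, ..., m + 1 that polarization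
    of an (m + 1)-st difference needs. *)
Definition mixed_dirs (m : nat) : seq ((R * R) * R) :=
  ((1, 0), 1%:R) :: [seq ((0, 1), i.+2%:R) | i <- iota 0 m].

Lemma polA_tail (s : seq nat) (G : R * R -> F) x :
  polA [seq ((0, 1), i.+2%:R) | i <- s] 0 G x =
  (-1) ^+ size s *: iter (size s) (@dif R F) (fun u => G (x.1, x.2 + u)) 0.
Proof.
elim: s x => [|i s IH] x /=.
  by rewrite addr0 scale1r; case: x.
rewrite !IH /= mul0r subr0 !scale1r addr0.
have -> : (fun u => G (x.1, x.2 + 1 + u)) =
    (fun u => (fun v => G (x.1, x.2 + v)) (u + 1)).
  by apply/funext => u /=; rewrite [u + 1]addrC addrA.
rewrite (iter_dif_shift (fun v => G (x.1, x.2 + v))) difE exprS !add0r.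
set A := iter _ _ _ 1; lmod F.
Qed.

Lemma polarization_mixed m (G : R * R -> F) :
  \sum_(z <- polS (mixed_dirs m)) z.1.1 *:
     iter m.+1 (@dif R F) (fun r => G (z.1.2 - r *: z.2)) 0
  = iter m (@dif R F) (fun s => G (1, s) - G (0, s)) 0.
Proof.
rewrite polarization => [|k /andP[k0 km]]; last first.
  case: k k0 km => [//|[|k]] _ km; first by rewrite inE eqxx.
  rewrite inE; apply/orP; right; apply/mapP; exists ((0, 1), k.+2%:R) => //.
  by apply/mapP; exists k => //; rewrite mem_iota.
rewrite iter_difD iter_difN [polA _ _ _ _]/= !polA_tail size_iota /= mul0r subr0 scale1r !add0r.
set A := iter _ _ _ _; set B := iter _ _ _ _.
have -> : A = iter m (@dif R F) (fun s => G (0, s)) 0.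
  by congr (iter _ _ _ _); apply/funext => u; congr (G (_, _)); exact: add0r.
have -> : B = iter m (@dif R F) (fun s => G (1, s)) 0.
  by congr (iter _ _ _ _); apply/funext => u; by rewrite scaler0 add0r.
have e2 : (-1) ^+ m * (-1) ^+ m = 1 :> R by rewrite -expr2 sqrr_sign.
by rewrite exprS -scalerBr scalerA -mulrA e2 mulr1 scaleN1r opprB.
Qed.

Lemma dirnZ f N u w x y h : scw f ->
  dirn N (h * u) (h * w) f x y = h ^+ N *: dirn N u w f x y.
Proof.
move=> hf; have := cderivn_affine (a := 0) (b := h) N (t := 0) openT (scw_line x y u w hf) I.
rewrite mul0r addr0 => <-; congr cderivn; apply/funext => s.
by congr (f _ _); ring.
Qed.

(** By [diffN_bound] the error is the oscillation of the N-th directional derivative over the nodes,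
    small by [dirn_cont] and uniformly so for base points near (x, y). *)
Lemma dif_dirn f N (U W : R * R) x y (p : F -> R) e : scw f -> csemi p -> 0 < e ->
  exists2 d, 0 < d & forall x' y' h, `|x' - x| < d -> `|y' - y| < d -> 0 < h -> h < d ->
    p (iter N (@dif R F) (fun r => f (x' + h * (U - r *: W).1) (y' + h * (U - r *: W).2)) 0
       - h ^+ N *: dirn N (- W.1) (- W.2) f x y) <= e * h ^+ N.
Proof.
move=> hf hp e0; have [d d0 Hd] := dirn_cont N (- W.1) (- W.2) hf x y hp e0.
pose K := 1 + `|U.1| + `|U.2| + N%:R * (`|W.1| + `|W.2|).
have K0 : 0 < K by rewrite /K -!addrA ltr_pwDl // !addr_ge0 // mulr_ge0 // addr_ge0.
exists (Order.min (d / 2) (d / (2 * K))); first by rewrite lt_min !divr_gt0 // mulr_gt0.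
move=> x' y' h; rewrite !lt_min => /andP[hx _] /andP[hy _] h0 /andP[_ hd].
have hK : h * K < d / 2.
  have -> : d / 2 = d / (2 * K) * K by field; rewrite gt_eqF.
  by rewrite ltr_pM2r.
apply: diffN_bound => //.
  have hl := scw_line (x' + h * U.1) (y' + h * U.2) (h * - W.1) (h * - W.2) hf.
  apply: sm_ext openT _ hl => r _.
  by rewrite -[(U - r *: W).1]/(U.1 - r * W.1) -[(U - r *: W).2]/(U.2 - r * W.2); congr (f _ _); ring.
move=> r; rewrite add0r => r0 rN.
have -> : (fun r0 => f (x' + h * (U - r0 *: W).1) (y' + h * (U - r0 *: W).2)) =
  (fun r0 => f (x' + h * U.1 + r0 * (h * - W.1)) (y' + h * U.2 + r0 * (h * - W.2))).
  apply/funext => s; rewrite -[(U - s *: W).1]/(U.1 - s * W.1) -[(U - s *: W).2]/(U.2 - s * W.2).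
  by congr (f _ _); ring.
rewrite dirn_line // dirnZ // -scalerBr.
have hN0 : 0 < h ^+ N by rewrite exprn_gt0.
have [_ -> _] := hp; rewrite (gtr0_norm hN0) mulrC ler_pM2r //.
apply: ltW; apply: Hd.
  have -> : x' + h * U.1 + r * (h * - W.1) - x = (x' - x) + h * (U.1 - r * W.1) by ring.
  apply: le_lt_trans (ler_normD _ _) _; rewrite normrM (gtr0_norm h0).
  suff : h * `|U.1 - r * W.1| <= h * K by lra.
  rewrite ler_pM2l //; apply: le_trans (ler_normB _ _) _; rewrite normrM ger0_norm //.
  have : r * `|W.1| <= N%:R * `|W.1| by exact: ler_wpM2r.
  have := normr_ge0 U.2; have : 0 <= N%:R * `|W.2| by rewrite mulr_ge0.
  rewrite /K; lra.
have -> : y' + h * U.2 + r * (h * - W.2) - y = (y' - y) + h * (U.2 - r * W.2) by ring.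
apply: le_lt_trans (ler_normD _ _) _; rewrite normrM (gtr0_norm h0).
suff : h * `|U.2 - r * W.2| <= h * K by lra.
rewrite ler_pM2l //; apply: le_trans (ler_normB _ _) _; rewrite normrM ger0_norm //.
have : r * `|W.2| <= N%:R * `|W.2| by exact: ler_wpM2r.
have := normr_ge0 U.1; have : 0 <= N%:R * `|W.1| by rewrite mulr_ge0.
rewrite /K; lra.
Qed.

Lemma dif_dirn_sum f N (l : seq (R * (R * R) * (R * R))) x y (p : F -> R) e :
  scw f -> csemi p -> 0 < e ->
  exists2 d, 0 < d & forall x' y' h, `|x' - x| < d -> `|y' - y| < d -> 0 < h -> h < d ->
    p (\sum_(z <- l) z.1.1 *: iter N (@dif R F) (fun r => f (x' + h * (z.1.2 - r *: z.2).1)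
          (y' + h * (z.1.2 - r *: z.2).2)) 0
       - h ^+ N *: \sum_(z <- l) z.1.1 *: dirn N (- z.2.1) (- z.2.2) f x y) <= e * h ^+ N.
Proof.
move=> hf hp; have [pD pZ _] := hp; elim: l e => [|z l IH] e e0.
  exists 1 => // x' y' h _ _ h0 _; rewrite !big_nil scaler0 subr0 csemi0 //.
  by rewrite mulr_ge0 ?exprn_ge0 // ltW.
have e2 : 0 < e / 2 by rewrite divr_gt0.
have k0 : 0 < `|z.1.1| + 1 by rewrite ltr_wpDl.
have [d d0 Hd] := IH _ e2.
have e3 : 0 < e / 2 / (`|z.1.1| + 1) by rewrite divr_gt0.
have [d' d'0 Hd'] := dif_dirn N z.1.2 z.2 x y hf hp e3.
exists (Order.min d d'); first by rewrite lt_min d0.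
move=> x' y' h; rewrite !lt_min => /andP[x1 x2] /andP[y1 y2] h0 /andP[h1 h2].
have b1 := Hd _ _ _ x1 y1 h0 h1; have b2 := Hd' _ _ _ x2 y2 h0 h2.
rewrite !big_cons; set S := \sum_(z <- l) _ in b1 *; set S' := \sum_(z <- l) _ in b1 *.
set A := iter _ _ _ _ in b2 *; set B := dirn _ _ _ _ _ _ in b2 *.
have -> : z.1.1 *: A + S - h ^+ N *: (z.1.1 *: B + S') =
   z.1.1 *: (A - h ^+ N *: B) + (S - h ^+ N *: S') by lmod F.
apply: le_trans (pD _ _) _; rewrite pZ.
have hN : 0 <= h ^+ N by rewrite exprn_ge0 // ltW.
have : `|z.1.1| * p (A - h ^+ N *: B) <= (`|z.1.1| + 1) * (e / 2 / (`|z.1.1| + 1) * h ^+ N).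
  by apply: ler_pM => //; [exact: csemi_ge0 | rewrite lerDl].
have -> : (`|z.1.1| + 1) * (e / 2 / (`|z.1.1| + 1) * h ^+ N) = e / 2 * h ^+ N.
  by field; rewrite gt_eqF.
lra.
Qed.

(** The mixed derivative d_x d_y^m f, written by polarization through pure directional derivatives,
    which are known to exist; [mixd0] and [isd_mixd] justify this reading. *)
Definition mixd m f x y : F :=
  \sum_(z <- polS (mixed_dirs m)) z.1.1 *: dirn m.+1 (- z.2.1) (- z.2.2) f x y.

Lemma mixed_square f m x y (p : F -> R) e : scw f -> csemi p -> 0 < e ->
  exists2 d, 0 < d & forall x' y' h, `|x' - x| < d -> `|y' - y| < d -> 0 < h -> h < d ->
    p (iter m (@dif R F) (fun s => f (x' + h) (y' + h * s) - f x' (y' + h * s)) 0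
       - h ^+ m.+1 *: mixd m f x y) <= e * h ^+ m.+1.
Proof.
move=> hf hp e0; have [d d0 Hd] := dif_dirn_sum m.+1 (polS (mixed_dirs m)) x y hf hp e0.
exists d => // x' y' h hx hy h0 hd; have := Hd x' y' h hx hy h0 hd.
have := polarization_mixed m (fun q => f (x' + h * q.1) (y' + h * q.2)).
rewrite /mixd /= => ->; rewrite mulr1 mulr0 addr0; exact.
Qed.

(** [mixed_square] uses the same step h in x and y. The increment a in x is cut into steps of size h
    and the estimates are summed; for small h the m-th difference in y is close to h^m times the
    m-th derivative. *)
Lemma mixed_limit f m x y (p : F -> R) e : scw f -> csemi p -> 0 < e ->
  exists2 d, 0 < d & forall y' a, `|y' - y| < d -> 0 < a -> a < d ->
    p (cderivn m (fun t => f (x + a) t - f x t) y' - a *: mixd m f x y) <= e * a.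
Proof.
move=> hf hp e0; have [pD pZ _] := hp; have e2 : 0 < e / 2 by rewrite divr_gt0.
have [d d0 Hd] := mixed_square m x y hf hp e2.
exists d => // y' a hy a0 ad.
pose Fa t := f (x + a) t - f x t.
have hFa : sm setT Fa.
  apply: smB; apply: hf; try exact: sm_id; exact: sm_cst.
have ea : 0 < e / 2 * a by rewrite mulr_gt0.
have [d1 d10 Hd1] := isd_cont (smT_isd y' m hFa) hp ea.
have k0 : 0 < d1 / (m%:R + 1) by rewrite divr_gt0 // ltr_wpDl.
(* So many steps make h (m + 1) < d1, and all nodes y' + r h with r <= m stay where [cderivn m Fa]
   is within e a / 2 of its value at y'. *)
have [L HL] : exists L : nat, a / (d1 / (m%:R + 1)) < L.+1%:R.
  exists (Num.Def.truncn (a / (d1 / (m%:R + 1)))); exact: truncnS_gt.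
pose h := a / L.+1%:R.
have L0 : 0 < L.+1%:R :> R by rewrite ltr0n.
have h0 : 0 < h by rewrite divr_gt0.
have hm : h * (m%:R + 1) < d1.
  by rewrite -ltr_pdivlMr ?ltr_wpDl // /h ltr_pdivrMr // mulrC -ltr_pdivrMr.
have hLa : h * L.+1%:R = a by rewrite /h mulfVK // gt_eqF.
have row l : (l <= L.+1)%N ->
  p (iter m (@dif R F) (fun s => f (x + h * l%:R) (y' + h * s) - f x (y' + h * s)) 0
       - (l%:R * h ^+ m.+1) *: mixd m f x y) <= e / 2 * (l%:R * h ^+ m.+1).
  elim: l => [|l IH] lL.
    rewrite mulr0 addr0; have -> : (fun s => f x (y' + h * s) - f x (y' + h * s)) = (fun=> 0).
      by apply/funext => s; rewrite subrr.
    have -> : iter m (@dif R F) (fun=> 0) 0 = 0.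
      have := iter_difN (fun=> 0) m 0; rewrite oppr0 => /eqP; rewrite -addr_eq0 -mulr2n.
      by rewrite -scaler_nat scaler_eq0 pnatr_eq0 /= => /eqP.
    by rewrite mul0r scale0r subr0 csemi0 // mulr0.
  have lb : h * l%:R < d.
    apply: le_lt_trans ad; rewrite -hLa ler_pM2l // ler_nat; exact: ltnW.
  have hl0 : 0 <= h * l%:R by apply: mulr_ge0; [exact: ltW | exact: ler0n].
  have := Hd (x + h * l%:R) y' h; rewrite addrAC subrr add0r (ger0_norm hl0).
  have hdd : h < d.
    apply: le_lt_trans ad; rewrite -hLa ler_peMr ?(ltW h0) // ler1n //.
  move=> /(_ lb hy h0 hdd) b1; have b2 := IH (ltnW lL).
  have -> : (fun s => f (x + h * l.+1%:R) (y' + h * s) - f x (y' + h * s)) =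
    (fun s => (f (x + h * l%:R + h) (y' + h * s) - f (x + h * l%:R) (y' + h * s)) +
              (f (x + h * l%:R) (y' + h * s) - f x (y' + h * s))).
    apply/funext => s; rewrite addrA subrK; congr (f _ _ - _).
    by rewrite -natr1; ring.
  rewrite iter_difD -natr1.
  set A := iter _ _ _ _ in b1 *; set B := iter _ _ _ _ in b2 *.
  set M := mixd _ _ _ _ in b1 b2 *.
  have -> : A + B - ((l%:R + 1) * h ^+ m.+1) *: M =
    (A - h ^+ m.+1 *: M) + (B - (l%:R * h ^+ m.+1) *: M) by lmod F.
  apply: le_trans (pD _ _) _; lra.
have b1 := row L.+1 (leqnn _); rewrite hLa in b1.
have Lh : L.+1%:R * h ^+ m.+1 = a * h ^+ m by rewrite exprS mulrA mulrC [L.+1%:R * _]mulrC hLa mulrC.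
rewrite Lh in b1.
have hm0 : 0 < h ^+ m by rewrite exprn_gt0.
have b2 : p (iter m (@dif R F) (fun s => Fa (y' + s * h)) 0 - h ^+ m *: cderivn m Fa y')
    <= e / 2 * a * h ^+ m.
  apply: diffN_bound => //.
    exact: sm_comp (fun _ _ => I) (sm_affine y' h) hFa.
  move=> r; rewrite add0r => r0 rm.
  rewrite (cderivn_affine (a := y') (b := h) m (t := r) openT hFa I) -scalerBr pZ (gtr0_norm hm0) mulrC ler_pM2r //.
  have rh0 : 0 <= r * h by apply: mulr_ge0 => //; exact: ltW.
  apply: ltW; apply: Hd1; rewrite addrAC subrr add0r (ger0_norm rh0).
  apply: le_lt_trans hm; rewrite mulrC ler_pM2l //; lra.
have E1 : (fun s => Fa (y' + s * h)) = (fun s => f (x + a) (y' + h * s) - f x (y' + h * s)).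
  by apply/funext => s; rewrite mulrC.
rewrite E1 in b2; rewrite -(ler_pM2l hm0) -{1}(gtr0_norm hm0) -pZ.
set A := iter _ _ _ _ in b1 b2; rewrite -/Fa.
set M := mixd _ _ _ _ in b1 *; set D := cderivn _ _ _ in b2 *.
have -> : h ^+ m *: (D - a *: M) = (A - (a * h ^+ m) *: M) - (A - h ^+ m *: D) by lmod F.
apply: le_trans (csemi_sub _ _ hp) _; lra.
Qed.

End MixedDerivatives.

(** * Smooth partials, symmetry of second derivatives and the diagonal rule *)

Section BomanConsequences.
Variables (R : realType) (F : tvsType R).
Context {hF : hs F}.
Implicit Types (f : R -> R -> F).

Lemma csemi_small_eq0 (x : F) :
  (forall p : F -> R, csemi p -> forall e, 0 < e -> p x <= e) -> x = 0.
Proof.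
move=> H; apply: csemi_eq0 => p hp; apply/eqP; rewrite eq_le csemi_ge0 // andbT.
by apply/ler_addgt0Pr => e e0; rewrite add0r; exact: H.
Qed.

Lemma scw_fst f y : scw f -> sm setT (f ^~ y).
Proof. by move=> hf; apply: (hf (fun s => s) (fun=> y)); [exact: sm_id | exact: sm_cst]. Qed.

Lemma scw_snd f x : scw f -> sm setT (f x).
Proof. by move=> hf; apply: (hf (fun=> x) (fun s => s)); [exact: sm_cst | exact: sm_id]. Qed.

Lemma scw_swap f : scw f -> scw (fun x y => f y x).
Proof. by move=> hf a b ha hb; exact: hf. Qed.

Lemma mixd0 f x y : scw f -> cderiv (f ^~ y) x = mixd 0 f x y.
Proof.
move=> hf; apply/eqP; rewrite -subr_eq0; apply/eqP; apply: csemi_small_eq0 => p hp e e0.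
have e2 : 0 < e / 2 by rewrite divr_gt0.
have [d d0 Hd] := mixed_limit 0 x y hf hp e2.
have [d' d'0 Hd'] := smT_isd x 0 (scw_fst y hf) hp e2.
have m0 : 0 < Order.min d d' by rewrite lt_min d0.
pose a := Order.min d d' / 2.
have a0 : 0 < a by rewrite divr_gt0.
have : a < Order.min d d' by rewrite ltr_pdivrMr // mulr_natr mulr2n ltrDl.
rewrite lt_min => /andP[ad ad'].
have := Hd y a; rewrite subrr normr0 => /(_ d0 a0 ad) /= b1.
have := Hd' a; rewrite (gtr0_norm a0) => /(_ ad') /= b2.
have [pD pZ _] := hp.
rewrite -(ler_pM2l a0) -{1}(gtr0_norm a0) -pZ.
set D := cderiv _ _ in b2 *; set M := mixd _ _ _ _ in b1 *.
have -> : a *: (D - M) = (f (x + a) y - f x y - a *: M) - (f (x + a) y - f x y - a *: D).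
  by lmod F.
apply: le_trans (csemi_sub _ _ hp) _; lra.
Qed.

(** The m-th y-derivative of f(x + a, .) - f(x, .) has derivative a [mixd m.+1] up to e a by
    [mixed_limit]. The mean value inequality in y followed by division by a gives the expansion. *)
Lemma isd_mixd f m x y : scw f -> isd (mixd m f x) y (mixd m.+1 f x y).
Proof.
move=> hf p hp e e0; have [pD pZ _] := hp; have e3 : 0 < e / 3 by rewrite divr_gt0.
have [d d0 Hd] := mixed_limit m.+1 x y hf hp e3.
exists d => // h hd; have [->|h0] := eqVneq h 0.
  by rewrite addr0 scale0r !subrr csemi0 // normr0 mulr0.
have hn : 0 < `|h| by rewrite normr_gt0.
have e4 : 0 < e / 3 * `|h| by rewrite mulr_gt0.
have [d1 d10 H1] := mixed_limit m x y hf hp e4.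
have [d2 d20 H2] := mixed_limit m x (y + h) hf hp e4.
have m0 : 0 < Order.min d (Order.min d1 d2) by rewrite !lt_min d0 d10.
pose a := Order.min d (Order.min d1 d2) / 2.
have a0 : 0 < a by rewrite divr_gt0.
have : a < Order.min d (Order.min d1 d2) by rewrite ltr_pdivrMr // mulr_natr mulr2n ltrDl.
rewrite !lt_min => /and3P[ad ad1 ad2].
have := H1 y a; rewrite subrr normr0 => /(_ d10 a0 ad1) b1.
have := H2 (y + h) a; rewrite subrr normr0 => /(_ d20 a0 ad2) b2.
pose Fa t := f (x + a) t - f x t; rewrite -/Fa in b1 b2.
have hFa : sm setT Fa by apply: smB; exact: scw_snd.
set M := mixd m.+1 f x y in Hd *.
have := @mvt_abs R F p (fun t => cderivn m Fa t - t *: (a *: M))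
   (fun t => cderivn m.+1 Fa t - a *: M) y (y + h) (e / 3 * a) hp.
rewrite addrAC subrr add0r => B.
have b3 : p (cderivn m Fa (y + h) - (y + h) *: (a *: M) - (cderivn m Fa y - y *: (a *: M)))
   <= e / 3 * a * `|h|.
  apply: B => t ty; last by apply: Hd => //; exact: le_lt_trans ty hd.
  apply: isdB; first exact: smT_isd.
  by apply: isd_eq (isd_scal (isd_id t) (isd_cst _ t)) _; rewrite scaler0 addr0 scale1r.
rewrite -(ler_pM2l a0) -{1}(gtr0_norm a0) -pZ.
set X := mixd m f x (y + h) in b2 *; set Y := mixd m f x y in b1 *.
set P := cderivn m Fa (y + h) in b2 b3; set Q := cderivn m Fa y in b1 b3.
have -> : a *: (X - Y - h *: M) =
   (Q - a *: Y) - (P - a *: X) + (P - (y + h) *: (a *: M) - (Q - y *: (a *: M))) by lmod F.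
apply: le_trans (pD _ _) _; apply: le_trans (lerD (csemi_sub _ _ hp) (lexx _)) _; lra.
Qed.

Lemma scw_partial f x : scw f -> sm setT (fun t => cderiv (f ^~ t) x).
Proof.
move=> hf; have -> : (fun t => cderiv (f ^~ t) x) = mixd 0 f x.
  by apply/funext => t; exact: mixd0.
move=> n; have : forall m, Cn n setT (mixd m f x); last exact.
elim: n => [//|n IH] m; exists (mixd m.+1 f x) => // t _; exact: isd_mixd.
Qed.

Lemma scw_partial2 f x y : scw f -> cderiv (fun t => cderiv (f ^~ t) x) y = mixd 1 f x y.
Proof.
move=> hf; have -> : (fun t => cderiv (f ^~ t) x) = mixd 0 f x.
  by apply/funext => t; exact: mixd0.
exact: isd_cderiv (isd_mixd 0 x y hf).
Qed.

(** Both iterated partials are the limit of the second difference of f over a square of side h,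
    divided by h^2. *)
Lemma scw_sym f x y : scw f ->
  cderiv (fun t => cderiv (f ^~ t) x) y = cderiv (fun s => cderiv (f s) y) x.
Proof.
move=> hf; rewrite scw_partial2 //; have := scw_partial2 y x (scw_swap hf) => /= ->.
apply/eqP; rewrite -subr_eq0; apply/eqP; apply: csemi_small_eq0 => p hp e e0.
have e2 : 0 < e / 2 by rewrite divr_gt0.
have [d d0 Hd] := mixed_square 1 x y hf hp e2.
have [d' d'0 Hd'] := mixed_square 1 y x (scw_swap hf) hp e2.
have m0 : 0 < Order.min d d' by rewrite lt_min d0.
pose h := Order.min d d' / 2.
have h0 : 0 < h by rewrite divr_gt0.
have : h < Order.min d d' by rewrite ltr_pdivrMr // mulr_natr mulr2n ltrDl.
rewrite lt_min => /andP[hd hd'].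
have := Hd x y h; rewrite !subrr normr0 => /(_ d0 d0 h0 hd) b1.
have := Hd' y x h; rewrite !subrr normr0 => /(_ d'0 d'0 h0 hd') b2.
rewrite /= /dif add0r mulr1 mulr0 !addr0 in b1 b2.
have h20 : 0 < h ^+ 2 by rewrite exprn_gt0.
have [pD pZ _] := hp.
rewrite -(ler_pM2l h20) -{1}(gtr0_norm h20) -pZ.
set A := mixd _ _ _ _ in b1 *; set B := mixd _ _ _ _ in b2 *.
have -> : h ^+ 2 *: (A - B) =
   (f (x + h) (y + h) - f (x + h) y - (f x (y + h) - f x y) - h ^+ 2 *: B) -
   (f (x + h) (y + h) - f x (y + h) - (f (x + h) y - f x y) - h ^+ 2 *: A) by lmod F.
apply: le_trans (csemi_sub _ _ hp) _; lra.
Qed.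

(** Go first in y, then in x: on the second leg the mean value inequality applies because the
    x-derivative is continuous in both variables. *)
Lemma scw_diag f x y : scw f ->
  isd (fun t => f (x + t) (y + t)) 0 (cderiv (f ^~ y) x + cderiv (f x) y).
Proof.
move=> hf p hp e e0; have [pD pZ _] := hp; have e2 : 0 < e / 2 by rewrite divr_gt0.
have [d d0 Hd] := dirn_cont 1 1 0 hf x y hp e2.
have [d' d'0 Hd'] := smT_isd y 0 (scw_snd x hf) hp e2.
exists (Order.min d d'); first by rewrite lt_min d0.
move=> h; rewrite lt_min => /andP[hd hd'].
have b2 := Hd' _ hd'; rewrite /= in b2.
have D1 s t : isd (fun u => f u t) s (dirn 1 1 0 f s t).
  have := @isd_dirn R F hF f 0 1 0 0 t s hf.
  rewrite !mulr1 !add0r !mulr0 !addr0 => H; apply: (@isd_near _ _ _ _ _ _ 1 _ _ H) => // u _.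
  by rewrite /dirn /= !mul0r !mulr0 !addr0 mulr1 add0r.
rewrite (isd_cderiv (D1 x y)).
have := @mvt_abs R F p (fun s => f s (y + h) - s *: dirn 1 1 0 f x y)
  (fun s => dirn 1 1 0 f s (y + h) - dirn 1 1 0 f x y) x (x + h) (e / 2) hp.
have xh z : z + h - z = h :> R by rewrite addrAC subrr add0r.
rewrite xh => B.
have b1 : p (f (x + h) (y + h) - (x + h) *: dirn 1 1 0 f x y -
            (f x (y + h) - x *: dirn 1 1 0 f x y)) <= e / 2 * `|h|.
  apply: B => t tx.
    apply: isdB; first exact: D1.
    by apply: isd_eq (isd_scal (isd_id t) (isd_cst _ t)) _; rewrite scaler0 addr0 scale1r.
  by apply: ltW; apply: Hd; rewrite ?xh //; exact: le_lt_trans tx hd.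
rewrite !add0r !addr0.
set A := dirn 1 1 0 f x y in b1 *; set B' := cderiv _ _ in b2 *.
have -> : f (x + h) (y + h) - f x y - h *: (A + B') =
  (f (x + h) (y + h) - (x + h) *: A - (f x (y + h) - x *: A)) + (f x (y + h) - f x y - h *: B').
  by lmod F.
apply: le_trans (pD _ _) _; lra.
Qed.

End BomanConsequences.

(** * Hadamard's lemma for curves *)

Section Hadamard.
Variables (R : realType) (E : tvsType R).
Context {hE : hs E}.

(** For t different from 0 this is t^(n+1) times the n-th derivative of c(t)/t. *)
Fixpoint hadw (c : R -> E) (n : nat) (t : R) : E :=
  if n is m.+1 then t ^+ m.+1 *: cderivn m.+1 c t - m.+1%:R *: hadw c m t else c t.

Lemma isd_exp n (t : R) : isd (fun s => s ^+ n : R^o) t (n%:R * t ^+ n.-1 : R^o).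
Proof.
elim: n => [|n IH].
  apply: (@isd_eq R R^o _ _ 0); last by rewrite mul0r.
  by apply: (@isd_near R R^o (fun=> 1) _ _ _ 1) => //; exact: isd_cst.
apply: (@isd_near R R^o (fun s => s * s ^+ n) _ _ _ 1) => //.
  by move=> s _; rewrite exprS.
apply: isd_eq (isd_scal (isd_id t) IH) _; rewrite -![_ *: _]/(_ * _) mul1r /=.
case: n {IH} => [|n]; first by rewrite mul0r mulr0 addr0 expr0 mulr1.
by rewrite /= exprS -[n.+2]addn1 natrD; ring.
Qed.

Lemma isd_hadw c n t : sm setT c -> isd (hadw c n) t (t ^+ n *: cderivn n.+1 c t).
Proof.
move=> hc; elim: n => [|n IH].
  by rewrite expr0 scale1r; exact: (smT_isd t 0 hc).
apply: isd_eq (isdB (isd_scal (isd_exp n.+1 t) (smT_isd t n.+1 hc)) (isdZ (n.+1%:R) IH)) _.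
by rewrite /= -!/(cderivn _ _) scalerA; lmod E.
Qed.

Lemma hadw0 c n : c 0 = 0 -> hadw c n 0 = 0.
Proof.
by move=> c0; elim: n => [//|n IH]; rewrite /= IH scaler0 subr0 expr0n scale0r.
Qed.

(** The n-th derivative of c(t)/t when c(0) = 0, with the value at t = 0 that Taylor's formula
    dictates. *)
Definition hadq (c : R -> E) (n : nat) (t : R) : E :=
  if t == 0 then n.+1%:R^-1 *: cderivn n.+1 c 0 else t ^- n.+1 *: hadw c n t.

Lemma isd_hadq c n t : sm setT c -> c 0 = 0 -> isd (hadq c n) t (hadq c n.+1 t).
Proof.
move=> hc c0; have [->|t0] := eqVneq t 0; last first.
  rewrite /hadq (negPf t0).
  apply: (@isd_near R E (fun s => (s ^+ n.+1)^-1 *: hadw c n s) _ _ _ `|t|).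
  - by rewrite normr_gt0.
  - move=> s st; rewrite ifF //; apply/negP => /eqP s0.
    by move: st; rewrite s0 sub0r normrN ltxx.
  have tn0 : t ^+ n.+1 != 0 by rewrite expf_neq0.
  apply: isd_eq (isd_scal (isd_comp (isd_exp n.+1 t) (isd_inv tn0)) (isd_hadw n t hc)) _.
  rewrite -[_ *: (- _ : R^o)]/(_ * _) /= !exprS; have tm0 : t ^+ n != 0 by rewrite expf_neq0.
  by lm_main R E; field; rewrite ?t0 ?tm0.
move=> {t} p hp e e0; have [pD pZ _] := hp.
have [d d0 Hd] := smT_isd 0 n.+1 hc hp e0.
exists d => // h hd; rewrite add0r; have [->|h0] := eqVneq h 0.
  by rewrite scale0r !subrr csemi0 // normr0 mulr0.
pose A := cderivn n.+1 c 0; pose B := cderivn n.+2 c 0.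
(* At 0 the Taylor polynomial of [hadw c n] is subtracted. The derivative of the rest is t^n times
   o(t), so after division by h^(n+1) an error o(h) remains. *)
have := @mvt_abs R E p (fun t => hadw c n t - t ^+ n.+1 *: (n.+1%:R^-1 *: A) - t ^+ n.+2 *: (n.+2%:R^-1 *: B))
  (fun t => t ^+ n *: (cderivn n.+1 c t - A - t *: B)) 0 h (`|h| ^+ n * (e * `|h|)) hp.
rewrite !subr0 => H.
have b : p (hadw c n h - h ^+ n.+1 *: (n.+1%:R^-1 *: A) - h ^+ n.+2 *: (n.+2%:R^-1 *: B)) <=
    `|h| ^+ n * (e * `|h|) * `|h|.
  have -> : hadw c n h - h ^+ n.+1 *: (n.+1%:R^-1 *: A) - h ^+ n.+2 *: (n.+2%:R^-1 *: B) =
     hadw c n h - h ^+ n.+1 *: (n.+1%:R^-1 *: A) - h ^+ n.+2 *: (n.+2%:R^-1 *: B) -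
     (hadw c n 0 - 0 ^+ n.+1 *: (n.+1%:R^-1 *: A) - 0 ^+ n.+2 *: (n.+2%:R^-1 *: B)).
    by rewrite hadw0 // !expr0n /= !scale0r !subr0.
  apply: H => t; rewrite subr0 => th.
    apply: isd_eq (isdB (isdB (isd_hadw n t hc) (isd_scal (isd_exp n.+1 t) (isd_cst _ t)))
       (isd_scal (isd_exp n.+2 t) (isd_cst _ t))) _.
    rewrite /= -/(cderivn n.+1 c t) !exprS.
    have n1 : n.+1%:R != 0 :> R by rewrite pnatr_eq0.
    have n2 : n.+2%:R != 0 :> R by rewrite pnatr_eq0.
    have -> : cderiv (cderivn n c) t = cderivn n.+1 c t by [].
    move: n1 n2; set X := cderivn n.+1 c t; move: n.+1%:R n.+2%:R => N1 N2 n1 n2.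
    by lm_main R E; field; rewrite ?n1 ?n2.
  rewrite pZ normrX; apply: ler_pM.
  - by rewrite exprn_ge0.
  - exact: csemi_ge0.
  - by apply: lerXn2r; rewrite ?nnegrE.
  have := Hd t; rewrite add0r => /(_ (le_lt_trans th hd)) /le_trans; apply.
  by rewrite ler_pM2l.
rewrite /hadq eqxx (negPf h0).
have hn : h ^+ n.+1 != 0 by rewrite expf_neq0.
have pn : 0 < `|h ^+ n.+1| by rewrite normr_gt0.
rewrite -(ler_pM2l pn) -pZ -/A -/B.
have -> : h ^+ n.+1 *: (h ^- n.+1 *: hadw c n h - n.+1%:R^-1 *: A - h *: (n.+2%:R^-1 *: B)) =
   hadw c n h - h ^+ n.+1 *: (n.+1%:R^-1 *: A) - h ^+ n.+2 *: (n.+2%:R^-1 *: B).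
  by rewrite !scalerBr !scalerA divff // scale1r [h ^+ n.+2]exprSr; lmod E.
apply: le_trans b _; rewrite normrX exprSr le_eqVlt; apply/orP; left; apply/eqP; ring.
Qed.

Lemma hadamard (c : R -> E) : sm setT c ->
  exists2 q : R -> E, sm setT q & forall t, c t = c 0 + t *: q t.
Proof.
move=> hc; pose k t := c t - c 0.
have hk : sm setT k by apply: smB => //; exact: sm_cst.
have k0 : k 0 = 0 by rewrite /k subrr.
exists (hadq k 0) => [n|t].
  have : forall m, Cn n setT (hadq k m); last exact.
  elim: n => [//|n IH] m; exists (hadq k m.+1) => // t _; exact: isd_hadq.
rewrite /hadq; case: eqP => [->|/eqP t0]; first by rewrite scale0r addr0.
by rewrite scalerA expr1 divff // scale1r /= /k subrKC.
Qed.

End Hadamard.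

(** * Germs of smooth maps on c^infty-open sets *)

Section ConvenientCalculus.
Variables (R : realType) (E F : tvsType R).
Context {hE : hs E} {hF : hs F}.
Implicit Types (U : set E) (f : E -> F).

Lemma curve_globalize (c : R -> E) t : smooth_near c t ->
  forall e, 0 < e -> exists psi : R -> R^o, [/\ sm setT (fun s => c (psi s)),
    exists2 d, 0 < d & forall s, `|s - t| < d -> psi s = s
    & forall s, `|psi s - t| < e].
Proof.
move=> /smooth_nearP[d d0 hd] e e0.
have m0 : 0 < Order.min d e by rewrite lt_min d0.
have [psi [h1 h2 h3]] := smooth_cutoff t m0.
exists psi; split.
- by apply: (sm_comp _ h1 hd) => s _; have := h3 s; rewrite lt_min => /andP[].
- by exists (Order.min d e / 4) => //; rewrite divr_gt0.
- by move=> s; have := h3 s; rewrite lt_min => /andP[].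
Qed.

Lemma cinf_open_near U (c : R -> E) t : cinf_open U -> smooth_near c t -> U (c t) ->
  exists2 d, 0 < d & forall s, `|s - t| < d -> U (c s).
Proof.
move=> oU hc Ut; have [psi [h1 [d d0 h2] _]] := curve_globalize hc ltr01.
have ct : psi t = t by apply: h2; rewrite subrr normr0.
have [d' d'0 h3] : exists2 d, 0 < d & forall s, `|s - t| < d -> U (c (psi s)).
  apply: (open_real (oU _ _)); last by rewrite /= ct.
  by apply/smooth_curveP.
exists (Order.min d d'); first by rewrite lt_min d0.
by move=> s; rewrite lt_min => /andP[s1 s2]; rewrite -(h2 s s1); exact: h3.
Qed.

Lemma smooth_on_near U f (c : R -> E) t : cinf_open U -> smooth_on U f ->
  smooth_near c t -> U (c t) -> smooth_near (f \o c) t.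
Proof.
move=> oU hf hc Ut; have [e e0 He] := cinf_open_near oU hc Ut.
have [psi [h1 [d d0 h2] h3]] := curve_globalize hc e0.
have /smooth_curveP H : smooth_curve (f \o (fun s => c (psi s))).
  by apply: hf; [apply/smooth_curveP | move=> s; apply: He].
apply/smooth_nearP; exists d => //.
apply: sm_ext (@open_ballR R t d) _ (sm_sub (@subsetT _ _) H) => s sd /=.
by rewrite h2.
Qed.

Lemma smooth_near_sm (c : R -> E) t : sm setT c -> smooth_near c t.
Proof. by move=> H; apply/smooth_nearP; exists 1 => //; apply: sm_sub H. Qed.

Lemma smooth_near_ext (c c' : R -> E) t d : 0 < d ->
  (forall s, `|s - t| < d -> c s = c' s) -> smooth_near c t -> smooth_near c' t.
Proof.
move=> d0 cc /smooth_nearP[e e0 H]; apply/smooth_nearP.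
exists (Order.min d e); first by rewrite lt_min d0.
apply: sm_ext (@open_ballR R t _) _ (sm_sub _ H).
  by move=> s /=; rewrite lt_min => /andP[/cc].
by move=> s /=; rewrite lt_min => /andP[].
Qed.

Lemma smooth_near_isd (c : R -> E) t : smooth_near c t -> isd c t (cderiv c t).
Proof.
move=> /smooth_nearP[d d0 H].
by apply: (sm_isd (@open_ballR R t d) H); rewrite /= subrr normr0.
Qed.

Lemma smooth_curve_near (c : R -> E) : (forall t, smooth_near c t) <-> smooth_curve c.
Proof.
split=> [H|/smooth_curveP H t]; last exact: smooth_near_sm.
by apply/smooth_curveP; apply: sm_loc => [|t _]; [exact: openT | apply/smooth_nearP].
Qed.

(** Cutoffs in both plane variables keep k inside [U]. Boman's theorem thereby applies to maps that
    are smooth only on a c^infty-open set. *)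
Lemma smooth_on_plot U f (k : R -> R -> E) x y : cinf_open U -> smooth_on U f ->
  scw k -> U (k x y) -> exists K : R -> R -> F, exists2 d, 0 < d & scw K /\
    (forall x' y', `|x' - x| < d -> `|y' - y| < d -> U (k x' y') /\ K x' y' = f (k x' y')).
Proof.
move=> oU hf hk Uk.
have [|d d0 Hd] := @plane_open R (fun x' y' => U (k x' y')) _ x y Uk.
  by move=> a b ha hb; apply: oU; apply/smooth_curveP; exact: hk.
have [phi [p1 p2 p3]] := smooth_cutoff x d0.
have [psi [q1 q2 q3]] := smooth_cutoff y d0.
exists (fun x' y' => f (k (phi x') (psi y'))), (d / 4); first by rewrite divr_gt0.
split=> [a b ha hb|x' y' hx hy].
  apply/smooth_curveP; apply: (hf (fun t => k (phi (a t)) (psi (b t)))).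
    by apply/smooth_curveP; apply: hk; apply: (@sm_comp _ _ setT setT).
  by move=> t; apply: Hd; [exact: p3 | exact: q3].
by rewrite p2 // q2 //; split=> //; apply: Hd; lra.
Qed.

Lemma scw_aff2 (x u v : E) : scw (fun s t => x + s *: u + t *: v).
Proof.
move=> a b ha hb; apply: smD; first apply: smD; try exact: sm_cst.
  by apply: sm_scal => //; exact: sm_cst.
by apply: sm_scal => //; exact: sm_cst.
Qed.

Lemma isd_translate (c : R -> E) t l : isd (fun s => c (t + s)) 0 l <-> isd c t l.
Proof.
by split=> H p hp e e0; have [d d0 Hd] := H p hp e e0; exists d => // h hd;
  have := Hd h hd; rewrite add0r addr0.
Qed.

Lemma isd_dirder U f x v : cinf_open U -> smooth_on U f -> U x ->
  isd (fun t => f (x + t *: v)) 0 (dirder f x v).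
Proof.
move=> oU hf Ux; apply: cderivable_isd.
have sl : smooth_near (fun t : R => x + t *: v) 0.
  apply: smooth_near_sm; apply: smD; first exact: sm_cst.
  by apply: sm_scal; [exact: sm_id | exact: sm_cst].
have := smooth_on_near oU hf sl; rewrite scale0r addr0 => /(_ Ux) /smooth_nearP[d d0 H].
by have [h _] := (sm_derivP _ (@open_ballR R 0 d)).1 H; apply: h; rewrite /= subrr normr0.
Qed.

End ConvenientCalculus.

(** * Chain rule, linearity, smoothness and symmetry of derivatives *)

Section ChainRule.
Variables (R : realType) (E F : tvsType R).
Context {hE : hs E} {hF : hs F}.
Implicit Types (U : set E) (f : E -> F).

(** By Hadamard c(t + s) = c(t) + s q(s) with q(0) = c'(t). The plane map f(c(t) + s q(r)) is
    constant on s = 0 and has s-derivative [dirder f (c t) (q 0)] at the origin; the diagonal rule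
    adds the two partials. *)
Lemma cc_chain U f (c : R -> E) t : cinf_open U -> smooth_on U f ->
  smooth_near c t -> U (c t) -> isd (f \o c) t (dirder f (c t) (cderiv c t)).
Proof.
move=> oU hf hc Ut.
have [psi [h1 [d d0 h2] _]] := curve_globalize hc ltr01.
pose c' s := c (psi (t + s)).
have hc' : sm setT c'.
  apply: (@sm_comp _ _ setT setT (fun s => t + s : R^o)) h1 => //.
  by apply: smD; [exact: sm_cst | exact: sm_id].
have cE s : `|s| < d -> c' s = c (t + s).
  by move=> sd; rewrite /c' h2 // addrAC subrr add0r.
have c0 : c' 0 = c t by rewrite cE ?normr0 // addr0.
have [q hq cq] := hadamard hc'.
have q0 : q 0 = cderiv c t.
  have e1 : isd c' 0 (cderiv c t).
    apply: (@isd_near _ _ (fun s => c (t + s)) _ _ _ d) => //.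
      by move=> s; rewrite subr0 => /cE.
    by apply/isd_translate; exact: smooth_near_isd.
  have e2 : isd c' 0 (q 0).
    have hqd : isd q 0 (cderiv q 0) by exact: (smT_isd 0 0 hq).
    apply: (@isd_near _ _ (fun s => c' 0 + s *: q s) _ _ _ 1) => //.
    apply: isd_eq (isdD (isd_cst _ 0) (isd_scal (isd_id 0) hqd)) _.
    by rewrite add0r scale1r scale0r addr0.
  exact: isd_unique e2 e1.
pose k s r := c t + s *: q r.
have hk : scw k.
  move=> a b ha hb; apply: smD; first exact: sm_cst.
  by apply: sm_scal => //; apply: (@sm_comp _ _ setT setT).
have Uk : U (k 0 0) by rewrite /k scale0r addr0.
have [K [e e0 [hK KE]]] := smooth_on_plot oU hf hk Uk.
have := @scw_diag R F hF K 0 0 hK.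
have -> : cderiv (K 0) 0 = 0.
  rewrite (@cderiv_ext _ _ _ (fun=> f (c t)) 0 e e0); last first.
    move=> s se; have [_ ->] := KE 0 s ltac:(by rewrite subrr normr0) se.
    by rewrite /k scale0r addr0.
  exact: isd_cderiv (isd_cst _ _).
have -> : cderiv (K ^~ 0) 0 = dirder f (c t) (cderiv c t).
  rewrite /dirder -q0; apply: (@cderiv_ext _ _ _ _ 0 e e0) => s se.
  by have [_ ->] := KE s 0 se ltac:(by rewrite subrr normr0).
rewrite addr0 => H; apply/isd_translate.
apply: (@isd_near _ _ _ _ _ _ (Order.min d e) _ _ H); first by rewrite lt_min d0.
move=> s; rewrite subr0 lt_min !add0r => /andP[sd se].
have [_ ->] := KE s s ltac:(by rewrite subr0) ltac:(by rewrite subr0).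
by rewrite /k /= -cE // cq c0.
Qed.

Lemma cc_chain' U f (c : R -> E) t l : cinf_open U -> smooth_on U f ->
  smooth_near c t -> U (c t) -> isd c t l -> isd (f \o c) t (dirder f (c t) l).
Proof. by move=> oU hf hc Ut /isd_cderiv <-; exact: cc_chain hc Ut. Qed.

Lemma cc_linear U f x a u v : cinf_open U -> smooth_on U f -> U x ->
  dirder f x (a *: u + v) = a *: dirder f x u + dirder f x v.
Proof.
move=> oU hf Ux.
pose k s t := x + s *: (a *: u) + t *: v.
have Uk : U (k 0 0) by rewrite /k !scale0r !addr0.
have [K [e e0 [hK KE]]] := smooth_on_plot oU hf (scw_aff2 x (a *: u) v) Uk.
have := @scw_diag R F hF K 0 0 hK.
have z : `|0 - 0 : R| < e by rewrite subrr normr0.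
have -> : cderiv (K 0) 0 = dirder f x v.
  rewrite /dirder; apply: (@cderiv_ext _ _ _ _ 0 e e0) => s se.
  by have [_ ->] := KE 0 s z se; rewrite scale0r addr0.
have -> : cderiv (K ^~ 0) 0 = a *: dirder f x u.
  have H : isd (fun s => f (x + s *: (a *: u))) 0 (a *: dirder f x u).
    have h1 : isd (fun s => s * a : R^o) 0 (a : R^o).
      apply: isd_eq (isd_scal (isd_id 0) (isd_cst (a : R^o) 0)) _.
      by rewrite scaler0 addr0 -[_ *: _]/(1 * a) mul1r.
    have h2 : isd (fun s => f (x + s *: u)) (0 * a) (dirder f x u).
      by rewrite mul0r; exact: isd_dirder oU hf Ux.
    have := isd_comp h1 h2.
    by apply: (@isd_near _ _ _ _ _ _ 1) => // s _; rewrite scalerA.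
  rewrite -(isd_cderiv H); apply: (@cderiv_ext _ _ _ _ 0 e e0) => s se.
  by have [_ ->] := KE s 0 se z; rewrite scale0r addr0.
have H : isd (fun s => f (x + s *: (a *: u + v))) 0 (dirder f x (a *: u + v)).
  exact: isd_dirder oU hf Ux.
move=> H2; apply: isd_unique (H) _.
apply: (@isd_near _ _ _ _ _ _ e _ _ H2) => // s; rewrite subr0 !add0r => se.
have [_ ->] := KE s s ltac:(by rewrite subr0) ltac:(by rewrite subr0).
by rewrite scalerDr addrA.
Qed.

Lemma dirder0 U f x : cinf_open U -> smooth_on U f -> U x -> dirder f x 0 = 0.
Proof.
move=> oU hf Ux; have := cc_linear (-1) 0 0 oU hf Ux.
by rewrite scaler0 addr0 scaleN1r addNr.
Qed.

(** Along a smooth curve of pairs (x(t), v(t)) the derivative is the s-partial at 0 of f(x(t) + s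
    v(t)), smooth in t by [scw_partial]. *)
Lemma cc_smooth U f : cinf_open U -> smooth_on U f ->
  smooth_on [set p : E * E | U p.1] (fun p => dirder f p.1 p.2).
Proof.
move=> oU hf c /smooth_curveP hc Uc; apply/smooth_curve_near => t.
pose k s r := (c r).1 + s *: (c r).2.
have hk : scw k.
  move=> a b ha hb; have hcb : sm setT (fun r => c (b r)) by apply: (@sm_comp _ _ setT setT).
  apply: smD; first exact: (sm_fst hcb).
  by apply: sm_scal => //; exact: (sm_snd hcb).
have Uk : U (k 0 t) by rewrite /k scale0r addr0; exact: Uc.
have [K [e e0 [hK KE]]] := smooth_on_plot oU hf hk Uk.
apply: (@smooth_near_ext _ _ _ (fun t => cderiv (K ^~ t) 0) _ _ e) => //.
  move=> s se /=; rewrite /dirder; apply: (@cderiv_ext _ _ _ _ 0 e e0) => r re.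
  by have [_ ->] := KE r s re se.
by apply: smooth_near_sm; exact: scw_partial.
Qed.

Lemma cc_sym U f x v w : cinf_open U -> smooth_on U f -> U x ->
  dirder (fun y => dirder f y v) x w = dirder (fun y => dirder f y w) x v.
Proof.
move=> oU hf Ux.
have Uk : U (x + 0 *: v + 0 *: w) by rewrite !scale0r !addr0.
have [K [e e0 [hK KE]]] := smooth_on_plot oU hf (scw_aff2 x v w) Uk.
have z : `|0 - 0 : R| < e by rewrite subrr normr0.
have -> : dirder (fun y => dirder f y v) x w = cderiv (fun t => cderiv (K ^~ t) 0) 0.
  rewrite {1}/dirder; apply: (@cderiv_ext _ _ _ _ 0 e e0) => s se.
  rewrite /dirder; apply: (@cderiv_ext _ _ _ _ 0 e e0) => r re.
  by have [_ ->] := KE r s re se; rewrite addrAC.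
have -> : dirder (fun y => dirder f y w) x v = cderiv (fun s => cderiv (K s) 0) 0.
  rewrite {1}/dirder; apply: (@cderiv_ext _ _ _ _ 0 e e0) => s se.
  rewrite /dirder; apply: (@cderiv_ext _ _ _ _ 0 e e0) => r re.
  by have [_ ->] := KE s r se re.
exact: scw_sym.
Qed.

End ChainRule.

(** * Smooth curves, plots and velocities in a manifold *)

Lemma manifold_hs (R : realType) (E : tvsType R) (M : premanifold E) :
  is_manifold M -> hs E.
Proof. by case=> -[]. Qed.

Section ManifoldCurves.
Variables (R : realType) (E : tvsType R) (M : premanifold E).
Context {hE : hs E}.
Hypothesis hM : is_manifold M.
Implicit Types (i j k : idx M) (c : R -> M).

Definition msm c t : Prop := forall i, dom i (c t) ->
  (\forall s \near t, dom i (c s)) /\ smooth_near (chart i \o c) t.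

Definition img i j : set E := chart i @` (dom i `&` dom j).

Lemma dom_at (x : M) : dom (chart_at x) x. Proof. by case: hM. Qed.
Lemma chartK i (x : M) : dom i x -> cochart i (chart i x) = x.
Proof. by case: hM => _ _ h _ _; exact: h. Qed.
Lemma img_open i j : cinf_open (img i j). Proof. by case: hM => _ _ _ h _; exact: h. Qed.
Lemma trans_smooth i j : smooth_on (img i j) (chart j \o cochart i).
Proof. by case: hM => _ _ _ _ h; exact: h. Qed.
Lemma img_chart i j (x : M) : dom i x -> dom j x -> img i j (chart i x).
Proof. by move=> di dj; exists x. Qed.
Lemma img_dom i j y : img i j y -> dom i (cochart i y) /\ dom j (cochart i y).
Proof. by case=> x [di dj] <-; rewrite chartK. Qed.
Lemma img_cochart i j y : img i j y -> chart i (cochart i y) = y.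
Proof. by case=> x [di dj] <-; rewrite chartK. Qed.
Lemma img_sub i j y : img i j y -> img i i y.
Proof. by case=> x [di dj] <-; exact: img_chart. Qed.
Lemma img_of i j y : img i i y -> dom j (cochart i y) -> img i j y.
Proof. by move=> hy dj; exists (cochart i y); [split=> //; exact: (img_dom hy).1 | exact: img_cochart hy]. Qed.

Lemma msm_ext c c' t d : 0 < d -> (forall s, `|s - t| < d -> c s = c' s) ->
  msm c t -> msm c' t.
Proof.
move=> d0 cc H i; rewrite -cc ?subrr ?normr0 // => /H[/nbhs_real[e e0 h1] h2]; split.
  apply/nbhs_real; exists (Order.min d e); first by rewrite lt_min d0.
  by move=> s; rewrite lt_min => /andP[/cc <- /h1].
by apply: smooth_near_ext d0 _ h2 => s /cc /= ->.
Qed.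

Lemma msm_chart c t i : dom i (c t) -> (\forall s \near t, dom i (c s)) ->
  smooth_near (chart i \o c) t -> msm c t.
Proof.
move=> di /nbhs_real[d d0 hd] hc j dj.
have [e e0 he] := cinf_open_near (@img_open i j) hc (img_chart di dj).
split.
  apply/nbhs_real; exists (Order.min d e); first by rewrite lt_min d0.
  by move=> s; rewrite lt_min => /andP[/hd ds /he /img_dom[_]]; rewrite /= chartK.
have := @smooth_on_near R E E hE hE _ _ _ _ (@img_open i j) (@trans_smooth i j) hc (img_chart di dj).
by apply: smooth_near_ext d0 _ => s /hd ds /=; rewrite chartK.
Qed.

Lemma msm_cochart i (y : R -> E) t : smooth_near y t -> img i i (y t) ->
  msm (fun s => cochart i (y s)) t.
Proof.
move=> hy yt; have [d d0 hd] := cinf_open_near (@img_open i i) hy yt.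
apply: (@msm_chart _ _ i).
- exact: (img_dom yt).1.
- by apply/nbhs_real; exists d => // s /hd /img_dom[].
by apply: smooth_near_ext d0 _ hy => s /hd /img_cochart /= ->.
Qed.

Lemma msm_cst (x : M) t : msm (fun=> x) t.
Proof.
apply: (@msm_chart _ _ (chart_at x)); first exact: dom_at.
  by apply/nbhs_real; exists 1 => // s _; exact: dom_at.
by apply: smooth_near_sm; exact: sm_cst.
Qed.

Lemma msmooth_cst (x : M) : msmooth (fun=> x : M). Proof. by move=> t; exact: msm_cst. Qed.

Lemma msm_reparam c (f : R -> R^o) t : msm c (f t) -> smooth_near f t -> msm (fun s => c (f s)) t.
Proof.
move=> hc hf i /hc[/nbhs_real[d d0 hd] /smooth_nearP[e e0 he]].
move: hf => /smooth_nearP[a a0 ha].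
have ft : isd f t (cderiv f t).
  by apply: (sm_isd (@open_ballR R t a) ha); rewrite /= subrr normr0.
have m0 : 0 < Order.min d e by rewrite lt_min d0.
have [b b0 hb] := isd_cont ft (csemi_norm R) m0.
split.
  apply/nbhs_real; exists b => // s /hb; rewrite lt_min => /andP[/hd]; exact.
apply/smooth_nearP; exists (Order.min a b); first by rewrite lt_min a0.
apply: (sm_comp _ _ he); last by apply: sm_sub ha => s /=; rewrite lt_min => /andP[].
by move=> s /=; rewrite lt_min => /andP[_ /hb]; rewrite lt_min => /andP[].
Qed.

Lemma msmooth_reparam c (f : R -> R^o) : msmooth c -> sm setT f -> msmooth (fun s => c (f s)).
Proof. by move=> hc hf t; apply: msm_reparam; [exact: hc | exact: smooth_near_sm]. Qed.

Lemma vchart c t i j : msm c t -> dom i (c t) -> dom j (c t) ->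
  cderiv (chart j \o c) t =
  dirder (chart j \o cochart i) (chart i (c t)) (cderiv (chart i \o c) t).
Proof.
move=> hc di dj; have [/nbhs_real[d d0 hd] hi] := hc i di.
have := @cc_chain R E E hE hE _ _ _ _ (@img_open i j) (@trans_smooth i j) hi (img_chart di dj).
move=> H; apply: isd_cderiv.
by apply: isd_near d0 _ H => s /hd ds /=; rewrite chartK.
Qed.

Lemma mtan_chart_velocity c t i : msm c t -> dom i (c t) ->
  @chart R (E * E)%type (mtan M) i (velocity c t) = (cderiv (chart i \o c) t, chart i (c t)).
Proof.
by move=> hc di; rewrite /= -(vchart hc _ di) //; exact: dom_at.
Qed.

Lemma velocity_ext c c' t d : 0 < d -> (forall s, `|s - t| < d -> c s = c' s) ->
  velocity c t = velocity c' t.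
Proof.
move=> d0 cc; have ct : c t = c' t by apply: cc; rewrite subrr normr0.
rewrite /velocity ct; congr (_, _); apply: (cderiv_ext d0) => s /cc /= -> //.
Qed.

Lemma isd_chart c t i : msm c t -> dom i (c t) -> isd (chart i \o c) t (cderiv (chart i \o c) t).
Proof. by move=> hc di; apply: smooth_near_isd; case: (hc i di). Qed.

Lemma velocity_reparam c (f : R -> R^o) t (a : R) : msm c (f t) -> isd f t (a : R^o) ->
  velocity (fun s => c (f s)) t = (a *: (velocity c (f t)).1, c (f t)).
Proof.
move=> hc hf; rewrite /velocity /=; congr (_, _).
have := isd_chart hc (dom_at (c (f t))) => /(isd_comp hf) /isd_cderiv; exact.
Qed.

Lemma velocity_cst (x : M) t : velocity (fun=> x) t = ((0 : E), x) :> mtan M.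
Proof. by rewrite /velocity; congr (_, _); exact: isd_cderiv (isd_cst _ _). Qed.

(** A straight line in the chart, cut off to stay in the chart image. Hence every tangent vector is
    the velocity of a global curve, and statements on TM may be proved for velocities. *)
Lemma cochart_curve i (y w : E) : img i i y -> exists c, [/\ msmooth c,
  exists2 d, 0 < d & forall s, `|s| < d -> c s = cochart i (y + s *: w)
  & @cochart R (E * E)%type (mtan M) i (w, y) = velocity c 0].
Proof.
move=> hy.
have sl : smooth_near (fun t : R => y + t *: w) 0.
  apply: smooth_near_sm; apply: smD; first exact: sm_cst.
  by apply: sm_scal; [exact: sm_id | exact: sm_cst].
have [|d d0 hd] := cinf_open_near (@img_open i i) sl; first by rewrite scale0r addr0.
have [phi [p1 p2 p3]] := smooth_cutoff 0 d0.
pose c s := cochart i (y + phi s *: w).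
have hc : msmooth c.
  move=> t; apply: msm_cochart.
    apply: smooth_near_sm; apply: smD; first exact: sm_cst.
    by apply: sm_scal => //; exact: sm_cst.
  exact: hd.
exists c; split=> //.
  exists (d / 4); first by rewrite divr_gt0.
  by move=> s sd; rewrite /c p2 // subr0.
have c0 : c 0 = cochart i y.
  by rewrite /c p2 ?scale0r ?addr0 // subrr normr0 divr_gt0.
have [di _] := img_dom hy.
have dic : dom i (c 0) by rewrite c0.
rewrite /velocity /= (vchart (hc 0) dic (dom_at _)) c0 (img_cochart hy).
congr (dirder _ _ _, _).
have d4 : 0 < d / 4 by rewrite divr_gt0.
apply/esym; apply: isd_cderiv.
apply: (@isd_near _ _ (fun s => y + s *: w) _ _ _ (d / 4)) => //.
  by move=> s sd; rewrite /= /c p2 // (img_cochart (j := i)) //; apply: hd; lra.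
apply: isd_eq (isdD (isd_cst _ _) (isd_scal (isd_id _) (isd_cst _ _))) _.
by rewrite add0r scale1r scaler0 addr0.
Qed.

Lemma dirder_id i (y v : E) : img i i y -> dirder (chart i \o cochart i) y v = v.
Proof.
move=> hy; rewrite /dirder.
have sl : smooth_near (fun t : R => y + t *: v) 0.
  apply: smooth_near_sm; apply: smD; first exact: sm_cst.
  by apply: sm_scal; [exact: sm_id | exact: sm_cst].
have [|d d0 hd] := cinf_open_near (@img_open i i) sl; first by rewrite scale0r addr0.
apply: isd_cderiv; apply: (@isd_near _ _ (fun s => y + s *: v) _ _ _ d) => //.
  by move=> s /hd h /=; rewrite (img_cochart h).
apply: isd_eq (isdD (isd_cst _ _) (isd_scal (isd_id _) (isd_cst _ _))) _.
by rewrite add0r scale1r scaler0 addr0.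
Qed.

Lemma mtan_self (p : mtan M) : @chart R (E * E)%type (mtan M) (chart_at p.2) p = (p.1, chart (chart_at p.2) p.2).
Proof. by rewrite /= dirder_id //; apply: img_chart; exact: dom_at. Qed.

Lemma tangent_curve (p : mtan M) : exists c, [/\ msmooth c, c 0 = p.2 & velocity c 0 = p].
Proof.
case: p => v x; have hy := img_chart (dom_at x) (dom_at x).
have [c [h1 [d d0 h2] h3]] := cochart_curve v hy.
have c0 : c 0 = x by rewrite h2 ?normr0 // scale0r addr0 chartK //; exact: dom_at.
exists c; split=> //; rewrite -h3 /= chartK; last exact: dom_at.
by rewrite dirder_id.
Qed.

Lemma mtan_cochartK i (w y : E) : img i i y ->
  @chart R (E * E)%type (mtan M) i (@cochart R (E * E)%type (mtan M) i (w, y)) = (w, y).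
Proof.
move=> hy; have [c [h1 [d d0 h2] ->]] := cochart_curve w hy.
have c0 : c 0 = cochart i y by rewrite h2 ?normr0 // scale0r addr0.
rewrite (mtan_chart_velocity (h1 0)); last by rewrite c0; exact: (img_dom hy).1.
rewrite c0 (img_cochart hy); congr (_, _); rewrite -[RHS](dirder_id w hy).
by apply: (cderiv_ext d0) => s; rewrite subr0 => /h2 /= ->.
Qed.

(** Smooth two parameter families, tested as in Boman's theorem; [mplot_chart] gives them [scw]
    coordinates. *)
Definition mplot (P : R -> R -> M) : Prop := forall a b : R -> R^o,
  sm setT a -> sm setT b -> msmooth (fun t => P (a t) (b t)).

Lemma mplot_near (P : R -> R -> M) x y i : mplot P -> dom i (P x y) ->
  exists2 d, 0 < d & forall x' y', `|x' - x| < d -> `|y' - y| < d -> dom i (P x' y').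
Proof.
move=> hP di; apply: (@plane_open R (fun x' y' => dom i (P x' y')) _ x y di).
move=> a b ha hb; apply: real_open => t /= dt.
by have [/nbhs_real] := hP a b ha hb t i dt.
Qed.

Lemma mplot_chart (P : R -> R -> M) x y i : mplot P -> dom i (P x y) ->
  exists K : R -> R -> E, exists2 d, 0 < d & scw K /\
    (forall x' y', `|x' - x| < d -> `|y' - y| < d ->
       dom i (P x' y') /\ K x' y' = chart i (P x' y')).
Proof.
move=> hP di; have [d d0 hd] := mplot_near hP di.
have [phi [p1 p2 p3]] := smooth_cutoff x d0.
have [psi [q1 q2 q3]] := smooth_cutoff y d0.
exists (fun x' y' => chart i (P (phi x') (psi y'))), (d / 4); first by rewrite divr_gt0.
split=> [a b ha hb|x' y' hx hy]; last by rewrite p2 // q2 //; split=> //; apply: hd; lra.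
apply/smooth_curveP; apply/smooth_curve_near => t.
have hpa : sm setT (fun t => phi (a t)) by apply: (@sm_comp _ _ setT setT).
have hqb : sm setT (fun t => psi (b t)) by apply: (@sm_comp _ _ setT setT).
by have [] := hP _ _ hpa hqb t i (hd _ _ (p3 _) (q3 _)).
Qed.

Lemma mplot_fst (P : R -> R -> M) y : mplot P -> msmooth (P ^~ y).
Proof. by move=> hP; apply: (hP (fun s => s) (fun=> y)); [exact: sm_id | exact: sm_cst]. Qed.

Lemma mplot_snd (P : R -> R -> M) x : mplot P -> msmooth (P x).
Proof. by move=> hP; apply: (hP (fun=> x) (fun s => s)); [exact: sm_cst | exact: sm_id]. Qed.

Lemma mplot_swap (P : R -> R -> M) : mplot P -> mplot (fun s t => P t s).
Proof. by move=> hP a b ha hb; exact: hP. Qed.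

Lemma mplot_velocity (P : R -> R -> M) x : mplot P ->
  @msmooth R (E * E)%type (mtan M) (fun t => velocity (P ^~ t) x).
Proof.
move=> hP t i /= di; have [K [d d0 [hK KE]]] := mplot_chart hP di.
split; first by apply/nbhs_real; exists d => // s sd; case: (KE x s) => //; rewrite subrr normr0.
apply: (@smooth_near_ext _ _ _ (fun t => (cderiv (K ^~ t) x, K x t)) _ _ d) => //.
  move=> s sd; have [ds ks] := KE x s ltac:(by rewrite subrr normr0) sd.
  have := @mtan_chart_velocity (P ^~ s) x i (@mplot_fst P s hP x) ds; rewrite /= => ->.
  rewrite ks; congr (_, _); apply: (cderiv_ext d0) => r rd.
  by have [_ ->] := KE r s rd sd.
by apply: smooth_near_sm; apply: sm_pair; [exact: scw_partial | exact: scw_snd].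
Qed.

(** With coordinates (w(s), y(s)) of the curve the plot is y(s) + r w(s) in the chart, with cutoffs.
    Smoothness on TM is thereby reduced to [mplot_velocity]. *)
Lemma tangent_plot (c : R -> mtan M) t : @msmooth R (E * E)%type (mtan M) c ->
  exists P : R -> R -> M, mplot P /\
    exists2 d, 0 < d & forall s, `|s - t| < d -> c s = velocity (P ^~ s) 0.
Proof.
move=> hc; pose i := chart_at (c t).2.
have di : dom i (c t).2 by exact: dom_at.
have [/nbhs_real[d d0 hd] hs] := hc t i di.
have [psi [q1 [e e0 q2] q3]] := curve_globalize hs d0.
pose y s := (@chart R (E * E)%type (mtan M) i (c (psi s))).2.
pose w s := (@chart R (E * E)%type (mtan M) i (c (psi s))).1.
have hy : sm setT y by exact: (sm_snd q1).
have hw : sm setT w by exact: (sm_fst q1).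
have yimg s : img i i (y s) by apply: img_chart; exact: hd.
pose k (r s : R) := y s + r *: w s.
have hk : scw k.
  move=> a b ha hb; apply: smD; first by apply: (@sm_comp _ _ setT setT).
  by apply: sm_scal => //; apply: (@sm_comp _ _ setT setT).
have o1 (a b : R -> R^o) : sm setT a -> sm setT b -> open [set r | img i i (k (a r) (b r))].
  by move=> ha hb; apply: (@img_open i i); apply/smooth_curveP; exact: hk.
have o2 : img i i (k 0 t) by rewrite /k scale0r addr0.
have [a a0 ha] := @plane_open R (fun r s => img i i (k r s)) o1 0 t o2.
have [phi [p1 p2 p3]] := smooth_cutoff 0 a0.
have [chi [r1 r2 r3]] := smooth_cutoff t a0.
exists (fun r s => cochart i (k (phi r) (chi s))); split.
  move=> f g hf hg s; apply: (@msm_cochart i (fun r => k (phi (f r)) (chi (g r)))); last by apply: ha.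
  by apply: smooth_near_sm; apply: hk; apply: (@sm_comp _ _ setT setT).
have a4 : 0 < a / 4 by rewrite divr_gt0.
exists (Order.min e (a / 4)); first by rewrite lt_min e0.
move=> s; rewrite lt_min => /andP[se sa].
have dom_s : dom i (c s).2 by rewrite -(q2 s se); exact: hd.
have [c' [h1 [b b0 h2] h3]] := cochart_curve (w s) (yimg s).
rewrite r2 //; have -> : c s = @cochart R (E * E)%type (mtan M) i (w s, y s).
  have [c0 [g1 g2 g3]] := tangent_curve (c s).
  have dg : dom i (c0 0) by rewrite g2.
  rewrite -g3 /w /y q2 // -surjective_pairing -g3 (mtan_chart_velocity (g1 0)) //=.
  rewrite chartK // /velocity; congr (_, _); exact: (vchart (g1 0) dg (dom_at _)).
rewrite h3; apply: (@velocity_ext _ _ _ (Order.min b (a / 4))); first by rewrite lt_min b0.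
by move=> r; rewrite subr0 lt_min => /andP[/h2 -> ra]; rewrite /k p2 // subr0.
Qed.

End ManifoldCurves.

(** * Tangent maps and their functoriality *)

Section TangentMaps.
Variables (R : realType) (E F : tvsType R) (M : premanifold E) (N : premanifold F).
Context {hE : hs E} {hF : hs F}.
Hypotheses (hM : is_manifold M) (hN : is_manifold N).
Implicit Types (f : M -> N).

Definition frep_dom f (k : idx M) (j : idx N) : set E :=
  [set y | img k k y /\ dom j (f (cochart k y))].

Lemma frep_open f k j : smooth_map f -> cinf_open (frep_dom f k j).
Proof.
move=> hf c hc; apply: real_open => t /= [ct dj].
have sc : smooth_near c t by apply: smooth_near_sm; apply/smooth_curveP.
have [d d0 hd] := cinf_open_near (@img_open R E M hM k k) sc ct.
have [psi [p1 p2 p3]] := smooth_cutoff t d0.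
have hcp : msmooth (fun s => cochart k (c (psi s)) : M).
  move=> s; apply: (@msm_cochart R E M hE hM k (fun s => c (psi s))); last exact: hd.
  apply: smooth_near_sm; apply: (@sm_comp _ _ setT setT) => //.
  by apply/smooth_curveP.
have pt : psi t = t by rewrite p2 // subrr normr0 divr_gt0.
have [] := hf _ hcp t j; first by rewrite /= pt.
move=> /nbhs_real[e e0 he] _; exists (Order.min (d / 4) e); first by rewrite lt_min e0 divr_gt0.
move=> s; rewrite lt_min => /andP[sd se]; split; first by apply: hd; lra.
by have := he s se; rewrite /= p2.
Qed.

Lemma frep_smooth f k j : smooth_map f ->
  smooth_on (frep_dom f k j) (chart j \o f \o cochart k).
Proof.
move=> hf c /smooth_curveP hc Uc; apply/smooth_curve_near => t.
have hcp : msmooth (fun s => cochart k (c s) : M).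
  move=> s; apply: (@msm_cochart R E M hE hM k c); last by case: (Uc s).
  exact: smooth_near_sm.
by have [] := hf _ hcp t j (Uc t).2.
Qed.

Lemma velocity_tmap f (c : R -> M) t : smooth_map f -> msmooth c ->
  velocity (f \o c) t = tmap f (velocity c t).
Proof.
move=> hf hc; rewrite /velocity /tmap /=; congr (_, _).
set k := chart_at (c t); set j := chart_at (f (c t)).
have dk : dom k (c t) by exact: dom_at.
have dj : dom j (f (c t)) by exact: dom_at.
have [/nbhs_real[d d0 hd] hk] := hc t k dk.
have U : frep_dom f k j (chart k (c t)).
  by split; [exact: img_chart | rewrite (chartK hM)].
have := @cc_chain R E F hE hF _ _ _ _ (frep_open (k := k) (j := j) hf) (frep_smooth (k := k) (j := j) hf) hk U.
move=> H; apply: isd_cderiv; apply: isd_near d0 _ H => s /hd ds.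
by rewrite /= (chartK hM).
Qed.

Lemma tmap_linear f (x : M) a (u v : E) : smooth_map f ->
  (tmap f (a *: u + v, x)).1 = a *: (tmap f (u, x)).1 + (tmap f (v, x)).1.
Proof.
move=> hf; apply: (@cc_linear R E F hE hF _ _ _ _ _ _ (frep_open (k := chart_at x) (j := chart_at (f x)) hf)).
  exact: frep_smooth.
split; first by apply: img_chart; exact: dom_at.
by rewrite (chartK hM); exact: dom_at.
Qed.

(** Locally a curve in TM consists of velocities of a plot P, and [tmap f] sends them to the
    velocities of the plot f(P). *)
Lemma tmap_smooth f : smooth_map f -> @smooth_map R _ _ (mtan M) (mtan N) (tmap f).
Proof.
move=> hf c hc t.
have [P [hP [d d0 hd]]] := tangent_plot hM t hc.
have hQ : mplot (fun r s => f (P r s)) by move=> a b ha hb; apply: (hf _ (hP a b ha hb)).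
apply: (@msm_ext R _ (mtan N) _ (fun s => velocity (fun r => f (P r s)) 0) _ t d d0); last first.
  exact: (@mplot_velocity R F N hF hN (fun r s => f (P r s)) 0 hQ t).
move=> s /hd e; rewrite /= e; apply: (@velocity_tmap f (P ^~ s) 0 hf); exact: mplot_fst.
Qed.

End TangentMaps.

Section TangentComposition.
Variables (R : realType) (E F H : tvsType R).
Variables (M : premanifold E) (N : premanifold F) (L : premanifold H).
Context {hE : hs E} {hF : hs F} {hH : hs H}.
Hypotheses (hM : is_manifold M) (hN : is_manifold N) (hL : is_manifold L).

Lemma smooth_map_comp (g : N -> L) (f : M -> N) : smooth_map g -> smooth_map f ->
  smooth_map (g \o f).
Proof. by move=> hg hf c /hf; exact: hg. Qed.

Lemma tmap_comp (g : N -> L) (f : M -> N) p : smooth_map g -> smooth_map f ->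
  tmap (g \o f) p = tmap g (tmap f p).
Proof.
move=> hg hf; have [c [hc c0 <-]] := tangent_curve hM p.
have hgf : smooth_map (g \o f) by exact: smooth_map_comp.
have e1 : velocity (f \o c) 0 = tmap f (velocity c 0) by exact: velocity_tmap.
have hfc : msmooth (f \o c) by exact: hf.
have e2 : velocity (g \o (f \o c)) 0 = tmap g (velocity (f \o c) 0) by exact: velocity_tmap.
have e3 : velocity ((g \o f) \o c) 0 = tmap (g \o f) (velocity c 0) by exact: velocity_tmap.
by rewrite -e1 -e2 -e3.
Qed.

End TangentComposition.

(** * Tangent bundles, vector spaces and products as manifolds *)

Section ManifoldConstructions.
Variables (R : realType).
Implicit Types (E F : tvsType R).

Lemma smooth_map_id E (M : premanifold E) : @smooth_map R E E M M id.
Proof. by []. Qed.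

Lemma tmap_id E {hE : hs E} (M : premanifold E) (p : mtan M) : is_manifold M -> tmap id p = p.
Proof. by move=> hM; have [c [hc c0 <-]] := tangent_curve hM p; rewrite -velocity_tmap. Qed.

Lemma smooth_map_cst E {hE : hs E} F {hF : hs F} (M : premanifold E) (N : premanifold F) (y : N) :
  is_manifold N -> @smooth_map R E F M N (fun=> y).
Proof. by move=> hN c hc; exact: msmooth_cst. Qed.

Lemma convenient_prod E F : convenient E -> convenient F -> convenient (E * F : tvsType R)%type.
Proof.
move=> [hE cE] [hF cF]; split; first exact: (@hs_prod R E F hE hF).
move=> x [B [s [bB hs xs]]].
have [|l hl] := cE (fun n => (x n).1).
  exists (fst @` B), s; split=> //.
    move=> U nU; have [|r r0 hr] := bB (U `*` setT).
      by exists (U, setT) => //=; split=> //; exact: filterT.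
    exists r => // _ [b Bb <-]; have [[u v] [/= Uu _] <-] := hr b Bb.
    by exists u.
  by move=> m n; have [b Bb hb] := xs m n; exists b.1; [exists b | rewrite -[LHS]/((x m - x n).1) hb].
have [|l' hl'] := cF (fun n => (x n).2).
  exists (snd @` B), s; split=> //.
    move=> U nU; have [|r r0 hr] := bB (setT `*` U).
      by exists (setT, U) => //=; split=> //; exact: filterT.
    exists r => // _ [b Bb <-]; have [[u v] [/= _ Uv] <-] := hr b Bb.
    by exists v.
  by move=> m n; have [b Bb hb] := xs m n; exists b.2; [exists b | rewrite -[LHS]/((x m - x n).2) hb].
exists (l, l'); have -> : x = (fun n => ((x n).1, (x n).2)) by apply/funext => n; case: (x n).
exact: cvg_pair.
Qed.

Lemma mtan_manifold E (M : premanifold E) : is_manifold M -> is_manifold (mtan M).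
Proof.
move=> hM; have hE := manifold_hs hM.
have fstK (i : idx M) (p : mtan M) : dom i p.2 ->
    @cochart R (E * E)%type (mtan M) i (@chart R (E * E)%type (mtan M) i p) = p.
  move=> di; have [c [hc c0 <-]] := tangent_curve hM p.
  have dc : dom i (c 0) by rewrite c0.
  rewrite (mtan_chart_velocity hM (hc 0) dc) /= (chartK hM dc).
  by rewrite -(vchart hM (hc 0) dc) //; exact: dom_at.
have imgE (i j : idx M) (z : E * E) : @img R E M i j z.2 <-> 
    (@chart R (E * E)%type (mtan M) i @` (@dom R _ (mtan M) i `&` @dom R _ (mtan M) j)) z.
  split=> [hz|[p [/= di dj] <-]]; last exact: img_chart.
  exists (@cochart R (E * E)%type (mtan M) i z).
    by have [d1 d2] := img_dom hM hz; split.
  by case: z hz => w y hz; apply: mtan_cochartK => //; exact: img_sub hz.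
split.
- by apply: convenient_prod; case: hM.
- by move=> p; exact: (dom_at hM p.2).
- exact: fstK.
- move=> i j c hc.
  have -> : c @^-1` (@chart R (E * E)%type (mtan M) i @` (@dom R _ (mtan M) i `&` @dom R _ (mtan M) j)) =
      (fun t => (c t).2) @^-1` @img R E M i j.
    by apply/seteqP; split=> t /= /imgE.
  apply: (img_open hM); apply/smooth_curveP; apply: sm_snd; exact/smooth_curveP.
move=> i j c /smooth_curveP hc Uc.
have Ui t : @img R E M i j (c t).2 by apply/imgE; exact: Uc.
have -> : (@chart R (E * E)%type (mtan M) j \o @cochart R (E * E)%type (mtan M) i) \o c =
   (fun t => (dirder (@chart R E M j \o @cochart R E M i) (c t).2 (c t).1,
     (@chart R E M j \o @cochart R E M i) (c t).2)).
  apply/funext => t; rewrite /=.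
  have hi := img_sub (Ui t).
  have [c' [h1 [d d0 h2] h3]] := cochart_curve hM (c t).1 hi.
  have c0 : c' 0 = @cochart R E M i (c t).2 by rewrite h2 ?normr0 // scale0r addr0.
  have := @mtan_chart_velocity R E M hE hM c' 0 j (h1 0); rewrite -h3 /= c0 => ->; last first.
    by have [_] := img_dom hM (Ui t).
  congr (_, _); apply: (cderiv_ext d0) => s; rewrite subr0 => /h2 /= -> //.
apply/smooth_curveP; apply: sm_pair; last first.
  apply/smooth_curveP; apply: (trans_smooth hM) => //; apply/smooth_curveP; exact: sm_snd.
apply/smooth_curveP.
apply: (@cc_smooth R E E hE hE _ _ (@img_open R E M hM i j) (@trans_smooth R E M hM i j)
   (fun t => ((c t).2, (c t).1))) => //.
by apply/smooth_curveP; apply: sm_pair; [exact: sm_snd | exact: sm_fst].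
Qed.

Lemma mvec_manifold E : convenient E -> is_manifold (mvec E).
Proof.
move=> cE; split=> //.
- move=> i j c hc; have -> : c @^-1` (@chart R E (mvec E) i @` (@dom R E (mvec E) i `&` @dom R E (mvec E) j)) = setT.
    by apply/seteqP; split=> t // _; exists (c t).
  exact: openT.
- by move=> i j c hc _.
Qed.

Lemma msmooth_vec E {hE : hs E} (c : R -> E) : @msmooth R E (mvec E) c <-> sm setT c.
Proof.
split=> [H|H t i _].
  apply/smooth_curveP; apply/smooth_curve_near => t.
  by have [] := H t tt I.
by split; [apply/nbhs_real; exists 1 | exact: smooth_near_sm].
Qed.

Lemma velocity_vec E (c : R -> E) t : @velocity R E (mvec E) c t = (cderiv c t, c t).
Proof. by []. Qed.

Section Products.
Variables (E F : tvsType R) (M : premanifold E) (N : premanifold F).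
Context {hE : hs E} {hF : hs F}.
Hypotheses (hM : is_manifold M) (hN : is_manifold N).

Lemma msmooth_fst (c : R -> M * N) : @msmooth R _ (mprod M N) c -> msmooth (fun t => (c t).1).
Proof.
move=> H t i di; have [|/nbhs_real[d d0 hd] hs] := H t (i, chart_at (c t).2).
  by split=> //; exact: (dom_at hN).
split; first by apply/nbhs_real; exists d => // s /hd [].
have /smooth_nearP[e e0 he] := hs; apply/smooth_nearP; exists e => //.
exact: (sm_fst he).
Qed.

Lemma msmooth_snd (c : R -> M * N) : @msmooth R _ (mprod M N) c -> msmooth (fun t => (c t).2).
Proof.
move=> H t i di; have [|/nbhs_real[d d0 hd] hs] := H t (chart_at (c t).1, i).
  by split=> //; exact: (dom_at hM).
split; first by apply/nbhs_real; exists d => // s /hd [].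
have /smooth_nearP[e e0 he] := hs; apply/smooth_nearP; exists e => //.
exact: (sm_snd he).
Qed.

Lemma msmooth_pair (c : R -> M) (d : R -> N) : msmooth c -> msmooth d ->
  @msmooth R _ (mprod M N) (fun t => (c t, d t)).
Proof.
move=> hc hd t [i j] /= [di dj].
have [/nbhs_real[a a0 ha] /smooth_nearP[b b0 hb]] := hc t i di.
have [/nbhs_real[a' a'0 ha'] /smooth_nearP[b' b'0 hb']] := hd t j dj.
split.
  apply/nbhs_real; exists (Order.min a a'); first by rewrite lt_min a0.
  by move=> s; rewrite lt_min => /andP[/ha h1 /ha' h2]; split.
apply/smooth_nearP; exists (Order.min b b'); first by rewrite lt_min b0.
apply: sm_pair; [apply: sm_sub hb | apply: sm_sub hb'];
  by move=> s /=; rewrite lt_min => /andP[].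
Qed.

Lemma velocity_pair (c : R -> M) (d : R -> N) t : msmooth c -> msmooth d ->
  @velocity R _ (mprod M N) (fun t => (c t, d t)) t =
  (((velocity c t).1, (velocity d t).1), (c t, d t)).
Proof.
move=> hc hd; rewrite /velocity /=; congr (_, _).
apply: isd_cderiv; apply: isd_pair.
  exact: (isd_chart (hc t) (dom_at hM _)).
exact: (isd_chart (hd t) (dom_at hN _)).
Qed.

Lemma mprod_manifold : is_manifold (mprod M N).
Proof.
have imgE (i j : idx M * idx N) (z : E * F) : (@img R E M i.1 j.1 z.1 /\ @img R F N i.2 j.2 z.2) <->
   (@chart R _ (mprod M N) i @` (@dom R _ (mprod M N) i `&` @dom R _ (mprod M N) j)) z.
  split=> [[[x [h1 h2] h3] [y [h4 h5] h6]]|[[x y] [[/= h1 h2] [/= h3 h4]] <-]].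
    by exists (x, y); [split; split | rewrite /= h3 h6; case: (z)].
  by split; exact: img_chart.
have [cE _ _ _ _] := hM; have [cF _ _ _ _] := hN.
split.
- exact: convenient_prod.
- by move=> p; split; exact: dom_at.
- by move=> i [x y] [/= d1 d2]; rewrite !chartK.
- move=> i j c /smooth_curveP hc.
  have -> : c @^-1` (@chart R _ (mprod M N) i @` (@dom R _ (mprod M N) i `&` @dom R _ (mprod M N) j)) =
     ((fun t => (c t).1) @^-1` @img R E M i.1 j.1) `&` ((fun t => (c t).2) @^-1` @img R F N i.2 j.2).
    by apply/seteqP; split=> t /= /imgE.
  apply: openI; [apply: (img_open hM) | apply: (img_open hN)]; apply/smooth_curveP.
    exact: sm_fst.
  exact: sm_snd.
move=> i j c /smooth_curveP hc Uc; apply/smooth_curveP.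
have U t : @img R E M i.1 j.1 (c t).1 /\ @img R F N i.2 j.2 (c t).2 by apply/imgE; exact: Uc.
apply: (@sm_pair R E F setT (fun t => (chart j.1 \o cochart i.1) (c t).1)
   (fun t => (chart j.2 \o cochart i.2) (c t).2)).
  apply/smooth_curveP; apply: (trans_smooth hM); last by move=> t; case: (U t).
  by apply/smooth_curveP; exact: sm_fst.
apply/smooth_curveP; apply: (trans_smooth hN); last by move=> t; case: (U t).
by apply/smooth_curveP; exact: sm_snd.
Qed.

End Products.
End ManifoldConstructions.

(** * Derivatives of plots in a manifold *)

Section ManifoldPlots.
Variables (R : realType) (E : tvsType R) (M : premanifold E).
Context {hE : hs E}.
Hypothesis hM : is_manifold M.

Lemma velocity0_const (c : R -> M) : msmooth c -> (forall t, (velocity c t).1 = 0) ->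
  forall a b, c a = c b.
Proof.
move=> hc v0; suff H a b : a <= b -> c b = c a.
  by move=> a b; case: (leP a b) => [/H|/ltW/H].
move=> ab; apply: (@real_induction R (fun t => c t = c a) a b) => // t _ _.
pose i := chart_at (c t); have di : dom i (c t) by exact: dom_at.
have [/nbhs_real[d d0 hd] _] := hc t i di.
exists d => // s u _ st tu _ ds ud <-.
have dr r : s <= r -> r <= u -> `|r - t| < d.
  by move=> sr ru; rewrite ltr_norml; apply/andP; split; lra.
have su : s <= u by lra.
suff e : chart i (c u) = chart i (c s).
  have h1 := hd _ (dr _ su (lexx _)); have h2 := hd _ (dr _ (lexx _) su).
  by rewrite -(chartK hM h1) e (chartK hM h2).
apply: (@isd0_const R E hE (chart i \o c) s u su) => r sr ru.
have dir := hd _ (dr _ sr ru).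
have := @isd_chart R E M hE _ _ _ (hc r) dir; rewrite (vchart hM (hc r) (dom_at hM _) dir).
have := v0 r; rewrite /velocity /= => ->.
by rewrite (@dirder0 R E E hE hE _ _ _ (@img_open R E M hM _ i) (@trans_smooth R E M hM _ i)
  (img_chart (dom_at hM _) dir)).
Qed.

Lemma mplot_diag (P : R -> R -> M) x : mplot P ->
  (velocity (fun t => P t t) x).1 = (velocity (P ^~ x) x).1 + (velocity (P x) x).1.
Proof.
move=> hP; pose i := chart_at (P x x); have di : dom i (P x x) by exact: dom_at.
have [K [d d0 [hK KE]]] := mplot_chart hP di.
have z : `|x - x| < d by rewrite subrr normr0.
rewrite /velocity /=.
have -> : cderiv (chart i \o P ^~ x) x = cderiv (K ^~ x) x.
  by apply: (cderiv_ext d0) => s sd; have [_ e] := KE s x sd z; rewrite /= e.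
have -> : cderiv (chart i \o P x) x = cderiv (K x) x.
  by apply: (cderiv_ext d0) => s sd; have [_ e] := KE x s z sd; rewrite /= e.
have H := @scw_diag R E hE K x x hK.
apply: isd_cderiv; apply: (@isd_near R E (fun t => K t t) _ _ _ d) => //.
  by move=> s sd; have [_ e] := KE s s sd sd; rewrite /= e.
by apply/isd_translate.
Qed.

Lemma mplot_sym (P : R -> R -> M) x y i : mplot P -> dom i (P x y) ->
  cderiv (fun t => cderiv (fun s => chart i (P s t)) x) y =
  cderiv (fun s => cderiv (fun t => chart i (P s t)) y) x.
Proof.
move=> hP di; have [K [d d0 [hK KE]]] := mplot_chart hP di.
transitivity (cderiv (fun t => cderiv (K ^~ t) x) y).
  apply: (cderiv_ext d0) => t td; apply: (cderiv_ext d0) => s sd.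
  by have [_ ->] := KE s t sd td.
rewrite scw_sym //; apply: (cderiv_ext d0) => s sd; apply: (cderiv_ext d0) => t td.
by have [_ ->] := KE s t sd td.
Qed.

Lemma msmooth_fiber (Y : R -> E) (x : M) : sm setT Y ->
  @msmooth R _ (mtan M) (fun t => ((Y t, x) : mtan M)).
Proof.
move=> hY t i di; split; first by apply/nbhs_real; exists 1.
have hx := img_chart (dom_at hM x) di.
apply: (@smooth_near_ext R _ _ (fun t => (dirder (@chart R E M i \o @cochart R E M (chart_at x)) (chart (chart_at x) x) (Y t), @chart R E M i x)) _ _ 1) => //.
apply: smooth_near_sm; apply: sm_pair; last exact: sm_cst.
apply/smooth_curveP.
apply: (@cc_smooth R E E hE hE _ _ (@img_open R E M hM (chart_at x) i) (@trans_smooth R E M hM _ i)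
  (fun t => (chart (chart_at x) x, Y t))) => //.
by apply/smooth_curveP; apply: sm_pair => //; exact: sm_cst.
Qed.

Lemma msmooth_foot (p : R -> mtan M) : @msmooth R _ (mtan M) p -> msmooth (fun t => (p t).2).
Proof.
move=> hp t i di; have [h1 /smooth_nearP[d d0 h2]] := hp t i di; split=> //.
by apply/smooth_nearP; exists d => //; exact: (sm_snd h2).
Qed.

Lemma smooth_fiber_part (p : R -> mtan M) (x : M) : @msmooth R _ (mtan M) p ->
  (forall t, (p t).2 = x) -> sm setT (fun t => (p t).1).
Proof.
move=> hp px; apply/smooth_curveP; apply/smooth_curve_near => t.
have dx : @dom R _ (mtan M) (chart_at x) (p t) by rewrite /= px; exact: dom_at.
have [_ /smooth_nearP[d d0 h]] := hp t _ dx; apply/smooth_nearP; exists d => //.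
apply: sm_ext (@open_ballR R t d) _ (sm_fst h) => s _ /=.
by rewrite px (dirder_id hM) //; apply: img_chart; exact: dom_at.
Qed.

End ManifoldPlots.

(** * The right logarithmic derivative of curves in a Lie group *)

Section LieGroupCalculus.
Variables (R : realType) (E : tvsType R) (G : prelie E).
Context {hE : hs E}.
Hypothesis hG : is_lie_group G.
Local Notation "x ** y" := (@gmul R E G x y) (at level 40, left associativity).
Local Notation inv := (@ginv R E G).
Local Notation one := (gone G).
Implicit Types (x y z g h : G) (a b c : R -> G).

Lemma lie_manifold : is_manifold G. Proof. by case: hG. Qed.
Let hM := lie_manifold.

Lemma gmulA x y z : x ** (y ** z) = x ** y ** z. Proof. by case: hG => _ []. Qed.
Lemma gmul1g x : one ** x = x. Proof. by case: hG => _ [_ h _ _ _]; case: (h x). Qed.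
Lemma gmulg1 x : x ** one = x. Proof. by case: hG => _ [_ h _ _ _]; case: (h x). Qed.
Lemma gmulVg x : inv x ** x = one. Proof. by case: hG => _ [_ _ h _ _]; case: (h x). Qed.
Lemma gmulgV x : x ** inv x = one. Proof. by case: hG => _ [_ _ h _ _]; case: (h x). Qed.
Lemma gmulK x y : x ** y ** inv y = x. Proof. by rewrite -gmulA gmulgV gmulg1. Qed.
Lemma gmulVK x y : x ** inv y ** y = x. Proof. by rewrite -gmulA gmulVg gmulg1. Qed.
Lemma gmulKg x y : inv x ** (x ** y) = y. Proof. by rewrite gmulA gmulVg gmul1g. Qed.
Lemma gmulI x y z : x ** y = x ** z -> y = z.
Proof. by move=> e; rewrite -(gmulKg x y) e gmulKg. Qed.
Lemma ginv1 : inv one = one. Proof. by rewrite -[LHS]gmulg1 gmulVg. Qed.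
Lemma ginvM x y : inv (x ** y) = inv y ** inv x.
Proof. by apply: (@gmulI (x ** y)); rewrite gmulgV gmulA gmulK gmulgV. Qed.
Lemma ginvK x : inv (inv x) = x.
Proof. by apply: (@gmulI (inv x)); rewrite gmulgV gmulVg. Qed.

Lemma msmoothM a b : msmooth a -> msmooth b -> msmooth (fun t => a t ** b t).
Proof.
move=> ha hb; case: hG => _ [_ _ _ h _].
by have := h (fun t => (a t, b t)); apply; exact: msmooth_pair.
Qed.

Lemma msmoothV a : msmooth a -> msmooth (fun t => inv (a t)).
Proof. by move=> ha; case: hG => _ [_ _ _ _ h]; exact: (h a). Qed.

Lemma smooth_lmul g : @smooth_map R E E G G (gmul g).
Proof. by move=> c hc; apply: msmoothM hc; exact: msmooth_cst. Qed.

Lemma smooth_rmul g : @smooth_map R E E G G (fun h => h ** g).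
Proof. by move=> c hc; apply: (msmoothM hc); exact: msmooth_cst. Qed.

Lemma smooth_conj g : @smooth_map R E E G G (fun h => g ** h ** inv g).
Proof.
move=> c hc; apply: (@msmoothM (fun t => g ** c t) (fun=> inv g)); last exact: msmooth_cst.
exact: (@smooth_lmul g c hc).
Qed.

Lemma mplotM (P Q : R -> R -> G) : mplot P -> mplot Q -> mplot (fun s t => P s t ** Q s t).
Proof. by move=> hP hQ a b ha hb; apply: msmoothM; [exact: hP | exact: hQ]. Qed.

Lemma mplotV (P : R -> R -> G) : mplot P -> mplot (fun s t => inv (P s t)).
Proof. by move=> hP a b ha hb; apply: msmoothV; exact: hP. Qed.

Lemma mplot_s (c : R -> G) : msmooth c -> mplot (fun s _ => c s).
Proof. by move=> hc a b ha hb; apply: msmooth_reparam. Qed.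

Lemma mplot_t (c : R -> G) : msmooth c -> mplot (fun _ t => c t).
Proof. by move=> hc a b ha hb; apply: msmooth_reparam. Qed.

Lemma mplot_cst g : mplot (fun _ _ => g).
Proof. by move=> a b _ _; exact: msmooth_cst. Qed.

Definition rv c t : E := kappa (velocity c t).

Lemma rvE c t : msmooth c -> velocity (fun s => c s ** inv (c t)) t = ((rv c t, one) : mtan G).
Proof.
move=> hc; rewrite /rv /kappa.
have e : velocity ((fun h => h ** inv (c t)) \o c) t = tmap (fun h => h ** inv (c t)) (velocity c t).
  by apply: velocity_tmap => //; exact: smooth_rmul.
rewrite -[LHS]/(velocity ((fun h => h ** inv (c t)) \o c) t) e.
by rewrite [LHS]surjective_pairing; congr (_, _); rewrite /= gmulgV.
Qed.

Lemma tmap_rmulK g (p : mtan G) : tmap (fun h => h ** g) (tmap (fun h => h ** inv g) p) = p.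
Proof.
rewrite -(@tmap_comp R E E E G G G) //; try exact: smooth_rmul.
have -> : (fun h => h ** g) \o (fun h => h ** inv g) = id.
  by apply/funext => h /=; rewrite gmulVK.
exact: tmap_id.
Qed.

Lemma tmap_rmul_kappa (p : mtan G) : tmap (fun h => h ** p.2) ((kappa p, one) : mtan G) = p.
Proof.
rewrite -[RHS](tmap_rmulK p.2); congr (tmap _ _).
by rewrite [RHS]surjective_pairing; congr (_, _); rewrite /= gmulgV.
Qed.

Lemma tmap_rmulVK g (p : mtan G) : tmap (fun h => h ** inv g) (tmap (fun h => h ** g) p) = p.
Proof.
rewrite -(@tmap_comp R E E E G G G) //; try exact: smooth_rmul.
have -> : (fun h => h ** inv g) \o (fun h => h ** g) = id.
  by apply/funext => h /=; rewrite gmulK.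
exact: tmap_id.
Qed.

Lemma kappaK (X : E) g : kappa (tmap (fun h => h ** g) ((X, one) : mtan G)) = X.
Proof.
rewrite /kappa; have -> : (tmap (fun h => h ** g) ((X, one) : mtan G)).2 = g by exact: gmul1g.
by rewrite tmap_rmulVK.
Qed.

Lemma velocity_rv c t : velocity c t = tmap (fun h => h ** c t) ((rv c t, one) : mtan G).
Proof. by rewrite -[LHS]tmap_rmul_kappa. Qed.

(** Right trivialization turns the evolution equation into a prescription of the logarithmic
    derivative; this form is used from here on. *)
Lemma is_EvolP (X : R -> E) c : is_Evol X c <->
  [/\ msmooth c, c 0 = one & forall t, rv c t = X t].
Proof.
split=> -[h1 h2 h3]; split=> // t; last by rewrite velocity_rv h3.
by rewrite /rv h3 kappaK.
Qed.

Lemma Ad_linear g u (X Y : E) : Ad g (u *: X + Y) = u *: Ad g X + Ad g Y.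
Proof. by apply: (tmap_linear hM hM); exact: smooth_conj. Qed.

Lemma Ad0 g : Ad g (0 : E) = 0.
Proof. by have := Ad_linear g (-1) 0 0; rewrite scaler0 addr0 scaleN1r addNr. Qed.

Lemma AdD g (X Y : E) : Ad g (X + Y) = Ad g X + Ad g Y.
Proof. by have := Ad_linear g 1 X Y; rewrite !scale1r. Qed.

Lemma AdZ g u (X : E) : Ad g (u *: X) = u *: Ad g X.
Proof. by have := Ad_linear g u X 0; rewrite Ad0 !addr0. Qed.

Lemma AdN g (X : E) : Ad g (- X) = - Ad g X.
Proof. by rewrite -scaleN1r AdZ scaleN1r. Qed.

Lemma AdE g (X : E) : tmap (fun h => g ** h ** inv g) ((X, one) : mtan G) = ((Ad g X, one) : mtan G).
Proof. by rewrite [LHS]surjective_pairing; congr (_, _); rewrite /= gmulg1 gmulgV. Qed.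

Lemma Ad1 (X : E) : Ad one X = X.
Proof.
rewrite /Ad; have -> : (fun h => one ** h ** inv one) = id.
  by apply/funext => h; rewrite gmul1g ginv1 gmulg1.
by rewrite tmap_id.
Qed.

Lemma AdM g h (X : E) : Ad (g ** h) X = Ad g (Ad h X).
Proof.
rewrite {2}/Ad -AdE -(@tmap_comp R E E E G G G) //; try exact: smooth_conj.
by rewrite /Ad; congr (tmap _ _).1; apply/funext => k /=; rewrite ginvM !gmulA.
Qed.

Lemma AdK g (X : E) : Ad (inv g) (Ad g X) = X.
Proof. by rewrite -AdM gmulVg Ad1. Qed.

Lemma AdVK g (X : E) : Ad g (Ad (inv g) X) = X.
Proof. by rewrite -AdM gmulgV Ad1. Qed.

(** Apply the diagonal rule to a(s) b(r) (a(t) b(t))^-1: in s it is a translate of a, in r a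
    conjugate by a(t) of a translate of b. The rule is what makes right trivialization a
    homomorphism ([rtriv_morph]). *)
Lemma rvM a b t : msmooth a -> msmooth b ->
  rv (fun s => a s ** b s) t = rv a t + Ad (a t) (rv b t).
Proof.
move=> ha hb; have hab := msmoothM ha hb.
have := congr1 fst (rvE t hab); rewrite /= => <-.
pose P s r := a s ** b r ** inv (a t ** b t).
have hP : mplot P.
  by apply: mplotM; [apply: mplotM; [exact: mplot_s | exact: mplot_t] | exact: mplot_cst].
transitivity (velocity (fun s => P s s) t).1; first by [].
rewrite (mplot_diag hM t hP); congr (_ + _).
  have -> : P ^~ t = (fun s => a s ** inv (a t)).
    by apply/funext => s; rewrite /P ginvM gmulA gmulK.
  by rewrite rvE.
have -> : P t = (fun h => a t ** h ** inv (a t)) \o (fun s => b s ** inv (b t)).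
  by apply/funext => s; rewrite /P /= ginvM !gmulA.
have hbt : msmooth (fun s => b s ** inv (b t)) by exact: smooth_rmul.
rewrite (velocity_tmap hM hM) //; last exact: smooth_conj.
by rewrite rvE // AdE.
Qed.

Lemma rv_cst g t : rv (fun=> g) t = 0.
Proof.
have e := congr1 fst (@rvE (fun=> g) t (msmooth_cst hM (x := g))).
by rewrite velocity_cst in e; rewrite -[LHS]/((rv (fun=> g) t, one).1) -e.
Qed.

Lemma rvV a t : msmooth a -> rv (fun s => inv (a s)) t = - Ad (inv (a t)) (rv a t).
Proof.
move=> ha; apply/eqP; rewrite -addr_eq0 -(rvM t (msmoothV ha) ha).
by under eq_fun do rewrite gmulVg; rewrite rv_cst.
Qed.

Lemma rv_rmul a g t : msmooth a -> rv (fun s => a s ** g) t = rv a t.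
Proof.
by move=> ha; rewrite (rvM t ha (msmooth_cst hM (x := g))) rv_cst Ad0 addr0.
Qed.

(** The product rule shows that a^-1 b has zero velocity, so it is constant. *)
Lemma rv_unique a b : msmooth a -> msmooth b -> (forall t, rv a t = rv b t) ->
  a 0 = b 0 -> forall t, a t = b t.
Proof.
move=> ha hb ab ab0 t; pose c s := inv (a s) ** b s.
have hc : msmooth c by apply: msmoothM => //; exact: msmoothV.
have e : c t = c 0.
  apply: (velocity0_const hM hc) => s; rewrite velocity_rv.
  rewrite /c (rvM s (msmoothV ha) hb) rvV // ab addNr.
  by have := @tmap_linear R E E G G hE hE hM hM _ one (-1) 0 0 (@smooth_rmul (c s));
     rewrite scaler0 addr0 scaleN1r addNr.
by rewrite -[RHS](gmulKg (inv (a t))) ginvK -/(c t) e /c ab0 gmulVg gmulg1.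
Qed.

(** Locally p consists of velocities of a plot P at r = 0. Those of P(r, s) P(0, s)^-1 lie over the
    unit, and their fibre part is [kappa] of p. *)
Lemma kappa_smooth (p : R -> mtan G) : @msmooth R _ (mtan G) p -> sm setT (fun t => kappa (p t)).
Proof.
move=> hp; apply/smooth_curveP; apply/smooth_curve_near => t.
have [P [hP [d d0 hd]]] := tangent_plot hM t hp.
pose Q r s := P r s ** inv (P 0 s).
have hQ : mplot Q.
  apply: mplotM => //; apply: mplotV; apply: mplot_t; exact: mplot_snd.
apply: (@smooth_near_ext R E _ (fun s => (velocity (Q ^~ s) 0).1) _ _ d) => //.
  move=> s /hd ->; rewrite -[RHS]/(rv (P ^~ s) 0).
  by have := congr1 fst (rvE 0 (@mplot_fst R E G P s hP)).
apply: smooth_near_sm; apply: (@smooth_fiber_part R E G hE hM _ one).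
  exact: mplot_velocity.
by move=> s; rewrite /= /Q gmulgV.
Qed.

Lemma scw_rv1 (P : R -> R -> G) : mplot P -> scw (fun s t => rv (P ^~ t) s).
Proof.
move=> hP a b ha hb.
have hQ : mplot (fun r s => P (a s + r) (b s)).
  move=> f g hf hg; apply: hP; last exact: (@sm_comp _ _ setT setT).
  by apply: smD => //; exact: (@sm_comp _ _ setT setT).
have := kappa_smooth (@mplot_velocity R E G hE hM _ 0 hQ).
apply: sm_ext openT _ => t _; rewrite /rv; congr kappa; rewrite /velocity addr0; congr (_, _).
rewrite /cderiv; congr (xget _ _); apply/seteqP; split=> l /= /diffquotP H; apply/diffquotP.
  by apply/isd_translate.
by apply/(isd_translate (chart (chart_at (P (a t) (b t))) \o P ^~ (b t))).
Qed.

Lemma scw_rv2 (P : R -> R -> G) : mplot P -> scw (fun s t => rv (P s) t).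
Proof. by move=> /mplot_swap/scw_rv1 H a b ha hb; exact: H. Qed.

Lemma Ad_smooth (g : R -> G) (Y : R -> E) : msmooth g -> sm setT Y -> sm setT (fun t => Ad (g t) (Y t)).
Proof.
move=> hg hY; apply/smooth_curveP; apply/smooth_curve_near => t.
have [P [hP [d d0 hd]]] := tangent_plot hM t (msmooth_fiber hM hY (x := one)).
pose Q r s := g s ** P r s ** inv (g s).
have hQ : mplot Q.
  apply: mplotM; first by apply: mplotM => //; exact: mplot_t.
  by apply: mplotV; exact: mplot_t.
have hk := kappa_smooth (@mplot_velocity R E G hE hM _ 0 hQ).
apply: (@smooth_near_ext R E _ (fun s => kappa (velocity (Q ^~ s) 0)) _ _ d) => //; last first.
  exact: smooth_near_sm.
move=> s /hd e.
have -> : velocity (Q ^~ s) 0 = tmap (fun h => g s ** h ** inv (g s)) (velocity (P ^~ s) 0).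
  apply: (@velocity_tmap R E E G G hE hE hM hM _ (P ^~ s)); first exact: smooth_conj.
  exact: mplot_fst.
rewrite -e AdE; have := kappaK (Ad (g s) (Y s)) one.
have -> : (fun h => h ** one) = id by apply/funext => h; exact: gmulg1.
by rewrite tmap_id.
Qed.

End LieGroupCalculus.

(** * Linear maps that preserve smooth curves *)

Section LinearSmooth.
Variables (R : realType) (E F : tvsType R).
Context {hE : hs E} {hF : hs F}.

(** The convenient chain rule takes the place of the seminorm bounds that [isd_linear] asks for; it
    is applied to Ad(g) and to the bracket in one argument. *)
Lemma isd_smooth_linear (L : E -> F) (c : R -> E) t l :
  (forall a u v, L (a *: u + v) = a *: L u + L v) ->
  (forall c : R -> E, sm setT c -> sm setT (fun t => L (c t))) ->
  smooth_near c t -> isd c t l -> isd (fun s => L (c s)) t (L l).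
Proof.
move=> Ll Ls hc hl.
have oT : cinf_open (@setT E) by move=> d hd; rewrite preimage_setT; exact: openT.
have sL : smooth_on (@setT E) L.
  by move=> d /smooth_curveP hd _; apply/smooth_curveP; exact: Ls.
have := @cc_chain' R E F hE hF _ _ _ _ _ oT sL hc I hl.
have -> : dirder L (c t) l = L l; last exact.
apply: isd_cderiv; apply: (@isd_near _ _ (fun s => s *: L l + L (c t)) _ _ _ 1) => //.
  by move=> s _; rewrite [c t + _]addrC Ll.
apply: isd_eq (isdD (isd_scal (isd_id 0) (isd_cst _ 0)) (isd_cst _ 0)) _.
by rewrite scale1r scaler0 !addr0.
Qed.

End LinearSmooth.

(** * The Maurer-Cartan equation on plots *)

Section MaurerCartan.
Variables (R : realType) (E : tvsType R) (G : prelie E).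
Context {hE : hs E}.
Hypothesis hG : is_lie_group G.
Local Notation "x ** y" := (@gmul R E G x y) (at level 40, left associativity).
Local Notation inv := (@ginv R E G).
Local Notation one := (gone G).
Let hM := lie_manifold hG.
Let i0 : idx G := chart_at one.

Lemma tmap_id_rmul (p : mtan G) : tmap (fun h => h ** one) p = p.
Proof.
have -> : (fun h => h ** one) = id by apply/funext => h; exact: gmulg1.
exact: tmap_id.
Qed.

Lemma kappa_one (X : E) : kappa ((X, one) : mtan G) = X.
Proof. by have := @kappaK R E G hE hG X one; rewrite tmap_id_rmul. Qed.

Lemma rv_one (c : R -> G) t : c t = one -> rv c t = (velocity c t).1.
Proof.
move=> ct; rewrite /rv [velocity c t]surjective_pairing.
by rewrite -[(velocity c t).2]/(c t) ct kappa_one.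
Qed.

Lemma curve_at_one (X : E) : exists q : R -> G,
  [/\ msmooth q, q 0 = one, velocity q 0 = ((X, one) : mtan G) & rv q 0 = X].
Proof.
have [q [h1 h2 h3]] := tangent_curve hM ((X, one) : mtan G).
by exists q; split=> //; rewrite rv_one // h3.
Qed.

Lemma left_field_smooth (X : E) : @smooth_map R _ _ G (mtan G) (left_field X).
Proof.
move=> g hg; have [q [hq q0 vq _]] := curve_at_one X.
have hP : mplot (fun r t => g t ** q r) by apply: mplotM => //; [exact: mplot_t | exact: mplot_s].
have -> : @left_field R E G X \o g = (fun t => velocity (fun r => g t ** q r) 0).
  apply/funext => t; rewrite /= /left_field -vq.
  by apply/esym; apply: (@velocity_tmap R E E G G hE hE hM hM _ q) => //; exact: smooth_lmul.
exact: (@mplot_velocity R E G hE hM _ 0 hP).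
Qed.

Lemma left_loc_smooth (X : E) : smooth_on (img i0 i0) (vfield_loc (@left_field R E G X) i0).
Proof.
move=> y /smooth_curveP hy Uy; apply/smooth_curve_near => t.
have hg : msmooth (fun s => cochart i0 (y s) : G).
  by move=> s; apply: (@msm_cochart R E G hE hM i0 y); [exact: smooth_near_sm | exact: Uy].
have dg : dom i0 (cochart i0 (y t)) by case: (img_dom hM (Uy t)).
have [_ /smooth_nearP[d d0 h]] := left_field_smooth (X := X) hg (t := t) (i := i0) ltac:(by rewrite /= gmulg1).
by apply/smooth_nearP; exists d => //; exact: (sm_fst h).
Qed.

(** The derivative at the unit of the left invariant field of [Y] in direction [X], in the chart at
    the unit; antisymmetrized it is the bracket. *)
Definition LL (X Y : E) : E := dirder (vfield_loc (@left_field R E G Y) i0) (chart i0 one) X.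

Lemma left_loc_one (X : E) : vfield_loc (@left_field R E G X) i0 (chart i0 one) = X.
Proof.
rewrite /vfield_loc (chartK hM); last exact: dom_at.
rewrite /left_field; have -> : gmul one = id by apply/funext => h; exact: gmul1g.
by rewrite (tmap_id _ hM) (mtan_self hM ((X, one) : mtan G)).
Qed.

Lemma lie_bracketE (X Y : E) : lie_bracket G X Y = LL X Y - LL Y X.
Proof. by rewrite /lie_bracket /vfield_bracket !left_loc_one. Qed.

(** The inner derivative is the left invariant field of the velocity of p, taken at q(t); the outer
    one differentiates that field along q. *)
Lemma mixed_LL (q p : R -> G) (s0 t0 : R) : msmooth q -> msmooth p ->
  q t0 = one -> p s0 = one ->
  cderiv (fun t => cderiv (fun s => chart i0 (q t ** p s)) s0) t0
  = LL (velocity q t0).1 (velocity p s0).1.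
Proof.
move=> hq hp q1 p1.
have di : dom i0 (q t0) by rewrite q1; exact: dom_at.
have [/nbhs_real[d d0 hd] hu] := hq t0 i0 di.
have inner t : `|t - t0| < d -> cderiv (fun s => chart i0 (q t ** p s)) s0 =
    vfield_loc (@left_field R E G (velocity p s0).1) i0 (chart i0 (q t)).
  move=> /hd dt; rewrite /vfield_loc (chartK hM dt).
  have hqp : msmooth (fun s => q t ** p s) by exact: (@smooth_lmul R E G hE hG (q t) p hp).
  have e : velocity (fun s => q t ** p s) s0 = left_field (velocity p s0).1 (q t).
    have -> : velocity (fun s => q t ** p s) s0 = tmap (gmul (q t)) (velocity p s0).
      by apply: (@velocity_tmap R E E G G hE hE hM hM _ p) => //; exact: smooth_lmul.
    by rewrite /left_field -{1}p1.
  have := @mtan_chart_velocity R E G hE hM _ _ i0 (hqp s0); rewrite e => -> //.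
  by rewrite p1 gmulg1.
rewrite (cderiv_ext d0 inner).
have U : img i0 i0 (chart i0 (q t0)) by exact: img_chart.
have oU := @img_open R E G hM i0 i0.
have := @cc_chain R E E hE hE _ _ _ _ oU (@left_loc_smooth (velocity p s0).1) hu U.
by move=> /isd_cderiv ->; rewrite /LL /velocity /= q1.
Qed.

Definition kloc (z : E * E) : E := kappa (@cochart R _ (mtan G) i0 z).

Lemma kloc_open : cinf_open [set z : E * E | img i0 i0 z.2].
Proof.
move=> c /smooth_curveP hc; apply: (@img_open R E G hM i0 i0 (fun t => (c t).2)).
by apply/smooth_curveP; exact: sm_snd.
Qed.

Lemma kloc_smooth : smooth_on [set z : E * E | img i0 i0 z.2] kloc.
Proof.
move=> z /smooth_curveP hz Uz; apply/smooth_curveP; apply: (kappa_smooth hG).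
move=> t; apply: (@msm_cochart R _ (mtan G) _ (mtan_manifold hM) i0 z).
  exact: smooth_near_sm.
exists (@cochart R _ (mtan G) i0 (z t)).
  by have [] := img_dom hM (Uz t); split.
by case: (z t) (Uz t) => w y hy; apply: mtan_cochartK.
Qed.

Lemma kloc_one (v : E) : kloc (v, chart i0 one) = v.
Proof.
rewrite /kloc /= (chartK hM) ?(dirder_id hM) ?kappa_one //; last exact: dom_at.
by apply: img_chart; exact: dom_at.
Qed.

(** The derivative of [kappa] in the chart splits into a fibre part, where [kappa] is the identity
    over the unit, and a footpoint part. The latter is left unevaluated, as [maurer_cartan_half]
    cancels it. *)
Lemma kappa_deriv (V : R -> mtan G) s0 : @msmooth R _ (mtan G) V -> (V s0).2 = one ->
  isd (fun s => kappa (V s)) s0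
    (cderiv (fun s => (@chart R _ (mtan G) i0 (V s)).1) s0 +
     dirder kloc ((V s0).1, chart i0 one) (0, cderiv (fun s => chart i0 (V s).2) s0)).
Proof.
move=> hV V1; have di : @dom R _ (mtan G) i0 (V s0) by rewrite /= V1; exact: dom_at.
have [/nbhs_real[d d0 hd] hu] := hV s0 i0 di.
have V0 : @chart R _ (mtan G) i0 (V s0) = ((V s0).1, chart i0 one).
  by have := @mtan_self R E G hE hM (V s0); rewrite V1.
have U : [set z : E * E | img i0 i0 z.2] (@chart R _ (mtan G) i0 (V s0)).
  by rewrite V0 /=; apply: img_chart; exact: dom_at.
have hd1 : isd (@chart R _ (mtan G) i0 \o V) s0 (cderiv (@chart R _ (mtan G) i0 \o V) s0).
  exact: smooth_near_isd.
have D1 := isd_fst hd1; have D2 := isd_snd hd1.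
have H := @cc_chain R _ E (@hs_prod R E E hE hE) hE _ _ _ _ kloc_open kloc_smooth hu U.
have H2 : isd (fun s => kappa (V s)) s0
    (dirder kloc ((V s0).1, chart i0 one) (cderiv (@chart R _ (mtan G) i0 \o V) s0)).
  rewrite -V0; apply: isd_near d0 _ H => s /hd ds /=; rewrite /kloc.
  by congr kappa; exact: (chartK (mtan_manifold hM) ds).
apply: isd_eq H2 _; rewrite (isd_cderiv D1) (isd_cderiv D2).
set W := cderiv _ s0.
have WE : W = 1 *: (W.1, 0) + (0, W.2).
  by rewrite scale1r -[RHS]/(W.1 + 0, 0 + W.2) addr0 add0r -surjective_pairing.
rewrite V0 /= in U; rewrite {1}WE.
rewrite (@cc_linear R _ E (@hs_prod R E E hE hE) hE _ _ ((V s0).1, chart i0 one) _ _ _ kloc_open kloc_smooth U) scale1r; congr (_ + _).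
rewrite /dirder; apply: isd_cderiv; apply: (@isd_near _ _ (fun t => (V s0).1 + t *: W.1) _ _ _ 1) => //.
  move=> t _; rewrite -[(_, _) + _]/((V s0).1 + t *: W.1, chart i0 one + t *: 0).
  by rewrite scaler0 addr0 kloc_one.
apply: isd_eq (isdD (isd_cst _ 0) (isd_scal (isd_id 0) (isd_cst _ 0))) _.
by rewrite add0r scale1r scaler0 addr0.
Qed.

(** Compare P with Q(s, t) = P(s0, t) P(s, t0). Both have the same first order data at (s0, t0),
    hence the same footpoint term in [kappa_deriv]; but the t-logarithmic derivative of Q is
    constant in s by right invariance, and its mixed second derivative is an [LL] term. *)
Lemma maurer_cartan_half (P : R -> R -> G) s0 t0 : mplot P -> P s0 t0 = one ->
  cderiv (fun s => rv (P s) t0) s0 =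
  cderiv (fun s => cderiv (fun t => chart i0 (P s t)) t0) s0
  - LL (rv (P s0) t0) (rv (P ^~ t0) s0).
Proof.
move=> hP P1; have hP' := mplot_swap hP.
have hq : msmooth (P s0) by exact: mplot_snd.
have hp : msmooth (P ^~ t0) by exact: mplot_fst.
pose Q s t := P s0 t ** P s t0.
have hQ : mplot Q by apply: mplotM => //; [exact: mplot_t | exact: mplot_s].
have hV : @msmooth R _ (mtan G) (fun s => velocity (P s) t0).
  exact: (@mplot_velocity R E G hE hM _ t0 hP').
have hW : @msmooth R _ (mtan G) (fun s => velocity (Q s) t0).
  exact: (@mplot_velocity R E G hE hM _ t0 (mplot_swap hQ)).
have Q1 : Q s0 t0 = one by rewrite /Q P1 gmulg1.
have HV := kappa_deriv hV P1; have HW := kappa_deriv hW Q1.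
have QP : Q s0 = P s0 by apply/funext => t; rewrite /Q P1 gmulg1.
have QPt s : Q s t0 = P s t0 by rewrite /Q P1 gmul1g.
have wE (S : R -> R -> G) : mplot S -> S s0 t0 = one ->
    cderiv (fun s => (@chart R _ (mtan G) i0 (velocity (S s) t0)).1) s0 =
    cderiv (fun s => cderiv (fun t => chart i0 (S s t)) t0) s0.
  move=> hS S1; have dS : dom i0 (S s0 t0) by rewrite S1; exact: dom_at.
  have [d d0 hd] := mplot_near hS dS.
  apply: (cderiv_ext d0) => s sd.
  have ds := hd s t0 sd ltac:(by rewrite subrr normr0).
  have := @mtan_chart_velocity R E G hE hM _ _ i0 (@mplot_snd R E G S s hS t0) ds.
  by move=> ->.
have W0 : isd (fun s => kappa (velocity (Q s) t0)) s0 0.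
  apply: (@isd_near _ _ (fun=> rv (P s0) t0) _ _ _ 1) => //; last exact: isd_cst.
  by move=> s _; rewrite -[RHS]/(rv (Q s) t0) (rv_rmul hG).
have := @isd_unique R E hE _ _ _ _ HW W0.
rewrite wE // -(mplot_sym hQ) ?Q1; last exact: dom_at.
have e2 : (fun s => chart i0 (velocity (Q s) t0).2) = (fun s => chart i0 (velocity (P s) t0).2).
  by apply/funext => s; rewrite -[(velocity (Q s) t0).2]/(Q s t0) QPt.
rewrite e2 QP -[cderiv (fun t => cderiv _ s0) t0]/(cderiv (fun t => cderiv (fun s =>
  chart i0 (P s0 t ** P s t0)) s0) t0) (mixed_LL hq hp P1 P1) -!rv_one //.
move=> /eqP; rewrite addrC addr_eq0 => /eqP e.
rewrite -[cderiv (fun s => rv (P s) t0) s0]/(cderiv (fun s => kappa (velocity (P s) t0)) s0).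
by rewrite (isd_cderiv HV) wE // -(@rv_one (P s0) t0 P1) e.
Qed.

(** A right translation moves P(s0, t0) to the unit. In the difference of the two halves the mixed
    partials cancel by symmetry and the antisymmetrization of [LL] remains. *)
Lemma maurer_cartan (P : R -> R -> G) s0 t0 : mplot P ->
  cderiv (fun s => rv (P s) t0) s0 - cderiv (fun t => rv (P ^~ t) s0) t0 =
  lie_bracket G (rv (P ^~ t0) s0) (rv (P s0) t0).
Proof.
move=> hP; pose g := inv (P s0 t0); pose Q s t := P s t ** g.
have hQ : mplot Q by apply: mplotM => //; exact: mplot_cst.
have Q1 : Q s0 t0 = one by rewrite /Q gmulgV.
have r1 s t : rv (Q s) t = rv (P s) t by apply: (rv_rmul hG); exact: mplot_snd.
have r2 s t : rv (Q ^~ t) s = rv (P ^~ t) s.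
  by apply: (rv_rmul hG); exact: (@mplot_fst R E G P t hP).
have h1 := maurer_cartan_half hQ Q1.
have h2 := maurer_cartan_half (mplot_swap hQ) Q1.
have sy := mplot_sym hQ (x := s0) (y := t0) (i := i0) ltac:(by rewrite Q1; exact: dom_at).
rewrite r1 r2 /= in h1; rewrite /= r1 r2 in h2.
have e1 : (fun s => rv (Q s) t0) = (fun s => rv (P s) t0) by apply/funext => s.
have e2 : (fun s => rv (fun t : R => Q t s) s0) = (fun t => rv (P ^~ t) s0).
  by apply/funext => s; exact: r2.
rewrite e1 in h1; rewrite e2 in h2.
by rewrite h1 h2 sy lie_bracketE; lmod E.
Qed.

End MaurerCartan.

(** * Derivatives of Ad and of the bracket *)

Lemma scw_diag_isd (R : realType) (F : tvsType R) {hF : hs F} (f : R -> R -> F) x u v :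
  scw f -> isd (f ^~ x) x u -> isd (f x) x v -> isd (fun t => f t t) x (u + v).
Proof.
move=> hf /isd_cderiv <- /isd_cderiv <-.
exact: (iffLR (isd_translate (fun s => f s s) x _) (scw_diag x x hf)).
Qed.

Section AdjointCalculus.
Local Opaque lie_bracket.
Variables (R : realType) (E : tvsType R) (G : prelie E).
Context {hE : hs E}.
Hypothesis hG : is_lie_group G.
Local Notation "x ** y" := (@gmul R E G x y) (at level 40, left associativity).
Local Notation inv := (@ginv R E G).
Local Notation one := (gone G).
Local Notation br := (lie_bracket G).
Let hM := lie_manifold hG.

Lemma rv_lmul_cst (q : R -> G) g t : msmooth q -> rv (fun s => g ** q s) t = Ad g (rv q t).
Proof.
move=> hq; rewrite (rvM hG t (msmooth_cst hM (x := g)) hq) (rv_cst hG) add0r //.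
Qed.

(** Maurer-Cartan for the plot g(s) q(r), with q of velocity Y: its r-logarithmic derivative at r =
    0 is Ad(g(s)) Y, and its s-logarithmic derivative is that of g, constant in r. *)
Lemma Ad_deriv (g : R -> G) (Y : E) t : msmooth g ->
  isd (fun s => Ad (g s) Y) t (br (rv g t) (Ad (g t) Y)).
Proof.
move=> hg; have [q [hq q0 _ qY]] := curve_at_one hG Y.
pose P s r := g s ** q r.
have hP : mplot P by apply: mplotM => //; [exact: mplot_s | exact: mplot_t].
have := @maurer_cartan R E G hE hG P t 0 hP.
have e1 : (fun s => rv (P s) 0) = (fun s => Ad (g s) Y).
  by apply/funext => s; rewrite -qY -rv_lmul_cst.
have e2 : (fun r => rv (P ^~ r) t) = (fun=> rv g t).
  by apply/funext => r; rewrite /P (rv_rmul hG).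
rewrite e1 e2 (isd_cderiv (isd_cst (rv g t) 0)) subr0.
have e3 : rv (P ^~ 0) t = rv g t := congr1 (fun f => f 0) e2.
have e4 : rv (P t) 0 = Ad (g t) Y := congr1 (fun f => f t) e1.
rewrite e3 e4 => <-; have h : sm setT (fun s => Ad (g s) Y) by apply: (Ad_smooth hG) => //; exact: sm_cst.
exact: (smT_isd t 0 h).
Qed.

Lemma Ad_smooth_linear (g : G) (c : R -> E) : sm setT c -> sm setT (fun t => Ad g (c t)).
Proof. by move=> hc; apply: (Ad_smooth hG (msmooth_cst hM (x := g)) hc). Qed.

Lemma Ad_deriv2 (g : R -> G) (Y : R -> E) t : msmooth g -> sm setT Y ->
  isd (fun s => Ad (g s) (Y s)) t (br (rv g t) (Ad (g t) (Y t)) + Ad (g t) (cderiv Y t)).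
Proof.
move=> hg hY; pose f s r := Ad (g s) (Y r).
have hf : scw f.
  by move=> a b ha hb; apply: (Ad_smooth hG); [exact: msmooth_reparam | exact: (@sm_comp _ _ setT setT)].
have h1 : isd (f ^~ t) t (br (rv g t) (Ad (g t) (Y t))) by exact: Ad_deriv.
have h2 : isd (f t) t (Ad (g t) (cderiv Y t)).
  apply: (isd_smooth_linear (L := Ad (g t))).
  - exact: Ad_linear.
  - exact: Ad_smooth_linear.
  - exact: smooth_near_sm.
  - exact: (smT_isd t 0 hY).
exact: (scw_diag_isd hf h1 h2).
Qed.

Lemma br_linear_r (X : E) a (Y Z : E) : br X (a *: Y + Z) = a *: br X Y + br X Z.
Proof.
have [q [hq q0 _ qX]] := curve_at_one hG X.
have D Y' : isd (fun s => Ad (q s) Y') 0 (br X Y').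
  by apply: isd_eq (Ad_deriv Y' 0 hq) _; rewrite qX q0 (Ad1 hG).
apply: (isd_unique (D _)); apply: isd_near ltr01 _ (isdD (isdZ a (D Y)) (D Z)) => s _.
by rewrite (Ad_linear hG).
Qed.

Lemma br_anti (X Y : E) : br X Y = - br Y X.
Proof. by rewrite !(lie_bracketE hG) opprB. Qed.

Lemma br_linear_l (X : E) a (Y Z : E) : br (a *: Y + Z) X = a *: br Y X + br Z X.
Proof. rewrite br_anti br_linear_r (br_anti Y X) (br_anti Z X); lmod E. Qed.

Lemma brDl (X Y Z : E) : br (X + Y) Z = br X Z + br Y Z.
Proof. by have := br_linear_l Z 1 X Y; rewrite !scale1r. Qed.
Lemma brDr (X Y Z : E) : br X (Y + Z) = br X Y + br X Z.
Proof. by have := br_linear_r X 1 Y Z; rewrite !scale1r. Qed.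
Lemma br0r (X : E) : br X 0 = 0.
Proof. by have := br_linear_r X (-1) 0 0; rewrite scaler0 addr0 scaleN1r addNr. Qed.
Lemma br0l (X : E) : br 0 X = 0. Proof. by rewrite br_anti br0r oppr0. Qed.
Lemma brNr (X Y : E) : br X (- Y) = - br X Y.
Proof. by have := br_linear_r X (-1) Y 0; rewrite br0r !addr0 !scaleN1r. Qed.
Lemma brNl (X Y : E) : br (- X) Y = - br X Y.
Proof. by rewrite br_anti brNr (br_anti X Y). Qed.
Lemma brxx (X : E) : br X X = 0.
Proof.
have /eqP := br_anti X X; rewrite -addr_eq0 -mulr2n -scaler_nat scaler_eq0 pnatr_eq0 /=.
by move/eqP.
Qed.

(** Differentiate Ad(g) Ad(q(s)) Y = Ad(g q(s) g^-1) Ad(g) Y along a curve q through the unit with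
    velocity X. *)
Lemma Ad_br (g : G) (X Y : E) : Ad g (br X Y) = br (Ad g X) (Ad g Y).
Proof.
have [q [hq q0 _ qX]] := curve_at_one hG X.
have h1 : isd (fun s => Ad (q s) Y) 0 (br X Y).
  by apply: isd_eq (Ad_deriv Y 0 hq) _; rewrite qX q0 (Ad1 hG).
have hs1 : sm setT (fun s => Ad (q s) Y) by apply: (Ad_smooth hG) => //; exact: sm_cst.
have h2 : isd (fun s => Ad g (Ad (q s) Y)) 0 (Ad g (br X Y)).
  apply: (isd_smooth_linear (L := Ad g)) h1; [exact: Ad_linear | exact: Ad_smooth_linear |].
  exact: smooth_near_sm.
have hc : msmooth (fun s => g ** q s ** inv g) by exact: (@smooth_conj R E G hE hG g q hq).
have h4 : isd (fun s => Ad (g ** q s ** inv g) (Ad g Y)) 0 _ := Ad_deriv (Ad g Y) 0 hc.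
have hgq : msmooth (fun s => g ** q s) by exact: (@smooth_lmul R E G hE hG g q hq).
rewrite (rv_rmul hG) // rv_lmul_cst // qX q0 gmulg1 // gmulgV // (Ad1 hG) in h4.
apply: (isd_unique h2); apply: isd_near ltr01 _ h4 => s _.
by rewrite -!(AdM hG) gmulVK.
Qed.

Lemma br_smooth (X Y : R -> E) : sm setT X -> sm setT Y -> sm setT (fun t => br (X t) (Y t)).
Proof.
move=> hX hY; apply/smooth_curveP; apply/smooth_curve_near => t.
have [P [hP [d d0 hd]]] := tangent_plot hM t (msmooth_fiber hM hX (x := one)).
have hf : scw (fun s r => Ad (P s r) (Y r)).
  by move=> a b ha hb; apply: (Ad_smooth hG); [exact: hP | exact: (@sm_comp _ _ setT setT)].
apply: (@smooth_near_ext R E _ (fun r => cderiv (fun s => Ad (P s r) (Y r)) 0) _ _ d) => //.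
  move=> r /hd e; have Pr : msmooth (P ^~ r) by exact: mplot_fst.
  have P1 : P 0 r = one by have := congr1 snd e.
  rewrite (isd_cderiv (Ad_deriv (Y r) 0 Pr)) P1 (Ad1 hG) (@rv_one R E G hE hG (P ^~ r) 0 P1).
  by rewrite -e.
by apply: smooth_near_sm; exact: (scw_partial 0 hf).
Qed.

Lemma br_deriv (X Y : R -> E) t : sm setT X -> sm setT Y ->
  isd (fun s => br (X s) (Y s)) t (br (cderiv X t) (Y t) + br (X t) (cderiv Y t)).
Proof.
move=> hX hY; pose f s r := br (X s) (Y r).
have hf : scw f by move=> a b ha hb; apply: br_smooth; exact: (@sm_comp _ _ setT setT).
have h1 : isd (f ^~ t) t (br (cderiv X t) (Y t)).
  apply: (isd_smooth_linear (L := fun z => br z (Y t))).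
  - exact: br_linear_l.
  - by move=> c hc; apply: br_smooth => //; exact: sm_cst.
  - exact: smooth_near_sm.
  - exact: (smT_isd t 0 hX).
have h2 : isd (f t) t (br (X t) (cderiv Y t)).
  apply: (isd_smooth_linear (L := br (X t))).
  - exact: br_linear_r.
  - by move=> c hc; apply: br_smooth => //; exact: sm_cst.
  - exact: smooth_near_sm.
  - exact: (smT_isd t 0 hY).
exact: (scw_diag_isd hf h1 h2).
Qed.

End AdjointCalculus.

(** * The tangent group, the semidirect product and right trivialization *)

Section TangentGroup.
Variables (R : realType) (E : tvsType R) (G : prelie E).
Hypothesis hG : is_lie_group G.
Local Opaque lie_bracket.
Local Notation "x ** y" := (@gmul R E G x y) (at level 40, left associativity).
Local Notation inv := (@ginv R E G).
Local Notation one := (gone G).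
Local Notation br := (lie_bracket G).
Let hM := lie_manifold hG.
Context {hE : hs E}.
Local Notation TG := (tangent_group G).
Local Notation SG := (semidirect G).

Lemma model_convenient : convenient E. Proof. by case: hM. Qed.

(** Multiplication in TG is that of velocities of curves, so the group axioms of TG come from those
    of G applied pointwise to curves. *)
Lemma tg_mul_velocity (a b : R -> G) t : msmooth a -> msmooth b ->
  @gmul R _ TG (velocity a t) (velocity b t) = velocity (fun s => a s ** b s) t.
Proof.
move=> ha hb; have hGG : is_manifold (mprod G G) by exact: mprod_manifold.
have sm_mul : @smooth_map R _ _ (mprod G G) G (fun p => p.1 ** p.2) by case: hG => _ [].
have := @velocity_tmap R _ E (mprod G G) G _ _ hGG hM (fun p => p.1 ** p.2) (fun s => (a s, b s)) t
  sm_mul (msmooth_pair ha hb).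
by rewrite (velocity_pair hM hM t ha hb) => H; exact: (esym (H _ _ _ _)).
Qed.

Lemma tg_inv_velocity (a : R -> G) t : msmooth a ->
  @ginv R _ TG (velocity a t) = velocity (fun s => inv (a s)) t.
Proof.
move=> ha; have h : @smooth_map R E E G G inv by case: hG => _ [].
exact: (esym (velocity_tmap hM hM t h ha)).
Qed.

Lemma tg_one : gone TG = velocity (fun=> one) 0.
Proof. by rewrite velocity_cst. Qed.

Lemma tangent_group_lie : is_lie_group TG.
Proof.
have c1 : msmooth (fun=> one) by exact: msmooth_cst.
split; first exact: mtan_manifold.
split.
- move=> p q r.
  have [a [ha _ <-]] := tangent_curve hM p; have [b [hb _ <-]] := tangent_curve hM q.
  have [c [hc _ <-]] := tangent_curve hM r.
  have hbc := msmoothM (hE:=hE) hG hb hc; have hab := msmoothM (hE:=hE) hG ha hb.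
  rewrite (tg_mul_velocity 0 hb hc) (tg_mul_velocity 0 ha hb) (tg_mul_velocity 0 ha hbc) (tg_mul_velocity 0 hab hc).
  by congr (velocity _ 0); apply/funext => s; exact: gmulA.
- move=> p; have [a [ha _ <-]] := tangent_curve hM p.
  rewrite tg_one (tg_mul_velocity 0 c1 ha) (tg_mul_velocity 0 ha c1).
  by split; congr (velocity _ 0); apply/funext => s; rewrite ?gmul1g ?gmulg1.
- move=> p; have [a [ha _ <-]] := tangent_curve hM p.
  have hia := msmoothV hG ha.
  rewrite tg_one (tg_inv_velocity 0 ha) (tg_mul_velocity 0 hia ha) (tg_mul_velocity 0 ha hia).
  by split; congr (velocity _ 0); apply/funext => s; rewrite ?gmulVg ?gmulgV.
- move=> z hz t.
  have h1 : @msmooth R _ (mtan G) (fun s => (z s).1) by exact: (msmooth_fst (mtan_manifold hM)).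
  have h2 : @msmooth R _ (mtan G) (fun s => (z s).2) by exact: (msmooth_snd (mtan_manifold hM)).
  have [P [hP [d d0 hd]]] := tangent_plot hM t h1.
  have [Q [hQ [e e0 he]]] := tangent_plot hM t h2.
  apply: (@msm_ext R _ (mtan G) _ (fun s => velocity (fun r => P r s ** Q r s) 0) _ t (Order.min d e)).
  + by rewrite lt_min d0.
  + move=> s; rewrite lt_min => /andP[sd se]; rewrite -[RHS]/(@gmul R _ TG (z s).1 (z s).2).
    rewrite (hd s sd) (he s se) tg_mul_velocity //; exact: mplot_fst.
  exact: (@mplot_velocity R E G _ hM _ 0 (mplotM hG hP hQ) t).
by apply: (tmap_smooth hM hM); case: hG => _ [].
Qed.

Lemma semidirect_manifold : is_manifold SG.
Proof. by apply: mprod_manifold => //; exact: mvec_manifold model_convenient. Qed.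

Lemma semidirect_smooth_parts (c : R -> SG) : msmooth c ->
  sm setT (fun t => (c t).1) /\ msmooth (fun t => (c t).2 : G).
Proof.
move=> hc; split; first by apply/msmooth_vec; exact: (msmooth_fst hM hc).
exact: (msmooth_snd (mvec_manifold model_convenient) hc).
Qed.

Lemma semidirect_smooth (h : R -> E) (g : R -> G) : sm setT h -> msmooth g ->
  @msmooth R _ SG (fun t => ((h t, g t) : SG)).
Proof. by move=> /msmooth_vec hh hg; exact: (@msmooth_pair R E E (mvec E) G). Qed.

Lemma semidirect_lie : is_lie_group SG.
Proof.
split; first exact: semidirect_manifold.
split.
- move=> [X g] [Y h] [Z k]; rewrite /gmul /= (AdD hG) (AdM hG) addrA (gmulA hG) //.
- move=> [X g]; rewrite /gmul /= (Ad1 hG) (Ad0 hG) add0r addr0 (gmul1g hG) (gmulg1 hG) //.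
- move=> [X g]; rewrite /gmul /ginv /= (AdN hG) (AdVK hG) addNr subrr (gmulVg hG) (gmulgV hG) //.
- move=> z hz.
  have h1 : @msmooth R _ SG (fun s => (z s).1) by exact: (msmooth_fst semidirect_manifold).
  have h2 : @msmooth R _ SG (fun s => (z s).2) by exact: (msmooth_snd semidirect_manifold).
  have [a1 a2] := semidirect_smooth_parts h1; have [b1 b2] := semidirect_smooth_parts h2.
  apply: (@semidirect_smooth (fun t => (z t).1.1 + Ad (z t).1.2 (z t).2.1) (fun t => (z t).1.2 ** (z t).2.2)).
    by apply: smD => //; exact: (Ad_smooth hG).
  exact: (msmoothM hG).
move=> z hz; have [a1 a2] := semidirect_smooth_parts hz; have hi := msmoothV hG a2.
apply: (@semidirect_smooth (fun t => - Ad (inv (z t).2) (z t).1) (fun t => inv (z t).2)) => //.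
by apply: smN; exact: (Ad_smooth hG).
Qed.

Lemma rtriv_smooth : @smooth_map R _ _ TG SG (@rtriv R E G).
Proof.
move=> p hp; apply: (@semidirect_smooth (fun t => kappa (p t)) (fun t => (p t).2)).
  exact: (kappa_smooth hG).
exact: (@msmooth_foot R E G).
Qed.

Lemma rtriv_morph (p q : TG) : rtriv (gmul p q) = @gmul R _ SG (rtriv p) (rtriv q).
Proof.
have [a [ha _ <-]] := tangent_curve hM p; have [b [hb _ <-]] := tangent_curve hM q.
by rewrite tg_mul_velocity // /rtriv -[kappa _]/(rv _ 0) (rvM hG).
Qed.

Definition rtriv_inv (z : SG) : TG := tmap (fun h => h ** z.2) ((z.1, one) : mtan G).

Lemma rtrivK : cancel (@rtriv R E G) rtriv_inv.
Proof. by move=> p; exact: (tmap_rmul_kappa hG). Qed.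

Lemma rtriv_invK : cancel rtriv_inv (@rtriv R E G).
Proof. by case=> X g; rewrite /rtriv /rtriv_inv (kappaK hG) /= (gmul1g hG). Qed.

Lemma rtriv_inv_smooth : @smooth_map R _ _ SG TG rtriv_inv.
Proof.
move=> z hz t; have [hX hg] := semidirect_smooth_parts hz.
have [P [hP [d d0 hd]]] := tangent_plot hM t (msmooth_fiber hM hX (x := one)).
apply: (@msm_ext R _ (mtan G) _ (fun s => velocity (fun r => P r s ** (z s).2) 0) _ t d d0).
  move=> s /hd e; rewrite /= /rtriv_inv e.
  apply: (velocity_tmap hM hM 0); last exact: (@mplot_fst R E G P s hP).
  exact: smooth_rmul.
apply: (@mplot_velocity R E G _ hM (fun r s => P r s ** (z s).2) 0).
by apply: (mplotM hG) => //; exact: mplot_t.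
Qed.

Lemma rtriv_iso : @lie_iso R _ _ TG SG (@rtriv R E G).
Proof.
split; [exact: rtriv_smooth | exact: rtriv_morph |].
by exists rtriv_inv; split; [exact: rtriv_inv_smooth | exact: rtrivK | exact: rtriv_invK].
Qed.

Lemma rtriv_one : rtriv (gone TG) = gone SG.
Proof. by rewrite /rtriv (kappa_one hG). Qed.

Lemma kloc0 (y : E) : img (chart_at one) (chart_at one) y -> @kloc R E G (0, y) = 0.
Proof.
move=> hy; rewrite /kloc /=.
rewrite (@dirder0 R E E _ _ _ _ _ (@img_open R E G hM _ _) (@trans_smooth R E G hM (chart_at one) (chart_at (cochart (chart_at one) y)))).
  set x := cochart _ y; rewrite /kappa /=.
  have := @tmap_linear R E E G G hE hE hM hM (fun h => h ** inv x) x (-1) 0 0 (@smooth_rmul R E G hE hG (inv x)).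
  by rewrite scaler0 addr0 scaleN1r addNr.
by apply: (img_of hM hy); exact: dom_at.
Qed.

(** This makes the Lie algebra coordinates E * E of TG and of the semidirect product correspond, so
    that brackets and evolutions can be compared. Over the zero vector only the fibre part of the
    derivative of [kappa] survives, since [kappa] is 0 on all zero vectors. *)
Lemma tmap_rtriv_one (W : E * E) :
  @tmap R _ _ TG SG (@rtriv R E G) (W, gone TG) = (W, gone SG).
Proof.
have hT : is_manifold (mtan G) by exact: mtan_manifold.
have [V [hV V0 vV]] := @tangent_curve R _ (mtan G) _ hT ((W, gone TG) : mtan (mtan G)).
have V1 : (V 0).2 = one by rewrite V0.
rewrite -vV -(velocity_tmap hT semidirect_manifold 0 rtriv_smooth hV).
have hk : sm setT (fun t => kappa (V t)) by exact: kappa_smooth.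
have hf : msmooth (fun t => (V t).2 : G) by exact: msmooth_foot.
have := @velocity_pair R E E (mvec E) G hE hE (mvec_manifold model_convenient) hM
  (fun t => kappa (V t)) (fun t => (V t).2) 0 (iffRL (@msmooth_vec R E hE _) hk) hf.
rewrite -[@velocity R _ (mprod (mvec E) G) _ 0]/(@velocity R _ SG (@rtriv R E G \o V) 0) => ->.
have vW : velocity V 0 = (W, gone TG) :> mtan (mtan G) by exact: vV.
have hd : isd (@chart R _ (mtan G) (chart_at one) \o V) 0 W.
  have hEE : hs (E * E : tvsType R)%type by exact: hs_prod.
  have := @isd_chart R _ (mtan G) hEE V 0 (chart_at one) (hV 0) ltac:(by rewrite /= V1; exact: dom_at).
  have -> : cderiv (@chart R _ (mtan G) (chart_at one) \o V) 0 = W; last exact.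
  by have := congr1 fst vW; rewrite /velocity /= V1.
have H := @kappa_deriv R E G hE hG V 0 hV V1.
rewrite V0 /= (isd_cderiv (isd_fst hd)) in H.
have e2 : cderiv (fun s => chart (chart_at one) (V s).2) 0 = W.2 by exact: (isd_cderiv (isd_snd hd)).
have hy : img (chart_at one) (chart_at one) (chart (chart_at one) one) by apply: img_chart; exact: dom_at.
have e3 : dirder (@kloc R E G) (0, chart (chart_at one) one) (0, cderiv (fun s => chart (chart_at one) (V s).2) 0) = 0.
  rewrite e2 /dirder; apply: isd_cderiv.
  have sl : smooth_near (fun t : R => chart (chart_at one) one + t *: W.2) 0.
    by apply: smooth_near_sm; apply: smD; [exact: sm_cst | apply: sm_scal; [exact: sm_id | exact: sm_cst]].
  have [|d d0 dd] := cinf_open_near (@img_open R E G hM (chart_at one) (chart_at one)) sl.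
    by rewrite scale0r addr0.
  apply: (@isd_near _ _ (fun=> 0) _ _ _ d) => //; last exact: isd_cst.
  move=> s /dd hs; rewrite -[(_, _) + _]/(0 + s *: 0, chart (chart_at one) one + s *: W.2).
  by rewrite scaler0 addr0 kloc0.
rewrite e3 addr0 in H.
have e4 : cderiv (fun t => kappa (V t)) 0 = W.1 by exact: isd_cderiv.
congr (_, _); last by rewrite V0; exact: rtriv_one.
have w1 : cderiv (@chart R _ (mtan G) (chart_at (V 0)) \o V) 0 = W := congr1 fst vW.
rewrite [RHS]surjective_pairing; congr (_, _); rewrite [in RHS]w1 ?e4 //.
by rewrite /velocity /= V1.
Qed.

(** Translation to the unit at time t turns the vector component into h(s) - Ad(g(s) g(t)^-1) h(t),
    which [Ad_deriv] differentiates. Bracket, adjoint and evolutions of the semidirect product are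
    all computed from this formula. *)
Lemma rv_semidirect (h : R -> E) (g : R -> G) t : sm setT h -> msmooth g ->
  @rv R _ SG (fun s => ((h s, g s) : SG)) t = (cderiv h t - br (rv g t) (h t), rv g t).
Proof.
move=> hh hg; have hc := semidirect_smooth hh hg.
have e := congr1 fst (@rvE R _ SG _ semidirect_lie _ t hc).
rewrite -[LHS]/((rv (fun s => ((h s, g s) : SG)) t, gone SG).1) -e.
pose k s := h s + Ad (g s) (- Ad (inv (g t)) (h t)).
have hk : sm setT k.
  by apply: smD => //; apply: (Ad_smooth hG) => //; exact: sm_cst.
have hgt : msmooth (fun s => g s ** inv (g t)) by exact: (@smooth_rmul R E G hE hG (inv (g t)) g hg).
have := @velocity_pair R E E (mvec E) G hE hE (mvec_manifold model_convenient) hM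
  k (fun s => g s ** inv (g t)) t (iffRL (@msmooth_vec R E hE _) hk) hgt.
rewrite -[@velocity R _ (mprod (mvec E) G) _ t]/(@velocity R _ SG (fun s => @gmul R _ SG (h s, g s) (@ginv R _ SG (h t, g t))) t) => ->.
rewrite -[(_, _).1]/((@velocity R E (mvec E) k t).1, (velocity (fun s => g s ** inv (g t)) t).1).
rewrite (rvE hG t hg); congr (_, _); rewrite velocity_vec /=.
apply: isd_cderiv; apply: isdD; first exact: (smT_isd t 0 hh).
apply: isd_eq (Ad_deriv hG _ t hg) _.
by rewrite (AdN hG) (AdVK hG) (brNr hG).
Qed.

Lemma semidirect_curve (X Z : E) : exists q : R -> G, [/\ msmooth q, q 0 = one, rv q 0 = Z &
  @rv R _ SG (fun s => ((s *: X, q s) : SG)) 0 = (X, Z)].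
Proof.
have [q [hq q0 _ qZ]] := curve_at_one hG Z; exists q; split=> //.
have hl : sm setT (fun s : R => s *: X) by apply: sm_scal; [exact: sm_id | exact: sm_cst].
rewrite rv_semidirect // qZ scale0r (br0r hG) subr0; congr (_, _).
by apply: isd_cderiv; apply: isd_eq (isd_scal (isd_id 0) (isd_cst X 0)) _;
   rewrite scale1r scaler0 addr0.
Qed.

Lemma sm_line (X : E) : sm setT (fun s : R => s *: X).
Proof. by apply: sm_scal; [exact: sm_id | exact: sm_cst]. Qed.

Lemma isd_line (X : E) t : isd (fun s : R => s *: X) t X.
Proof.
by apply: isd_eq (isd_scal (isd_id t) (isd_cst X t)) _; rewrite scale1r scaler0 addr0.
Qed.

Lemma Ad_semidirect (X Y Z : E) (g : G) :
  @Ad R _ SG ((X, g) : SG) (Y, Z) = (Ad g Y - br (Ad g Z) X, Ad g Z).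
Proof.
have [q [hq q0 qZ qv]] := semidirect_curve Y Z.
have hc := semidirect_smooth (sm_line Y) hq.
rewrite -qv -(@rv_lmul_cst R _ SG _ semidirect_lie _ _ 0 hc).
rewrite -(@rv_rmul R _ SG _ semidirect_lie _ (@ginv R _ SG (X, g)) 0); last first.
  exact: (@smooth_lmul R _ SG _ semidirect_lie (X, g) _ hc).
pose h s := X + Ad g (s *: Y) + Ad (g ** q s) (- Ad (inv g) X).
have hgq : msmooth (fun s => g ** q s) by exact: (@smooth_lmul R E G hE hG g q hq).
have hgqg : msmooth (fun s => g ** q s ** inv g) by exact: (@smooth_rmul R E G hE hG (inv g) _ hgq).
have d2 := Ad_deriv (hE:=hE) hG (- Ad (inv g) X) 0 hgq.
have hh : sm setT h.
  apply: smD; last by apply: (Ad_smooth hG) => //; exact: sm_cst.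
  apply: smD; first exact: sm_cst.
  exact: (Ad_smooth_linear hG g (sm_line Y)).
rewrite -[rv _ 0]/(@rv R _ SG (fun s => ((h s, g ** q s ** inv g) : SG)) 0).
rewrite rv_semidirect // (rv_rmul hG (inv g) 0 hgq) (rv_lmul_cst hG _ 0 hq) qZ.
(* The conjugated curve starts at the unit, so the bracket term of [rv_semidirect] drops out. *)
have -> : h 0 = 0.
  by rewrite /h scale0r (Ad0 hG) addr0 q0 (gmulg1 hG) (AdN hG) (AdVK hG) subrr.
rewrite (br0r hG) subr0; congr (_, _); apply: isd_cderiv.
apply: isd_eq (isdD (isdD (isd_cst X 0) _) d2) _.
- apply: (isd_smooth_linear (L := Ad g)) (isd_line Y 0).
  + exact: Ad_linear.
  + exact: Ad_smooth_linear.
  + exact: smooth_near_sm (sm_line Y).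
by rewrite add0r (rv_lmul_cst hG _ 0 hq) qZ q0 (gmulg1 hG) (AdN hG) (AdVK hG) (brNr hG).
Qed.

(** The bracket is the derivative of the explicit [Ad_semidirect] along the curve (s X1, q(s)),
    where q has velocity Y1. *)
Lemma br_semidirect (X1 Y1 X2 Y2 : E) :
  lie_bracket SG (X1, Y1) (X2, Y2) = (br Y1 X2 - br Y2 X1, br Y1 Y2).
Proof.
have [q [hq q0 qY qv]] := semidirect_curve X1 Y1.
have hc := semidirect_smooth (sm_line X1) hq.
have := @Ad_deriv R _ SG (@hs_prod R E E hE hE) semidirect_lie _ (X2, Y2) 0 hc.
rewrite qv.
have -> : (((0 : R) *: X1, q 0) : SG) = gone SG by rewrite scale0r q0.
rewrite (Ad1 semidirect_lie) => H; apply: (isd_unique H).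
have -> : (fun s => @Ad R _ SG ((s *: X1, q s) : SG) (X2, Y2)) =
   (fun s => (Ad (q s) X2 - br (Ad (q s) Y2) (s *: X1), Ad (q s) Y2)).
  by apply/funext => s; exact: Ad_semidirect.
have D Y' : isd (fun s => Ad (q s) Y') 0 (br Y1 Y').
  by apply: isd_eq (Ad_deriv hG Y' 0 hq) _; rewrite qY q0 (Ad1 hG).
have hA : sm setT (fun s => Ad (q s) Y2) by apply: (Ad_smooth hG) => //; exact: sm_cst.
apply: isd_pair => //; apply: isdB => //.
apply: isd_eq (br_deriv hG 0 hA (sm_line X1)) _.
by rewrite (isd_cderiv (isd_line X1 0)) scale0r (br0r hG) q0 (Ad1 hG) add0r.
Qed.

End TangentGroup.

(** * Smooth curves in function spaces *)

Section FunctionCurves.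
Variables (R : realType) (E F : tvsType R) (M : premanifold E).
Context {hE : hs E} {hF : hs F}.
Hypothesis hM : is_manifold M.

Lemma fun_curveP (c : R -> M -> F) : fun_curve c <->
  forall (a : R -> R^o) (p : R -> M), sm setT a -> msmooth p -> sm setT (fun t => c (a t) (p t)).
Proof.
split=> [H a p ha hp|H z hz].
  have ha' : @msmooth R R^o (mvec R^o) a by apply/msmooth_vec.
  have hap : @msmooth R _ (mprod (mvec R^o) M) (fun t => (a t, p t)) by exact: msmooth_pair.
  have := H _ hap; by move/(@msmooth_vec R F hF).
apply/(@msmooth_vec R F hF); apply: H.
  apply/smooth_curveP/smooth_curve_near => t.
  have [_ /smooth_nearP[e e0 he]] := hz t (tt, chart_at (z t).2) (conj I (dom_at hM _)).
  by apply/smooth_nearP; exists e => //; exact: (sm_fst he).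
move=> t i di; have [/nbhs_real[d d0 hd] /smooth_nearP[e e0 he]] := hz t (tt, i) (conj I di).
split; first by apply/nbhs_real; exists d => // s /hd [].
by apply/smooth_nearP; exists e => //; exact: (sm_snd he).
Qed.

Lemma fun_curve_scw (c : R -> R -> F) : @fun_curve R R^o F (mvec R^o) c <-> scw c.
Proof.
split=> [H a b ha hb|H z hz].
  have ha' : @msmooth R R^o (mvec R^o) a by apply/msmooth_vec.
  have hb' : @msmooth R R^o (mvec R^o) b by apply/msmooth_vec.
  have hab : @msmooth R _ (mprod (mvec R^o) (mvec R^o)) (fun t => (a t, b t)) by exact: msmooth_pair.
  have := H _ hab; by move/(@msmooth_vec R F hF).
have hz' : sm setT (z : R -> R^o * R^o).
  apply/smooth_curveP/smooth_curve_near => t.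
  have [_ h] := hz t (tt, tt) (conj I I).
  apply: (@smooth_near_ext R _ _ _ _ _ 1 ltr01 _ h) => s _ /=; by case: (z s).
by apply/(@msmooth_vec R F hF); apply: H; [exact: (sm_fst hz') | exact: (sm_snd hz')].
Qed.

End FunctionCurves.

(** * Uniqueness of evolutions *)

Section Evolution.
Variables (R : realType) (E : tvsType R) (G : prelie E).
Context {hE : hs E}.
Hypothesis hG : is_lie_group G.

Lemma is_Evol_unique (X : R -> E) (g : R -> G) : is_Evol X g -> Evol G X = g.
Proof.
move=> hg; rewrite /Evol; case: pselect => [ex|]; last by case; exists g.
case: (cid ex) => h /= hh; apply/funext => t.
have [h1 h2 h3] := iffLR (is_EvolP hG X h) hh.
have [g1 g2 g3] := iffLR (is_EvolP hG X g) hg.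
apply: (rv_unique hG h1 g1); last by rewrite h2.
by move=> s; rewrite h3.
Qed.

End Evolution.

(** * Transport along isomorphisms that are the identity on the Lie algebra *)

Section Transfer.
Variables (R : realType) (E : tvsType R) (H K : prelie E).
Context {hE : hs E}.
Hypotheses (hH : is_lie_group H) (hK : is_lie_group K).
Local Opaque lie_bracket.
Variable phi : H -> K.
Hypothesis phi_iso : lie_iso phi.
Hypothesis phi_one : forall W : E, tmap phi ((W, gone H) : mtan H) = ((W, gone K) : mtan K).
Let phiS : smooth_map phi. Proof. by case: phi_iso. Qed.
Let phiM x y : phi (gmul x y) = gmul (phi x) (phi y). Proof. by case: phi_iso. Qed.

Lemma iso_one : phi (gone H) = gone K.
Proof. by have := congr1 snd (phi_one 0). Qed.

(** [phi] intertwines right translations, which reduces its tangent map to the one at the unit.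
    Adjoint, bracket, evolution and regularity are then transported, as they are determined by
    [rv]. *)
Lemma iso_rv (c : R -> H) t : msmooth c -> rv (fun s => phi (c s)) t = rv c t.
Proof.
move=> hc; rewrite {1}/rv.
have -> : velocity (fun s => phi (c s)) t = tmap phi (velocity c t).
  by apply: (velocity_tmap (lie_manifold hH) (lie_manifold hK)).
rewrite (velocity_rv hH).
have s1 : @smooth_map R E E H H (fun h => gmul h (c t)) by exact: smooth_rmul.
have s2 : @smooth_map R E E K K (fun h => gmul h (phi (c t))) by exact: smooth_rmul.
have := @tmap_comp R E E E H H K hE hE hE (lie_manifold hH) (lie_manifold hH) (lie_manifold hK)
  phi (fun h => gmul h (c t)) ((rv c t, gone H) : mtan H) phiS s1.
have -> : phi \o (fun h => gmul h (c t)) = (fun h => gmul h (phi (c t))) \o phi.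
  by apply/funext => h /=; rewrite phiM.
rewrite (@tmap_comp R E E E H K K hE hE hE (lie_manifold hH) (lie_manifold hK) (lie_manifold hK)
  (fun h => gmul h (phi (c t))) phi _ s2 phiS) phi_one => <-.
exact: kappaK.
Qed.

Lemma iso_Ad (g : H) (X : E) : Ad (phi g) X = Ad g X.
Proof.
have [q [hq q0 _ qX]] := curve_at_one hH X.
have hpq : msmooth (fun s => phi (q s)) by exact: (phiS hq).
have hgq : msmooth (fun s => gmul g (q s)) by exact: (@smooth_lmul R E H hE hH g q hq).
rewrite -{1}qX -(iso_rv 0 hq) -(rv_lmul_cst hK _ 0 hpq).
have -> : (fun s => gmul (phi g) (phi (q s))) = (fun s => phi (gmul g (q s))).
  by apply/funext => s; rewrite phiM.
by rewrite iso_rv // (rv_lmul_cst hH _ 0 hq) qX.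
Qed.

Lemma iso_bracket (X Y : E) : lie_bracket K X Y = lie_bracket H X Y.
Proof.
have [q [hq q0 _ qX]] := curve_at_one hH X.
have hpq : msmooth (fun s => phi (q s)) by exact: (phiS hq).
have h1 := Ad_deriv (hE:=hE) hH Y 0 hq.
have h2 := Ad_deriv (hE:=hE) hK Y 0 hpq.
move: h1 h2; rewrite iso_rv // qX q0 iso_one (Ad1 hH) (Ad1 hK) => h1 h2.
apply: (isd_unique h2).
suff -> : (fun s => Ad (phi (q s)) Y) = (fun s => Ad (q s) Y) by [].
by apply/funext => s; exact: iso_Ad.
Qed.

Lemma iso_is_Evol (X : R -> E) (c : R -> H) : is_Evol X c -> is_Evol X (fun t => phi (c t)).
Proof.
move=> /(is_EvolP hH)[h1 h2 h3]; apply/(is_EvolP hK); split.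
- exact: (phiS h1).
- by rewrite h2 iso_one.
- by move=> t; rewrite iso_rv.
Qed.

Lemma iso_Evol (X : R -> E) (c : R -> H) : is_Evol X c -> Evol K X = (fun t => phi (Evol H X t)).
Proof.
by move=> hc; rewrite (is_Evol_unique hH hc); apply: (is_Evol_unique hK (iso_is_Evol hc)).
Qed.

Lemma iso_evol (X : R -> E) (c : R -> H) : is_Evol X c -> evol K X = phi (evol H X).
Proof. by move=> hc; rewrite /evol (iso_Evol hc). Qed.

Lemma iso_regular : regular H -> regular K.
Proof.
case=> _ ex sm_ev; split=> //.
  by move=> X /ex[c hc]; exists (fun t => phi (c t)); exact: iso_is_Evol.
move=> c hc.
have -> : (fun s => evol K (c s)) = (fun s => phi (evol H (c s))); last exact: (phiS (sm_ev c hc)).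
apply/funext => s.
have hs : smooth_curve (c s) by apply/smooth_curveP; apply: scw_snd; exact/fun_curve_scw.
by have [g hg] := ex _ hs; apply: (iso_evol hg).
Qed.

End Transfer.

(** * Riemann integrals of curves with a primitive *)

Section FundamentalTheorem.
Variables (R : realType) (E : tvsType R).
Context {hE : hs E}.

Lemma uniform_continuity (c : R -> E) (a b : R) (p : E -> R) (e : R) : csemi p -> a <= b -> 0 < e ->
  (forall t, a <= t -> t <= b -> exists2 d, 0 < d & forall s, `|s - t| < d -> p (c s - c t) < e / 2) ->
  exists2 d, 0 < d & forall s t, a <= s -> s <= t -> t <= b -> t - s < d -> p (c t - c s) <= e.
Proof.
move=> hp ab e0 H.
apply: (@real_induction R (fun b => exists2 d, 0 < d & forall s t, a <= s -> s <= t -> t <= b -> t - s < d ->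
   p (c t - c s) <= e) a b ab).
  exists 1 => // s t sa st ta _; have -> : s = t by apply/eqP; rewrite eq_le st (le_trans ta).
  by rewrite subrr (csemi0 hp) ltW.
move=> t ta tb; have [d d0 hd] := H t ta tb; exists d => // s u _ st tu _ ds ud [d' d'0 hd'].
have k0 : 0 < s - (t - d) by lra.
exists (Order.min d' (s - (t - d))); first by rewrite lt_min d'0.
move=> x y ax xy yu; rewrite lt_min => /andP[xyd xys].
have [ys|sy] := leP y s; first exact: hd'.
have dr r : t - d < r -> r <= u -> `|r - t| < d.
  by move=> r1 r2; rewrite ltr_norml; apply/andP; split; lra.
have hx := hd x (dr x ltac:(lra) ltac:(lra)); have hy := hd y (dr y ltac:(lra) yu).
have := csemi_tri (c t) (c y) (c x) hp; rewrite (csemi_dist (c t)) //; lra.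
Qed.

(** On each cell the mean value inequality bounds the increment of F minus its Riemann term by the
    oscillation of c, and the errors add up. The integral exists because a primitive is at hand. *)
Lemma is_rint_primitive (F c : R -> E) (a b : R) : a <= b -> sm setT c ->
  (forall t, isd F t (c t)) -> is_rint c a b (F b - F a).
Proof.
move=> ab hc hF U /nbhs_csemi[p hp pU]; have [pD _ _] := hp.
(* Chosen so that e (b - a) < 1, the radius supplied by [nbhs_csemi]. *)
pose e := (2 * (b - a + 1))^-1.
have e0 : 0 < e by rewrite invr_gt0; lra.
have e2 : 0 < e / 2 by lra.
have [d d0 hd] := uniform_continuity hp ab e0 (fun t _ _ => sm_cont openT hc I hp e2).
exists d => // n u q u0 un huq; apply: pU.
have mono i : (i <= n)%N -> a <= u i /\ u i <= b.
  move=> iN; split.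
    elim: i iN => [|i IH] iN; first by rewrite u0.
    by have [h1 h2 _] := huq i iN; apply: le_trans (IH (ltnW iN)) (le_trans h1 h2).
  rewrite -(subKn iN); elim: (n - i)%N (leq_subr i n) => [|k IH] kn; first by rewrite subn0 un.
  have kn' : (n - k.+1 < n)%N by rewrite ltn_subrL (leq_ltn_trans _ kn).
  have [h1 h2 _] := huq _ kn'; rewrite -subSn // subSS in h2.
  exact: le_trans h1 (le_trans h2 (IH (ltnW kn))).
have tel : F b - F a = \sum_(i < n) (F (u i.+1) - F (u i)).
  by rewrite -(big_mkord xpredT (fun i => F (u i.+1) - F (u i))) telescope_sumr // u0 un.
have len : b - a = \sum_(i < n) (u i.+1 - u i).
  by rewrite -(big_mkord xpredT (fun i => u i.+1 - u i)) telescope_sumr // u0 un.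
rewrite tel -sumrB.
have bound : p (\sum_(i < n) ((u i.+1 - u i) *: c (q i) - (F (u i.+1) - F (u i)))) <= e * (b - a).
  rewrite len mulr_sumr; elim/big_ind2 : _ => [|x1 x2 y1 y2 h1 h2|[i iN] _ /=].
  - by rewrite csemi0.
  - by apply: le_trans (pD _ _) _; lra.
  have [h1 h2 h3] := huq i iN; have [m1 _] := mono _ (ltnW iN); have [_ m2] := mono _ iN.
  rewrite csemi_dist //.
  have -> : F (u i.+1) - F (u i) - (u i.+1 - u i) *: c (q i) =
    (F (u i.+1) - u i.+1 *: c (q i)) - (F (u i) - u i *: c (q i)) by lmod E.
  apply: (@mvt R E p (fun t => F t - t *: c (q i)) (fun t => c t - c (q i))) => //.
  - exact: le_trans h1 h2.
  - move=> t _ _; apply: isdB => //.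
    by apply: isd_eq (isd_scal (isd_id t) (isd_cst (c (q i)) t)) _; rewrite scale1r scaler0 addr0.
  move=> t t1 t2; have [tq|qt] := leP t (q i).
    rewrite csemi_dist //; apply: hd; lra.
  apply: hd => //; lra.
apply: le_lt_trans bound _; rewrite /e ltr_pdivrMl; lra.
Qed.

Lemma is_rint_unique (c : R -> E) (a b : R) v w : a <= b -> is_rint c a b v -> is_rint c a b w -> v = w.
Proof.
move=> ab hv hw; apply/eqP; rewrite -subr_eq0; apply/eqP; apply: csemi_small_eq0 => p hp e e0.
have e2 : 0 < e / 2 by lra.
have [d d0 hd] := hv _ (nbhs_of_csemi v hp e2); have [d' d'0 hd'] := hw _ (nbhs_of_csemi w hp e2).
pose m := Order.min d d'; have m0 : 0 < m by rewrite lt_min d0.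
pose n := (Num.bound ((b - a) / m)).+1.
pose u (i : nat) := a + i%:R * ((b - a) / n%:R).
have n0 : 0 < n%:R :> R by rewrite ltr0n.
have du i : u i.+1 - u i = (b - a) / n%:R by rewrite /u -natr1; ring.
have st : 0 <= (b - a) / n%:R by apply: divr_ge0; [lra | exact: ltW].
have sm : (b - a) / n%:R < m.
  rewrite ltr_pdivrMr // mulrC -ltr_pdivrMr //.
  apply: lt_le_trans (archi_boundP _) _; first by apply: divr_ge0; lra.
  by rewrite ler_nat.
have u0 : u 0%N = a by rewrite /u mul0r addr0.
have un : u n = b by rewrite /u mulrC divfK ?gt_eqF //; lra.
have hu dd : m <= dd -> forall i, (i < n)%N -> [/\ u i <= u i, u i <= u i.+1 & u i.+1 - u i < dd].
  move=> md i _; have := du i; split=> //; first by lra.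
  by rewrite du; apply: lt_le_trans md.
have h1 := hd n u u u0 un (hu d _); have h2 := hd' n u u u0 un (hu d' _).
have {}h1 := h1 ltac:(by rewrite ge_min lexx); have {}h2 := h2 ltac:(by rewrite ge_min lexx orbT).
set S := \sum_(i < n) _ in h1 h2; rewrite /= in h1 h2.
have := csemi_tri S v w hp; rewrite (csemi_dist v S) //; lra.
Qed.

Lemma rint_primitive (F c : R -> E) (a b : R) : sm setT c ->
  (forall t, isd F t (c t)) -> rint a b c = F b - F a.
Proof.
move=> hc hF.
have H x y : x <= y -> xget 0 (is_rint c x y) = F y - F x.
  move=> xy; have h := is_rint_primitive xy hc hF.
  by case: xgetP => [z _ hz|/(_ _ h)//]; apply: is_rint_unique xy hz h.
rewrite /rint; case: leP => [/H //|/ltW/H ->]; by rewrite opprB.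
Qed.

End FundamentalTheorem.

(** * Regularity of TG and the derivative of evolutions *)

Section RegularGroups.
Variables (R : realType) (E : tvsType R) (G : prelie E).
Context {hE : hs E}.
Hypothesis hG : is_lie_group G.
Local Opaque lie_bracket.
Local Notation "x ** y" := (@gmul R E G x y) (at level 40, left associativity).
Local Notation inv := (@ginv R E G).
Local Notation one := (gone G).
Local Notation br := (lie_bracket G).
Let hM := lie_manifold hG.
Local Notation TG := (tangent_group G).
Local Notation SG := (semidirect G).

Lemma rtriv_inv_one (W : E * E) :
  @tmap R _ _ SG TG (@rtriv_inv R E G) ((W, gone SG) : mtan SG) = ((W, gone TG) : mtan TG).
Proof.
transitivity (@tmap R _ _ SG TG (@rtriv_inv R E G) (@tmap R _ _ TG SG (@rtriv R E G) (W, gone TG))).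
  by rewrite (tmap_rtriv_one hG W).
have hT : is_manifold (mtan G) by exact: mtan_manifold.
have hS : is_manifold SG by exact: semidirect_manifold.
rewrite -(@tmap_comp R _ _ _ TG SG TG _ _ _ hT hS hT _ _ _ (rtriv_inv_smooth hG) (rtriv_smooth hG)).
have -> : (@rtriv_inv R E G : SG -> TG) \o (@rtriv R E G : TG -> SG) = id.
  by apply/funext => z /=; exact: (rtrivK hG).
exact: (@tmap_id R _ _ (mtan G) (W, gone TG) hT).
Qed.

Lemma rtriv_inv_iso : @lie_iso R _ _ SG TG (@rtriv_inv R E G).
Proof.
have [h1 h2 _] := rtriv_iso hG; split; first exact: rtriv_inv_smooth.
  move=> x y; rewrite -{1}(rtriv_invK hG x) -{1}(rtriv_invK hG y) -h2; exact: (rtrivK hG).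
by exists (@rtriv R E G); split=> //; [exact: (rtriv_invK hG) | exact: (rtrivK hG)].
Qed.

Lemma br_tangent (X1 Y1 X2 Y2 : E) :
  lie_bracket TG (X1, Y1) (X2, Y2) = (br Y1 X2 - br Y2 X1, br Y1 Y2).
Proof.
rewrite (@iso_bracket R _ SG TG _ (semidirect_lie hG) (tangent_group_lie hG) _ rtriv_inv_iso rtriv_inv_one).
exact: br_semidirect.
Qed.

Lemma rv_reparam (c : R -> G) (f : R -> R^o) t (a : R) : msmooth c -> isd f t (a : R^o) ->
  rv (fun s => c (f s)) t = a *: rv c (f t).
Proof.
move=> hc hf; rewrite /rv (velocity_reparam hM (hc _) hf).
have := @tmap_linear R E E G G hE hE hM hM (fun h => h ** inv (c (f t))) (c (f t)) a
  (velocity c (f t)).1 0 (@smooth_rmul R E G hE hG (inv (c (f t)))).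
have := @tmap_linear R E E G G hE hE hM hM (fun h => h ** inv (c (f t))) (c (f t)) (-1)
  0 0 (@smooth_rmul R E G hE hG (inv (c (f t)))).
rewrite scaler0 addr0 scaleN1r addNr => ->; rewrite !addr0 => H; exact: H.
Qed.

Hypothesis regG : regular G.

Lemma EvolP (X : R -> E) : sm setT X -> is_Evol X (Evol G X).
Proof.
move=> /smooth_curveP hX; have [_ ex _] := regG; have [g hg] := ex X hX.
by rewrite (is_Evol_unique hG hg).
Qed.

Lemma Evol_smooth (X : R -> E) : sm setT X -> msmooth (Evol G X).
Proof. by move=> /EvolP[]. Qed.

Lemma Evol0 (X : R -> E) : sm setT X -> Evol G X 0 = one.
Proof. by move=> /EvolP[]. Qed.

Lemma rv_Evol (X : R -> E) t : sm setT X -> rv (Evol G X) t = X t.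
Proof. by move=> /EvolP/(is_EvolP hG)[]. Qed.

Lemma evol_smooth (c : R -> R -> E) : scw c -> msmooth (fun s => evol G (c s)).
Proof. by move=> hc; have [_ _ h] := regG; apply: h; apply/fun_curve_scw. Qed.

(** Rescaling time expresses Evol at any time through [evol]; smoothness of [evol] thus becomes
    joint smoothness in parameter and time ([Evol_mplot]). *)
Lemma evol_scale (X : R -> E) t : sm setT X -> evol G (fun u => t *: X (t * u)) = Evol G X t.
Proof.
move=> hX; pose g u := Evol G X (t * u).
have lin : sm setT (fun u => t * u : R^o) by apply: smM; [exact: sm_cst | exact: sm_id].
have dlin u : isd (fun u => t * u : R^o) u (t : R^o).
  by apply: isd_eq (isdZ t (isd_id u)) _; exact: mulr1.
have hg : msmooth g by exact: (msmooth_reparam (Evol_smooth hX) lin).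
have : is_Evol (fun u => t *: X (t * u)) g.
  apply/(is_EvolP hG); split=> //; first by rewrite /g mulr0 Evol0.
  by move=> u; rewrite (rv_reparam (Evol_smooth hX) (dlin u)) rv_Evol.
by move=> /(is_Evol_unique hG) e; rewrite /evol e /g mulr1.
Qed.

Lemma Evol_mplot (c : R -> R -> E) : scw c -> mplot (fun s t => Evol G (c s) t).
Proof.
move=> hc a b ha hb.
have -> : (fun t => Evol G (c (a t)) (b t)) = (fun r => evol G (fun u => b r *: c (a r) (b r * u))).
  by apply/funext => r; rewrite evol_scale //; exact: scw_snd.
apply: (@evol_smooth (fun r u => b r *: c (a r) (b r * u))) => f k hf hk.
have hbf : sm setT (fun t => b (f t)) by exact: (@sm_comp _ _ setT setT).
apply: sm_scal => //; apply: hc; first exact: (@sm_comp _ _ setT setT).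
exact: smM.
Qed.

(** Let P(s, t) = Evol(c_s)(t), X = c_0, Y the velocity of c, and A(t) the s-logarithmic derivative
    of P at s = 0. The Maurer-Cartan equation of P reads A' = Y + [X, A], which by [rv_semidirect]
    says that (A, Evol X) has logarithmic derivative (Y, X). *)
Lemma Evol_variation (c : R -> R -> E) : scw c ->
  is_Evol (G := SG) (twist (c 0, fun_velocity c))
    (fun t => ((rv (fun s => Evol G (c s) t) 0, Evol G (c 0) t) : SG)).
Proof.
move=> hc; have hP := Evol_mplot hc; pose A t := rv (fun s => Evol G (c s) t) 0.
have hA : sm setT A.
  by apply: (scw_rv1 hG hP); [exact: sm_cst | exact: sm_id].
have hg : msmooth (Evol G (c 0)) by exact: (Evol_smooth (scw_snd 0 hc)).
apply/(is_EvolP (semidirect_lie hG)); split.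
- exact: (@semidirect_smooth R E G hE A (Evol G (c 0)) hA hg).
- rewrite (Evol0 (scw_snd 0 hc)); congr (_, _).
  have -> : (fun s => Evol G (c s) 0) = fun=> one.
    by apply/funext => s; exact: (Evol0 (scw_snd s hc)).
  by rewrite rv_cst.
move=> t; rewrite (rv_semidirect hG t hA hg) (rv_Evol t (scw_snd 0 hc)) /twist /=; congr (_, _).
have := maurer_cartan hG 0 t hP.
have -> : (fun s => rv (Evol G (c s)) t) = c ^~ t.
  by apply/funext => s; exact: (rv_Evol t (scw_snd s hc)).
rewrite (rv_Evol t (scw_snd 0 hc)) -/(A t) -[cderiv (fun t => rv _ 0) t]/(cderiv A t) => H.
by rewrite (br_anti hG) -H opprK addrC subrK.
Qed.

(** The affine family X + s Y realizes every pair (Y, X), so [Evol_variation] reaches all curves in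
    the semidirect Lie algebra. *)
Lemma twist_linear (W : R -> E * E) : sm setT W ->
  exists2 c : R -> R -> E, scw c & W = twist (c 0, fun_velocity c) /\
    c = (fun s t => (W t).2 + s *: (W t).1).
Proof.
move=> hW; exists (fun s t => (W t).2 + s *: (W t).1).
  move=> a b ha hb; apply: smD.
    exact: (sm_snd (@sm_comp R _ setT setT _ _ (fun _ _ => I) hb hW)).
  apply: sm_scal => //.
  exact: (sm_fst (@sm_comp R _ setT setT _ _ (fun _ _ => I) hb hW)).
split=> //; apply/funext => t; rewrite [LHS]surjective_pairing /twist /= scale0r addr0; congr (_, _).
rewrite /fun_velocity; apply/esym; apply: isd_cderiv.
by apply: isd_eq (isdD (isd_cst _ _) (isd_line (W t).1 0)) _; rewrite add0r.
Qed.

(** Existence is [Evol_variation] for affine families. The evolution at time 1 of a family (Y_s,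
    X_s) consists of the value and the r-logarithmic derivative at r = 0 of the plot evol(X_s + r
    Y_s), and both are smooth in s. *)
Lemma semidirect_regular : regular SG.
Proof.
split; first exact: semidirect_lie.
  move=> W /smooth_curveP hW; have [c hc [-> _]] := twist_linear hW.
  by eexists; exact: (Evol_variation hc).
move=> W /fun_curve_scw hW.
pose Q r s := evol G (fun t => (W s t).2 + r *: (W s t).1).
have hQ : mplot Q.
  move=> a b ha hb; apply: evol_smooth => f k hf hk.
  have hWbf : sm setT (fun t => W (b (f t)) (k t)).
    by apply: hW => //; exact: (@sm_comp _ _ setT setT).
  apply: smD; first exact: (sm_snd hWbf).
  by apply: sm_scal; [exact: (@sm_comp _ _ setT setT) | exact: (sm_fst hWbf)].
have -> : (fun s => evol SG (W s)) = (fun s => ((rv (Q ^~ s) 0, Q 0 s) : SG)).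
  apply/funext => s; have [c hc [e1 e2]] := twist_linear (scw_snd s hW).
  rewrite /evol {1}e1 (is_Evol_unique (semidirect_lie hG) (Evol_variation hc)) e2 //.
apply: (@semidirect_smooth R E G hE (fun s => rv (Q ^~ s) 0) (Q 0)); last exact: mplot_snd.
by apply: (scw_rv1 hG hQ); [exact: sm_cst | exact: sm_id].
Qed.

Lemma tangent_regular : regular TG.
Proof.
exact: (@iso_regular R _ SG TG _ (semidirect_lie hG) (tangent_group_lie hG) _ rtriv_inv_iso rtriv_inv_one semidirect_regular).
Qed.

Lemma Evol_tangent (W : R -> E * E) : sm setT W ->
  Evol TG W = fun t => rtriv_inv (Evol SG W t).
Proof.
move=> /smooth_curveP hW; have [_ ex _] := semidirect_regular; have [z hz] := ex W hW.
exact: (@iso_Evol R _ SG TG _ (semidirect_lie hG) (tangent_group_lie hG) _ rtriv_inv_iso rtriv_inv_one _ _ hz).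
Qed.

Lemma rtriv_evol (W : R -> E * E) : sm setT W -> rtriv (evol TG W : mtan G) = evol SG W.
Proof. by move=> hW; rewrite /evol (Evol_tangent hW); exact: (rtriv_invK hG). Qed.

Lemma twist_smooth (c : R -> R -> E) : scw c -> sm setT (twist (c 0, fun_velocity c)).
Proof.
move=> hc; apply: sm_pair; last exact: scw_snd.
exact: (scw_partial 0 hc).
Qed.

Lemma velocity_Evol (c : R -> R -> E) t : scw c ->
  velocity (fun s => Evol G (c s) t) 0 = Evol TG (twist (c 0, fun_velocity c)) t.
Proof.
move=> hc; rewrite (Evol_tangent (twist_smooth hc)).
by rewrite (is_Evol_unique (semidirect_lie hG) (Evol_variation hc)) (velocity_rv hG).
Qed.

(** Variation of constants: with g = Evol X the equation A' = Y + [X, A] becomes (Ad(g^-1) A)' =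
    Ad(g^-1) Y, so Ad(g^-1) A is a primitive of the integrand. *)
Lemma Evol_semidirect (c : R -> R -> E) t : scw c ->
  Evol SG (twist (c 0, fun_velocity c)) t =
  (Ad (Evol G (c 0) t) (rint 0 t (fun s => Ad (inv (Evol G (c 0) s)) (fun_velocity c s))), Evol G (c 0) t).
Proof.
move=> hc; have hX := scw_snd 0 hc.
set g := Evol G (c 0); have hg : msmooth g by exact: Evol_smooth.
have hgi : msmooth (fun s => inv (g s)) by exact: msmoothV.
rewrite (is_Evol_unique (semidirect_lie hG) (Evol_variation hc)); congr (_, _).
pose A t := rv (fun s => Evol G (c s) t) 0; rewrite -/(A t).
have hA : sm setT A by apply: (scw_rv1 hG (Evol_mplot hc)); [exact: sm_cst | exact: sm_id].
have [_ /(congr1 fst) A0 eA] := iffLR (is_EvolP (semidirect_lie hG) _ _) (Evol_variation hc).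
have {}A0 : A 0 = 0 := A0.
have A' s : cderiv A s = fun_velocity c s + br (c 0 s) (A s).
  have /(congr1 fst) := eA s; rewrite (rv_semidirect hG s hA hg) (rv_Evol s hX) /twist /= => <-.
  by rewrite subrK.
rewrite (@rint_primitive R E hE (fun s => Ad (inv (g s)) (A s))).
- by rewrite A0 (Ad0 hG) subr0 (AdVK hG).
- by apply: (Ad_smooth hG) => //; exact: (scw_partial 0 hc).
move=> s; apply: isd_eq (Ad_deriv2 hG s hgi hA) _.
rewrite (rvV hG s hg) (rv_Evol s hX) (brNl hG) -(Ad_br hG) A' (AdD hG) addrCA addNr addr0 //.
Qed.

(** Right translation of Ad(g) I by g is left translation of I by g, as seen on the curve g q(s)
    with q of velocity I. *)
Lemma velocity_Evol_rint (c : R -> R -> E) t : scw c ->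
  velocity (fun s => Evol G (c s) t) 0 =
  tmap (gmul (Evol G (c 0) t))
    ((rint 0 t (fun s => Ad (inv (Evol G (c 0) s)) (fun_velocity c s)), one) : mtan G).
Proof.
move=> hc; rewrite velocity_Evol // (Evol_tangent (twist_smooth hc)) Evol_semidirect //.
set I := rint _ _ _; set g := Evol G (c 0) t.
have [q [hq q0 vq qI]] := curve_at_one hG I.
have hgq : msmooth (fun s => g ** q s) by exact: (@smooth_lmul R E G hE hG g q hq).
rewrite -vq -(velocity_tmap hM hM 0 (@smooth_lmul R E G hE hG g) hq).
rewrite (velocity_rv hG (gmul g \o q) 0) [rv _ _](rv_lmul_cst hG g 0 hq) qI.
by rewrite /rtriv_inv /= q0 (gmulg1 hG).
Qed.

End RegularGroups.

(** * Plots with prescribed velocities *)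

Section PlotVelocities.
Variables (R : realType) (F : tvsType R) (M : premanifold F).
Context {hF : hs F}.
Hypothesis hM : is_manifold M.

Lemma velocity_shift (c : R -> M) x : velocity (fun r => c (x + r)) 0 = velocity c x.
Proof.
rewrite /velocity addr0; congr (_, _).
rewrite /cderiv; congr (xget _ _); apply/seteqP; split=> l /= /diffquotP H; apply/diffquotP.
  by apply/isd_translate.
by apply/(isd_translate (chart (chart_at (c x)) \o c)).
Qed.

Lemma mplot_velocity1 (P : R -> R -> M) (a b : R -> R^o) : mplot P -> sm setT a -> sm setT b ->
  @msmooth R _ (mtan M) (fun t => velocity (P ^~ (b t)) (a t)).
Proof.
move=> hP ha hb.
have -> : (fun t => velocity (P ^~ (b t)) (a t)) =
    (fun t => velocity ((fun r t => P (a t + r) (b t)) ^~ t) 0).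
  by apply/funext => t; rewrite -velocity_shift.
apply: (@mplot_velocity R F M hF hM _ 0) => f g hf hg; apply: hP; last exact: (@sm_comp _ _ setT setT).
by apply: smD => //; exact: (@sm_comp _ _ setT setT).
Qed.

Lemma mplot_velocity2 (P : R -> R -> M) (a b : R -> R^o) : mplot P -> sm setT a -> sm setT b ->
  @msmooth R _ (mtan M) (fun t => velocity (P (a t)) (b t)).
Proof. by move=> /mplot_swap hP ha hb; exact: (mplot_velocity1 hP hb ha). Qed.

Lemma msmooth_velocity (p : R -> M) : msmooth p -> @msmooth R _ (mtan M) (velocity p).
Proof.
move=> hp; apply: (@mplot_velocity1 (fun s _ => p s) id (fun=> 0)); try exact: sm_id.
  by move=> a b ha hb; exact: msmooth_reparam.
exact: sm_cst.
Qed.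

(** The affine plane y + s u + t v in the chart at x, with cutoffs. It permits identities of 2-forms
    to be checked on plots only. *)
Lemma plot_at (x : M) (u v : F) : exists Q : R -> R -> M, mplot Q /\
  [/\ Q 0 0 = x, velocity (Q ^~ 0) 0 = ((u, x) : mtan M) & velocity (Q 0) 0 = ((v, x) : mtan M)].
Proof.
pose i := chart_at x; pose y := chart i x.
have hy : img i i y by apply: img_chart; exact: dom_at.
have h0 : img i i (y + 0 *: u + 0 *: v) by rewrite !scale0r !addr0.
have [d d0 hd] : exists2 d, 0 < d & forall s t, `|s - 0| < d -> `|t - 0| < d -> img i i (y + s *: u + t *: v).
  apply: (@plane_open R (fun s t => img i i (y + s *: u + t *: v)) _ 0 0 h0) => a b ha hb.
  apply: (@img_open R F M hM i i); apply/smooth_curveP; exact: scw_aff2.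
have [psi [hpsi pid pb]] := smooth_cutoff 0 d0.
pose Q s t := cochart i (y + psi s *: u + psi t *: v).
have psi0 : psi 0 = 0 by apply: pid; rewrite subrr normr0; lra.
have hQ : mplot Q.
  move=> a b ha hb t; apply: (@msm_cochart R F M hF hM i (fun t => y + psi (a t) *: u + psi (b t) *: v)).
    by apply: smooth_near_sm; apply: (scw_aff2 y u v); exact: (@sm_comp _ _ setT setT).
  by apply: hd; exact: pb.
have Q0 : Q 0 0 = x by rewrite /Q psi0 !scale0r !addr0 (chartK hM) //; exact: dom_at.
have aux (w : F) (q : R -> M) : (forall s, q s = cochart i (y + psi s *: w)) ->
   (forall s, img i i (y + psi s *: w)) -> velocity q 0 = ((w, x) : mtan M).
  move=> qE qd; have q0 : q 0 = x by rewrite qE psi0 scale0r addr0 (chartK hM) //; exact: dom_at.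
  rewrite /velocity q0; congr (_, _); apply: isd_cderiv.
  apply: (@isd_near R F (fun s => y + s *: w) _ _ _ (d / 4)); first by lra.
    by move=> s sd; rewrite /= qE (img_cochart hM (qd s)) pid.
  by apply: isd_eq (isdD (isd_cst y 0) (isd_line w 0)) _; rewrite add0r.
exists Q; split=> //; split=> //.
- apply: aux => s; rewrite /Q ?psi0 ?scale0r ?addr0 //.
  by have := hd (psi s) 0 (pb s) ltac:(by rewrite subrr normr0); rewrite scale0r addr0.
- apply: aux => s; rewrite /Q ?psi0 ?scale0r ?addr0 //.
  by have := hd 0 (psi s) ltac:(by rewrite subrr normr0) (pb s); rewrite scale0r addr0.
Qed.

End PlotVelocities.

(** * The exterior derivative along plots *)

Section Forms.
Variables (R : realType) (F E : tvsType R) (M : premanifold F).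
Context {hF : hs F} {hE : hs E}.
Hypothesis hM : is_manifold M.
Implicit Types (w : mtan M -> E).

Lemma form_sm w p : is_form w -> @msmooth R _ (mtan M) p -> sm setT (fun t => w (p t)).
Proof. by move=> [_ h] /h /(@msmooth_vec R E hE). Qed.

Lemma form0 w x : is_form w -> w ((0, x) : mtan M) = 0.
Proof. by move=> [h _]; have := h x (-1) 0 0; rewrite scaler0 addr0 scaleN1r addNr. Qed.

Lemma form_scw1 w P : is_form w -> mplot P -> scw (fun s t => w (velocity (P ^~ t) s)).
Proof. by move=> hw hP a b ha hb; apply: (form_sm hw); exact: mplot_velocity1. Qed.

Lemma form_scw2 w P : is_form w -> mplot P -> scw (fun s t => w (velocity (P s) t)).
Proof. by move=> hw hP a b ha hb; apply: (form_sm hw); exact: mplot_velocity2. Qed.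

Section Local.
Variables (w : mtan M -> E) (i : idx M).
Hypothesis hw : is_form w.
Let W (z : F * F) : E := w (@cochart R _ (mtan M) i z).

Lemma form_loc_open : cinf_open [set z : F * F | img i i z.2].
Proof.
move=> c /smooth_curveP hc; apply: (@img_open R F M hM i i (fun t => (c t).2)).
by apply/smooth_curveP; exact: sm_snd.
Qed.

Lemma form_loc_smooth : smooth_on [set z : F * F | img i i z.2] W.
Proof.
move=> z /smooth_curveP hz Uz; apply/smooth_curveP; apply: (form_sm hw).
move=> t; apply: (@msm_cochart R _ (mtan M) _ (mtan_manifold hM) i z).
  exact: smooth_near_sm.
exists (@cochart R _ (mtan M) i (z t)).
  by have [] := img_dom hM (Uz t); split.
by case: (z t) (Uz t) => v y hy; apply: mtan_cochartK.
Qed.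

Lemma form_loc_linear y a (u v : F) : img i i y -> W (a *: u + v, y) = a *: W (u, y) + W (v, y).
Proof.
move=> hy; rewrite /W /=; have [h _] := hw; rewrite -h; congr (w (_, _)).
set j := chart_at _.
apply: (@cc_linear R F F hF hF _ _ _ _ _ _ (@img_open R F M hM i j) (@trans_smooth R F M hM i j)).
by apply: (img_of hM hy); exact: dom_at.
Qed.

Lemma form_loc_isd y (v v' u : F) : img i i y ->
  dirder W (v, y) (v', u) = dirder (fun y => form_loc w i y v) y u + W (v', y).
Proof.
move=> hy.
have L : dirder W (v, y) (1 *: (0, u) + (v', 0)) = 1 *: dirder W (v, y) (0, u) + dirder W (v, y) (v', 0).
  exact: (@cc_linear R _ E (@hs_prod R F F hF hF) hE [set z : F * F | img i i z.2] W (v, y) 1 (0, u) (v', 0)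
    form_loc_open form_loc_smooth hy).
have e : 1 *: (0, u) + (v', 0) = (v', u) :> F * F.
  by rewrite scale1r -[LHS]/(0 + v', u + 0) add0r addr0.
rewrite e scale1r in L; rewrite L.
have -> : dirder W (v, y) (0, u) = dirder (fun y => form_loc w i y v) y u.
  apply: (congr1 (fun f => cderiv f 0)); apply/funext => t.
  have -> : (v, y) + t *: (0, u) = (v, y + t *: u) :> F * F.
    by rewrite -[LHS]/(v + t *: 0, y + t *: u) scaler0 addr0.
  by [].
suff -> : dirder W (v, y) (v', 0) = W (v', y) by [].
rewrite /dirder; apply: isd_cderiv.
have -> : (fun t : R => W ((v, y) + t *: (v', 0))) = (fun t => W (v, y) + t *: W (v', y)).
  apply/funext => t; rewrite -[(v, y) + _]/(v + t *: v', y + t *: 0) scaler0 addr0.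
  by rewrite [v + _]addrC form_loc_linear // addrC.
by apply: isd_eq (isdD (isd_cst _ 0) (isd_line (W (v', y)) 0)) _; rewrite add0r.
Qed.

Lemma form_loc_chain (y v : R -> F) t : smooth_near y t -> smooth_near v t -> img i i (y t) ->
  isd (fun s => W (v s, y s)) t
    (dirder (fun y => form_loc w i y (v t)) (y t) (cderiv y t) + W (cderiv v t, y t)).
Proof.
move=> hy hv yt; rewrite -form_loc_isd //.
have hz : smooth_near (fun s => (v s, y s)) t.
  move: hy hv => /smooth_nearP[a a0 ha] /smooth_nearP[b b0 hb].
  apply/smooth_nearP; exists (Order.min a b); first by rewrite lt_min a0.
  apply: sm_pair; [apply: sm_sub hb | apply: sm_sub ha];
    by move=> s /=; rewrite lt_min => /andP[].
apply: (@cc_chain' R _ E _ _ _ W (fun s => (v s, y s)) t _ form_loc_open form_loc_smooth hz yt).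
by apply: isd_pair; exact: smooth_near_isd.
Qed.

End Local.

(** In the chart each term is a derivative of the coefficients of w plus w of a mixed second
    derivative of Q. The coefficient parts form dw, and the mixed parts cancel by symmetry. *)
Lemma extd_plot w (Q : R -> R -> M) s0 t0 : is_form w -> mplot Q ->
  cderiv (fun s => w (velocity (Q s) t0)) s0 - cderiv (fun t => w (velocity (Q ^~ t) s0)) t0 =
  extd w (Q s0 t0) (velocity (Q ^~ t0) s0).1 (velocity (Q s0) t0).1.
Proof.
move=> hw hQ; pose i := chart_at (Q s0 t0); have di : dom i (Q s0 t0) by exact: dom_at.
have [K [d d0 [hK KE]]] := mplot_chart hQ di.
have z0 (r : R) : `|r - r| < d by rewrite subrr normr0.
have half (P : R -> R -> M) (k : R -> R -> F) r0 q0 : mplot P -> scw k ->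
  (forall r q, `|r - r0| < d -> `|q - q0| < d -> dom i (P r q) /\ k r q = chart i (P r q)) ->
  cderiv (fun r => w (velocity (P r) q0)) r0 =
  dirder (fun y => form_loc w i y (cderiv (k r0) q0)) (k r0 q0) (cderiv (k ^~ q0) r0)
  + w (@cochart R _ (mtan M) i (cderiv (fun r => cderiv (k r) q0) r0, k r0 q0)).
  move=> hP hk kE; apply: isd_cderiv.
  have hy : smooth_near (k ^~ q0) r0 by apply: smooth_near_sm; exact: scw_fst.
  have hv : smooth_near (fun r => cderiv (k r) q0) r0.
    by apply: smooth_near_sm; exact: (scw_partial q0 (scw_swap hk)).
  have [dP kP] := kE r0 q0 (z0 _) (z0 _).
  have im : img i i (k r0 q0) by rewrite kP; exact: img_chart.
  apply: (isd_near d0 _ (form_loc_chain hw hy hv im)) => r rd.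
  have [dr kr] := kE r q0 rd (z0 _); congr w.
  have -> : cderiv (k r) q0 = cderiv (chart i \o P r) q0.
    by apply: (cderiv_ext d0) => q qd; have [_ ->] := kE r q rd qd.
  rewrite kr -(mtan_chart_velocity hM (@mplot_snd R F M P r hP q0) dr).
  exact: (@chartK R _ (mtan M) (mtan_manifold hM) i).
rewrite (half Q K) // (half (fun s t => Q t s) (fun s t => K t s)) //; last first.
- by move=> t s td sd; exact: KE.
- exact: scw_swap.
- exact: mplot_swap.
rewrite (scw_sym s0 t0 hK) opprD addrACA subrr addr0 /extd.
have [_ K0] := KE s0 t0 (z0 _) (z0 _).
have e1 : cderiv (K ^~ t0) s0 = (velocity (Q ^~ t0) s0).1.
  by rewrite /velocity /=; apply: (cderiv_ext d0) => s sd; have [_ ->] := KE s t0 sd (z0 _).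
have e2 : cderiv (K s0) t0 = (velocity (Q s0) t0).1.
  by rewrite /velocity /=; apply: (cderiv_ext d0) => t td; have [_ ->] := KE s0 t (z0 _) td.
by rewrite e1 e2 K0.
Qed.

End Forms.

(** * The structure equations expressed on plots *)

Section StructureEquation.
Variables (R : realType) (F E : tvsType R) (M : premanifold F).
Context {hF : hs F} {hE : hs E}.
Hypothesis hM : is_manifold M.
Implicit Types (w : mtan M -> E) (Q : R -> R -> M).

Definition curl w Q s t : E :=
  cderiv (fun s => w (velocity (Q s) t)) s - cderiv (fun t => w (velocity (Q ^~ t) s)) t.

Lemma mc_eqP (br : E -> E -> E) w : is_form w -> (forall x y, br x y = - br y x) ->
  mc_eq br w <-> forall Q, mplot Q -> forall s t,
    curl w Q s t = br (w (velocity (Q ^~ t) s)) (w (velocity (Q s) t)).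
Proof.
move=> hw anti.
(* Antisymmetry absorbs the factor 1/2: the wedge bracket of a form with itself is twice the bracket
   of its values. *)
have half a b : 2%:R^-1 *: (br a b - br b a) = br a b.
  have -> : br a b - br b a = 2%:R *: br a b by rewrite (anti b a) opprK scaler_nat mulr2n.
  by rewrite scalerA mulVf ?scale1r // pnatr_eq0.
split=> [H Q hQ s t|H x u v].
  rewrite /curl (extd_plot hM s t hw hQ).
  have := H (Q s t) (velocity (Q ^~ t) s).1 (velocity (Q s) t).1.
  by rewrite /bracket_wedge half => /eqP; rewrite subr_eq0 => /eqP.
have [Q [hQ [Q0 Qu Qv]]] := plot_at hM x u v.
have := H Q hQ 0 0; rewrite /curl (extd_plot hM 0 0 hw hQ) Q0 Qu Qv /= => ->.
by rewrite /bracket_wedge half subrr.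
Qed.

Lemma mc_lin_eqP (br : E -> E -> E) xi eta : is_form eta ->
  mc_lin_eq br xi eta <-> forall Q, mplot Q -> forall s t,
    curl eta Q s t = br (xi (velocity (Q ^~ t) s)) (eta (velocity (Q s) t))
     - br (xi (velocity (Q s) t)) (eta (velocity (Q ^~ t) s)).
Proof.
move=> hw; split=> [H Q hQ s t|H x u v].
  rewrite /curl (extd_plot hM s t hw hQ).
  have := H (Q s t) (velocity (Q ^~ t) s).1 (velocity (Q s) t).1.
  by rewrite /bracket_wedge => /eqP; rewrite subr_eq0 => /eqP.
have [Q [hQ [Q0 Qu Qv]]] := plot_at hM x u v.
have := H Q hQ 0 0; rewrite /curl (extd_plot hM 0 0 hw hQ) Q0 Qu Qv /= => ->.
by rewrite /bracket_wedge subrr.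
Qed.

Lemma curve_pair (A B : R -> E) : sm setT A -> sm setT B -> forall t,
  cderiv (fun t => (A t, B t)) t = (cderiv A t, cderiv B t).
Proof.
by move=> hA hB t; apply: isd_cderiv; apply: isd_pair; [exact: (smT_isd t 0 hA) | exact: (smT_isd t 0 hB)].
Qed.

Lemma is_form_pair (eta xi : mtan M -> E) :
  @is_form R F (E * E)%type M (fun z => (eta z, xi z)) <-> is_form eta /\ is_form xi.
Proof.
split=> [[h1 h2]|[[a1 a2] [b1 b2]]].
  have S z : @msmooth R _ (mtan M) z -> sm setT (fun t => (eta (z t), xi (z t))).
    by move=> hz; have := h2 z hz; move/(@msmooth_vec R _ (@hs_prod R E E hE hE)).
  split; split.
  - by move=> x a u v; have /(congr1 fst) := h1 x a u v.
  - by move=> z hz; apply/(@msmooth_vec R E hE); exact: (sm_fst (S z hz)).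
  - by move=> x a u v; have /(congr1 snd) := h1 x a u v.
  - by move=> z hz; apply/(@msmooth_vec R E hE); exact: (sm_snd (S z hz)).
split=> [x a u v|z hz]; first by rewrite a1 b1.
apply/(@msmooth_vec R _ (@hs_prod R E E hE hE)); apply: sm_pair.
  by have := a2 z hz; move/(@msmooth_vec R E hE).
by have := b2 z hz; move/(@msmooth_vec R E hE).
Qed.

Lemma form_curveP (c : R -> mtan M -> E) : form_curve c -> forall (a : R -> R^o) (p : R -> mtan M),
  sm setT a -> @msmooth R _ (mtan M) p -> sm setT (fun t => c (a t) (p t)).
Proof. by move=> [_ /(fun_curveP (mtan_manifold hM))]. Qed.

Lemma form_curve_scw (c : R -> mtan M -> E) p : form_curve c -> @msmooth R _ (mtan M) p ->
  scw (fun s t => c s (p t)).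
Proof.
move=> hc hp a b ha hb; apply: (form_curveP hc ha).
exact: (@msmooth_reparam R _ (mtan M)).
Qed.

Lemma form_curve_isd (c : R -> mtan M -> E) x s : form_curve c ->
  isd (fun s => c s x) s (cderiv (fun s => c s x) s).
Proof.
move=> hc; apply: (smT_isd s 0 (c := fun s => c s x)).
have hx : @msmooth R _ (mtan M) (fun=> x) by apply: msmooth_cst; exact: mtan_manifold.
exact: (scw_fst 0 (form_curve_scw hc hx)).
Qed.

Lemma form_curve_velocity (c : R -> mtan M -> E) : form_curve c -> is_form (fun_velocity c).
Proof.
move=> hc; split=> [x a u v|p hp].
  rewrite /fun_velocity.
  have -> : (fun t => c t (a *: u + v, x)) = (fun t => a *: c t (u, x) + c t (v, x)).
    by apply/funext => t; have [[h _] _] := (hc.1 t, I); exact: h.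
  by apply: isd_cderiv; apply: isdD; [apply: isdZ |]; exact: form_curve_isd.
apply/(@msmooth_vec R E hE); exact: (scw_partial 0 (form_curve_scw hc hp)).
Qed.

End StructureEquation.

(** * Logarithmic derivatives of maps, and flatness over the semidirect product *)

Section GroupForms.
Variables (R : realType) (F E : tvsType R) (M : premanifold F) (G : prelie E).
Context {hF : hs F} {hE : hs E}.
Hypotheses (hM : is_manifold M) (hG : is_lie_group G).
Local Opaque lie_bracket.
Local Notation br := (lie_bracket G).
Let hGM := lie_manifold hG.

Lemma rlogder_velocity (f : M -> G) (p : R -> M) t : smooth_map f -> msmooth p ->
  rlogder f (velocity p t) = rv (fun s => f (p s)) t.
Proof.
move=> hf hp; rewrite /rlogder -(velocity_tmap hM hGM t hf hp) //.
Qed.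

Lemma kappa_linear (x : G) a (u v : E) :
  kappa ((a *: u + v, x) : mtan G) = a *: kappa ((u, x) : mtan G) + kappa ((v, x) : mtan G).
Proof. exact: (@tmap_linear R E E G G hE hE hGM hGM _ x a u v (@smooth_rmul R E G hE hG (ginv x))). Qed.

Lemma rlogder_form (f : M -> G) : smooth_map f -> is_form (rlogder f).
Proof.
move=> hf; split=> [x a u v|p hp].
  have L := @tmap_linear R F E M G hF hE hM hGM f x a u v hf.
  have e y : tmap f ((y, x) : mtan M) = (((tmap f ((y, x) : mtan M)).1, f x) : mtan G) by [].
  by rewrite /rlogder (e (a *: u + v)) L kappa_linear.
apply/(@msmooth_vec R E hE); apply: (kappa_smooth hG).
by apply: (tmap_smooth hM hGM).
Qed.

Lemma rlogder_mc (f : M -> G) : smooth_map f -> mc_eq br (rlogder f).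
Proof.
move=> hf; apply/(mc_eqP hM (rlogder_form hf) (br_anti hG)) => Q hQ s t.
have hP : mplot (fun s t => f (Q s t)) by move=> a b ha hb; exact: (hf _ (hQ a b ha hb)).
have e1 s' t' : rlogder f (velocity (Q s') t') = rv ((fun s t => f (Q s t)) s') t'.
  by rewrite rlogder_velocity //; exact: mplot_snd.
have e2 s' t' : rlogder f (velocity (Q ^~ t') s') = rv ((fun s t => f (Q s t)) ^~ t') s'.
  by rewrite rlogder_velocity //; exact: (@mplot_fst R F M Q t' hQ).
rewrite (e1 s t) (e2 s t) -(maurer_cartan hG s t hP).
exact: (f_equal2 (fun a b => cderiv a s - cderiv b t) (funext (fun s' => e1 s' t))
  (funext (fun t' => e2 s t'))).
Qed.

(** Differentiate the structure equation of c_r on a plot with respect to r at 0: partials commute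
    by [scw_sym], and [br_deriv] gives the two bracket terms. *)
Lemma flat_velocity (c : R -> mtan M -> E) : flat_curve br c ->
  mc_lin_eq br (c 0) (fun_velocity c).
Proof.
move=> [hc fl]; apply/(mc_lin_eqP hM br (c 0) (form_curve_velocity hM hc)) => Q hQ s t.
have hb : scw (fun r s' => c r (velocity (Q s') t)).
  apply: (form_curve_scw hM hc); apply: (mplot_velocity2 hM hQ); [exact: sm_id | exact: sm_cst].
have ha : scw (fun r t' => c r (velocity (Q ^~ t') s)).
  apply: (form_curve_scw hM hc); apply: (mplot_velocity1 hM hQ); [exact: sm_cst | exact: sm_id].
pose al r := c r (velocity (Q ^~ t) s); pose be r := c r (velocity (Q s) t).
have hal : sm setT al by exact: (scw_fst t ha).
have hbe : sm setT be by exact: (scw_fst s hb).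
pose A r := cderiv (fun s' => c r (velocity (Q s') t)) s.
pose B r := cderiv (fun t' => c r (velocity (Q ^~ t') s)) t.
have hA : sm setT A by exact: (scw_partial s (scw_swap hb)).
have hB : sm setT B by exact: (scw_partial t (scw_swap ha)).
have -> : curl (fun_velocity c) Q s t = cderiv A 0 - cderiv B 0.
  by rewrite /curl /fun_velocity (scw_sym 0 s hb) (scw_sym 0 t ha).
have AB : (fun r => A r - B r) = (fun r => br (al r) (be r)).
  apply/funext => r; have [hr] := fl r.
  by move/(mc_eqP hM hr (br_anti hG)) => /(_ Q hQ s t).
have h1 : isd (fun r => A r - B r) 0 (cderiv A 0 - cderiv B 0).
  by apply: isdB; [exact: (smT_isd 0 0 hA) | exact: (smT_isd 0 0 hB)].
rewrite AB in h1; rewrite (isd_unique h1 (br_deriv hG 0 hal hbe)).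
have comm x y x' y' : br x' y + br x y' = br x y' - br y x'.
  by rewrite [br y x'](br_anti hG) opprK; exact: addrC.
exact: (comm (al 0) (be 0) (cderiv al 0) (cderiv be 0)).
Qed.

(** On plots the equation splits into components, and [br_semidirect] yields the linearized equation
    in the first and flatness in the second. *)
Lemma flat_semidirect (w : mtan M -> E * E) : flat (lie_bracket (semidirect G)) w <->
  [/\ is_form w, mc_lin_eq br (fun z => (w z).2) (fun z => (w z).1) & mc_eq br (fun z => (w z).2)].
Proof.
have wE : w = (fun z => ((w z).1, (w z).2)) by apply/funext => z; case: (w z).
have formP : is_form w <-> is_form (fun z => (w z).1) /\ is_form (fun z => (w z).2).
  by rewrite {1}wE; exact: is_form_pair.
have curlE Q s t : is_form w -> mplot Q ->
  curl w Q s t = (curl (fun z => (w z).1) Q s t, curl (fun z => (w z).2) Q s t).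
  move=> hw hQ; have [h1 h2] := iffLR formP hw; rewrite /curl.
  rewrite {1 2}wE.
  rewrite (curve_pair (scw_fst t (form_scw2 hM h1 hQ)) (scw_fst t (form_scw2 hM h2 hQ))).
  by rewrite (curve_pair (scw_snd s (form_scw1 hM h1 hQ)) (scw_snd s (form_scw1 hM h2 hQ))).
split=> [[hw]|[hw]].
  move/(mc_eqP hM hw (br_anti (semidirect_lie hG))) => H; have [h1 h2] := iffLR formP hw.
  split=> //; [apply/(mc_lin_eqP hM br _ h1) | apply/(mc_eqP hM h2 (br_anti hG))] => Q hQ s t;
    have := H Q hQ s t; rewrite curlE // [w (velocity (Q ^~ t) s)]surjective_pairing
    [w (velocity (Q s) t)]surjective_pairing (br_semidirect hG).
  - by move/(congr1 fst).
  - by move/(congr1 snd).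
have [h1 h2] := iffLR formP hw.
move=> /(mc_lin_eqP hM br _ h1) H1 /(mc_eqP hM h2 (br_anti hG)) H2; split=> //.
apply/(mc_eqP hM hw (br_anti (semidirect_lie hG))) => Q hQ s t.
rewrite curlE // H1 // H2 // [w (velocity (Q ^~ t) s)]surjective_pairing.
by rewrite [w (velocity (Q s) t)]surjective_pairing (br_semidirect hG).
Qed.

End GroupForms.

(** * Star shaped chart neighbourhoods *)

Section Stars.
Variables (R : realType) (F : tvsType R) (M : premanifold F).
Context {hF : hs F}.
Hypothesis hM : is_manifold M.

Definition step : R -> R^o := projT1 (cid (@smooth_step R)).

Lemma step_smooth : sm setT step.
Proof. by rewrite /step; case: (cid _) => rho /= []. Qed.
Lemma step0 : step 0 = 0.
Proof. by rewrite /step; case: (cid _) => rho /= [_ h _ _]; exact: h. Qed.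
Lemma step1 : step 1 = 1.
Proof. by rewrite /step; case: (cid _) => rho /= [_ _ h _]; exact: h. Qed.
Lemma step_itv t : 0 <= (step t : R) <= 1.
Proof. by rewrite /step; case: (cid _) => rho /= []. Qed.

Definition star (A : set F) (y : F) : set F :=
  [set z | forall r, 0 <= r -> r <= 1 -> A (y + r *: (z - y))].

Lemma star_center A y : A y -> star A y y.
Proof. by move=> Ay r _ _; rewrite subrr scaler0 addr0. Qed.

Lemma star_sub A y z : star A y z -> A z.
Proof. by move=> /(_ 1 ler01 (lexx _)); rewrite scale1r addrC subrK. Qed.

Lemma star_line A y z r : star A y z -> 0 <= r -> r <= 1 -> star A y (y + r *: (z - y)).
Proof.
move=> H r0 r1 q q0 q1; have -> : y + q *: (y + r *: (z - y) - y) = y + (q * r) *: (z - y) by lmod F.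
by apply: H; [exact: mulr_ge0 | rewrite mulr_ile1].
Qed.

Lemma scw_line_to (y : F) (c : R -> F) : sm setT c -> scw (fun r t => y + r *: (c t - y)).
Proof.
move=> hc a b ha hb; apply: smD; first exact: sm_cst.
apply: sm_scal => //; apply: smB; last exact: sm_cst.
exact: (@sm_comp _ _ setT setT).
Qed.

(** [plane_open] gives room around each point of the segment to c(t0), and real induction along the
    segment makes the room in t uniform. *)
Lemma star_open A y : cinf_open A -> cinf_open (star A y).
Proof.
move=> oA c /smooth_curveP hc; apply: real_open => t0 st0.
have hl := scw_line_to y hc.
have [d d0 hd] : exists2 d, 0 < d & forall r t, 0 <= r -> r <= 1 -> `|t - t0| < d -> A (y + r *: (c t - y)).
  apply: (@real_induction R (fun q => exists2 d, 0 < d & forall r t, 0 <= r -> r <= q -> `|t - t0| < d ->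
     A (y + r *: (c t - y))) 0 1 ler01).
    exists 1 => // r t r0 r1 _; have -> : r = 0 by apply/eqP; rewrite eq_le r0 r1.
    rewrite scale0r addr0; have := st0 0 (lexx _) ler01; by rewrite scale0r addr0.
  move=> q q0 q1; have [d d0 hd] : exists2 d, 0 < d & forall r t, `|r - q| < d -> `|t - t0| < d -> A (y + r *: (c t - y)).
    apply: (@plane_open R (fun r t => A (y + r *: (c t - y)))); last exact: st0.
    by move=> a b ha hb; apply: oA; apply/smooth_curveP; exact: hl.
  exists d => // s u s0 sq qu u1 ds ud [d' d'0 hd'].
  exists (Order.min d d'); first by rewrite lt_min d0.
  move=> r t r0 ru; rewrite lt_min => /andP[td td'].
  have [rs|sr] := leP r s; first exact: hd'.
  by apply: hd => //; rewrite ltr_norml; apply/andP; split; lra.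
by exists d => // t td r r0 r1; exact: hd.
Qed.

Lemma mopenP (W : set M) : mopen W <-> forall (q : R -> M) t, msm q t -> W (q t) ->
  exists2 d, 0 < d & forall s, `|s - t| < d -> W (q s).
Proof.
split=> [oW q t hq Wq|H i].
  pose i := chart_at (q t); have di : dom i (q t) by exact: dom_at.
  have [/nbhs_real[d d0 hd] hc] := hq i di.
  have [|e e0 he] := cinf_open_near (oW i) hc; first by exists (q t).
  exists (Order.min d e); first by rewrite lt_min d0.
  move=> s; rewrite lt_min => /andP[sd se]; have [z [Wz dz]] := he s se.
  by move=> /(congr1 (cochart i)); rewrite /= !(chartK hM) // => [<-//|]; exact: hd.
move=> c /smooth_curveP hc; apply: real_open => t [z [Wz dz] zt].
have im : img i i (c t) by rewrite -zt; exact: img_chart.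
have hq : msm (fun s => cochart i (c s)) t by apply: (msm_cochart hM) => //; exact: smooth_near_sm.
have qz : cochart i (c t) = z by rewrite -zt (chartK hM).
have [|d d0 hd] := H _ _ hq; first by rewrite qz.
have [e e0 he] := cinf_open_near (@img_open R F M hM i i) (smooth_near_sm t hc) im.
exists (Order.min d e); first by rewrite lt_min d0.
move=> s; rewrite lt_min => /andP[sd se]; exists (cochart i (c s)).
  by split; [exact: hd | have [] := img_dom hM (he s se)].
exact: (img_cochart hM (he s se)).
Qed.

Lemma mopenT : mopen (setT : set M).
Proof. by apply/mopenP => q t _ _; exists 1. Qed.

Lemma mopenI (V W : set M) : mopen V -> mopen W -> mopen (V `&` W).
Proof.
move=> /mopenP hV /mopenP hW; apply/mopenP => q t hq [Vq Wq].
have [d d0 hd] := hV q t hq Vq; have [e e0 he] := hW q t hq Wq.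
exists (Order.min d e); first by rewrite lt_min d0.
by move=> s; rewrite lt_min => /andP[sd se]; split; [exact: hd | exact: he].
Qed.

Let A (V : set M) (x : M) : set F := chart (chart_at x) @` (V `&` dom (chart_at x)).

Definition mstar (V : set M) (x : M) : set M :=
  [set z | dom (chart_at x) z /\ star (A V x) (chart (chart_at x) x) (chart (chart_at x) z)].

Lemma mstar_open V x : mopen V -> mopen (mstar V x).
Proof.
move=> oV; have oA : cinf_open (A V x) by exact: oV.
apply/mopenP => q t hq [di st].
have [/nbhs_real[d d0 hd] hc] := hq _ di.
have [e e0 he] := cinf_open_near (@star_open _ (chart (chart_at x) x) oA) hc st.
exists (Order.min d e); first by rewrite lt_min d0.
by move=> s; rewrite lt_min => /andP[sd se]; split; [exact: hd | exact: he].
Qed.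

Lemma mstar_center (V : set M) x : V x -> mstar V x x.
Proof.
move=> Vx; split; first exact: dom_at.
by apply: star_center; exists x; [split=> //; exact: dom_at | ].
Qed.

(** The segment from x to z in the chart at x. Running it with [step] keeps it inside the star for
    all real times. *)
Definition join (x z : M) (t : R) : M :=
  cochart (chart_at x)
    (chart (chart_at x) x + step t *: (chart (chart_at x) z - chart (chart_at x) x)).

Lemma A_of V x y : A V x y -> [/\ img (chart_at x) (chart_at x) y, V (cochart (chart_at x) y),
  dom (chart_at x) (cochart (chart_at x) y) & chart (chart_at x) (cochart (chart_at x) y) = y].
Proof. by case=> z [Vz dz] <-; rewrite (chartK hM) //; split=> //; exact: img_chart. Qed.

Lemma mstar_img V x z r : mstar V x z -> 0 <= r <= 1 ->
  img (chart_at x) (chart_at x) (chart (chart_at x) x + r *: (chart (chart_at x) z - chart (chart_at x) x)).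
Proof. by move=> [dz st] /andP[r0 r1]; have [] := A_of (st r r0 r1). Qed.

Lemma join_mstar V x z t : mstar V x z -> mstar V x (join x z t).
Proof.
move=> [dz st]; have /andP[s0 s1] := step_itv t; have [_ _ dj ej] := A_of (st _ s0 s1).
by split=> //; rewrite /join ej; exact: star_line.
Qed.

Lemma mstar_sub V x z : mstar V x z -> V z.
Proof. by move=> [dz /star_sub/A_of[_]]; rewrite (chartK hM). Qed.

Lemma join_mplot V x (q : R -> M) : msmooth q -> (forall s, mstar V x (q s)) ->
  mplot (fun s t => join x (q s) t).
Proof.
move=> hq Vq a b ha hb t; rewrite /join.
have hc : smooth_near (chart (chart_at x) \o (fun s => q (a s))) t.
  have hqa : msmooth (fun s => q (a s)) by exact: msmooth_reparam.
  by have [] := hqa t (chart_at x) (Vq _).1.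
apply: (msm_cochart hM); last by apply: mstar_img => //; exact: step_itv.
have /smooth_nearP[d d0 hd] := hc; apply/smooth_nearP; exists d => //.
apply: smD; first exact: sm_cst.
apply: sm_scal; last by apply: smB => //; exact: sm_cst.
exact: (@sm_comp _ _ _ setT _ _ (fun _ _ => I) (sm_sub (fun _ _ => I) hb) step_smooth).
Qed.

Lemma join_smooth V x z : mstar V x z -> msmooth (join x z).
Proof.
move=> h; have hz : msmooth (fun=> z) by exact: msmooth_cst.
exact: (@mplot_snd R F M _ 0 (join_mplot hz (fun=> h))).
Qed.

Lemma join0 x z : join x z 0 = x.
Proof. by rewrite /join step0 scale0r addr0 (chartK hM) //; exact: dom_at. Qed.

Lemma join1 V x z : mstar V x z -> join x z 1 = z.
Proof. by case=> dz _; rewrite /join step1 scale1r addrC subrK (chartK hM). Qed.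

End Stars.

(** * Local primitives of flat forms *)

Section Primitives.
Variables (R : realType) (F E : tvsType R) (M : premanifold F) (K : prelie E).
Context {hF : hs F} {hE : hs E}.
Hypotheses (hM : is_manifold M) (hK : is_lie_group K).
Local Opaque lie_bracket.
Local Notation br := (lie_bracket K).
Local Notation "x ** y" := (@gmul R E K x y) (at level 40, left associativity).
Local Notation inv := (@ginv R E K).
Local Notation one := (gone K).

(** Having logarithmic derivative xi on V, stated on curves inside V because f is a total map whose
    values off V are arbitrary. *)
Definition primitive (xi : mtan M -> E) (f : M -> K) (V : set M) : Prop :=
  forall p : R -> M, msmooth p -> (forall t, V (p t)) ->
    msmooth (fun t => f (p t)) /\ forall t, rv (fun t => f (p t)) t = xi (velocity p t).

Lemma primitive_unique xi f h V x : primitive xi f V -> primitive xi h V ->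
  exists k, forall z, mstar V x z -> f z = h z ** k.
Proof.
move=> hf hh; exists (inv (h x) ** f x) => z Vz.
have hj : msmooth (join x z) by exact: (join_smooth hM Vz).
have Vj t : V (join x z t) by apply: (mstar_sub hM); exact: join_mstar.
have [f1 f2] := hf _ hj Vj; have [h1 h2] := hh _ hj Vj.
have hk : msmooth (fun t => h (join x z t) ** (inv (h x) ** f x)) by exact: (@smooth_rmul R E K hE hK _ _ h1).
have := rv_unique hK f1 hk _ _ 1; rewrite (join1 hM Vz); apply.
  by move=> t; rewrite (rv_rmul hK _ t h1) f2 h2.
by rewrite (join0 hM) (gmulA hK) (gmulgV hK) (gmul1g hK).
Qed.

(** The equation makes Ad(g^-1) x constant. *)
Lemma linear_ode0 (g : R -> K) (x : R -> E) : msmooth g -> sm setT x -> x 0 = 0 ->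
  (forall t, cderiv x t = br (rv g t) (x t)) -> forall t, x t = 0.
Proof.
move=> hg hx x0 ode t; have hi := msmoothV hK hg.
have D s : isd (fun s => Ad (inv (g s)) (x s)) s 0.
  apply: isd_eq (Ad_deriv2 hK s hi hx) _.
  by rewrite (rvV hK s hg) (brNl hK) -(Ad_br hK) ode addNr.
have e : Ad (inv (g t)) (x t) = 0.
  rewrite -[RHS](Ad0 hK (inv (g 0))) -x0; have [t0|/ltW t0] := leP 0 t.
    exact: (isd0_const t0 (c := fun s => Ad (inv (g s)) (x s))).
  exact/esym/(isd0_const t0 (c := fun s => Ad (inv (g s)) (x s))).
by rewrite -(AdVK hK (g t) (x t)) e (Ad0 hK).
Qed.

Lemma br_difference (X Y Z a b c : E) : X - Z = br a c -> X - Y = br b c -> Z - Y = br c (a - b).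
Proof.
move=> e1 e2; rewrite (br_anti hK c) (brDl hK) (brNl hK) -e1 -e2 opprB opprB.
by rewrite [RHS]addrC addrA subrK.
Qed.

Hypothesis regK : regular K.

Definition local_primitive (xi : mtan M -> E) (x z : M) : K :=
  evol K (fun t => xi (velocity (join x z) t)).

(** Let Q(s, t) be the radial paths to p(s) and Ga(s, t) the evolutions of xi along them. The defect
    d(t), the s-logarithmic derivative of Ga minus xi of the s-velocity of Q, is 0 at t = 0. The
    Maurer-Cartan equation of Ga and the flatness of xi give d' = [rv Ga, d], so d vanishes also at
    t = 1. *)
Lemma local_primitiveP xi x : is_form xi -> mc_eq br xi ->
  primitive xi (local_primitive xi x) (mstar setT x).
Proof.
move=> hxi /(mc_eqP hM hxi (br_anti hK)) mc p hp Vp.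
pose Q s t := join x (p s) t.
have hQ : mplot Q by exact: (join_mplot hM hp Vp).
have hb : scw (fun s t => xi (velocity (Q s) t)) by exact: (form_scw2 hM hxi hQ).
have ha : scw (fun s t => xi (velocity (Q ^~ t) s)) by exact: (form_scw1 hM hxi hQ).
pose Ga s t := Evol K (fun t => xi (velocity (Q s) t)) t.
have hGa : mplot Ga by exact: (Evol_mplot hK regK hb).
split=> [|s]; first exact: (@mplot_fst R E K Ga 1 hGa).
rewrite -[LHS]/(rv (Ga ^~ 1) s).
pose d t := rv (Ga ^~ t) s - xi (velocity (Q ^~ t) s).
have hr : sm setT (fun t => rv (Ga ^~ t) s) by exact: (scw_snd s (scw_rv1 hK hGa)).
have hd : sm setT d by apply: smB => //; exact: (scw_snd s ha).
have rvGa r t : rv (Ga r) t = xi (velocity (Q r) t) by exact: (rv_Evol hK regK t (scw_snd r hb)).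
suff /eqP : d 1 = 0.
  rewrite subr_eq0 => /eqP ->; congr (xi (velocity _ _)).
  by apply/funext => s'; rewrite /Q (join1 hM (Vp s')).
apply: (@linear_ode0 (Ga s) d (@mplot_snd R E K Ga s hGa) hd).
  rewrite /d.
  have -> : Ga ^~ 0 = fun=> one by apply/funext => r; exact: (Evol0 hK regK (scw_snd r hb)).
  have -> : Q ^~ 0 = fun=> x by apply/funext => r; exact: (join0 hM).
  by rewrite (rv_cst hK) velocity_cst (form0 _ hxi) subr0.
move=> t; have MC := @maurer_cartan R E K hE hK Ga s t hGa; have := mc Q hQ s t; rewrite /curl.
set X := cderiv _ s; set Y := cderiv _ t => e2.
have e1 : X - cderiv (fun t => rv (Ga ^~ t) s) t = br (rv (Ga ^~ t) s) (xi (velocity (Q s) t)).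
  rewrite -rvGa -MC; apply: (congr1 (fun f => cderiv f s - _)).
  by apply/funext => r; rewrite rvGa.
have -> : cderiv d t = cderiv (fun t => rv (Ga ^~ t) s) t - Y.
  apply: isd_cderiv; apply: isdB; first exact: (smT_isd t 0 hr).
  exact: (smT_isd t 0 (scw_snd s ha)).
by rewrite rvGa; exact: br_difference e1 e2.
Qed.

End Primitives.

(** * Continuous paths, concatenation and chains of smooth paths *)

Section ContinuousPaths.
Variables (R : realType) (F : tvsType R) (M : premanifold F).
Context {hF : hs F}.
Hypothesis hM : is_manifold M.

Lemma mcontP (c : R -> M) : mcontinuous c <->
  forall W t, mopen W -> W (c t) -> exists2 d, 0 < d & forall s, `|s - t| < d -> W (c s).
Proof.
split=> [H W t oW Wt|H W oW]; first exact: (open_real (H W oW)).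
by apply: real_open => t Wt; exact: H.
Qed.

Lemma mcont_box (H : R * R -> M) W s t : mcontinuous H -> mopen W -> W (H (s, t)) ->
  exists2 d, 0 < d & forall s' t', `|s' - s| < d -> `|t' - t| < d -> W (H (s', t')).
Proof.
move=> cH oW Wst; have := open_nbhs_nbhs (conj (cH W oW) Wst).
case=> -[A B] /= [/nbhs_real[a a0 ha] /nbhs_real[b b0 hb]] AB.
exists (Order.min a b); first by rewrite lt_min a0.
move=> s' t'; rewrite !lt_min => /andP[sa _] /andP[_ tb].
by apply: (AB (s', t')); split; [exact: ha | exact: hb].
Qed.

Lemma mcont_slice (H : R * R -> M) s : mcontinuous H -> mcontinuous (fun t => H (s, t)).
Proof.
move=> cH; apply/mcontP => W t oW Wt; have [d d0 hd] := mcont_box cH oW Wt.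
by exists d => // t' td; apply: hd => //; rewrite subrr normr0.
Qed.

Lemma mcont_smooth (c : R -> M) : msmooth c -> mcontinuous c.
Proof. by move=> hc; apply/mcontP => W t /(mopenP hM) oW Wt; exact: (oW c t (hc t) Wt). Qed.

Lemma affine_near (a b t d : R) : 0 < d -> exists2 e, 0 < e &
  forall s, `|s - t| < e -> `|(a * s + b) - (a * t + b)| < d.
Proof.
move=> d0; have a1 : 0 < `|a| + 1 by have := normr_ge0 a; lra.
exists (d / (`|a| + 1)); first exact: divr_gt0.
move=> s; rewrite ltr_pdivlMr // => h.
have -> : a * s + b - (a * t + b) = (s - t) * a by ring.
rewrite normrM; have := normr_ge0 (s - t); nra.
Qed.

Lemma mcont_affine (c : R -> M) (a b : R) : mcontinuous c -> mcontinuous (fun t : R => c (a * t + b)).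
Proof.
move=> /mcontP cc; apply/mcontP => W t oW Wt; have [d d0 hd] := cc W _ oW Wt.
by have [e e0 he] := affine_near a b t d0; exists e => // s /he/hd.
Qed.

(** The summand 0 keeps both halves in the shape a t + b of [mcont_affine] and [lift_affine]. *)
Definition conc (T : Type) (a b : R -> T) (t : R) : T :=
  if t <= 2^-1 then a (2 * t + 0) else b (2 * t + -1).

Lemma conc0 T (a b : R -> T) : conc a b 0 = a 0.
Proof. by rewrite /conc invr_ge0 ler0n mulr0 addr0. Qed.

Lemma conc1 T (a b : R -> T) : conc a b 1 = b 1.
Proof. by rewrite /conc ifF; [congr b; lra | apply/negbTE; rewrite -ltNge; lra]. Qed.

Lemma conc_left T (a b : R -> T) t : t < 2^-1 -> exists2 d, 0 < d &
  forall s, `|s - t| < d -> conc a b s = a (2 * s + 0).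
Proof.
move=> t2; exists (2^-1 - t) => [|s]; first by lra.
by rewrite ltr_norml => /andP[_ s2]; rewrite /conc ifT //; lra.
Qed.

Lemma conc_right T (a b : R -> T) t : 2^-1 < t -> exists2 d, 0 < d &
  forall s, `|s - t| < d -> conc a b s = b (2 * s + -1).
Proof.
move=> t2; exists (t - 2^-1) => [|s]; first by lra.
by rewrite ltr_norml => /andP[s2 _]; rewrite /conc ifF //; apply/negbTE; rewrite -ltNge; lra.
Qed.

Lemma conc_cont (a b : R -> M) : mcontinuous a -> mcontinuous b -> a 1 = b 0 -> mcontinuous (conc a b).
Proof.
move=> ca cb ab; have /mcontP ca' := @mcont_affine a 2 0 ca; have /mcontP cb' := @mcont_affine b 2 (-1) cb.
apply/mcontP => W t oW Wt; case: (ltgtP t 2^-1) => t2.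
- have [d d0 hd] := conc_left a b t2; rewrite hd ?subrr ?normr0 // in Wt.
  have [e e0 he] := ca' W t oW Wt; exists (Order.min d e); first by rewrite lt_min d0.
  by move=> s; rewrite lt_min => /andP[sd se]; rewrite hd //; exact: he.
- have [d d0 hd] := conc_right a b t2; rewrite hd ?subrr ?normr0 // in Wt.
  have [e e0 he] := cb' W t oW Wt; exists (Order.min d e); first by rewrite lt_min d0.
  by move=> s; rewrite lt_min => /andP[sd se]; rewrite hd //; exact: he.
have Wa : W (a (2 * t + 0)) by move: Wt; rewrite /conc t2 lexx.
have Wb : W (b (2 * t + -1)).
  move: Wa; have -> : 2 * t + 0 = 1 by lra. have -> : 2 * t + -1 = 0 by lra. by rewrite ab.
have [d d0 hd] := ca' W t oW Wa; have [e e0 he] := cb' W t oW Wb.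
exists (Order.min d e); first by rewrite lt_min d0.
by move=> s; rewrite lt_min => /andP[sd se]; rewrite /conc; case: ifP => _; [exact: hd | exact: he].
Qed.

(** Cover a continuous path c by stars: in the star about c(t) one passes from c(s) back to the
    centre and on to c(u) along smooth radial paths. *)
Lemma smooth_chain_ind (x0 : M) (P : M -> Prop) : simply_connected x0 ->
  (forall p : R -> M, msmooth p -> P (p 0) -> P (p 1)) -> P x0 -> forall x, P x.
Proof.
move=> [pc _] HP P0 x; have [c [/mcontP cc c0 <-]] := pc x.
apply: (@real_induction R (fun t => P (c t)) 0 1 ler01); first by rewrite c0.
move=> t t0 t1; have oU : mopen (mstar setT (c t)) by exact: (mstar_open hM (mopenT hM)).
have [d d0 hd] := cc _ t oU (mstar_center hM I).
exists d => // s u s0 st tu u1 ds ud Ps.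
have ball r : t - d < r -> r < t + d -> mstar setT (c t) (c r).
  by move=> h1 h2; apply: hd; rewrite ltr_norml; apply/andP; split; lra.
have hs := ball s ds ltac:(lra); have hu := ball u ltac:(lra) ud.
rewrite -(join1 hM hu); apply: (HP _ (join_smooth hM hu)); rewrite (join0 hM).
have hr : msmooth (fun r => join (c t) (c s) (1 - r)).
  apply: msmooth_reparam; first exact: (join_smooth hM hs).
  by apply: smB; [exact: sm_cst | exact: sm_id].
by have := HP _ hr; rewrite subr0 subrr (join0 hM) (join1 hM hs); apply.
Qed.

End ContinuousPaths.

(** * Lifting paths and homotopies by local primitives *)

Section Monodromy.
Variables (R : realType) (F E : tvsType R) (M : premanifold F) (K : prelie E).
Context {hF : hs F} {hE : hs E}.
Hypotheses (hM : is_manifold M) (hK : is_lie_group K) (regK : regular K).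
Local Opaque lie_bracket.
Local Notation "x ** y" := (@gmul R E K x y) (at level 40, left associativity).
Local Notation inv := (@ginv R E K).
Local Notation one := (gone K).
Variable xi : mtan M -> E.
Hypotheses (hxi : is_form xi) (mc : mc_eq (lie_bracket K) xi).

Let lp : M -> M -> K := local_primitive K xi.
Let U (x : M) : set M := mstar setT x.

Let U_open x : mopen (U x). Proof. exact: (mstar_open hM (mopenT hM)). Qed.
Let U_center x : U x x. Proof. exact: (mstar_center hM I). Qed.

Lemma primitive_compare x y z : U x z -> U y z -> exists k W,
  [/\ mopen W, W z, forall z', W z' -> U x z' /\ U y z' & forall z', W z' -> lp x z' = lp y z' ** k].
Proof.
move=> xz yz.
have hx : primitive xi (lp x) (U x) by exact: (local_primitiveP hM hK regK hxi mc).
have hy : primitive xi (lp y) (U y) by exact: (local_primitiveP hM hK regK hxi mc).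
have [k hk] : exists k, forall z', mstar (U x `&` U y) z z' -> lp x z' = lp y z' ** k.
  by apply: (primitive_unique hM hK) => p hp Vp; [apply: hx | apply: hy] => // t; have [] := Vp t.
exists k, (mstar (U x `&` U y) z); split=> //.
- by apply: (mstar_open hM); exact: (mopenI hM).
- exact: (mstar_center hM).
- by move=> z' /(mstar_sub hM).
Qed.

(** Continuation of a primitive of xi along c: near t it is a local primitive times a right
    constant. This makes sense for the merely continuous paths in which simple connectedness is
    phrased. *)
Definition lift_at (c : R -> M) (g : R -> K) (t : R) : Prop :=
  exists x k, exists2 d, 0 < d & forall s, `|s - t| < d -> U x (c s) /\ g s = lp x (c s) ** k.

Lemma lift_ext c c' g g' t d : 0 < d -> (forall s, `|s - t| < d -> c s = c' s /\ g s = g' s) ->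
  lift_at c g t -> lift_at c' g' t.
Proof.
move=> d0 hd [x [k [e e0 he]]]; exists x, k, (Order.min d e); first by rewrite lt_min d0.
by move=> s; rewrite lt_min => /andP[sd se]; have [<- <-] := hd s sd; exact: he.
Qed.

Lemma lift_affine c g (a b t : R) : lift_at c g (a * t + b) ->
  lift_at (fun t => c (a * t + b)) (fun t => g (a * t + b)) t.
Proof.
move=> [x [k [d d0 hd]]]; have [e e0 he] := affine_near a b t d0.
by exists x, k, e => // s /he/hd.
Qed.

Lemma lift_rmul c g k t : lift_at c g t -> lift_at c (fun t => g t ** k) t.
Proof.
move=> [x [l [d d0 hd]]]; exists x, (l ** k), d => // s /hd[h1 ->]; split=> //.
by rewrite (gmulA hK).
Qed.

Lemma lift_lp c x k t : mcontinuous c -> U x (c t) -> lift_at c (fun s => lp x (c s) ** k) t.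
Proof.
move=> /mcontP cc xt; have [d d0 hd] := cc _ t (@U_open x) xt.
by exists x, k, d => // s /hd.
Qed.

(** By [primitive_compare] the two local primitives differ by a right factor. The paths are asked to
    coincide only at t, s and u, so paths that agree merely on [0, 1] can be compared. *)
Lemma lift_agree c c' g g' t : mcontinuous c -> c t = c' t -> lift_at c g t -> lift_at c' g' t ->
  exists2 d, 0 < d & forall s u, `|s - t| < d -> `|u - t| < d -> c s = c' s -> c u = c' u ->
  g s = g' s -> g u = g' u.
Proof.
move=> /mcontP cc ct [x [k [d d0 hd]]] [y [l [e e0 he]]].
have z (r : R) : 0 < r -> `|t - t| < r by rewrite subrr normr0.
have [xt _] := hd t (z _ d0); have [yt _] := he t (z _ e0); rewrite -ct in yt.
have [m [W [oW Wt WU hW]]] := primitive_compare xt yt; have [f f0 hf] := cc W t oW Wt.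
exists (Order.min d (Order.min e f)); first by rewrite !lt_min d0 e0.
move=> s u; rewrite !lt_min => /andP[sd /andP[se sf]] /andP[ud /andP[ue uf]] cs cu.
have [_ ->] := hd s sd; have [_ ->] := he s se; have [_ ->] := hd u ud; have [_ ->] := he u ue.
by rewrite -cs -cu !hW; try exact: hf; rewrite -!(gmulA hK) => /(gmulI hK) ->.
Qed.

Lemma lift_unique c c' g g' a b : mcontinuous c -> a <= b ->
  (forall t, a <= t -> t <= b -> c t = c' t) ->
  (forall t, a <= t -> t <= b -> lift_at c g t) ->
  (forall t, a <= t -> t <= b -> lift_at c' g' t) -> g a = g' a -> g b = g' b.
Proof.
move=> cc ab ccE hg hg' gg; apply: (@real_induction R (fun t => g t = g' t) a b) => // t ta tb.
have [d d0 hd] := lift_agree cc (ccE t ta tb) (hg t ta tb) (hg' t ta tb).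
exists d => // s u sa st tu ub ds ud; apply: hd; try apply: ccE; try lra;
  by rewrite ltr_norml; apply/andP; split; lra.
Qed.

Lemma lift_exists c k0 : mcontinuous c -> exists g, g 0 = k0 /\
  forall t, 0 <= t -> t <= 1 -> lift_at c g t.
Proof.
move=> cc; have cc' := iffLR (mcontP c) cc.
apply: (@real_induction R (fun b => exists g, g 0 = k0 /\
  forall t, 0 <= t -> t <= b -> lift_at c g t) 0 1 ler01).
  exists (fun s => lp (c 0) (c s) ** (inv (lp (c 0) (c 0)) ** k0)); split.
    by rewrite (gmulA hK) (gmulgV hK) (gmul1g hK).
  move=> t t0 t1; have -> : t = 0 by apply/eqP; rewrite eq_le t0 t1.
  exact: lift_lp.
move=> t t0 t1; have [d d0 hd] := cc' _ t (@U_open (c t)) (U_center (c t)); exists d => //.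
move=> a b a0 at' tb b1 da bd [g [g0 hg]].
have ball r : a <= r -> r <= b -> U (c t) (c r).
  by move=> h1 h2; apply: hd; rewrite ltr_norml; apply/andP; split; lra.
(* The continuation of the lift inside the star about c(t), normalized to agree with [g] at [a]. *)
pose h s := lp (c t) (c s) ** (inv (lp (c t) (c a)) ** g a).
have hh r : a <= r -> r <= b -> lift_at c h r by move=> h1 h2; apply: lift_lp => //; exact: ball.
have ab : a <= b by lra.
pose f s := if s <= a then g s else h s.
exists f; split; first by rewrite /f a0.
move=> s s0 sb; case: (ltgtP s a) => sa.
- apply: (@lift_ext c c g f s (a - s)) (hg s s0 (ltW sa)); first by lra.
  by move=> r; rewrite ltr_norml => /andP[_ r2]; split=> //; rewrite /f ifT //; lra.
- apply: (@lift_ext c c h f s (s - a)) (hh s (ltW sa) sb); first by lra.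
  move=> r; rewrite ltr_norml => /andP[r1 _]; split=> //; rewrite /f ifF //.
  by apply/negbTE; rewrite -ltNge; lra.
have ga := hg a a0 (lexx _); have [e e0 he] := lift_agree cc erefl (hh a (lexx _) ab) ga.
rewrite sa; apply: (@lift_ext c c g f a e) ga => // r re; split=> //.
rewrite /f; case: ifP => // _; apply/esym; apply: (he a r) => //; first by rewrite subrr normr0.
by rewrite /h (gmulA hK) (gmulgV hK) (gmul1g hK).
Qed.

Definition lifts c g : Prop := forall t, 0 <= t -> t <= 1 -> lift_at c g t.

Lemma conc_lift c c' g g' : c 1 = c' 0 -> g 1 = g' 0 -> lifts c g -> lifts c' g' ->
  mcontinuous c -> mcontinuous c' -> lifts (conc c c') (conc g g').
Proof.
move=> cc gg hg hg' cn cn' t t0 t1; case: (ltgtP t 2^-1) => t2.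
- have [d d0 hd] := conc_left c c' t2; have [e e0 he] := conc_left g g' t2.
  apply: (@lift_ext (fun s => c (2 * s + 0)) _ (fun s => g (2 * s + 0)) _ t (Order.min d e)).
  + by rewrite lt_min d0.
  + by move=> s; rewrite lt_min => /andP[sd se]; rewrite hd // he.
  by apply: lift_affine; apply: hg; lra.
- have [d d0 hd] := conc_right c c' t2; have [e e0 he] := conc_right g g' t2.
  apply: (@lift_ext (fun s => c' (2 * s + -1)) _ (fun s => g' (2 * s + -1)) _ t (Order.min d e)).
  + by rewrite lt_min d0.
  + by move=> s; rewrite lt_min => /andP[sd se]; rewrite hd // he.
  by apply: lift_affine; apply: hg'; lra.
have e1 : 2 * t + 0 = 1 by lra. have e2 : 2 * t + -1 = 0 by lra.
have h1 : lift_at (fun s => c (2 * s + 0)) (fun s => g (2 * s + 0)) t.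
  by apply: lift_affine; rewrite e1; apply: hg.
have h2 : lift_at (fun s => c' (2 * s + -1)) (fun s => g' (2 * s + -1)) t.
  by apply: lift_affine; rewrite e2; apply: hg'.
(* At the junction both halves are rewritten through one local primitive and one constant. *)
pose x := c 1; pose k := inv (lp x x) ** g 1.
have k1 : g 1 = lp x x ** k by rewrite /k (gmulA hK) (gmulgV hK) (gmul1g hK).
have ca := @mcont_affine R F M c 2 0 cn; have ca' := @mcont_affine R F M c' 2 (-1) cn'.
have p1 : lift_at (fun s => c (2 * s + 0)) (fun s => lp x (c (2 * s + 0)) ** k) t.
  by apply: (lift_lp (c := fun s => c (2 * s + 0))) => //; rewrite e1; exact: U_center.
have p2 : lift_at (fun s => c' (2 * s + -1)) (fun s => lp x (c' (2 * s + -1)) ** k) t.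
  by apply: (lift_lp (c := fun s => c' (2 * s + -1))) => //; rewrite e2 -cc; exact: U_center.
have [d d0 hd] := lift_agree ca erefl h1 p1; have [e e0 he] := lift_agree ca' erefl h2 p2.
have q1 : U x (c (2 * t + 0)) by rewrite e1; exact: U_center.
have q2 : U x (c' (2 * t + -1)) by rewrite e2 -cc; exact: U_center.
have [d' d'0 hd'] := iffLR (mcontP _) ca _ t (@U_open x) q1.
have [e' e'0 he'] := iffLR (mcontP _) ca' _ t (@U_open x) q2.
exists x, k, (Order.min (Order.min d e) (Order.min d' e')); first by rewrite !lt_min d0 e0 d'0.
move=> s; rewrite !lt_min => /andP[/andP[sd se] /andP[sd' se']].
have z (r : R) : 0 < r -> `|t - t| < r by rewrite subrr normr0.
rewrite /conc; case: ifP => _; split; [exact: hd' | | exact: he' |].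
  by apply: (hd t s) => //; [exact: z | rewrite e1].
by apply: (he t s) => //; [exact: z | rewrite e2 -gg -cc].
Qed.

(** The end value is locally constant in s: for r near s the lifts at time t are given by a common
    primitive and a common constant ([P t]), a property that propagates in t; at t = 1 all paths are
    at x1, so the values coincide. *)
Lemma lift_homotopy (H : R * R -> M) (x0 x1 : M) (g : R -> R -> K) : mcontinuous H ->
  (forall s, 0 <= s -> s <= 1 -> H (s, 0) = x0 /\ H (s, 1) = x1) ->
  (forall s, g s 0 = one /\ lifts (fun t => H (s, t)) (g s)) -> g 1 1 = g 0 1.
Proof.
move=> cH Hx hg.
apply: (@real_induction R (fun s => g s 1 = g 0 1) 0 1 ler01) => // s s0 s1.
have cS r : mcontinuous (fun t : R => H (r, t)) by exact: mcont_slice.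
pose P t := exists x k, exists2 d, 0 < d & forall r, 0 <= r -> r <= 1 -> `|r - s| < d ->
  U x (H (r, t)) /\ g r t = lp x (H (r, t)) ** k.
have [x [k [d d0 hd]]] : P 1; last first.
  exists d => // a b a0 as' sb b1 da bd <-.
  have ball r : a <= r -> r <= b -> `|r - s| < d by move=> h1 h2; rewrite ltr_norml; apply/andP; split; lra.
  have ab : a <= b by lra. have a1 : a <= 1 by lra. have b0 : 0 <= b by lra.
  have [_ ->] := hd a a0 a1 (ball a (lexx _) ab); have [_ ->] := hd b b0 b1 (ball b ab (lexx _)).
  by have [_ ->] := Hx a a0 a1; have [_ ->] := Hx b b0 b1.
apply: (@real_induction R P 0 1 ler01).
  exists x0, (inv (lp x0 x0)), 1 => // r r0 r1 _; have [-> _] := Hx r r0 r1; have [-> _] := hg r.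
  by rewrite (gmulgV hK); split.
move=> t t0 t1; pose y := H (s, t).
have [d d0 hd] := mcont_box cH (@U_open y) (U_center y); exists d => //.
move=> a b a0 at' tb b1 da bd [x [k [e e0 he]]].
have ball r : a <= r -> r <= b -> `|r - t| < d by move=> h1 h2; rewrite ltr_norml; apply/andP; split; lra.
have ab : a <= b by lra.
have z (r : R) : 0 < r -> `|s - s| < r by rewrite subrr normr0.
have [xs _] := he s s0 s1 (z _ e0).
have ys := hd s a (z _ d0) (ball a (lexx _) ab).
have [l [W [oW Ws WU hW]]] := primitive_compare xs ys.
have [f f0 hf] := mcont_box cH oW Ws.
exists y, (l ** k), (Order.min d (Order.min e f)); first by rewrite !lt_min d0 e0.
move=> r r0 r1; rewrite !lt_min => /andP[rd /andP[re rf]].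
split; first by apply: hd => //; exact: ball.
apply: (lift_unique (c' := fun t => H (r, t)) (cS r) ab (g := g r) (g' := fun t => lp y (H (r, t)) ** (l ** k))).
- by [].
- by move=> q qa qb; have [_ h] := hg r; apply: h; lra.
- by move=> q qa qb; apply: (lift_lp (c := fun t => H (r, t))) => //; apply: hd => //; exact: ball.
have [_ ->] := he r r0 r1 re; rewrite hW ?(gmulA hK) //.
by apply: hf => //; rewrite subrr normr0.
Qed.

End Monodromy.

(** * Existence of the Cartan development *)

Section Development.
Variables (R : realType) (F E : tvsType R) (M : premanifold F) (K : prelie E).
Context {hF : hs F} {hE : hs E}.
Hypotheses (hM : is_manifold M) (hK : is_lie_group K) (regK : regular K).
Local Opaque lie_bracket.
Local Notation "x ** y" := (@gmul R E K x y) (at level 40, left associativity).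
Local Notation inv := (@ginv R E K).
Local Notation one := (gone K).
Variable xi : mtan M -> E.
Hypotheses (hxi : is_form xi) (mc : mc_eq (lie_bracket K) xi).
Local Notation lp := (local_primitive K xi).
Variable x0 : M.
Hypothesis sc : simply_connected x0.

Lemma lift_const (x : M) (k : K) (t : R) : lift_at xi (fun=> x) (fun=> k) t.
Proof.
exists x, (inv (lp x x) ** k), 1 => // s _; split; first exact: (mstar_center hM).
by rewrite (gmulA hK) (gmulgV hK) (gmul1g hK).
Qed.

(** The loop made of c and the reverse of c' contracts, so its lift ends at the unit; that end value
    is g'(1)^-1 g(1). *)
Lemma lift_endpoint (c c' : R -> M) (g g' : R -> K) : mcontinuous c -> mcontinuous c' -> c 0 = x0 -> c' 0 = x0 -> c 1 = c' 1 ->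
  lifts xi c g -> lifts xi c' g' -> g 0 = one -> g' 0 = one -> g 1 = g' 1.
Proof.
move=> cc cc' c0 c0' c1 hg hg' g0 g0'.
have [_ /(_ (conc c (fun t => c' (-1 * t + 1))))] := sc.
have ccr : mcontinuous (fun t : R => c' (-1 * t + 1)) by exact: (@mcont_affine R F M c' (-1) 1).
have e0 : -1 * 0 + 1 = 1 :> R by ring.
have e1 : -1 * 1 + 1 = 0 :> R by ring.
(* The factor k makes the reversed lift of c' start where g ends. *)
pose k := inv (g' 1) ** g 1; pose gr t := g' (-1 * t + 1) ** k.
have hgr : lifts xi (fun t => c' (-1 * t + 1)) gr.
  move=> t t0 t1; apply: (lift_rmul hK (g := fun t => g' (-1 * t + 1))); apply: lift_affine.
  by apply: hg'; lra.
have cl : mcontinuous (conc c (fun t => c' (-1 * t + 1))).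
  by apply: conc_cont => //; rewrite e0.
case; [exact: cl | by rewrite conc0 | by rewrite conc1 e1 |].
move=> H [cH Hc Hx].
have ex s : exists q : R -> K, q 0 = one /\ lifts xi (fun t => H (s, t)) q.
  by apply: (lift_exists hM hK regK hxi mc); exact: mcont_slice.
have [q hq] := choice ex.
have cS s : mcontinuous (fun t : R => H (s, t)) by exact: mcont_slice.
have q1 : q 1 1 = one.
  apply: (lift_unique hM hK regK hxi mc (c' := fun=> x0) (g' := fun=> one) (cS 1) ler01); last exact: (hq 1).1.
  - by move=> t t0 t1; have [] := Hc t t0 t1.
  - exact: (hq 1).2.
  - by move=> t _ _; exact: lift_const.
have lam : lifts xi (conc c (fun t => c' (-1 * t + 1))) (conc g gr).
  apply: (conc_lift hM hK regK hxi mc) => //; first by rewrite e0.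
  by rewrite /gr e0 /k (gmulA hK) (gmulgV hK) (gmul1g hK).
have q0 : q 0 1 = conc g gr 1.
  apply: (lift_unique hM hK regK hxi mc (c' := conc c (fun t => c' (-1 * t + 1))) (cS 0) ler01).
  - by move=> t t0 t1; have [] := Hc t t0 t1.
  - exact: (hq 0).2.
  - exact: lam.
  - by rewrite (hq 0).1 conc0.
have := lift_homotopy hM hK regK hxi mc cH Hx hq.
rewrite q1 q0 conc1 /gr e1 g0' (gmul1g hK) /k => e.
by apply: (gmulI hK (x := inv (g' 1))); rewrite -e (gmulVg hK).
Qed.

(** f(x) is the end value of a lift along any path from x0 to x. Appending radial paths shows that f
    is a local primitive times a constant on each star ([loc]), which gives smoothness and the
    logarithmic derivative. *)
Lemma development_exists : exists f : M -> K, [/\ smooth_map f, f x0 = one & rlogder f = xi].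
Proof.
have ex (x : M) : exists k : K, forall (c : R -> M) (g : R -> K), mcontinuous c -> c 0 = x0 -> c 1 = x -> lifts xi c g -> g 0 = one ->
   g 1 = k.
  have [c [cc c0 c1]] := sc.1 x.
  have [g [g0 hg]] := lift_exists hM hK regK hxi mc one cc.
  exists (g 1) => c' g' cc' c0' c1' hg' g0'.
  by apply: (lift_endpoint cc' cc) => //; rewrite c1.
have [f hf] := choice ex.
have loc (x z : M) : mstar setT x z -> f z = lp x z ** (inv (lp x x) ** f x).
  move=> xz; have [c [cc c0 c1]] := sc.1 x.
  have [g [g0 hg]] := lift_exists hM hK regK hxi mc one cc.
  pose k := inv (lp x x) ** f x; rewrite -/k.
  have hj : msmooth (join x z) by exact: (join_smooth hM xz).
  have cj : mcontinuous (join x z) by exact: (mcont_smooth hM hj).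
  rewrite -(hf z (conc c (join x z)) (conc g (fun t => lp x (join x z t) ** k))).
  - by rewrite conc1 (join1 hM xz).
  - by apply: conc_cont => //; rewrite c1 (join0 hM).
  - by rewrite conc0.
  - by rewrite conc1 (join1 hM xz).
  - apply: (conc_lift hM hK regK hxi mc) => //; first by rewrite c1 (join0 hM).
      by rewrite (join0 hM) (hf x c g) // /k (gmulA hK) (gmulgV hK) (gmul1g hK).
    by move=> t _ _; apply: (lift_lp hM) => //; exact: join_mstar.
  - by rewrite conc0.
(* A cutoff keeps the whole curve in one star without changing its germ at t. *)
have near (p : R -> M) (t : R) : msmooth p -> exists2 psi : R -> R^o, [/\ sm setT psi, msmooth (fun s => f (p (psi s))) &
    forall s, rv (fun s => f (p (psi s))) s = xi (velocity (fun s => p (psi s)) s)] &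
    exists2 d, 0 < d & forall s, `|s - t| < d -> psi s = s.
  move=> hp; have oU : mopen (mstar setT (p t)) by exact: (mstar_open hM (mopenT hM)).
  have [e e0 he] := iffLR (mopenP hM _) oU p t (hp t) (mstar_center hM I).
  have [psi [h1 h2 h3]] := smooth_cutoff t e0.
  have hpp : msmooth (fun s => p (psi s)) by exact: msmooth_reparam.
  have Up s : mstar setT (p t) (p (psi s)) by apply: he; exact: h3.
  have [s1 s2] := local_primitiveP hM hK regK hxi mc hpp Up.
  have fE : (fun s => f (p (psi s))) = (fun s => lp (p t) (p (psi s)) ** (inv (lp (p t) (p t)) ** f (p t))).
    by apply/funext => s; exact: loc.
  exists psi; last by exists (e / 4) => //; lra.
  split=> //; rewrite fE; first exact: (@smooth_rmul R E K hE hK _ _ s1).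
  by move=> s; rewrite (rv_rmul hK _ s s1) s2.
have fS : smooth_map f.
  move=> p hp t; have [psi [h1 h2 _] [d d0 hd]] := near p t hp.
  by apply: (@msm_ext R E K hE (fun s => f (p (psi s))) _ t d d0); [move=> s /hd /= -> | exact: h2].
exists f; split=> //.
  by apply/esym; apply: (hf x0 (fun=> x0) (fun=> one)) => //; [apply/mcontP => W t _ h; exists 1 |
    move=> t _ _; exact: lift_const].
apply/funext => v; have [p [hp p0 <-]] := tangent_curve hM v.
have [psi [h1 h2 h3] [d d0 hd]] := near p 0 hp.
have hpp : msmooth (fun s => p (psi s)) by exact: msmooth_reparam.
have -> : velocity p 0 = velocity (fun s => p (psi s)) 0.
  by apply: (velocity_ext d0) => s /hd ->.
by rewrite (rlogder_velocity hM hK _ fS hpp).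
Qed.

End Development.

(** * Uniqueness of the development *)

Section DevelopmentUnique.
Variables (R : realType) (F E : tvsType R) (M : premanifold F) (K : prelie E).
Context {hF : hs F} {hE : hs E}.
Hypotheses (hM : is_manifold M) (hK : is_lie_group K).

Lemma development_unique (x0 : M) (f h : M -> K) : simply_connected x0 ->
  smooth_map f -> smooth_map h -> rlogder f = rlogder h -> f x0 = h x0 -> forall x, f x = h x.
Proof.
move=> sc hf hh fh; apply: (smooth_chain_ind hM sc) => p hp e.
have a : msmooth (fun t => f (p t)) by exact: (hf p hp).
have b : msmooth (fun t => h (p t)) by exact: (hh p hp).
apply: (rv_unique hK a b) => // t.
by rewrite -(rlogder_velocity hM hK t hf hp) -(rlogder_velocity hM hK t hh hp) fh.
Qed.

End DevelopmentUnique.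

(** * Developments of curves of flat forms *)

Section DevelopmentFamilies.
Variables (R : realType) (F E : tvsType R) (M : premanifold F) (G : prelie E).
Context {hF : hs F} {hE : hs E}.
Hypotheses (hM : is_manifold M) (hG : is_lie_group G) (regG : regular G).
Local Opaque lie_bracket.
Local Notation "x ** y" := (@gmul R E G x y) (at level 40, left associativity).
Local Notation one := (gone G).
Local Notation br := (lie_bracket G).
Local Notation TG := (tangent_group G).
Local Notation SG := (semidirect G).

(** The computation behind [Evol_variation] for an arbitrary plot: the Maurer-Cartan equation read
    in the semidirect product. *)
Lemma variation_rv (P : R -> R -> G) s : mplot P ->
  @rv R _ SG (fun s => ((rv (P ^~ s) 0, P 0 s) : SG)) s =
  (cderiv (fun r => rv (P r) s) 0, rv (P 0) s).
Proof.
move=> hP; pose A t := rv (P ^~ t) 0.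
have hA : sm setT A by apply: (scw_rv1 hG hP); [exact: sm_cst | exact: sm_id].
rewrite (rv_semidirect hG s hA (@mplot_snd R E G P 0 hP)); congr (_, _).
have gen (X Y a b : E) : X - Y = br a b -> Y - br b a = X.
  by move=> e; rewrite (br_anti hG b) -e opprK addrC subrK.
exact: gen (maurer_cartan hG 0 s hP).
Qed.

Section Family.
Variables (x0 : M) (c : R -> mtan M -> E) (La : R -> M -> G).
Hypotheses (sc : simply_connected x0) (hc : form_curve c).
Hypotheses (LaS : forall r, smooth_map (La r)) (La0 : forall r, La r x0 = one).
Hypothesis Lac : forall r, rlogder (La r) = c r.

(** Along a smooth path a development is an evolution in G times its initial value. Smooth
    dependence of Evol on r enters here, and [family_smooth] carries it from x0 to every point. *)
Lemma family_along (p : R -> M) : msmooth p -> forall r s,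
  La r (p s) = Evol G (fun u => c r (velocity p u)) s ** La r (p 0).
Proof.
move=> hp r s; have hv : scw (fun r u => c r (velocity p u)).
  by apply: (form_curve_scw hM hc); exact: msmooth_velocity.
have hX := scw_snd r hv.
have h1 : msmooth (fun s => La r (p s)) by exact: (@LaS r p hp).
have h2 : msmooth (fun s => Evol G (fun u => c r (velocity p u)) s ** La r (p 0)).
  exact: (@smooth_rmul R E G hE hG _ _ (Evol_smooth hG regG hX)).
apply: (rv_unique hG h1 h2); last by rewrite (Evol0 hG regG hX) (gmul1g hG).
move=> t; rewrite (rv_rmul hG _ t (Evol_smooth hG regG hX)) (rv_Evol hG regG t hX).
by rewrite -Lac (rlogder_velocity hM hG t (@LaS r) hp).
Qed.

Lemma family_mplot0 (p : R -> M) : msmooth p -> msmooth (fun r => La r (p 0)) ->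
  mplot (fun r s => La r (p s)).
Proof.
move=> hp h0.
have -> : (fun r s => La r (p s)) = (fun r s => Evol G (fun u => c r (velocity p u)) s ** La r (p 0)).
  by apply/funext => r; apply/funext => s; exact: family_along.
apply: (mplotM hG); last exact: mplot_s.
apply: (Evol_mplot hG regG); apply: (form_curve_scw hM hc); exact: msmooth_velocity.
Qed.

Lemma family_smooth x : msmooth (fun r => La r x).
Proof.
move: x; apply: (smooth_chain_ind hM sc).
  by move=> p hp h0; exact: (@mplot_fst R E G _ 1 (family_mplot0 hp h0)).
have -> : (fun r => La r x0) = fun=> one by apply/funext => r.
by apply: msmooth_cst; exact: lie_manifold.
Qed.

Lemma family_mplot (p : R -> M) : msmooth p -> mplot (fun r s => La r (p s)).
Proof. by move=> hp; apply: family_mplot0 => //; exact: family_smooth. Qed.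

Definition family_velocity (x : M) : SG := (rv (fun r => La r x) 0, La 0 x).

Lemma family_velocity_smooth : smooth_map family_velocity.
Proof.
move=> p hp; have hP := family_mplot hp.
apply: (@semidirect_smooth R E G hE (fun s => rv (fun r => La r (p s)) 0) (fun s => La 0 (p s))).
  by apply: (scw_rv1 hG hP); [exact: sm_cst | exact: sm_id].
exact: (@mplot_snd R E G _ 0 hP).
Qed.

Lemma family_velocity_rlogder : rlogder family_velocity = twist (c 0, fun_velocity c).
Proof.
apply/funext => v; have [p [hp p0 <-]] := tangent_curve hM v.
rewrite (rlogder_velocity hM (semidirect_lie hG) 0 family_velocity_smooth hp).
rewrite [LHS](variation_rv 0 (family_mplot hp)) /twist /fun_velocity /=.
have e r : rv (fun s => La r (p s)) 0 = c r (velocity p 0).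
  by rewrite -Lac (rlogder_velocity hM hG 0 (@LaS r) hp).
by rewrite e; congr (cderiv _ _, _); apply/funext => r; exact: e.
Qed.

Lemma family_velocity0 : family_velocity x0 = gone SG.
Proof.
rewrite /family_velocity La0; have -> : (fun r => La r x0) = fun=> one by apply/funext => r.
by rewrite (rv_cst hG).
Qed.

End Family.

Lemma rtriv_rlogder (f : M -> TG) : smooth_map f ->
  smooth_map (fun x => (rtriv (f x : mtan G) : SG)) /\
  rlogder (fun x => (rtriv (f x : mtan G) : SG)) = rlogder f.
Proof.
move=> hf.
have hr : smooth_map (fun x => (rtriv (f x : mtan G) : SG)).
  by move=> p hp; exact: (rtriv_smooth hG (hf p hp)).
split; first exact: hr.
apply: funext => v; have [p [hp p0 <-]] := tangent_curve hM v.
rewrite (rlogder_velocity hM (semidirect_lie hG) 0 hr hp).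
rewrite (rlogder_velocity hM (tangent_group_lie hG) 0 hf hp).
exact: (@iso_rv R _ TG SG _ (tangent_group_lie hG) (semidirect_lie hG) _ (rtriv_iso hG) (tmap_rtriv_one hG)
  (fun t => f (p t)) 0 (hf p hp)).
Qed.

(** Develop (eta, xi) in the semidirect product to Phi = (A, f_0) and put f_r = exp(r A) f_0. The
    logarithmic derivatives of the f_r are flat and equal xi at r = 0; by [variation_rv] their
    r-derivative at 0 is the first component of that of Phi, namely eta. *)
Lemma flat_curve_exists (x0 : M) (xi eta : mtan M -> E) : simply_connected x0 ->
  is_form xi -> is_form eta -> mc_eq br xi -> mc_lin_eq br xi eta ->
  exists c, [/\ flat_curve br c, c 0 = xi & fun_velocity c = eta].
Proof.
move=> sc hxi heta e1 e2.
have [hw mc] : flat (lie_bracket SG) (fun z => (eta z, xi z)).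
  by apply/(flat_semidirect hM hG); split=> //; apply/is_form_pair.
have [Phi [PS P0 Pw]] := development_exists hM (semidirect_lie hG) (semidirect_regular hG regG) hw mc sc.
have Pparts (p : R -> M) : msmooth p -> sm setT (fun t => (Phi (p t)).1) /\ msmooth (fun t => (Phi (p t)).2 : G).
  by move=> hp; exact: (semidirect_smooth_parts hG (PS p hp)).
have Prv (p : R -> M) t : msmooth p -> @rv R _ SG (fun s => Phi (p s)) t = (eta (velocity p t), xi (velocity p t)).
  by move=> hp; rewrite -(rlogder_velocity hM (semidirect_lie hG) t PS hp) Pw.
(* The evolution of a constant curve at time 1 is the exponential map. *)
pose f r x := evol G (fun=> r *: (Phi x).1) ** (Phi x).2.
have fS (a : R -> R^o) (p : R -> M) : sm setT a -> msmooth p -> msmooth (fun t => f (a t) (p t)).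
  move=> ha hp; have [p1 p2] := Pparts p hp.
  have h : scw (fun t _ => a t *: (Phi (p t)).1).
    by move=> k l hk hl; exact: (@sm_comp _ _ setT setT _ _ (fun _ _ => I) hk (sm_scal ha p1)).
  exact: (msmoothM hG (evol_smooth regG h) p2).
have fsm r : smooth_map (f r) by move=> p hp; apply: (fS (fun=> r)) => //; exact: sm_cst.
have fplot (p : R -> M) : msmooth p -> mplot (fun r s => f r (p s)).
  by move=> hp a b ha hb; apply: (fS a (fun t => p (b t))) => //; exact: msmooth_reparam.
have ev0 (X : E) r : evol G (fun=> r *: X) = Evol G (fun=> X) r.
  by rewrite -(evol_scale hG regG r (sm_cst _ X)).
have f0 x : f 0 x = (Phi x).2 by rewrite /f ev0 (Evol0 hG regG (sm_cst _ _)) (gmul1g hG).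
have fr x : rv (fun r => f r x) 0 = (Phi x).1.
  have -> : (fun r => f r x) = (fun r => Evol G (fun=> (Phi x).1) r ** (Phi x).2).
    by apply/funext => r; rewrite /f ev0.
  by rewrite (rv_rmul hG _ 0 (Evol_smooth hG regG (sm_cst _ _))) (rv_Evol hG regG 0 (sm_cst _ _)).
have fv (p : R -> M) t : msmooth p ->
    cderiv (fun r => rv (fun s => f r (p s)) t) 0 = eta (velocity p t) /\ rv (fun s => f 0 (p s)) t = xi (velocity p t).
  move=> hp; have := variation_rv t (fplot p hp).
  have -> : (fun s => ((rv (fun r => f r (p s)) 0, f 0 (p s)) : SG)) = (fun s => Phi (p s)).
    by apply/funext => s; rewrite fr f0; case: (Phi (p s)).
  by rewrite (Prv p t hp) => -[].
exists (fun r => rlogder (f r)); split.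
- split=> [|r]; last by split; [exact: rlogder_form | exact: rlogder_mc].
  split=> [r|]; first exact: rlogder_form.
  apply/(fun_curveP (mtan_manifold hM)) => a p ha hp.
  apply/smooth_curveP/smooth_curve_near => t.
  have [P [hP [d d0 hd]]] := tangent_plot hM t hp.
  pose Q r s := f (a s) (P r s).
  have hQ : mplot Q.
    move=> k l hk hl; apply: (fS (fun t => a (l t)) (fun t => P (k t) (l t))); last exact: hP.
    exact: (@sm_comp _ _ setT setT).
  apply: (@smooth_near_ext R E _ (fun s => rv (Q ^~ s) 0) _ _ d) => //.
    move=> s /hd ->; rewrite (rlogder_velocity hM hG 0 (fsm (a s)) (@mplot_fst R F M P s hP)) //.
  by apply: smooth_near_sm; apply: (scw_rv1 hG hQ); [exact: sm_cst | exact: sm_id].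
- apply/funext => v; have [p [hp p0 <-]] := tangent_curve hM v.
  by rewrite (rlogder_velocity hM hG 0 (fsm 0) hp); have [_ ->] := fv p 0 hp.
apply/funext => v; have [p [hp p0 <-]] := tangent_curve hM v.
have [<- _] := fv p 0 hp; rewrite /fun_velocity; apply: (congr1 (fun h => cderiv h 0)).
by apply/funext => r; rewrite (rlogder_velocity hM hG 0 (fsm r) hp).
Qed.

End DevelopmentFamilies.

(** * Tangent vectors of function spaces as pairs *)

Section Twist.
Variables (R : realType) (E : tvsType R).
Context {hE : hs E}.

Lemma twist_inj (A : Type) (p q : (A -> E) * (A -> E)) : twist p = twist q -> p = q.
Proof.
case: p q => [a b] [a' b'] /(congr1 (fun f x => f x)) e; congr (_, _); apply/funext => x.
  by have := congr1 (fun f => (f x).2) e.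
by have := congr1 (fun f => (f x).1) e.
Qed.

Lemma twist_parts (A : Type) (w : A -> E * E) : w = twist (fun x => (w x).2, fun x => (w x).1).
Proof. by apply/funext => x; rewrite /twist /=; case: (w x). Qed.

Lemma path_tangent : kin_tangent (@fun_curve R R^o E (mvec R^o)) =
  [set p | sm setT p.1 /\ sm setT p.2].
Proof.
apply/seteqP; split=> [p [c /fun_curve_scw hc ->]|p [h1 h2]].
  by split; [exact: scw_snd | exact: (scw_partial 0 hc)].
have hW : sm setT (twist p) by exact: sm_pair.
have [c hc [e _]] := twist_linear hW.
by exists c; [exact/fun_curve_scw | exact: twist_inj].
Qed.

Lemma twist_path_iso : smooth_iso
  (kin_tangent (@fun_curve R R^o E (mvec R^o)))
  (fun c : R -> (R -> E) * (R -> E) =>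
     @fun_curve R R^o E (mvec R^o) (fun s => (c s).1) /\
     @fun_curve R R^o E (mvec R^o) (fun s => (c s).2))
  (@smooth_curve R (E * E)%type)
  (@fun_curve R R^o (E * E)%type (mvec R^o))
  (@twist R E R).
Proof.
rewrite path_tangent; split.
  split.
  - by move=> p [h1 h2]; apply/smooth_curveP; exact: sm_pair.
  - by move=> p q _ _; exact: twist_inj.
  move=> w /smooth_curveP hw; exists (fun x => (w x).2, fun x => (w x).1); last by rewrite -twist_parts.
  by split; [exact: sm_snd | exact: sm_fst].
move=> c _; split=> [[/fun_curve_scw h1 /fun_curve_scw h2]|/fun_curve_scw h].
  by apply/fun_curve_scw => a b ha hb; apply: sm_pair; [exact: h2 | exact: h1].
split; apply/fun_curve_scw => a b ha hb; first exact: (sm_snd (h a b ha hb)).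
exact: (sm_fst (h a b ha hb)).
Qed.

Lemma form_curve_pair (F : tvsType R) {hF : hs F} (M : premanifold F) (hM : is_manifold M)
    (c : R -> (mtan M -> E) * (mtan M -> E)) :
  form_curve (fun s => (c s).1) /\ form_curve (fun s => (c s).2) <->
  @form_curve R F (E * E)%type M (fun s => twist (c s)).
Proof.
have hT : is_manifold (mtan M) by exact: mtan_manifold.
split=> [[[a1 /(fun_curveP hT) a2] [b1 /(fun_curveP hT) b2]]|[h1 /(fun_curveP hT) h2]].
  split=> [t|]; first by apply/is_form_pair; split; [exact: b1 | exact: a1].
  by apply/(fun_curveP hT) => a p ha hp; apply: sm_pair; [exact: b2 | exact: a2].
split; split.
- by move=> t; have /is_form_pair[] := h1 t.
- by apply/(fun_curveP hT) => a p ha hp; exact: (sm_snd (h2 a p ha hp)).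
- by move=> t; have /is_form_pair[] := h1 t.
by apply/(fun_curveP hT) => a p ha hp; exact: (sm_fst (h2 a p ha hp)).
Qed.

End Twist.

(** * Tangent spaces of flat forms and the commuting diagram *)

Section FlatForms.
Variables (R : realType) (F E : tvsType R) (M : premanifold F) (G : prelie E).
Context {hF : hs F} {hE : hs E}.
Hypotheses (hM : is_manifold M) (hG : is_lie_group G) (regG : regular G).
Local Opaque lie_bracket.
Local Notation br := (lie_bracket G).
Local Notation TG := (tangent_group G).
Local Notation SG := (semidirect G).

Lemma brackets_agree : lie_bracket TG = lie_bracket SG.
Proof.
apply/funext => -[X1 Y1]; apply/funext => -[X2 Y2].
by rewrite (br_tangent hG) (br_semidirect hG).
Qed.

Lemma flat_tangent (x0 : M) : simply_connected x0 ->
  kin_tangent (@flat_curve R F E M br) =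
  [set p | [/\ is_form p.1, is_form p.2, mc_eq br p.1 & mc_lin_eq br p.1 p.2]].
Proof.
move=> sc; apply/seteqP; split=> [p [c hc ->]|[xi eta] [h1 h2 h3 h4]].
  have [[fc _] /(_ 0)[h1 h2]] := hc; split=> //.
    by apply: (form_curve_velocity hM); case: hc.
  exact: (flat_velocity hM hG).
have [c [hc e1 e2]] := flat_curve_exists hM hG regG sc h1 h2 h3 h4.
by exists c; rewrite ?e1 ?e2.
Qed.

Lemma twist_flat_iso (x0 : M) : simply_connected x0 -> smooth_iso
  (kin_tangent (@flat_curve R F E M br))
  (fun c : R -> (mtan M -> E) * (mtan M -> E) =>
     form_curve (fun s => (c s).1) /\ form_curve (fun s => (c s).2))
  (@flat R F (E * E)%type M (lie_bracket TG)) (@flat_curve R F (E * E)%type M (lie_bracket TG))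
  (@twist R E (mtan M)).
Proof.
move=> sc; rewrite (flat_tangent sc) brackets_agree.
have tw p : [/\ is_form p.1, is_form p.2, mc_eq br p.1 & mc_lin_eq br p.1 p.2] ->
    @flat R F (E * E)%type M (lie_bracket SG) (twist p).
  by move=> [h1 h2 h3 h4]; apply/(flat_semidirect hM hG); split=> //; apply/is_form_pair.
split.
  split=> //.
  - by move=> p q _ _; exact: twist_inj.
  move=> w /(flat_semidirect hM hG)[h1 h2 h3].
  exists (fun x => (w x).2, fun x => (w x).1); last by rewrite -twist_parts.
  by have [h4 h5] : is_form (fun z => (w z).1) /\ is_form (fun z => (w z).2);
    [apply/is_form_pair; rewrite {1}(twist_parts w) in h1 | split].
move=> c hc; split=> [/(form_curve_pair hM) h|[/(form_curve_pair hM) h _] //].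
by split=> // t; apply: tw; exact: hc.
Qed.

(** Composition with a diffeomorphism: test functions on either target are pulled back from the
    other by [rtriv] or [rtriv_inv]. *)
Lemma rtriv_pointed_iso (x0 : M) : smooth_iso
  (@pointed_map R F (E * E)%type M x0 (mtan G) (gone TG))
  (@pointed_curve R F (E * E)%type M x0 (mtan G) (gone TG))
  (@pointed_map R F (E * E)%type M x0 SG (gone SG))
  (@pointed_curve R F (E * E)%type M x0 SG (gone SG))
  (fun f : M -> mtan G => @rtriv R E G \o f).
Proof.
have fwd (f : M -> mtan G) : @pointed_map R F (E * E)%type M x0 (mtan G) (gone TG) f ->
    @pointed_map R F (E * E)%type M x0 SG (gone SG) (@rtriv R E G \o f).
  move=> [h1 h2]; split; first by move=> p hp; exact: (rtriv_smooth hG (h1 p hp)).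
  by rewrite /= h2; exact: (rtriv_one hG).
have bwd (f : M -> SG) : @pointed_map R F (E * E)%type M x0 SG (gone SG) f ->
    @pointed_map R F (E * E)%type M x0 (mtan G) (gone TG) (@rtriv_inv R E G \o f).
  move=> [h1 h2]; split; first by move=> p hp; exact: (rtriv_inv_smooth hG (h1 p hp)).
  by rewrite /= h2 -(rtriv_one hG); exact: (rtrivK hG).
have invK (f : M -> mtan G) : @rtriv_inv R E G \o (@rtriv R E G \o f) = f.
  by apply/funext => x; exact: (rtrivK hG).
split.
  split.
  - exact: fwd.
  - by move=> f h _ _ e; rewrite -(invK f) e invK.
  move=> f hf; exists (@rtriv_inv R E G \o f); first exact: bwd.
  by apply/funext => x; exact: (rtriv_invK hG).
move=> k _; split=> -[h1 h2]; split.
- by move=> s; apply: fwd; exact: h1.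
- move=> c f l hc hf hl; apply: (h2 c (f \o @rtriv R E G) l hc _ hl).
  by move=> p hp; apply: (hf (fun t => rtriv (p t) : SG)); exact: (rtriv_smooth hG).
- by move=> s; rewrite -(invK (k s)); apply: bwd; exact: h1.
move=> c f l hc hf hl.
have hf' : @smooth_map R _ _ SG (mvec R^o) (f \o @rtriv_inv R E G).
  by move=> p hp; apply: (hf (fun t => rtriv_inv (p t))); exact: (rtriv_inv_smooth hG).
have := h2 c _ l hc hf' hl; congr smooth_curve; apply/funext => s; congr l.
by apply/funext => t /=; rewrite (rtrivK hG).
Qed.

(** After right trivialization both sides are maps into the semidirect product that send x0 to the
    unit and have logarithmic derivative (eta, xi), so [development_unique] identifies them. *)
Lemma development_tangent (x0 : M) (Evol_G : (mtan M -> E) -> M -> G)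
    (Evol_TG : (mtan M -> E * E) -> M -> TG) (c : R -> mtan M -> E) (x : M) :
  simply_connected x0 -> is_development x0 Evol_G -> is_development x0 Evol_TG -> flat_curve br c ->
  msmooth (fun s => Evol_G (c s) x) /\
  velocity (fun s => Evol_G (c s) x) 0 = Evol_TG (twist (c 0, fun_velocity c)) x.
Proof.
move=> sc [dG _] [dT _] hc; have [fc fl] := hc.
have LaS r : smooth_map (Evol_G (c r)) by have [[]] := dG _ (fl r).
have La0 r : Evol_G (c r) x0 = gone G by have [[]] := dG _ (fl r).
have Lac r : rlogder (Evol_G (c r)) = c r by have [] := dG _ (fl r).
split; first exact: (family_smooth hM hG regG sc fc LaS La0 Lac).
have [_ flE] := twist_flat_iso sc.
have hw : flat (lie_bracket TG) (twist (c 0, fun_velocity c)).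
  have [[fun_ _ _] _] := twist_flat_iso sc.
  by apply: fun_; exists c.
have [[TS T0] Tc] := dT _ hw; have [rS rE] := rtriv_rlogder hM hG TS.
have e := development_unique hM (semidirect_lie hG) sc
  (family_velocity_smooth hM hG regG sc fc LaS La0 Lac) rS _ _ x.
rewrite -(rtrivK hG (velocity _ 0)) -(rtrivK hG (Evol_TG _ x)); congr rtriv_inv.
apply: e; first by rewrite rE Tc (family_velocity_rlogder hM hG regG sc fc LaS La0 Lac).
by rewrite T0 (family_velocity0 hG La0) -(rtriv_one hG).
Qed.

Lemma development_rtriv (x0 : M) (Evol_TG : (mtan M -> E * E) -> M -> TG)
    (Evol_SG : (mtan M -> E * E) -> M -> SG) (w : mtan M -> E * E) :
  simply_connected x0 -> is_development x0 Evol_TG -> is_development x0 Evol_SG ->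
  flat (lie_bracket TG) w -> @rtriv R E G \o Evol_TG w = Evol_SG w.
Proof.
move=> sc [dT _] [dS _] hw; have [[TS T0] Tc] := dT _ hw.
rewrite brackets_agree in hw; have [[SS S0] Sc] := dS _ hw.
have [rS rE] := rtriv_rlogder hM hG TS.
apply/funext => x; apply: (development_unique hM (semidirect_lie hG) sc rS SS).
  by rewrite rE Tc Sc.
rewrite T0 S0; exact: (rtriv_one hG).
Qed.

End FlatForms.
Theorem theorem3p7 (R : realType) (E : tvsType R) (G : prelie E)
    (hG : is_lie_group G) :
  (* TG is isomorphic to the semidirect product of g and G via Ad *)
  ( [/\ (forall (g : G) (a : R) (X Y : E),
           Ad g (a *: X + Y) = a *: Ad g X + Ad g Y),
        (forall (g : G) (X Y : E),
           Ad g (lie_bracket G X Y) = lie_bracket G (Ad g X) (Ad g Y)),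
        (forall X : E, Ad (gone G) X = X),
        (forall (g h : G) (X : E), Ad (gmul g h) X = Ad g (Ad h X))
      & @smooth_map R (E * E)%type E (mprod G (mvec E)) (mvec E)
          (fun p => Ad p.1 p.2)] /\
    [/\ is_lie_group (tangent_group G), is_lie_group (semidirect G),
        @lie_iso R (E * E)%type (E * E)%type (tangent_group G) (semidirect G)
          (@rtriv R E G)
      & forall W : E * E,
          @tmap R (E * E)%type (E * E)%type (tangent_group G) (semidirect G)
            (@rtriv R E G) (W, gone (tangent_group G))
          = (W, gone (semidirect G))] /\
    [/\ (forall (X Y : E) (g h : G),
           @gmul R _ (semidirect G) (X, g) (Y, h) = (X + Ad g Y, gmul g h)),
        (forall (X : E) (g : G),
           @ginv R _ (semidirect G) (X, g) = (- Ad (ginv g) X, ginv g)),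
        (forall X1 Y1 X2 Y2 : E,
           lie_bracket (semidirect G) (X1, Y1) (X2, Y2)
           = (lie_bracket G Y1 X2 - lie_bracket G Y2 X1, lie_bracket G Y1 Y2)),
        (forall X1 Y1 X2 Y2 : E,
           lie_bracket (tangent_group G) (X1, Y1) (X2, Y2)
           = (lie_bracket G Y1 X2 - lie_bracket G Y2 X1, lie_bracket G Y1 Y2))
      & forall (X Y Z : E) (g : G),
          @Ad R _ (semidirect G) (X, g) (Y, Z)
          = (Ad g Y - lie_bracket G (Ad g Z) X, Ad g Z)] ) /\
  (* regularity of TG and the tangent map of evol *)
  ( regular G ->
    [/\ regular (tangent_group G), regular (semidirect G)
      & smooth_iso
          (kin_tangent (@fun_curve R R^o E (mvec R^o)))
          (fun c : R -> (R -> E) * (R -> E) =>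
             @fun_curve R R^o E (mvec R^o) (fun s => (c s).1) /\
             @fun_curve R R^o E (mvec R^o) (fun s => (c s).2))
          (@smooth_curve R (E * E)%type)
          (@fun_curve R R^o (E * E)%type (mvec R^o))
          (@twist R E R)] /\
    (forall c : R -> R -> E, @fun_curve R R^o E (mvec R^o) c ->
       let X := c 0 in
       let Y := fun_velocity c in
       let I t := rint 0 t (fun s => Ad (ginv (Evol G X s)) (Y s)) in
       [/\ velocity (fun s => evol G (c s)) 0
           = evol (tangent_group G) (twist (X, Y)),
           velocity (fun s => evol G (c s)) 0
           = tmap (gmul (evol G X)) ((I 1, gone G) : mtan G)
         & forall t : R,
             msmooth (fun s => Evol G (c s) t) /\
             velocity (fun s => Evol G (c s) t) 0
             = tmap (gmul (Evol G X t)) ((I t, gone G) : mtan G)]) /\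
    (forall X Y : R -> E, smooth_curve X -> smooth_curve Y ->
       rtriv (evol (tangent_group G) (twist (X, Y)))
       = evol (semidirect G) (twist (X, Y)) /\
       evol (semidirect G) (twist (X, Y))
       = (Ad (evol G X)
            (rint 0 1 (fun s => Ad (ginv (Evol G X s)) (Y s))), evol G X)) /\
  (* flat forms and the Cartan development *)
    (forall (F : tvsType R) (M : premanifold F) (x0 : M),
       is_manifold M -> simply_connected x0 ->
       let g := lie_bracket G in
       let Tg := lie_bracket (tangent_group G) in
       let gg := lie_bracket (semidirect G) in
       let T_flat := kin_tangent (@flat_curve R F E M g) in
       let T_flat_curve := fun c : R -> (mtan M -> E) * (mtan M -> E) =>
             form_curve (fun s => (c s).1) /\ form_curve (fun s => (c s).2) in
       [/\ T_flat
           = [set p | [/\ is_form p.1, is_form p.2,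
                         mc_eq g p.1 & mc_lin_eq g p.1 p.2]],
           @flat R F (E * E)%type M gg
           = [set w | [/\ is_form w,
                mc_lin_eq g (fun z => (w z).2) (fun z => (w z).1)
              & mc_eq g (fun z => (w z).2)]],
           @flat R F (E * E)%type M Tg = @flat R F (E * E)%type M gg,
           smooth_iso T_flat T_flat_curve
             (@flat R F (E * E)%type M Tg) (@flat_curve R F (E * E)%type M Tg)
             (@twist R E (mtan M))
         & smooth_iso
             (@pointed_map R F (E * E)%type M x0 (mtan G) (gone (tangent_group G)))
             (@pointed_curve R F (E * E)%type M x0 (mtan G)
                (gone (tangent_group G)))
             (@pointed_map R F (E * E)%type M x0 (semidirect G)
                (gone (semidirect G)))
             (@pointed_curve R F (E * E)%type M x0 (semidirect G)
                (gone (semidirect G)))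
             (fun f : M -> mtan G => @rtriv R E G \o f)] /\
       (forall (Evol_G : (mtan M -> E) -> M -> G)
               (Evol_TG : (mtan M -> E * E) -> M -> tangent_group G)
               (Evol_gG : (mtan M -> E * E) -> M -> semidirect G),
          is_development x0 Evol_G ->
          is_development x0 Evol_TG ->
          is_development x0 Evol_gG ->
          (forall c : R -> mtan M -> E, flat_curve g c -> forall x : M,
             msmooth (fun s => Evol_G (c s) x) /\
             velocity (fun s => Evol_G (c s) x) 0
             = Evol_TG (twist (c 0, fun_velocity c)) x) /\
          (forall w : mtan M -> E * E, flat Tg w ->
             @rtriv R E G \o Evol_TG w = Evol_gG w))) ).
Proof.
have hM := lie_manifold hG; have hE : hs E := manifold_hs hM.
split; [split; [|split] | move=> regG; split; [|split; [|split]]].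
- split.
  + exact: (Ad_linear hG).
  + exact: (Ad_br hG).
  + exact: (Ad1 hG).
  + exact: (AdM hG).
  move=> z hz; apply/(@msmooth_vec R E hE).
  have hV : is_manifold (mvec E) by apply: mvec_manifold; case: hM.
  apply: (Ad_smooth hG (g := fun t => (z t).1) (Y := fun t => (z t).2)).
    exact: (msmooth_fst hV hz).
  apply/(@msmooth_vec R E hE); exact: (msmooth_snd hM hz).
- split; [exact: tangent_group_lie | exact: semidirect_lie | exact: rtriv_iso | exact: tmap_rtriv_one].
- split=> //; [exact: br_semidirect | exact: br_tangent |].
  by move=> X Y Z g; exact: Ad_semidirect.
- split; [exact: tangent_regular | exact: semidirect_regular | exact: twist_path_iso].
- move=> c /fun_curve_scw hc X Y I; split.
  + by rewrite /evol (velocity_Evol hG regG 1 hc).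
  + by rewrite /evol (velocity_Evol_rint hG regG 1 hc).
  move=> t; split; first exact: (@mplot_fst R E G _ t (Evol_mplot hG regG hc)).
  by rewrite (velocity_Evol_rint hG regG t hc).
- move=> X Y /smooth_curveP hX /smooth_curveP hY.
  have hW : sm setT (twist (X, Y)) by exact: sm_pair.
  split; first exact: (rtriv_evol hG regG hW).
  (* The pair is realized as value and velocity of the affine family, to which [Evol_semidirect]
     applies. *)
  have [c hc [e _]] := twist_linear hW.
  have [eX eY] := twist_inj e.
  by rewrite /evol eX eY (Evol_semidirect hG regG 1 hc).
move=> F M x0 hMM sc; have hF : hs F := manifold_hs hMM; split.
  split.
  + exact: (flat_tangent hMM hG regG sc).
  + by apply/seteqP; split=> w /(flat_semidirect hMM hG).
  + by rewrite (brackets_agree hG).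
  + exact: (twist_flat_iso hMM hG regG sc).
  exact: rtriv_pointed_iso.
move=> Evol_G Evol_TG Evol_gG dG dT dS; split.
  move=> c hc x; exact: (development_tangent hMM hG regG x sc dG dT hc).
move=> w hw; exact: (development_rtriv hMM hG sc dT dS hw).
Qed.
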